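(* Let $N\ge 2$, let $\Omega\subset\mathbb{R}^N$ be a $C^2$-domain, and let $W,a,b,\gamma,\sigma,E_\varepsilon,E$ be as in the context. Let $u_\varepsilon\in H^2(\Omega)$ ($\varepsilon>0$) satisfy, as $\varepsilon\to0$, $u_\varepsilon\to u_A:=b\chi_A+a(1-\chi_A)\in BV(\Omega)$ in $L^1(\Omega)$ and $E_\varepsilon[u_\varepsilon]\to E[u_A]$. Define $v_\varepsilon:=\frac{u_\varepsilon-a}{\gamma}$. Then for all $\Psi\in C^1(\overline\Omega;\mathbb{R}^N)$ with $\Psi\cdot n_\Omega=0$ on $\partial\Omega$, $$\int_\Omega\Big(\frac1\varepsilon\,\partial_uW(x,u_\varepsilon)\,(\gamma\nabla v_\varepsilon\cdot\Psi)+\varepsilon\nabla u_\varepsilon\cdot\nabla(\gamma\nabla v_\varepsilon\cdot\Psi)\Big)\,dx\;\longrightarrow\;-\int_\Omega\sigma\,(\mathrm{Id}-n_A\otimes n_A):\nabla\Psi\,d|\nabla\chi_A|-\int_\Omega\nabla\sigma\cdot\Psi\,d|\nabla\chi_A|$$ as $\varepsilon\to0$.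
   Context: A $C^2$-domain is an open bounded set with $C^2$ boundary; $n_\Omega$ is the unit normal on $\partial\Omega$. A set $A\subset\Omega$ has finite perimeter in $\Omega$ if $\chi_A\in BV(\Omega;\{0,1\})$; $|\nabla\chi_A|$ is the total variation measure of its distributional derivative in $\Omega$ and $n_A=\frac{d\nabla\chi_A}{d|\nabla\chi_A|}$ is the measure-theoretic inner normal. Assumptions on the potential: $W\in C^2(\Omega\times\mathbb{R};[0,\infty))$; $W(x,u)=0$ if and only if $u\in\{a(x),b(x)\}$, where $a,b\in C^2(\overline\Omega)$ and $\inf_{x\in\Omega}(b(x)-a(x))=:\delta_{\rm sep}>0$. There are $C_1,C_2>0$ with $$C_1\min\{|u-a(x)|,|u-b(x)|\}^2\le W(x,u)\le C_2\min\{|u-a(x)|,|u-b(x)|\}^2$$ for all $x\in\Omega$ and all $u$ with $\min\{|u-a(x)|,|u-b(x)|\}<1$, and there is $C>0$ with $W(x,u)\ge\frac1C|u|^2-C$. Put $\gamma:=b-a$ and $W_{\rm n}(x,v):=W(x,a(x)+\gamma(x)v)$. It is assumed that $\partial_x\sqrt{W_{\rm n}(x,v)}\in C(\overline\Omega\times\mathbb{R};\mathbb{R}^N)$, $\partial_x^2\sqrt{W_{\rm n}(x,v)}\in C(\overline\Omega\times\mathbb{R};\mathbb{R}^{N\times N})$, and that there is $C>0$ with $|\partial_x\sqrt{W_{\rm n}(x,v)}|\le C\sqrt{W_{\rm n}(x,v)}$. Here $\partial_x$ is differentiation with respect to the $x$-argument only. Energies: $E_\varepsilon[u]:=\int_\Omega\big(\frac1\varepsilon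 W(x,u)+\frac\varepsilon2|\nabla u|^2\big)dx$ if $u\in H^1(\Omega)$ and $+\infty$ otherwise; $E[u]:=\int_\Omega\sigma\,d|\nabla\chi_A|$ if $u=b\chi_A+a(1-\chi_A)\in BV(\Omega)$ (in which case $A$ has finite perimeter in $\Omega$) and $+\infty$ otherwise, where $\sigma(x):=\int_{a(x)}^{b(x)}\sqrt{2W(x,s)}\,ds$.
   Formalization: The integral on the left is assumed to exist: for the given Ψ, its integrand is assumed Lebesgue integrable on Ω for all small ε, since without an upper growth bound on W or ∂_uW it can fail to be integrable for u_ε in H²(Ω). *)

(* Defs.v *)
From HB Require Import structures.
From mathcomp Require Import all_boot all_order all_algebra.
From mathcomp Require Import all_classical all_reals all_analysis.
Set Implicit Arguments.
Unset Strict Implicit.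
Unset Printing Implicit Defensive.
Import Order.TTheory GRing.Theory Num.Theory.
Import numFieldNormedType.Exports.
Local Open Scope classical_set_scope.
Local Open Scope ring_scope.

(* R^N is the type 'rV[R]_N. Its library norm is the sup norm, which is used
   only for the topology and for boundedness; [enorm] is the Euclidean norm. *)
Definition dot (R : realType) (N : nat) (u v : 'rV[R]_N) : R :=
  \sum_(i < N) u 0 i * v 0 i.

Definition enorm (R : realType) (N : nat) (u : 'rV[R]_N) : R :=
  Num.sqrt (dot u u).

Definition frob (R : realType) (N : nat) (A B : 'M[R]_N) : R :=
  \sum_(i < N) \sum_(j < N) A i j * B i j.

Definition measure_rV_display : measure_display.
Proof. exact. Qed.

(* The sigma-algebra generated by the coordinates, as for n.-tuple T in the
   library; on R^N it coincides with the Borel sigma-algebra. *)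
Section rV_measurable.
Context {R : realType} (n : nat).

Definition rV_coors (i : 'I_n) (x : 'rV[R]_n) : R := x 0 i.

Let rV_set0 : g_sigma_preimage rV_coors set0.
Proof. exact: sigma_algebra0. Qed.

Let rV_setC A : g_sigma_preimage rV_coors A -> g_sigma_preimage rV_coors (~` A).
Proof. exact: sigma_algebraC. Qed.

Let rV_bigcup (F : _^nat) : (forall i, g_sigma_preimage rV_coors (F i)) ->
  g_sigma_preimage rV_coors (\bigcup_i (F i)).
Proof. exact: sigma_algebra_bigcup. Qed.

HB.instance Definition _ := @isMeasurable.Build measure_rV_display
  'rV[R]_n (g_sigma_preimage rV_coors) rV_set0 rV_setC rV_bigcup.

End rV_measurable.

Lemma measurable_rV_coors (R : realType) (n : nat) (i : 'I_n) :
  measurable_fun [set: 'rV[R]_n] (@rV_coors R n i).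
Proof.
move=> _ Y mY; rewrite setTI; apply: sub_sigma_algebra => /=.
rewrite -bigcup_seq/=; exists i => /=; first by rewrite mem_index_enum.
by exists Y => //; rewrite setTI.
Qed.

Lemma measurable_fun_rV d (T : measurableType d) (R : realType) (n : nat)
    (f : T -> 'rV[R]_n) :
  (forall i, measurable_fun [set: T] (rV_coors i \o f)) ->
  measurable_fun [set: T] f.
Proof.
move=> mf.
suff prefS : g_sigma_preimage (fun i => rV_coors i \o f) `<=` measurable.
  move: prefS; rewrite g_sigma_preimage_comp => prefS _ A mA.
  by apply: prefS; exists A.
apply: smallest_sub; first exact: sigma_algebra_measurable.
case: n f mf => [|n] f mf; first by rewrite big_ord0.
rewrite -bigcup_mkord_ord; apply: bigcup_sub => i Ii.
by move=> A [B mB <-]; exact: mf.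
Qed.

Definition rV_cons (R : realType) (n : nat) (p : 'rV[R]_n * measurableTypeR R) : 'rV[R]_n.+1 :=
  row_mx (const_mx p.2 : 'rV[R]_1) p.1.

Lemma measurable_rV_cons (R : realType) (n : nat) :
  measurable_fun [set: 'rV[R]_n * measurableTypeR R] (@rV_cons R n).
Proof.
apply: measurable_fun_rV => i.
case: (@split_ordP 1 n i) => j ->.
  rewrite [X in measurable_fun _ X](_ : _ = snd); first exact: measurable_snd.
  by apply/funext => x; rewrite /rV_coors /= [LHS]row_mxEl mxE.
rewrite [X in measurable_fun _ X](_ : _ = @rV_coors R n j \o fst); last first.
  by apply/funext => x; rewrite /rV_coors /= [LHS]row_mxEr.
exact: (measurableT_comp (@measurable_rV_coors R n j) measurable_fst).
Qed.

Section lebesgueN.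
Context {R : realType}.

Section step.
Variables (n : nat) (mu : {measure set 'rV[R]_n -> \bar R}).

Definition lebesgue_step :=
  pushforward (mu \x @lebesgue_measure R)%E (@rV_cons R n).

HB.instance Definition _ := Measure.copy lebesgue_step
  (measure_function_pushforward__canonical__measure_function_Measure
     (mu \x @lebesgue_measure R :
       {measure set ('rV[R]_n * measurableTypeR R) -> \bar R})%E
     (@measurable_rV_cons R n)).

End step.

Fixpoint lebesgueN (n : nat) : {measure set 'rV[R]_n -> \bar R} :=
  match n with
  | 0 => \d_(0 : 'rV[R]_0)
  | m.+1 => lebesgue_step (lebesgueN m)
  end.

End lebesgueN.

(* On an open set U of a finite-dimensional space E: f is C^k iff all its
   iterated directional derivatives of order at most k exist and are
   continuous on U. *)
Fixpoint Ck (R : realType) (E : normedModType R) (k : nat) (U : set E)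
    (f : E -> R) : Prop :=
  (forall x, U x -> {for x, continuous f}) /\
  match k with
  | 0 => True
  | m.+1 => forall v : E,
      (forall x, U x -> derivable f x v) /\ Ck m U ('D_v f)
  end.

(* C^k(closure Om) for Om open: f is continuous on the closure, and its
   derivatives of order at most k exist in Om and extend continuously to the
   closure. *)
Fixpoint Ck_closure (R : realType) (E : normedModType R) (k : nat) (Om : set E)
    (f : E -> R) : Prop :=
  {within closure Om, continuous f} /\
  match k with
  | 0 => True
  | m.+1 => forall v : E,
      (forall x, Om x -> derivable f x v) /\
      exists g : E -> R, (forall x, Om x -> g x = 'D_v f x) /\ Ck_closure m Om g
  end.

Definition basis_rV (R : realType) (N : nat) (i : 'I_N) : 'rV[R]_N := delta_mx 0 i.

Definition grad (R : realType) (N : nat) (f : 'rV[R]_N -> R) (x : 'rV[R]_N) :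
    'rV[R]_N :=
  \row_i 'D_(basis_rV R i) f x.

Definition jac (R : realType) (N : nat) (F : 'rV[R]_N -> 'rV[R]_N)
    (x : 'rV[R]_N) : 'M[R]_N :=
  \matrix_(i, j) 'D_(basis_rV R j) (fun y => F y 0 i) x.

Definition bdry (T : topologicalType) (A : set T) : set T :=
  closure A `\` A°.

(* Near x0, up to the choice of the vertical coordinate x_i and of its
   orientation, Om is the region above the graph of a C^2 function h of the
   other N-1 coordinates, which [col' i] extracts: Om = { chart_fun < 0 }. *)
Definition chart_fun (R : realType) (N : nat) (i : 'I_N) (s : bool)
    (h : 'rV[R]_N.-1 -> R) (y : 'rV[R]_N) : R :=
  h (col' i y) - (-1) ^+ s * y 0 i.

Definition is_chart (R : realType) (N : nat) (Om : set 'rV[R]_N)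
    (x0 : 'rV[R]_N) (i : 'I_N) (s : bool) (h : 'rV[R]_N.-1 -> R) : Prop :=
  Ck 2 setT h /\
  \forall y \near x0, Om y <-> chart_fun i s h y < 0.

Definition C2_domain (R : realType) (N : nat) (Om : set 'rV[R]_N) : Prop :=
  [/\ open Om, bounded_set Om &
      forall x0, bdry Om x0 -> exists i s h, is_chart Om x0 i s h].

Definition is_outer_normal (R : realType) (N : nat) (Om : set 'rV[R]_N)
    (x n : 'rV[R]_N) : Prop :=
  exists i s h, is_chart Om x i s h /\
    n = (enorm (grad (chart_fun i s h) x))^-1 *: grad (chart_fun i s h) x.

(* At a boundary point of a C^2 domain there is exactly one such vector. *)
Definition outer_normal (R : realType) (N : nat) (Om : set 'rV[R]_N)
    (x : 'rV[R]_N) : 'rV[R]_N :=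
  xget 0 [set n | is_outer_normal Om x n].

Definition test_fun (R : realType) (N : nat) (Om : set 'rV[R]_N)
    (phi : 'rV[R]_N -> R) : Prop :=
  [/\ forall k, Ck k setT phi,
      compact (closure [set x | phi x != 0]) &
      closure [set x | phi x != 0] `<=` Om].

Definition loc_integrable (R : realType) (N : nat) (Om : set 'rV[R]_N)
    (f : 'rV[R]_N -> R) : Prop :=
  measurable_fun Om f /\
  forall K, compact K -> K `<=` Om ->
    (@lebesgueN R N).-integrable K (EFin \o f).

Definition is_weak_partial (R : realType) (N : nat) (Om : set 'rV[R]_N)
    (i : 'I_N) (f g : 'rV[R]_N -> R) : Prop :=
  [/\ loc_integrable Om f, loc_integrable Om g &
      forall phi, test_fun Om phi ->
        \int[@lebesgueN R N]_(x in Om) (f x * 'D_(basis_rV R i) phi x) =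
        - \int[@lebesgueN R N]_(x in Om) (g x * phi x)].

(* The weak derivatives are unique up to a.e. equality in Om; [weak_grad]
   selects a representative of them whenever they exist. *)
Definition weak_partial (R : realType) (N : nat) (Om : set 'rV[R]_N)
    (i : 'I_N) (f : 'rV[R]_N -> R) : 'rV[R]_N -> R :=
  xget (cst 0) [set g | is_weak_partial Om i f g].

Definition weak_grad (R : realType) (N : nat) (Om : set 'rV[R]_N)
    (f : 'rV[R]_N -> R) (x : 'rV[R]_N) : 'rV[R]_N :=
  \row_i weak_partial Om i f x.

Definition L2 (R : realType) (N : nat) (Om : set 'rV[R]_N)
    (f : 'rV[R]_N -> R) : Prop :=
  measurable_fun Om f /\
  (@lebesgueN R N).-integrable Om (fun x => (f x ^+ 2)%:E).

(* H^k(Om) = W^{k,2}(Om) *)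
Fixpoint Hk (R : realType) (N k : nat) (Om : set 'rV[R]_N)
    (f : 'rV[R]_N -> R) : Prop :=
  L2 Om f /\
  match k with
  | 0 => True
  | m.+1 => forall i : 'I_N, exists g, is_weak_partial Om i f g /\ Hk m Om g
  end.

(* Integral with respect to a finite signed measure, by its Jordan
   decomposition (which does not depend on the Hahn decomposition used). *)
Definition charge_integral d (T : measurableType d) (R : realType)
    (nu : {charge set T -> \bar R}) (f : T -> R) : R :=
  let: exist P hP := cid (Hahn_decomposition nu) in
  let: exist N nuPN := cid hP in
  (\int[jordan_pos nuPN]_x f x) - (\int[jordan_neg nuPN]_x f x).

(* D = (D_1, ..., D_N) is a finite vector measure in Om (extended by 0) which
   is the distributional gradient of f in Om. *)
Definition is_distr_grad (R : realType) (N : nat) (Om : set 'rV[R]_N)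
    (f : 'rV[R]_N -> R) (D : 'I_N -> {charge set 'rV[R]_N -> \bar R}) : Prop :=
  (forall i B, measurable B -> D i B = D i (B `&` Om)) /\
  (forall i phi, test_fun Om phi ->
     \int[@lebesgueN R N]_(x in Om) (f x * 'D_(basis_rV R i) phi x) =
     - charge_integral (D i) phi).

Definition BV (R : realType) (N : nat) (Om : set 'rV[R]_N)
    (f : 'rV[R]_N -> R) : Prop :=
  (@lebesgueN R N).-integrable Om (EFin \o f) /\
  exists D, is_distr_grad Om f D.

(* The gradient measure of f when f is BV (it is unique), 0 otherwise *)
Definition distr_grad (R : realType) (N : nat) (Om : set 'rV[R]_N)
    (f : 'rV[R]_N -> R) : 'I_N -> {charge set 'rV[R]_N -> \bar R} :=
  match pselect (exists D, is_distr_grad Om f D) with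
  | left exD => projT1 (cid exD)
  | right _ => fun=> czero
  end.

(* |D|(B) = sup of \sum_k |D(F_k)| over the countable measurable partitions
   (F_k) of B, with the Euclidean norm *)
Definition vector_variation d (T : measurableType d) (R : realType) (N : nat)
    (D : 'I_N -> {charge set T -> \bar R}) (B : set T) : \bar R :=
  ereal_sup [set (\sum_(0 <= k <oo) (enorm (\row_i fine (D i (F k))))%:E)%E |
    F in [set F : nat -> set T |
      [/\ forall k, measurable (F k), trivIset setT F & \bigcup_k F k = B]]].

(* [vector_variation D] as a (finite) measure; it always is one, so the default
   value is never used. *)
Definition tv_measure d (T : measurableType d) (R : realType) (N : nat)
    (D : 'I_N -> {charge set T -> \bar R}) : {finite_measure set T -> \bar R} :=
  match pselect (exists mu : {finite_measure set T -> \bar R},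
      forall B, measurable B -> mu B = vector_variation D B) with
  | left exmu => projT1 (cid exmu)
  | right _ => mzero
  end.

(* The measure |grad chi_A| on Om, extended by 0 *)
Definition perimeter_measure (R : realType) (N : nat) (Om A : set 'rV[R]_N) :
    {finite_measure set 'rV[R]_N -> \bar R} :=
  tv_measure (distr_grad Om \1_A).

(* n_A = d(grad chi_A)/d|grad chi_A| *)
Definition inner_normal (R : realType) (N : nat) (Om A : set 'rV[R]_N)
    (x : 'rV[R]_N) : 'rV[R]_N :=
  \row_i fine (Radon_Nikodym (distr_grad Om \1_A i) (perimeter_measure Om A) x).

Definition W_norm (R : realType) (N : nat) (W : 'rV[R]_N -> R -> R)
    (a b : 'rV[R]_N -> R) (x : 'rV[R]_N) (v : R) : R :=
  W x (a x + (b x - a x) * v).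

Definition well_dist (R : realType) (N : nat) (a b : 'rV[R]_N -> R)
    (x : 'rV[R]_N) (u : R) : R :=
  Num.min `|u - a x| `|u - b x|.

(* F, defined on Om x R, belongs to C(closure Om x R) *)
Definition continuous_ext (R : realType) (N : nat) (Om : set 'rV[R]_N)
    (F : 'rV[R]_N -> R -> R) : Prop :=
  exists G : 'rV[R]_N * R -> R,
    {within closure Om `*` setT, continuous G} /\
    forall x v, Om x -> G (x, v) = F x v.

Record potential (R : realType) (N : nat) (Om : set 'rV[R]_N)
    (W : 'rV[R]_N -> R -> R) (a b : 'rV[R]_N -> R) : Prop := Potential {
  pot_C2 : Ck 2 (Om `*` setT) (fun p : 'rV[R]_N * R => W p.1 p.2) ;
  pot_ge0 : forall x u, Om x -> 0 <= W x u ;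
  pot_eq0 : forall x u, Om x -> (W x u = 0 <-> u = a x \/ u = b x) ;
  pot_aC2 : Ck_closure 2 Om a ;
  pot_bC2 : Ck_closure 2 Om b ;
  pot_sep : (0 < ereal_inf [set (b x - a x)%:E | x in Om])%E ;
  pot_quadratic : exists C1 C2 : R, [/\ 0 < C1, 0 < C2 &
    forall x u, Om x -> well_dist a b x u < 1 ->
      C1 * well_dist a b x u ^+ 2 <= W x u /\
      W x u <= C2 * well_dist a b x u ^+ 2] ;
  pot_coercive : exists C : R, 0 < C /\
    forall x u, Om x -> C^-1 * `|u| ^+ 2 - C <= W x u ;
  pot_sqrt_dx : forall i,
    (forall x v, Om x ->
      derivable (fun y => Num.sqrt (W_norm W a b y v)) x (basis_rV R i)) /\
    continuous_ext Om (fun x v =>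
      'D_(basis_rV R i) (fun y => Num.sqrt (W_norm W a b y v)) x) ;
  pot_sqrt_dxx : forall i j,
    (forall x v, Om x -> derivable
      ('D_(basis_rV R i) (fun y => Num.sqrt (W_norm W a b y v))) x
      (basis_rV R j)) /\
    continuous_ext Om (fun x v => 'D_(basis_rV R j)
      ('D_(basis_rV R i) (fun y => Num.sqrt (W_norm W a b y v))) x) ;
  pot_sqrt_dx_le : exists C : R, 0 < C /\ forall x v, Om x ->
    enorm (grad (fun y => Num.sqrt (W_norm W a b y v)) x) <=
    C * Num.sqrt (W_norm W a b x v) }.

Definition sigma (R : realType) (N : nat) (W : 'rV[R]_N -> R -> R)
    (a b : 'rV[R]_N -> R) (x : 'rV[R]_N) : R :=
  \int[@lebesgue_measure R]_(s in `[a x, b x]) Num.sqrt (2 * W x s).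

Definition phase_fun (R : realType) (N : nat) (a b : 'rV[R]_N -> R)
    (A : set 'rV[R]_N) (x : 'rV[R]_N) : R :=
  b x * \1_A x + a x * (1 - \1_A x).

Definition energy_eps (R : realType) (N : nat) (Om : set 'rV[R]_N)
    (W : 'rV[R]_N -> R -> R) (eps : R) (u : 'rV[R]_N -> R) : \bar R :=
  if pselect (Hk 1 Om u) then
    (\int[@lebesgueN R N]_(x in Om)
      (eps^-1 * W x (u x) + eps / 2 * enorm (weak_grad Om u x) ^+ 2)%:E)%E
  else +oo%E.

Definition is_phase (R : realType) (N : nat) (Om : set 'rV[R]_N)
    (a b : 'rV[R]_N -> R) (u : 'rV[R]_N -> R) (A : set 'rV[R]_N) : Prop :=
  [/\ measurable A, A `<=` Om, ae_eq (@lebesgueN R N) Om u (phase_fun a b A) &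
      BV Om u].

(* The set A is determined by u up to a null set. *)
Definition energy (R : realType) (N : nat) (Om : set 'rV[R]_N)
    (W : 'rV[R]_N -> R -> R) (a b : 'rV[R]_N -> R) (u : 'rV[R]_N -> R) :
    \bar R :=
  match pselect (exists A, is_phase Om a b u A) with
  | left exA => (\int[perimeter_measure Om (projT1 (cid exA))]_(x in Om)
                   (sigma W a b x)%:E)%E
  | right _ => +oo%E
  end.

(* gamma grad v . Psi, where v = (u - a) / gamma and gamma = b - a *)
Definition variation_dir (R : realType) (N : nat) (Om : set 'rV[R]_N)
    (a b : 'rV[R]_N -> R) (Psi : 'rV[R]_N -> 'rV[R]_N) (u : 'rV[R]_N -> R)
    (x : 'rV[R]_N) : R :=
  (b x - a x) *
  dot (weak_grad Om (fun y => (u y - a y) / (b y - a y)) x) (Psi x).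

Definition variation_density (R : realType) (N : nat) (Om : set 'rV[R]_N)
    (W : 'rV[R]_N -> R -> R) (a b : 'rV[R]_N -> R)
    (Psi : 'rV[R]_N -> 'rV[R]_N) (eps : R) (u : 'rV[R]_N -> R)
    (x : 'rV[R]_N) : R :=
  eps^-1 * 'D_1 (W x) (u x) * variation_dir Om a b Psi u x +
  eps * dot (weak_grad Om u x) (weak_grad Om (variation_dir Om a b Psi u) x).

(* Main.v *)
(* Idea of the proof. Put v = (u - a) / gamma and W_n(x, v) = W(x, a + gamma v). Commuting the
   weak second derivatives of u, the integrand of the first variation is, up to terms of order
   sqrt eps,
     Psi . grad e - eps^-1 Psi . d_x W_n + eps (grad u (x) grad u) : D Psi
       - eps |grad u|^2 Psi . grad gamma / gamma,
   where e = W(x, u) / eps + eps |grad u|^2 / 2; as Psi is tangential, the first term integrates to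
   - \int e div Psi (cut-off in boundary charts). The other limits come from equipartition. For H
   vanishing at v = 0, 1 the functions H(x, v) grad u converge weakly to
   gamma (\int_0^1 H dv) n_A |grad chi_A|, because H(x, v) grad v is a gradient up to harmless
   terms and v -> chi_A in L^1. With H = sqrt (2 W_n) this gives, for a compactly supported
   continuous field X with |X| <= 1,
     \int (e - sqrt (2 W) grad u . X) -> \int sigma (1 - n_A . X) d|grad chi_A|.
   The integrand on the left dominates |sqrt eps grad u - sqrt (2 W / eps) X|^2 / 2, and the right
   side is small once X is close to n_A in L^1(|grad chi_A|); so grad u may be replaced by its optimal
   profile in the quadratic terms, which become linear in grad u and pass to the limit. *)
Require Import Defs.
From HB Require Import structures.
From mathcomp Require Import all_boot all_order all_algebra.
From mathcomp Require Import all_classical all_reals all_analysis.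
From mathcomp Require Import measurable_realfun ring lra.
Set Implicit Arguments.
Unset Strict Implicit.
Unset Printing Implicit Defensive.
Import Order.TTheory GRing.Theory Num.Theory.
Import numFieldNormedType.Exports.
Local Open Scope classical_set_scope.
Local Open Scope ring_scope.

(** * Borel sets of R^N *)

(** The direction is gamma grad v and not grad u because d_x W in general vanishes only to first
    order at the wells, so that eps^-1 d_x W is not controlled by the energy; d_x W_n = 2 sqrt(W_n)
    d_x sqrt(W_n) is bounded by a multiple of W_n. Three obstacles shape the rest. W has no upper
    growth bound in u, so W(x, u) and functions of (x, v) cannot be composed freely with Sobolev
    functions: every primitive in v carries a cut-off [theta] equal to 1 between the wells, and
    energy densities are truncated ([trunc]) before being differentiated. The cut-off costs nothing
    in the limit, since the nonnegative excess also measures the energy lost where theta < 1.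
    Secondly, no traces are taken at the boundary: tangency yields |grad phi . Psi| <= C |phi| for a
    local defining function phi, which compensates the blow-up of the gradient of the cut-off.
    Thirdly, only u_A is known to be BV, so the gradient of chi_A = (u_A - a) / gamma has to be
    constructed. The limits are then proved for any finite measure [P] and unit field [n] that
    satisfy the Gauss-Green formula for chi_A. *)

Section borel.
Context {R : realType} {N : nat}.
Implicit Types (x y : 'rV[R]_N) (O : set 'rV[R]_N).

Lemma coord_le_norm x i : `|x 0 i| <= `|x|.
Proof.
rewrite [leRHS]/Num.norm /= mx_normrE.
have := @le_bigmax _ R ('I_1 * 'I_N)%type 0 (fun i => `|x i.1 i.2|) (0, i).
by [].
Qed.

Lemma rV_norm_le x (r : R) : 0 <= r -> (forall i, `|x 0 i| <= r) -> `|x| <= r.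
Proof.
move=> r0 h; rewrite [leLHS]/Num.norm /= mx_normrE.
by apply/bigmax_leP; split => // -[i j] _ /=; rewrite ord1.
Qed.

Lemma rV_norm_lt x (r : R) : 0 < r -> (forall i, `|x 0 i| < r) -> `|x| < r.
Proof.
move=> r0 h; rewrite [ltLHS]/Num.norm /= mx_normrE.
by apply/bigmax_ltP; split => // -[i j] _ /=; rewrite ord1.
Qed.

Definition rat_box (p : 'rV[rat]_N * nat) : set 'rV[R]_N :=
  [set y | forall i, `|y 0 i - ratr (p.1 0 i)| < p.2.+1%:R^-1].

Lemma rat_box_dense x (e : R) : 0 < e ->
  exists p, rat_box p x /\ forall y, rat_box p y -> `|x - y| < e.
Proof.
move=> e0.
have [k ke] : exists k : nat, k.+1%:R^-1 < e / 2.
  have := near_infty_natSinv_lt (PosNum (divr_gt0 e0 (@ltr0n R 2))).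
  by move=> [k _ /(_ k (leqnn _))] /= ?; exists k.
have k0 : (0 : R) < k.+1%:R^-1 by rewrite invr_gt0 ltr0n.
have /choice[q hq] : forall i : 'I_N, exists q : rat, `|x 0 i - ratr q| < k.+1%:R^-1.
  move=> i.
  have [q] := @rat_in_itvoo R (x 0 i - k.+1%:R^-1) (x 0 i + k.+1%:R^-1)
     ltac:(by rewrite ltrBlDr -addrA ltrDl addr_gt0).
  rewrite in_itv/= => /andP[h1 h2]; exists q.
  by rewrite distrC ltr_distl h1 h2.
exists (\row_i q i, k); split => [i|y hy] /=; first by rewrite mxE.
apply: rV_norm_lt => // i; rewrite !mxE.
have := hy i; rewrite /= mxE => hy1.
rewrite -(subrK (ratr (q i)) (x 0 i)) -addrA (le_lt_trans (ler_normD _ _))//.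
rewrite (distrC (ratr _)); move: hy1 (hq i) ke; move: (k.+1%:R^-1) => c *; lra.
Qed.

Lemma measurable_coord (B : set (measurableTypeR R)) i : measurable B ->
  measurable [set x : 'rV[R]_N | B (x 0 i)].
Proof.
move=> mB; have := @measurable_rV_coors R N i measurableT B mB.
by rewrite setTI.
Qed.

Lemma measurable_rat_box p : measurable (rat_box p).
Proof.
rewrite (_ : rat_box p = \bigcap_(i in [set: 'I_N])
   [set x | `]ratr (p.1 0 i) - p.2.+1%:R^-1, ratr (p.1 0 i) + p.2.+1%:R^-1[%classic (x 0 i)]).
  by apply: fin_bigcap_measurable => // i _; exact: measurable_coord.
apply/seteqP; split => x.
  by move=> h i _ /=; rewrite in_itv/= -ltr_distl h.
by move=> h i; have := h i I; rewrite /= in_itv/= -ltr_distl; apply.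
Qed.

(** Rational boxes form a countable type, so [n] runs over their codes; the code of a box not
    contained in [O] contributes the empty set. *)
Lemma open_rat_box O : open O ->
  O = \bigcup_(n in [set: nat]) (if unpickle n is Some p then
        (if `[< rat_box p `<=` O >] then rat_box p else set0) else set0).
Proof.
move=> oO; apply/seteqP; split => [x Ox|x [n _]].
  have /nbhs_ballP[e e0 he] : nbhs x O by exact: open_nbhs_nbhs.
  have [p [px hp]] := rat_box_dense x e0.
  exists (pickle p) => //; rewrite pickleK; case: asboolP => // -[] y py.
  by apply: he; rewrite mx_norm_ball /ball_ /=; apply: hp.
by case: unpickle => // p; case: asboolP => // h; apply: h.
Qed.

Lemma open_measurable_rV O : open O -> measurable O.
Proof.
move=> /open_rat_box ->; apply: bigcupT_measurable => n.
case: unpickle => // p; case: asboolP => // _; exact: measurable_rat_box.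
Qed.

Lemma closed_measurable_rV O : closed O -> measurable O.
Proof.
move=> cO; rewrite -(setCK O); apply: measurableC; apply: open_measurable_rV.
exact: closed_openC.
Qed.

Lemma compact_measurable_rV O : compact O -> measurable O.
Proof. by move=> cO; apply: closed_measurable_rV; apply: compact_closed. Qed.

Lemma continuous_measurable_rV O (f : 'rV[R]_N -> R) : open O ->
  (forall x, O x -> {for x, continuous f}) -> measurable_fun O f.
Proof.
move=> oO cf.
apply: (measurability _ (RGenOpens.measurableE R)) => _ [_ [a [b ->] <-]].
apply: open_measurable_rV.
rewrite openE => x [Ox fx].
have oi : open (`]a, b[%classic : set R) by exact: interval_open.
have h1 : nbhs x (f @^-1` `]a, b[%classic).
  by apply: (cf x Ox); exact: open_nbhs_nbhs.
have h2 : nbhs x O by exact: open_nbhs_nbhs.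
by rewrite /interior; apply: filterI.
Qed.

(** The sigma-algebra being generated by the coordinates, only preimages of open intervals under one
    coordinate have to be examined. This inclusion makes the monotone class argument over open sets
    in [Cc_approx_indic] reach every measurable set. *)
Lemma measurable_sub_open (A : set 'rV[R]_N) : measurable A -> <<s open >> A.
Proof.
move=> mA; suff : @measurable _ 'rV[R]_N `<=` <<s open >> by exact.
apply: smallest_sub; first exact: smallest_sigma_algebra.
case: (N) => [|n]; first by rewrite big_ord0.
rewrite -bigcup_mkord_ord; apply: bigcup_sub => i _ _ [B mB <-].
pose H := [set B : set R | (<<s open >> : set (set 'rV[R]_n.+1))
   (setT `&` rV_coors (inord i) @^-1` B)].
have mB' : (@ocitv R).-sigma.-measurable B := mB.
rewrite RGenOpens.measurableE in mB'.
suff : <<s @RGenOpens.G R >> `<=` H by apply.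
apply: smallest_sub.
  split.
  - rewrite /H /= preimage_set0 setI0; exact: sigma_algebra0.
  - move=> C; rewrite /H /= !setTI => hC; rewrite setTD.
    by rewrite -[X in <<s _ >> X]/(~` _); exact: sigma_algebraC.
  - move=> F hF; rewrite /H /= setTI preimage_bigcup.
    apply: sigma_algebra_bigcup => k; have := hF k; by rewrite /H /= setTI.
move=> _ [a [b ->]]; rewrite /H /= setTI; apply: sub_sigma_algebra.
apply: open_comp; last exact: interval_open.
by move=> x _; exact: coord_continuous.
Qed.

End borel.

(** * Finiteness of Lebesgue measure on bounded sets *)

Section lebesgueN_finite.
Context {R : realType}.

Definition cube n (r : R) : set 'rV[R]_n := [set x | forall i, `|x 0 i| <= r].
Arguments cube : clear implicits.

Lemma rV_cons0 n (p : 'rV[R]_n * measurableTypeR R) :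
  rV_cons p 0 (@lshift 1 n 0) = p.2.
Proof. by rewrite [LHS]row_mxEl mxE. Qed.

Lemma rV_consS n (p : 'rV[R]_n * measurableTypeR R) j :
  rV_cons p 0 (@rshift 1 n j) = p.1 0 j.
Proof. by rewrite [LHS]row_mxEr. Qed.

Lemma preimage_cons_cube n r :
  @rV_cons R n @^-1` cube n.+1 r = cube n r `*` [set t | `|t| <= r].
Proof.
apply/seteqP; split => -[y t] /=.
  move=> h; split => [i|].
    by have := h (@rshift 1 n i); rewrite rV_consS.
  by have := h (@lshift 1 n 0); rewrite rV_cons0.
move=> [h1 h2] i; case: (@split_ordP 1 n i) => j -> /=.
  by rewrite (ord1 j) rV_cons0.
by rewrite rV_consS; exact: h1.
Qed.

Lemma closed_cube n r : closed (cube n r).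
Proof.
have -> : cube n r = \bigcap_(i in [set: 'I_n]) (fun x : 'rV[R]_n => x 0 i) @^-1` [set t : R | `|t| <= r].
  by apply/seteqP; split => x h i; [move=> _; exact: h|exact: h i I].
apply: closed_bigI => i _; apply: closed_comp => [x _|]; first exact: coord_continuous.
have -> : [set t : R | `|t| <= r] = `[- r, r]%classic.
  by apply/seteqP; split => t /=; rewrite in_itv/= ler_norml.
exact: interval_closed.
Qed.

Lemma lebesgueN_cube n r : (lebesgueN n (cube n r) < +oo)%E.
Proof.
elim: n => [|n IH]; first by rewrite /= diracE ltry.
rewrite /= /lebesgue_step /pushforward preimage_cons_cube.
have -> : [set t : R | `|t| <= r] = `[- r, r]%classic.
  by apply/seteqP; split => t /=; rewrite in_itv/= ler_norml.
have h : (lebesgue_measure (`[(- r)%R, r]%classic : set R) < +oo)%E.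
  by rewrite lebesgue_measure_itv; case: ifP => // _; rewrite ltry.
rewrite product_measure1E//; last by apply: closed_measurable_rV; exact: closed_cube.
rewrite lte_mul_pinfty// ?ge0_fin_numE//.
Qed.

Lemma lebesgueN_bounded n (A : set 'rV[R]_n) : measurable A -> bounded_set A ->
  (lebesgueN n A < +oo)%E.
Proof.
move=> mA [M [_ hM]]; apply: le_lt_trans (lebesgueN_cube n (M + 1)).
rewrite le_measure ?inE//; first by apply: closed_measurable_rV; exact: closed_cube.
by move=> x Ax i; rewrite (le_trans (coord_le_norm _ _))// (hM (M + 1))// ltrDl.
Qed.

Lemma cube_natP n (x : 'rV[R]_n) : exists k : nat, cube n k%:R x.
Proof.
have := near_infty_natSinv_lt.
exists (Num.truncn `|x|).+1 => i; rewrite (le_trans (coord_le_norm _ _))// ltW//.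
exact: truncnS_gt.
Qed.

Lemma lebesgueN_sigma_finite n : sigma_finite setT (@lebesgueN R n).
Proof.
exists (fun k : nat => cube n k%:R).
  by apply/seteqP; split => // x _; have [k hk] := cube_natP x; exists k.
move=> k; split; first by apply: closed_measurable_rV; exact: closed_cube.
exact: lebesgueN_cube.
Qed.

(** A head constant to carry the sigma-finite structure, which Tonelli's theorem and the uniqueness
    of product measures require. *)
Definition leb n : set 'rV[R]_n -> \bar R := @lebesgueN R n.

HB.instance Definition _ n := Measure.copy (@leb n) (@lebesgueN R n).

HB.instance Definition _ n := Measure_isSigmaFinite.Build _ _ _
  (@leb n) (@lebesgueN_sigma_finite n).

End lebesgueN_finite.
Arguments cube {R} n r.
Arguments leb R n : clear implicits.

(** * Translation invariance *)

Section transl.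
Context {R : realType}.
Implicit Type n : nat.

Definition shift_rV n (z x : 'rV[R]_n) : 'rV[R]_n := x + z.

Lemma measurable_shift_rV n (z : 'rV[R]_n) : measurable_fun setT (shift_rV z).
Proof.
apply: measurable_fun_rV => i.
rewrite [X in measurable_fun _ X](_ : _ = (fun t => t + z 0 i) \o rV_coors i); last first.
  by apply/funext => x; rewrite /= /rV_coors mxE.
by apply: measurableT_comp; [exact: measurable_funD|exact: measurable_rV_coors].
Qed.

(** The translated measure agrees with Lebesgue measure on half-open intervals, which determine
    it. *)
Lemma lebesgue_measure_shift (z : R) (A : set (measurableTypeR R)) : measurable A ->
  lebesgue_measure ((fun t => t + z) @^-1` A) = lebesgue_measure A :> \bar R.
Proof.
move=> mA.
have mf : measurable_fun setT (fun t : measurableTypeR R => (t + z : measurableTypeR R)).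
  exact: measurable_funD.
pose m' : {measure set (measurableTypeR R) -> \bar R} := pushforward (@lebesgue_measure R) (fun t : measurableTypeR R => (t + z : measurableTypeR R)).
rewrite [RHS](@lebesgue_measure_unique R (m' mf))// => _ [[a b] _ <-].
rewrite -[RHS]/(lebesgue_measure ((fun t : R => t + z) @^-1` `]a, b]%classic)).
have -> : (fun t : R => t + z) @^-1` `]a, b]%classic = `]a - z, b - z]%classic.
  by apply/seteqP; split => t /=; rewrite !in_itv/= ltrBlDr lerBrDr.
rewrite !lebesgue_measure_itv /= !lte_fin ltrD2r.
by case: ifP => // _; rewrite -!EFinB; congr (_%:E); lra.
Qed.

(** Induction on the dimension: through [rV_cons] a translation acts separately on the two factors,
    so the translated product measure has the right values on rectangles, and product measures are
    unique. *)
Lemma lebesgueN_shift n (z : 'rV[R]_n) (A : set 'rV[R]_n) : measurable A ->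
  lebesgueN n (shift_rV z @^-1` A) = lebesgueN n A.
Proof.
elim: n z A => [|n IH] z A mA.
  congr (_ _); apply/seteqP; split => x /=; by rewrite /shift_rV (_ : x + z = x)//; apply/rowP => -[].
pose z1 : 'rV[R]_n := \row_j z 0 (@rshift 1 n j).
pose t1 : measurableTypeR R := z 0 (@lshift 1 n 0).
pose sh (p : 'rV[R]_n * measurableTypeR R) : 'rV[R]_n * measurableTypeR R := (shift_rV z1 p.1, p.2 + t1).
have msh : measurable_fun setT sh.
  apply: measurable_fun_pair.
    by apply: measurableT_comp; [exact: measurable_shift_rV|exact: measurable_fst].
  by apply: measurable_funD => //; exact: measurable_snd.
have sh_cons p : shift_rV z (rV_cons p) = rV_cons (sh p).
  apply/rowP => i; rewrite /shift_rV mxE; case: (@split_ordP 1 n i) => j ->.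
    by rewrite (ord1 j) !rV_cons0.
  by rewrite !rV_consS /= /shift_rV !mxE.
rewrite /= /lebesgue_step /pushforward.
have -> : @rV_cons R n @^-1` (shift_rV z @^-1` A) = sh @^-1` (@rV_cons R n @^-1` A).
  by apply/seteqP; split => -[y t] /=; rewrite sh_cons.
have mB : measurable (@rV_cons R n @^-1` A).
  by rewrite -[X in measurable X]setTI; exact: measurable_rV_cons.
move: (_ @^-1` A) mB => B mB.
rewrite -[LHS]/(pushforward (lebesgueN n \x @lebesgue_measure R)%E sh B).
apply/esym.
apply: (@product_measure_unique _ _ _ _ _ (leb R n) (@lebesgue_measure R)
  (pushforward (lebesgueN n \x @lebesgue_measure R)%E sh)) => // A1 A2 mA1 mA2.
transitivity ((lebesgueN n \x @lebesgue_measure R)%E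
  ((shift_rV z1 @^-1` A1) `*` ((fun t => t + t1) @^-1` A2))) => //.
rewrite product_measure1E//.
- by congr (_ * _)%E; [exact: IH|exact: lebesgue_measure_shift].
- by rewrite -[X in measurable X]setTI; exact: measurable_shift_rV.
- rewrite -[X in measurable X]setTI.
  have mf : measurable_fun setT (fun t : measurableTypeR R => (t + t1 : measurableTypeR R)).
    exact: measurable_funD.
  exact: mf.
Qed.

Lemma ge0_integral_shift n (z : 'rV[R]_n) (f : 'rV[R]_n -> \bar R) :
  measurable_fun [set: 'rV[R]_n] f -> (forall x, 0 <= f x)%E ->
  (\int[@lebesgueN R n]_x f (x + z)%R = \int[@lebesgueN R n]_x f x)%E.
Proof.
move=> mf f0.
have := @ge0_integral_pushforward _ _ _ _ R (shift_rV z) (@measurable_shift_rV n z) (@lebesgueN R n) setT f.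
rewrite preimage_setT => <-//.
apply: eq_measure_integral => [|ms A mA _]; first exact: measurable_shift_rV.
by rewrite /= /pushforward lebesgueN_shift.
Qed.

Lemma integral_shift n (z : 'rV[R]_n) (f : 'rV[R]_n -> \bar R) :
  measurable_fun [set: 'rV[R]_n] f ->
  (\int[@lebesgueN R n]_x f (x + z)%R = \int[@lebesgueN R n]_x f x)%E.
Proof.
move=> mf; rewrite integralE [RHS]integralE; congr (_ - _)%E.
  have := @ge0_integral_shift n z (f^\+)%E (measurable_funepos mf) (fun=> funepos_ge0 _ _).
  by move=> H; etransitivity; [|exact: H]; apply: eq_integral => x _; rewrite !funeposE.
have := @ge0_integral_shift n z (f^\-)%E (measurable_funeneg mf) (fun=> funeneg_ge0 _ _).
by move=> H; etransitivity; [|exact: H]; apply: eq_integral => x _; rewrite !funenegE.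
Qed.

End transl.

(** * Real-valued integrals *)

Section real_integral.
Context d {T : measurableType d} {R : realType}.
Variables (mu : {measure set T -> \bar R}) (D : set T) (mD : measurable D).
Implicit Types f g : T -> R.

Definition itg f := mu.-integrable D (EFin \o f).

Lemma itg_measurable f : itg f -> measurable_fun D f.
Proof. by move=> h; apply/measurable_EFinP; exact: measurable_int h. Qed.

Lemma itg_le f g : measurable_fun D f -> (forall x, D x -> `|f x| <= g x) ->
  itg g -> itg f.
Proof.
move=> mf fg ig; apply: le_integrable ig => //; first exact/measurable_EFinP.
by move=> x Dx /=; rewrite lee_fin (le_trans (fg _ Dx))// ler_norm.
Qed.

Lemma itg_eq f g : (forall x, D x -> f x = g x) -> itg f -> itg g.
Proof.
move=> fg; apply: eq_integrable => // x; rewrite inE => Dx /=.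
by rewrite fg.
Qed.

Lemma itgD f g : itg f -> itg g -> itg (fun x => f x + g x).
Proof. by move=> hf hg; have := integrableD mD hf hg. Qed.

Lemma itgB f g : itg f -> itg g -> itg (fun x => f x - g x).
Proof. by move=> hf hg; have := integrableB mD hf hg. Qed.

Lemma itgZ (k : R) f : itg f -> itg (fun x => k * f x).
Proof. by move=> hf; have := integrableZl mD k hf. Qed.

Lemma itg_norm f : itg f -> itg (fun x => `|f x|).
Proof. by move=> hf; have := integrable_abse hf. Qed.

Lemma itg0 : itg (fun=> 0).
Proof. exact: integrable0. Qed.

Lemma itg_sum (I : Type) (s : seq I) (h : I -> T -> R) :
  (forall i, itg (h i)) -> itg (fun x => \sum_(i <- s) h i x).
Proof.
move=> hh; elim: s => [|i s IH].
  by apply: itg_eq itg0 => x _; rewrite big_nil.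
by apply: itg_eq (itgD (hh i) IH) => x _; rewrite big_cons.
Qed.

Lemma Rintegral_sum (I : Type) (s : seq I) (h : I -> T -> R) :
  (forall i, itg (h i)) ->
  \int[mu]_(x in D) (\sum_(i <- s) h i x) = \sum_(i <- s) \int[mu]_(x in D) h i x.
Proof.
move=> hh; elim: s => [|i s IH].
  rewrite big_nil; under eq_Rintegral do rewrite big_nil.
  by rewrite Rintegral_cst// mul0r.
rewrite big_cons -IH -RintegralD//; [|exact: hh|exact: itg_sum].
by apply: eq_Rintegral => x _; rewrite big_cons.
Qed.

Lemma itgM_bounded (C : R) f g : measurable_fun D g ->
  (forall x, D x -> `|g x| <= C) -> itg f -> itg (fun x => f x * g x).
Proof.
move=> mg gC hf; apply: (@itg_le _ (fun x => C * `|f x|)).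
- by apply: measurable_funM => //; exact: itg_measurable.
- by move=> x Dx; rewrite normrM mulrC ler_wpM2r// gC.
- by apply: itgZ; exact: itg_norm.
Qed.

Lemma itg_cst (C : R) : (mu D < +oo)%E -> itg (fun=> C).
Proof.
move=> h; apply/integrableP; split; first exact/measurable_EFinP.
rewrite /= integral_cst//; apply: lte_mul_pinfty => //.
Qed.

Lemma itg_bounded (C : R) f : (mu D < +oo)%E -> measurable_fun D f ->
  (forall x, D x -> `|f x| <= C) -> itg f.
Proof. by move=> fD mf fC; apply: itg_le (itg_cst C fD). Qed.

Lemma abs_Rintegral_le f g : measurable_fun D f ->
  (forall x, D x -> `|f x| <= g x) -> itg g ->
  `|\int[mu]_(x in D) f x| <= \int[mu]_(x in D) g x.
Proof.
move=> mf fg ig; have hf := itg_le mf fg ig.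
by rewrite (le_trans (le_normr_Rintegral _ hf))// le_Rintegral//; exact: itg_norm.
Qed.

Lemma Rintegral_EFin f : itg f ->
  (\int[mu]_(x in D) f x)%:E = (\int[mu]_(x in D) (f x)%:E)%E.
Proof. by move=> hf; rewrite fineK//; exact: integrable_fin_num. Qed.

Lemma Rintegral_dominated (f_ : nat -> T -> R) f g :
  (forall n, measurable_fun D (f_ n)) ->
  (forall x, D x -> f_ n x @[n --> \oo] --> f x) -> itg g ->
  (forall n x, D x -> `|f_ n x| <= g x) ->
  itg f /\ \int[mu]_(x in D) f_ n x @[n --> \oo] --> \int[mu]_(x in D) f x.
Proof.
move=> mf_ ff ig fg.
have mf : measurable_fun D f by apply: measurable_fun_cvg ff.
have hf : itg f.
  apply: (itg_le mf _ ig) => x Dx.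
  have h : `|f_ n x| @[n --> \oo] --> `|f x| by apply: cvg_norm; exact: ff.
  have -> : `|f x| = limn (fun n => `|f_ n x|) by apply/esym/cvg_lim.
  by apply: limr_le; [by apply/cvg_ex; exists (`|f x|)|by near=> n; exact: fg].
split => //.
have h1 n : measurable_fun D (EFin \o f_ n) by apply/measurable_EFinP.
have h2 : measurable_fun D (EFin \o f) by apply/measurable_EFinP.
have h3 : {ae mu, forall x, D x -> (EFin \o f_ n) x @[n --> \oo] --> (EFin \o f) x}.
  by apply: aeW => x Dx; apply: cvg_EFin; [near=> n|exact: ff].
have h4 : {ae mu, forall x n, D x -> (`|(EFin \o f_ n) x| <= (EFin \o g) x)%E}.
  by apply: aeW => x n Dx /=; rewrite lee_fin fg.
have [_ _ h] := dominated_convergence mD h1 h2 h3 ig h4.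
apply: fine_cvg; rewrite Rintegral_EFin//.
Unshelve. all: by end_near. Qed.

Lemma Rintegral_ae_eq f g : measurable_fun D f -> measurable_fun D g ->
  ae_eq mu D f g -> \int[mu]_(x in D) f x = \int[mu]_(x in D) g x.
Proof.
move=> mf mg fg; congr fine; apply: ae_eq_integral => //.
- exact/measurable_EFinP.
- exact/measurable_EFinP.
- by apply: filterS fg => x h Dx /=; rewrite h.
Qed.

Lemma Rintegral_norm0_ae f : itg f -> \int[mu]_(x in D) `|f x| = 0 ->
  ae_eq mu D f (fun=> 0).
Proof.
move=> hf h0.
have h : ae_eq mu D (EFin \o f) (cst 0%E).
  apply/(ae_eq_integral_abs mu mD (measurable_int mu hf)).
  have := Rintegral_EFin (itg_norm hf); rewrite h0 => /esym.
  by [].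
by apply: filterS h => x h Dx; have := h Dx; case.
Qed.

End real_integral.

Lemma Rintegral_mono d (T : measurableType d) (R : realType)
  (mu : {measure set T -> \bar R}) (A B : set T) (f : T -> R) :
  measurable A -> measurable B -> A `<=` B -> itg mu B f ->
  (forall x, B x -> 0 <= f x) ->
  \int[mu]_(x in A) f x <= \int[mu]_(x in B) f x.
Proof.
move=> mA mB AB hf f0.
have hA : itg mu A f by apply: integrableS hf.
rewrite -lee_fin !Rintegral_EFin//; apply: ge0_subset_integral => //.
  by apply/measurable_EFinP; exact: itg_measurable hf.
Qed.

(** * Continuous functions with compact support *)

Section compactly_supported.
Context {R : realType} {N : nat}.
Implicit Types (U : set 'rV[R]_N) (c : 'rV[R]_N -> R).

(** Any compact set off which [c] vanishes may serve as [K], which makes the class visibly stable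
    under sums, products and mollification; [c] is continuous on the whole space. *)
Definition Cc U c := continuous c /\
  exists K, [/\ compact K, K `<=` U & forall x, ~ K x -> c x = 0].

Lemma Cc_bounded U c : Cc U c -> exists2 M, 0 < M & forall x, `|c x| <= M.
Proof.
move=> [cc [K [cK KU c0]]].
have [K0|/set0P[x0 Kx0]] := eqVneq K set0.
  by exists 1 => // x; rewrite c0 ?K0// normr0.
have [|//||x1 /set_mem Kx1 hx1] := @compact_EVT_max _ _ (fun x => `|c x|) K.
- by exists x0.
- apply: continuous_subspaceT => x; apply: continuous_comp; first exact: cc.
  exact: norm_continuous.
exists (`|c x1| + 1) => [|x]; first by rewrite ltr_wpDl.
have [Kx|nKx] := pselect (K x); last by rewrite c0// normr0 ltW// ltr_wpDl.
by rewrite (le_trans (hx1 x (mem_set Kx)))// lerDl.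
Qed.

Lemma CcS U V c : U `<=` V -> Cc U c -> Cc V c.
Proof.
by move=> UV [cc [K [cK KU c0]]]; split => //; exists K; split => // x /KU/UV.
Qed.

Lemma Cc0 U : Cc U (fun=> 0).
Proof.
split; first by move=> x; exact: cst_continuous.
by exists set0; split => //; exact: compact0.
Qed.

Lemma Cc_comp2 U c1 c2 (h : R -> R -> R) : h 0 0 = 0 ->
  continuous (fun p : R * R => h p.1 p.2) ->
  Cc U c1 -> Cc U c2 -> Cc U (fun x => h (c1 x) (c2 x)).
Proof.
move=> h0 hc [cc1 [K1 [cK1 KU1 c10]]] [cc2 [K2 [cK2 KU2 c20]]]; split.
  move=> x.
  apply: (@continuous_comp _ _ _ (fun x => (c1 x, c2 x)) (fun p => h p.1 p.2)).
    exact: cvg_pair (cc1 x) (cc2 x).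
  exact: hc.
exists (K1 `|` K2); split; first exact: compactU.
  by move=> x [/KU1|/KU2].
by move=> x /not_orP[n1 n2]; rewrite c10// c20.
Qed.

Lemma CcD U c1 c2 : Cc U c1 -> Cc U c2 -> Cc U (fun x => c1 x + c2 x).
Proof.
move=> h1 h2; apply: (@Cc_comp2 U c1 c2 (fun s t => s + t)) => //; first by rewrite addr0.
by move=> p; apply: continuousD; [exact: cvg_fst|exact: cvg_snd].
Qed.

Lemma CcMl U c (f : 'rV[R]_N -> R) : open U -> (forall x, U x -> {for x, continuous f}) -> Cc U c ->
  Cc U (fun x => f x * c x).
Proof.
move=> oU cf [cc [K [cK KU c0]]]; split; last first.
  by exists K; split => // x nK; rewrite c0// mulr0.
move=> x; have [Ux|nUx] := pselect (U x).
  by apply: continuousM; [exact: cf|exact: cc].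
have nK : nbhs x (~` K).
  apply: open_nbhs_nbhs; split; last by move/KU.
  by apply: closed_openC; apply: compact_closed.
apply: (@near_cst_continuous _ _ 0).
by apply: (@filterS _ (nbhs x) _ _ _ _ nK) => y /c0 ->; rewrite mulr0.
Qed.

Lemma CcZ U c (k : R) : Cc U c -> Cc U (fun x => k * c x).
Proof.
move=> [cc [K [cK KU c0]]]; split; last first.
  by exists K; split => // x nK; rewrite c0// mulr0.
by move=> x; apply: continuousM; [exact: cst_continuous|exact: cc].
Qed.

Lemma Cc_measurable U c D : Cc U c -> measurable_fun D c.
Proof.
move=> [cc _]; apply: measurable_funTS; apply: continuous_measurable_rV; first exact: openT.
by move=> x _; exact: cc.
Qed.

End compactly_supported.

(** * Distance to the complement, compact exhaustion and cut-offs *)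

Section distance_to_complement.
Context {R : realType} {N : nat}.
Variable U : set 'rV[R]_N.

Let S (x : 'rV[R]_N) : set R := [set `|x - y| | y in ~` U] `|` [set 1].

(* Truncated at 1 so as to make sense when U is the whole space. *)
Definition distC x : R := inf (S x).

Let S0 x : S x !=set0. Proof. by exists 1; right. Qed.

Let Slb x : has_lbound (S x).
Proof. by exists 0 => _ [[y _ <-]|->]. Qed.

Lemma distC_le1 x : distC x <= 1.
Proof. by apply: ge_inf; [exact: Slb|right]. Qed.

Lemma distC_ge0 x : 0 <= distC x.
Proof. by apply: lb_le_inf => // _ [[y _ <-]|->]. Qed.

Lemma distC_out x : ~ U x -> distC x = 0.
Proof.
move=> nU; apply/eqP; rewrite eq_le distC_ge0 andbT.
by apply: ge_inf; [exact: Slb|left; exists x => //; rewrite subrr normr0].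
Qed.

Lemma distC_lip x y : distC x <= distC y + `|x - y|.
Proof.
rewrite -lerBlDr; apply: lb_le_inf => // _ [[z nUz <-]|->]; last first.
  by rewrite lerBlDr (le_trans (distC_le1 x))// lerDl.
rewrite lerBlDr addrC (le_trans _ (_ : `|x - z| <= _))//.
  by apply: ge_inf; [exact: Slb|left; exists z].
by rewrite (le_trans _ (ler_normD _ _))// addrA subrK.
Qed.

Lemma distC_gt0 x : open U -> U x -> 0 < distC x.
Proof.
move=> oU Ux; have /nbhs_ballP[e /= e0 he] : nbhs x U by exact: open_nbhs_nbhs.
apply: (@lt_le_trans _ _ (Num.min e 1)); first by rewrite lt_min e0 ltr01.
apply: lb_le_inf => // _ [[y nUy <-]|->]; last by rewrite ge_min lexx orbT.
rewrite ge_min leNgt; apply/orP; left; apply/negP => h; apply: nUy.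
by apply: he; rewrite mx_norm_ball.
Qed.

Lemma rV_continuousP (f : 'rV[R]_N -> R) x :
  (forall e, 0 < e -> exists2 d, 0 < d & forall y, `|x - y| < d -> `|f x - f y| < e) ->
  {for x, continuous f}.
Proof.
move=> h; apply/(@cvgrPdist_lt _ _ _ (nbhs x)) => e /h[d d0 hd].
apply/nbhs_ballP; exists d => // y.
by rewrite mx_norm_ball /ball_ /=; exact: hd.
Qed.

Lemma distC_continuous : continuous distC.
Proof.
move=> x; apply: rV_continuousP => e e0; exists e => // y h.
rewrite (le_lt_trans _ h)// ler_norml.
have := distC_lip x y; have := distC_lip y x; rewrite (distrC y x); lra.
Qed.

Definition shrink (r : R) := [set x | r <= distC x].

Lemma shrink_sub r : 0 < r -> shrink r `<=` U.
Proof.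
move=> r0 x h; apply: contrapT => nU; move: h; rewrite /shrink /= distC_out//.
by rewrite leNgt r0.
Qed.

Lemma closed_shrink r : closed (shrink r).
Proof.
apply: (@closed_comp _ _ distC [set t | r <= t]) => [x _|].
  exact: distC_continuous.
exact: closed_ge.
Qed.

Lemma compact_shrink r : bounded_set U -> 0 < r -> compact (shrink r).
Proof.
move=> bU r0; apply: bounded_closed_compact; last exact: closed_shrink.
case: bU => M [Mr hM]; exists M; split => // t tM x /(shrink_sub r0).
exact: hM.
Qed.

Lemma compact_sub_shrink K : open U -> compact K -> K `<=` U ->
  exists2 r, 0 < r & K `<=` shrink r.
Proof.
move=> oU cK KU; have [K0|/set0P[x0 Kx0]] := eqVneq K set0.
  by exists 1 => //; rewrite K0.
have [|//||x1 /set_mem Kx1 hx1] := @compact_EVT_min _ _ distC K.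
- by exists x0.
- by apply: continuous_subspaceT; exact: distC_continuous.
by exists (distC x1); [apply: distC_gt0 => //; exact: KU|move=> x /mem_set/hx1].
Qed.

Lemma shrinkS r r' : r <= r' -> shrink r' `<=` shrink r.
Proof. by move=> rr x; rewrite /shrink /=; exact: le_trans. Qed.

Lemma shrink_nbhs r s x y : shrink (r + s) x -> `|x - y| <= s -> shrink r y.
Proof.
rewrite /shrink /= => h1 h2; have := distC_lip x y; lra.
Qed.

(** It vanishes where [distC] is at most 1/k and equals 1 where [distC] is at least 2/k, hence tends
    to the indicator of [U] as k grows. *)
Definition cutoff (k : R) x : R := Num.min 1 (Num.max 0 (k * distC x - 1)).

Lemma cutoff_bounds k x : 0 <= cutoff k x <= 1.
Proof. by rewrite /cutoff le_min ler01 le_max lexx ge_min lexx. Qed.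

Lemma Cc_cutoff k : bounded_set U -> 0 < k -> Cc U (cutoff k).
Proof.
move=> bU k0; split.
  move=> x; have h1 : {for x, continuous (fun=> 1 : R)} by exact: cst_continuous.
  have h0 : {for x, continuous (fun=> 0 : R)} by exact: cst_continuous.
  have hd : {for x, continuous (fun x => k * distC x - 1)}; last first.
    exact: (continuous_min h1 (continuous_max h0 hd)).
  apply: (@continuousB _ _ _ (fun x => k * distC x) (fun=> 1)); last exact: cst_continuous.
  by apply: continuousM; [exact: cst_continuous|exact: distC_continuous].
exists (shrink k^-1); split.
- by apply: compact_shrink => //; rewrite invr_gt0.
- by apply: shrink_sub; rewrite invr_gt0.
- move=> x /negP; rewrite /shrink /= -ltNge => h.
  rewrite /cutoff max_l ?min_r// subr_le0 mulrC -ler_pdivlMr// div1r ltW//.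
Qed.

Lemma cutoff_cvg x : open U ->
  cutoff k.+1%:R x @[k --> \oo] --> (\1_U x : R).
Proof.
move=> oU; rewrite indicE; have [Ux|nUx] := pselect (U x); last first.
  rewrite memNset//; apply: cvg_near_cst; near=> k.
  by rewrite /cutoff distC_out// mulr0 sub0r max_l ?min_r// lerNl oppr0 ler01.
rewrite mem_set//; apply: cvg_near_cst; near=> k.
rewrite /cutoff min_l// le_max; apply/orP; right.
rewrite lerBrDr -ler_pdivrMr ?distC_gt0//.
near: k; exists (Num.truncn (2 / distC x)).+1 => // k /= hk.
by rewrite (le_trans (ltW (truncnS_gt _)))// ler_nat ltnW.
Unshelve. all: by end_near. Qed.

End distance_to_complement.

(** * Density of continuous functions with compact support *)

Section density.
Context {R : realType} {N : nat}.
Variables (mu : {measure set 'rV[R]_N -> \bar R}) (U : set 'rV[R]_N).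
Hypotheses (oU : open U) (bU : bounded_set U) (fU : (mu U < +oo)%E).

Let mU : measurable U. Proof. exact: open_measurable_rV. Qed.

Definition Cc_approx (f : 'rV[R]_N -> R) := forall e, 0 < e ->
  exists2 c, Cc U c & \int[mu]_(x in U) `|f x - c x| <= e.

Lemma Cc_itg c : Cc U c -> itg mu U c.
Proof.
move=> hc; have [M _ hM] := Cc_bounded hc.
by apply: (itg_bounded mU fU) => //; exact: Cc_measurable hc.
Qed.

Lemma indic_itg B : measurable B -> itg mu U (\1_B : _ -> R).
Proof.
move=> mB; apply: (@itg_bounded _ _ _ mu _ mU 1) => //.
by move=> x _; rewrite indicE; case: (_ \in _); rewrite ?normr1 ?normr0.
Qed.

Lemma Cc_approxD f g : itg mu U f -> itg mu U g ->
  Cc_approx f -> Cc_approx g -> Cc_approx (fun x => f x + g x).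
Proof.
move=> hf hg af ag e e0; have e2 : 0 < e / 2 by rewrite divr_gt0.
have [c1 h1 i1] := af _ e2; have [c2 h2 i2] := ag _ e2.
exists (fun x => c1 x + c2 x); first exact: CcD.
have k1 : itg mu U (fun x => `|f x - c1 x|).
  by apply: itg_norm => //; apply: itgB => //; exact: Cc_itg.
have k2 : itg mu U (fun x => `|g x - c2 x|).
  by apply: itg_norm => //; apply: itgB => //; exact: Cc_itg.
apply: (@le_trans _ _ (\int[mu]_(x in U) (`|f x - c1 x| + `|g x - c2 x|))); last first.
  by rewrite RintegralD//; lra.
apply: le_Rintegral => //.
- apply: itg_norm => //; apply: itgB => //; first exact: itgD.
  by apply: itgD => //; exact: Cc_itg.
- exact: itgD.
- by move=> x _; rewrite opprD addrACA ler_normD.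
Qed.

Lemma Cc_approxZ f (k : R) : itg mu U f -> Cc_approx f -> Cc_approx (fun x => k * f x).
Proof.
move=> hf af e e0.
have k0 : 0 < `|k| + 1 by rewrite ltr_wpDl.
have [c hc ic] := af _ (divr_gt0 e0 k0).
exists (fun x => k * c x); first exact: CcZ.
have k1 : itg mu U (fun x => `|f x - c x|).
  by apply: itg_norm => //; apply: itgB => //; exact: Cc_itg.
rewrite (@eq_Rintegral _ _ _ _ _ (fun x => `|k| * `|f x - c x|)); last first.
  by move=> x _; rewrite -mulrBr normrM.
rewrite RintegralZl//.
have I0 : 0 <= \int[mu]_(x in U) `|f x - c x| by exact: Rintegral_ge0.
move: ic I0; set I := Rintegral _ _ _; rewrite ler_pdivlMr// mulrDr mulr1 mulrC; lra.
Qed.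

Lemma Cc_approx_open O : open O -> Cc_approx \1_O.
Proof.
move=> oO.
have oOU : open (O `&` U) by exact: openI.
have bOU : bounded_set (O `&` U).
  by case: bU => M [Mr hM]; exists M; split => // t tM x [_ Ux]; exact: hM Ux.
have hC k : Cc U (cutoff (O `&` U) k.+1%:R).
  by apply: (@CcS _ _ (O `&` U)); [move=> x []|exact: Cc_cutoff].
have [||||_] := @Rintegral_dominated _ _ _ mu U mU
  (fun k x => `|\1_O x - cutoff (O `&` U) k.+1%:R x|) (fun=> 0) (fun=> 2).
- move=> k; apply: measurableT_comp => //; apply: measurable_funB.
    by apply: measurable_indic; exact: open_measurable_rV.
  exact: Cc_measurable (hC k).
- move=> x Ux; have h := cutoff_cvg (x := x) oOU.
  rewrite -(normr0 R); apply: cvg_norm.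
  rewrite -(subrr (\1_O x)); apply: cvgB; first exact: cvg_cst.
  suff -> : \1_O x = \1_(O `&` U) x :> R by [].
  by rewrite !indicE in_setI (mem_set Ux) andbT.
- exact: itg_cst.
- move=> k x Ux; rewrite normr_id.
  have /andP[h1 h2] := cutoff_bounds (O `&` U) k.+1%:R x.
  rewrite (le_trans (ler_normB _ _))// (ger0_norm h1) indicE.
  by case: (_ \in _); rewrite ?normr1 ?normr0/=; lra.
rewrite Rintegral_cst// mul0r => /cvgrPdist_le h e e0.
have [n _ /(_ n (leqnn _))] := h e e0.
rewrite sub0r normrN ger0_norm => [hn|]; last exact: Rintegral_ge0.
by exists (cutoff (O `&` U) n.+1%:R).
Qed.

(** The sets whose indicator can be approximated form a lambda-system, and it contains the open
    sets, which are stable under intersection. *)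
Lemma Cc_approx_indic B : measurable B -> Cc_approx \1_B.
Proof.
move=> mB.
pose H : set (set 'rV[R]_N) := [set B | measurable B /\ Cc_approx \1_B].
suff : <<s open >> `<=` H.
  by move=> /(_ B (measurable_sub_open mB))[].
apply: (@lambda_system_subset _ _ _ setT) => //.
- by move=> O1 O2; exact: openI.
- split => //.
  + by split => //; exact/Cc_approx_open/openT.
  + move=> X Y YX [mX aX] [mY aY]; split; first exact: measurableD.
    have -> : \1_(X `\` Y) = (fun x => \1_X x + (-1) * \1_Y x) :> ('rV[R]_N -> R).
      apply/funext => x; rewrite !indicE in_setD.
      have [Yx|nYx] := boolP (x \in Y).
        by rewrite (mem_set (YX _ (set_mem Yx)))/=; lra.
      by rewrite andbT mulr0 addr0.
    apply: Cc_approxD => //; [exact: indic_itg|by apply: itgZ => //; exact: indic_itg|].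
    by apply: Cc_approxZ => //; exact: indic_itg.
  + move=> F nF hF.
    have mF n : measurable (F n) by have [] := hF n.
    split; first exact: bigcupT_measurable.
    have [||||_] := @Rintegral_dominated _ _ _ mu U mU
      (fun k x => `|\1_(\bigcup_i F i) x - \1_(F k) x|) (fun=> 0) (fun=> 1).
    * move=> k; apply: measurableT_comp => //; apply: measurable_funB.
        exact/measurable_indic/bigcupT_measurable.
      exact/measurable_indic.
    * move=> x Ux; apply: cvg_near_cst; rewrite indicE.
      have [[n _ Fnx]|nFx] := pselect ((\bigcup_i F i) x).
        exists n => // k /= nk; rewrite indicE mem_set; last by exists n.
        by rewrite mem_set ?subrr ?normr0//; move/subsetPset: (nF _ _ nk); apply.
      exists 0%N => // k _ /=; rewrite memNset// indicE memNset ?subrr ?normr0//.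
      by move=> Fkx; apply: nFx; exists k.
    * exact: itg_cst.
    * move=> k x Ux; rewrite normr_id !indicE.
      have [kx|] := boolP (x \in F k); last first.
        by rewrite subr0; case: (_ \in _); rewrite ?normr1 ?normr0.
      by rewrite mem_set ?subrr ?normr0//; exists k => //; exact/set_mem.
    rewrite Rintegral_cst// mul0r => /cvgrPdist_le h e e0.
    have e2 : 0 < e / 2 by rewrite divr_gt0.
    have [n _ /(_ n (leqnn _))] := h _ e2.
    rewrite sub0r normrN ger0_norm => [hn|]; last exact: Rintegral_ge0.
    have [_ /(_ _ e2)[c hc ic]] := hF n.
    exists c => //.
    have i1 : itg mu U (\1_(\bigcup_i F i) : _ -> R).
      by apply: indic_itg; exact: bigcupT_measurable.
    have i2 : itg mu U (\1_(F n) : _ -> R) by exact: indic_itg.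
    have i3 := Cc_itg hc.
    have i4 : itg mu U (fun x => `|\1_(\bigcup_i F i) x - \1_(F n) x|).
      by apply: itg_norm => //; exact: itgB.
    have i5 : itg mu U (fun x => `|\1_(F n) x - c x|).
      by apply: itg_norm => //; exact: itgB.
    apply: (@le_trans _ _ (\int[mu]_(x in U)
      (`|\1_(\bigcup_i F i) x - \1_(F n) x| + `|\1_(F n) x - c x|))); last first.
      by rewrite RintegralD//; lra.
    apply: le_Rintegral => //.
    * by apply: itg_norm => //; exact: itgB.
    * exact: itgD.
    * by move=> x _; rewrite (le_trans _ (ler_normD _ _))// addrA subrK.
- by move=> O oO; split; [exact: open_measurable_rV|exact: Cc_approx_open].
Qed.

Import HBSimple.

(** Indicators give simple functions by linearity, and simple functions are dense in L^1. *)
Theorem Cc_dense f : itg mu U f -> Cc_approx f.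
Proof.
move=> hf e e0; have e2 : 0 < e / 2 by rewrite divr_gt0.
have [g_ [ig _ lg]] := approximation_sfun_integrable mU hf.
have [g [hg eg]] : exists g : {sfun 'rV[R]_N >-> R}, itg mu U g /\
    \int[mu]_(x in U) `|f x - g x| <= e / 2.
  have /fine_cvgP[_ /cvgrPdist_le h] := lg.
  have [n _ /(_ n (leqnn _))] := h _ e2.
  rewrite sub0r normrN => hn.
  exists (g_ n); split; first exact: ig.
  by apply: le_trans hn; rewrite /Rintegral ler_norm.
have ag : Cc_approx g.
  have -> : (g : _ -> R) = (fun x => \sum_(y <- finmap.enum_fset (fset_set (range g))) (y * \1_(g @^-1` [set y]) x)).
    by apply/funext => x; rewrite fimfunE fsbig_finite.
  have mi y : measurable (g @^-1` [set y]).
    exact: measurable_sfunP.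
  move: (finmap.enum_fset _) => s; elim: s => [|y s IH].
    move=> t t0; exists (fun=> 0); first exact: Cc0.
    rewrite (@eq_Rintegral _ _ _ _ _ (fun=> 0)).
      by rewrite Rintegral_cst// mul0r ltW.
    by move=> x _; rewrite big_nil subr0 normr0.
  have -> : (fun x => \sum_(y0 <- y :: s) (y0 * \1_(g @^-1` [set y0]) x)) =
     (fun x => y * \1_(g @^-1` [set y]) x + \sum_(y0 <- s) (y0 * \1_(g @^-1` [set y0]) x)).
    by apply/funext => x; rewrite big_cons.
  apply: Cc_approxD => //.
  - by apply: itgZ => //; exact: indic_itg.
  - by apply: itg_sum => // z; apply: itgZ => //; exact: indic_itg.
  - by apply: Cc_approxZ; [exact: indic_itg|exact: Cc_approx_indic].
have [c hc ic] := ag _ e2; exists c => //.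
have i3 := Cc_itg hc.
have i4 : itg mu U (fun x => `|f x - g x|) by apply: itg_norm => //; exact: itgB.
have i5 : itg mu U (fun x => `|g x - c x|) by apply: itg_norm => //; exact: itgB.
apply: (@le_trans _ _ (\int[mu]_(x in U) (`|f x - g x| + `|g x - c x|))); last first.
  by rewrite RintegralD//; lra.
apply: le_Rintegral => //.
- by apply: itg_norm => //; exact: itgB.
- exact: itgD.
- by move=> x _; rewrite (le_trans _ (ler_normD _ _))// addrA subrK.
Qed.

End density.

(** * Directional derivatives and smooth functions *)

Section directional.
Context {R : realType} {V : normedModType R}.
Implicit Types (f g : V -> R) (x v : V).

(** Reduces directional derivatives to derivatives of functions of one real variable, where the
    chain rule and the mean value theorem are available. *)
Lemma is_derive_lineE f x v d :
  is_derive x v f d <-> is_derive (0 : R) 1 (fun h : R => f (h *: v + x)) d.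
Proof.
have E : 'D_v f x = 'D_1 (fun h : R => f (h *: v + x)) 0.
  rewrite /derive; set g1 := fun h => h^-1 *: _; set g2 := fun h => h^-1 *: _.
  suff -> : g1 = g2 by [].
  by apply/funext => h; rewrite /g1 /g2 /= scale0r add0r addr0 [_%:A]mulr1.
split => -[h1 h2]; split.
- exact: (derivable1P f x v).1 h1.
- by rewrite -E.
- exact: (derivable1P f x v).2 h1.
- by rewrite E.
Qed.

Lemma is_derive_line f x v d (t : R) : is_derive (t *: v + x) v f d ->
  is_derive t 1 (fun h : R => f (h *: v + x)) d.
Proof.
move/is_derive_lineE => h.
have -> : (fun h => f (h *: v + x)) =
    (fun h => f (h *: v + (t *: v + x))) \o (fun h => h - t).
  by apply/funext => s /=; rewrite addrA -scalerDl subrK.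
rewrite -[d]mulr1; apply: is_derive1_comp; first by rewrite subrr.
by rewrite -[X in is_derive _ _ _ X](subr0 1); apply: is_deriveB.
Qed.

Lemma is_derive_comp_real (F : R -> R) g x v a b :
  is_derive x v g b -> is_derive (g x) 1 F a ->
  is_derive x v (fun y => F (g y)) (a * b).
Proof.
move=> /is_derive_lineE hg hF; apply/is_derive_lineE.
apply: (is_derive1_comp (f := F) (g := fun h : R => g (h *: v + x))) => //.
by rewrite scale0r add0r.
Qed.

Lemma is_derive_near_eq f g x v d : (\forall y \near x, f y = g y) ->
  is_derive x v f d -> is_derive x v g d.
Proof. by move=> h; apply: near_eq_is_derive. Qed.

Lemma is_derive_mul f g x v a b : is_derive x v f a -> is_derive x v g b ->
  is_derive x v (fun y => f y * g y) (f x * b + g x * a).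
Proof. by move=> hf hg; exact: is_deriveM. Qed.

Lemma line_mvt f df x v (r : R) : 0 < r ->
  (forall t, 0 < t < r -> is_derive (t *: v + x) v f (df (t *: v + x))) ->
  {within `[0, r], continuous (fun t : R => f (t *: v + x))} ->
  exists2 t, 0 < t < r & f (r *: v + x) - f x = df (t *: v + x) * r.
Proof.
move=> r0 hd hc.
have hd' t : t \in `]0, r[ ->
    is_derive t 1 (fun t : R => f (t *: v + x)) (df (t *: v + x)).
  by rewrite in_itv /= => ht; apply: is_derive_line; exact: hd.
have [t] := @MVT R (fun t => f (t *: v + x)) (fun t => df (t *: v + x)) 0 r r0 hd' hc.
rewrite in_itv /= => ht; rewrite scale0r add0r subr0 => E.
by exists t.
Qed.

End directional.

(** * Functions that are flat at the origin *)

Section smooth_bump.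
Context {R : realType}.

(** The polynomial makes the family closed under differentiation: the derivative of p(1/s) exp(-1/s)
    belongs to the polynomial X^2 (p - p'), so smoothness becomes an induction. *)
Definition expinv (p : {poly R}) (s : R) : R :=
  if 0 < s then p.[s^-1] * expR (- s^-1) else 0.

(** For the monomial of degree i, exp y >= y^(i+2) / (i+2)! with y = 1/s leaves a factor s^2;
    quadratic decay is what makes the derivative at 0 vanish. *)
Lemma expinv_bound (p : {poly R}) :
  exists2 C, 0 <= C & forall s, `|expinv p s| <= C * s ^+ 2.
Proof.
exists (\sum_(i < size p) `|p`_i| * (i.+2)`!%:R).
  by apply: sumr_ge0 => i _; rewrite mulr_ge0.
move=> s; rewrite /expinv; case: ifPn => [s0|_]; last first.
  rewrite normr0 mulr_ge0 ?sqr_ge0//.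
  by apply: sumr_ge0 => i _; rewrite mulr_ge0.
rewrite horner_coef mulr_suml (le_trans (ler_norm_sum _ _ _))// mulr_suml; apply: ler_sum => i _.
rewrite !normrM -!mulrA; apply: ler_wpM2l => //.
rewrite (ger0_norm (expR_ge0 _)) ger0_norm; last by rewrite exprn_ge0// invr_ge0 ltW.
have y0 : 0 < s^-1 by rewrite invr_gt0.
have h := @expR_ge1Dxn R s^-1 i.+1 (ltW y0).
have h2 : s^-1 ^+ i.+2 <= (i.+2)`!%:R * expR s^-1.
  by rewrite mulrC -ler_pdivrMr ?ltr0n ?fact_gt0//; apply: le_trans h; rewrite lerDr.
have -> : s^-1 ^+ i = s^-1 ^+ i.+2 * s ^+ 2.
  by rewrite -addn2 exprD -mulrA -exprMn mulVf ?gt_eqF// expr1n mulr1.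
rewrite -mulrA (mulrC (s ^+ 2)) mulrA ler_wpM2r ?sqr_ge0//.
by rewrite expRN ler_pdivrMr ?expR_gt0.
Qed.

Lemma expinv_derive (p : {poly R}) (s : R) :
  is_derive s (1 : R) (expinv p) (expinv ('X^2 * (p - p^`())) s).
Proof.
have [s0|s0|->] := ltgtP s 0; last first.
- rewrite [X in is_derive _ _ _ X]/expinv ltxx.
  have [C C0 hC] := expinv_bound p.
  have h : (h^-1 *: (expinv p (h *: (1 : R) + 0) - expinv p 0)) @[h --> 0^'] --> (0 : R).
    apply/cvgrPdist_le => e e0.
    have hE : \forall h \near (0 : R)^', `|h| <= e / (C + 1).
      by apply: dnbhs0_le; rewrite divr_gt0// ltr_wpDl.
    near=> h.
    rewrite sub0r normrN addr0 [h *: _]mulr1 {2}/expinv ltxx subr0 [_ *: _]/( _ * _).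
    have hN : h != 0 by near: h; exact: nbhs_dnbhs_neq.
    rewrite normrM normfV ler_pdivrMl ?normr_gt0// (le_trans (hC h))//.
    rewrite -real_normK ?num_real// expr2 mulrA mulrC ler_wpM2l//.
    have he : `|h| <= e / (C + 1).
      by near: h; exact: hE.
    rewrite (le_trans (ler_wpM2l C0 he))// mulrA ler_pdivrMr ?ltr_wpDl//.
    by rewrite mulrC ler_wpM2l ?lerDl// ltW.
  split; first by apply/cvg_ex; exists 0.
  exact/cvg_lim.
- apply: (@is_derive_near_eq R R^o (fun s : R => p.[s^-1] * expR (- s^-1))).
    near=> t; rewrite /expinv ifT//; near: t.
    exact: lt_nbhsr.
  rewrite /expinv s0.
  have sN : s != 0 by rewrite gt_eqF.
  have h1 : is_derive s 1 (fun t : R => t^-1) (- s ^- 2).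
    have := @is_deriveV R id s 1 1 sN (is_derive_id _ _).
    by rewrite /= [_ *: _]mulr1.
  have h2 : is_derive s 1 (fun t : R => p.[t^-1]) (p^`().[s^-1] * - s ^- 2).
    exact: (is_derive1_comp (f := horner p) (g := fun t : R => t^-1)).
  have h3 : is_derive s 1 (fun t : R => expR (- t^-1)) (expR (- s^-1) * - - s ^- 2).
    by apply: (is_derive1_comp (f := expR) (g := fun t : R => - t^-1)); exact: is_deriveN.
  have h4 := is_derive_mul h2 h3; apply: (is_derive_eq h4).
  by rewrite !hornerE /= exprVn; ring.
- apply: (@is_derive_near_eq _ _ (fun=> 0)).
    near=> t; rewrite /expinv ifF//; apply/negbTE; rewrite -leNgt ltW//; near: t.
    exact: lt_nbhsl.
  by rewrite /expinv ltNge (ltW s0) /=; exact: is_derive_cst.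
Unshelve. all: by end_near. Qed.

Lemma expinv_ge0 s : 0 <= expinv 1 s.
Proof. by rewrite /expinv; case: ifP => // _; rewrite hornerC mul1r expR_ge0. Qed.

Lemma expinv_gt0 s : 0 < s -> 0 < expinv 1 s.
Proof. by rewrite /expinv => ->; rewrite hornerC mul1r expR_gt0. Qed.

Lemma expinv_eq0 p s : s <= 0 -> expinv p s = 0.
Proof. by rewrite leNgt /expinv => /negbTE ->. Qed.

End smooth_bump.

(** * Stability properties of C^k functions *)

Section Ck_calculus.
Context {R : realType} {V : normedModType R}.
Implicit Types (f g : V -> R) (k : nat).

Lemma Ck_cst k (c : R) : Ck k (@setT V) (fun=> c).
Proof.
elim: k c => [|k IH] c; split=> //; try by move=> x _; exact: cst_continuous.
move=> v; split; first by move=> x _; exact: derivable_cst.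
rewrite (_ : 'D_v _ = fun=> 0)//; apply/funext => x.
exact: derive_cst.
Qed.

Lemma CkW k f : Ck k.+1 setT f -> Ck k setT f.
Proof.
elim: k f => [|k IH] f [h1 h2]; split => // v.
by have [h3 h4] := h2 v; split => //; exact: (IH _ h4).
Qed.

Lemma CkD k f g : Ck k setT f -> Ck k setT g -> Ck k setT (fun x => f x + g x).
Proof.
elim: k f g => [|k IH] f g [f1 f2] [g1 g2]; (split;
  first by move=> x _; apply: continuousD; [exact: f1|exact: g1]) => // v.
have [f3 f4] := f2 v; have [g3 g4] := g2 v; split.
  by move=> x _; apply: derivableD; [exact: f3|exact: g3].
rewrite (_ : 'D_v _ = fun x => 'D_v f x + 'D_v g x); first exact: IH.
by apply/funext => x; rewrite deriveD//; [exact: f3|exact: g3].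
Qed.

Lemma CkM k f g : Ck k setT f -> Ck k setT g -> Ck k setT (fun x => f x * g x).
Proof.
elim: k f g => [|k IH] f g hf hg.
  case: hf hg => f1 _ [g1 _]; split => // x _.
  by apply: continuousM; [exact: f1|exact: g1].
have hf' := CkW hf; have hg' := CkW hg.
case: hf hg => f1 f2 [g1 g2]; split.
  by move=> x _; apply: continuousM; [exact: f1|exact: g1].
move=> v; have [f3 f4] := f2 v; have [g3 g4] := g2 v; split.
  by move=> x _; apply: derivableM; [exact: f3|exact: g3].
rewrite (_ : 'D_v _ = fun x => f x * 'D_v g x + g x * 'D_v f x).
  by apply: CkD; exact: IH.
by apply/funext => x; rewrite deriveM//; [exact: f3|exact: g3].
Qed.

Lemma Ck_prod k (I : Type) (s : seq I) (h : I -> V -> R) :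
  (forall i, Ck k setT (h i)) -> Ck k setT (fun x => \prod_(i <- s) h i x).
Proof.
move=> hh; elim: s => [|i s IH].
  by under eq_fun do rewrite big_nil; exact: Ck_cst.
by under eq_fun do rewrite big_cons; exact: CkM.
Qed.

Lemma Ck_shift k f z : Ck k setT f -> Ck k setT (fun x => f (x - z)).
Proof.
have sh (h : V -> R) x v : is_derive (x - z) v h ('D_v h (x - z)) ->
    is_derive x v (fun x => h (x - z)) ('D_v h (x - z)).
  move=> /is_derive_lineE H; apply/is_derive_lineE.
  by under eq_fun do rewrite -addrA.
have cs x : {for x, continuous (fun y : V => y - z)}.
  by apply: continuousB; [exact: cvg_id|exact: cst_continuous].
elim: k f => [|k IH] f [h1 h2]; (split;
  first by move=> x _; apply: (continuous_comp (f := fun y => y - z) (g := f)); [exact: cs|exact: h1]) => // v.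
have [h3 h4] := h2 v.
have h5 x : is_derive x v (fun x => f (x - z)) ('D_v f (x - z)).
  by apply: sh; apply: derivableP; exact: h3.
split; first by move=> x _; have [] := h5 x.
have -> : 'D_v (fun x : V => f (x - z)) = (fun x : V => 'D_v f (x - z)).
  by apply/funext => x; have [] := h5 x.
exact: (IH _ h4).
Qed.

End Ck_calculus.

(** * A smooth even bump *)

Section mollifier_kernel.
Context {R : realType} {N : nat}.

(** Induction on [k] for all polynomials at once, since a derivative only changes [p] and a constant
    factor. *)
Lemma Ck_expinv_coord k (p : {poly R}) (al be : R) (i : 'I_N) :
  Ck k setT (fun x : 'rV[R]_N => expinv p (al + be * x 0 i)).
Proof.
have cD (x v : 'rV[R]_N) : is_derive x v (fun x : 'rV[R]_N => al + be * x 0 i) (be * v 0 i).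
  apply/is_derive_lineE.
  have -> : (fun h => al + be * (h *: v + x) 0 i) =
      (fun h => (al + be * x 0 i) + (be * v 0 i) * h).
    by apply/funext => h; rewrite !mxE; ring.
  have := is_deriveD (is_derive_cst (al + be * x 0 i) (0 : R) 1)
    (is_deriveZ (be * v 0 i) (is_derive_id (0 : R) 1)).
  by rewrite add0r [_ *: _]mulr1.
have dE q (x v : 'rV[R]_N) : is_derive x v (fun x : 'rV[R]_N => expinv q (al + be * x 0 i))
    (expinv ('X^2 * (q - q^`())) (al + be * x 0 i) * (be * v 0 i)).
  exact: is_derive_comp_real (cD x v) (expinv_derive q _).
have cc q (x : 'rV[R]_N) : {for x, continuous (fun x : 'rV[R]_N => expinv q (al + be * x 0 i))}.
  apply: (continuous_comp (f := fun x : 'rV[R]_N => al + be * x 0 i) (g := expinv q)).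
    apply: continuousD; first exact: cst_continuous.
    by apply: continuousM; [exact: cst_continuous|exact: coord_continuous].
  apply: differentiable_continuous; apply/derivable1_diffP.
  by have [] := expinv_derive q (al + be * x 0 i).
elim: k p => [|k IH] p; split => //; try by move=> x _; exact: cc.
move=> v; split; first by move=> x _; have [] := dE p x v.
rewrite (_ : 'D_v _ = fun x => expinv ('X^2 * (p - p^`())) (al + be * x 0 i) * (be * v 0 i)).
  by apply: CkM; [exact: IH|exact: Ck_cst].
by apply/funext => x; have [] := dE p x v.
Qed.

(** For r > 0 it is positive exactly on the open cube of half-side [r]. Both factors are written in
    the form treated by [Ck_expinv_coord]. *)
Definition bumpf (r : R) (x : 'rV[R]_N) : R :=
  \prod_(i < N) (expinv 1 (r + 1 * x 0 i) * expinv 1 (r + (-1) * x 0 i)).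

Lemma bumpf_Ck k r : Ck k setT (bumpf r).
Proof. by apply: Ck_prod => i; apply: CkM; exact: Ck_expinv_coord. Qed.

Lemma bumpf_ge0 r x : 0 <= bumpf r x.
Proof. by apply: prodr_ge0 => i _; rewrite mulr_ge0 ?expinv_ge0. Qed.

Lemma bumpfN r x : bumpf r (- x) = bumpf r x.
Proof.
apply: eq_bigr => i _; rewrite !mxE mulrC.
by congr (expinv 1 _ * expinv 1 _); ring.
Qed.

Lemma bumpf_gt0 r x : `|x| < r -> 0 < bumpf r x.
Proof.
move=> h; apply: prodr_gt0 => i _; rewrite mulr_gt0// expinv_gt0//.
  have := le_lt_trans (coord_le_norm x i) h; rewrite ltr_norml; lra.
have := le_lt_trans (coord_le_norm x i) h; rewrite ltr_norml; lra.
Qed.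

Lemma bumpf_eq0 r x : 0 < r -> r <= `|x| -> bumpf r x = 0.
Proof.
move=> r0 h.
have [i hi] : exists i, r <= `|x 0 i|.
  apply: contrapT => /forallNP nh; move: h; rewrite leNgt => /negP; apply.
  by apply: rV_norm_lt => // i; rewrite ltNge; exact/negP/nh.
rewrite /bumpf (bigD1 i)//=; move: hi; rewrite ler_normr => /orP[|] hi.
  by rewrite (@expinv_eq0 _ 1 (r + (-1) * _)) ?mulr0 ?mul0r//; lra.
by rewrite (@expinv_eq0 _ 1 (r + 1 * _)) ?mul0r//; lra.
Qed.

End mollifier_kernel.

(** * Uniform continuity and uniform convergence of difference quotients *)

Section uniform_continuity.
Context {R : realType} {V : normedModType R}.

(** As [f] is continuous at the points of [K] relative to the whole space, the second point [y] may
    lie outside [K]. *)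
Lemma compact_unif_continuous (K : set V) (f : V -> R) : compact K ->
  (forall x, K x -> {for x, continuous f}) -> forall e, 0 < e ->
  exists2 d, 0 < d & forall x y, K x -> `|x - y| < d -> `|f x - f y| < e.
Proof.
move=> /compact_near_coveringP cK cf e e0.
have e2 : 0 < e / 2 by rewrite divr_gt0.
pose P (d : R) (x : V) := forall y, `|x - y| < d -> `|f x - f y| < e.
have h : \forall d \near (0 : R)^'+, K `<=` P d.
  apply: cK => x Kx.
  have := cf x Kx; rewrite /prop_for /continuous_at => /cvgrPdist_lt/(_ _ e2).
  move=> /nbhs_ballP[r /= r0 hr].
  have r2 : 0 < r / 2 by rewrite divr_gt0.
  exists (ball x (r / 2), [set d : R | d < r / 2]) => /=.
    by split; [exact: nbhsx_ballx|exact: nbhs_right_lt].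
  move=> [x' d] /= [xx' dr] y hy.
  have h1 : `|f x - f x'| < e / 2.
    apply: hr; rewrite -ball_normE /ball_ /=.
    move: xx'; rewrite -ball_normE /ball_ /=; lra.
  have h2 : `|f x - f y| < e / 2.
    apply: hr; rewrite -ball_normE /ball_ /=.
    rewrite -(subrK x' x) -addrA (le_lt_trans (ler_normD _ _))//.
    move: xx'; rewrite -ball_normE /ball_ /=; lra.
  rewrite -(subrK (f x) (f x')) -addrA (le_lt_trans (ler_normD _ _))//.
  by rewrite (distrC (f x')); lra.
have [d [hd d0]] : exists d, K `<=` P d /\ 0 < d.
  near (0 : R)^'+ => d; exists d; split => //.
  by near: d.
by exists d => // x y Kx; exact: hd.
Unshelve. all: by end_near. Qed.

Lemma is_derive_eps (f : V -> R) (x v : V) (l : R) :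
  (forall e, 0 < e -> exists2 d, 0 < d & forall h : R, h != 0 -> `|h| < d ->
    `|h^-1 * (f (h *: v + x) - f x) - l| <= e) ->
  is_derive x v f l.
Proof.
move=> H.
have h : h^-1 *: (f (h *: v + x) - f x) @[h --> (0 : R)^'] --> l.
  apply/cvgrPdist_le => e /H[d d0 hd].
  have h1 : \forall h \near (0 : R)^', `|h| < d by exact: dnbhs0_lt.
  near=> h; rewrite distrC; apply: hd; last by near: h.
  by near: h; exact: nbhs_dnbhs_neq.
split; first by apply/cvg_ex; exists l.
exact/cvg_lim.
Unshelve. all: by end_near. Qed.

(** By the mean value theorem the quotient is a value of k' on the segment, within [d] of [z]; a
    negative step is reduced to a positive one by exchanging the end points. *)
Lemma diff_quotient_le (k k' : V -> R) (v : V) (d e : R) :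
  (forall x, is_derive x v k (k' x)) ->
  (forall x y, `|x - y| < d -> `|k' x - k' y| < e) ->
  forall z h, h != 0 -> `|h| * `|v| < d ->
  `|h^-1 * (k (h *: v + z) - k z) - k' z| <= e.
Proof.
move=> dk hd.
have pos z h : 0 < h -> exists2 t, 0 < t < h & k (h *: v + z) - k z = k' (t *: v + z) * h.
  move=> h0; apply: line_mvt => //.
  apply: derivable_within_continuous => t _.
  by have [] := is_derive_line (dk (t *: v + z)).
move=> z h hN hv; have [h0|h0|h0] := ltgtP h 0; last by rewrite h0 eqxx in hN.
  have [t /andP[t0 th]] := pos (h *: v + z) (- h) ltac:(by rewrite oppr_gt0).
  rewrite addrA -scalerDl addNr scale0r add0r => E.
  have -> : k (h *: v + z) - k z = k' (t *: v + (h *: v + z)) * h.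
    by rewrite -opprB E mulrN opprK.
  rewrite mulrC mulfK//.
  rewrite ltW//; apply: hd; rewrite addrA -scalerDl addrK normrZ.
  apply: le_lt_trans hv; rewrite ler_wpM2r// !ler0_norm//; lra.
have [t /andP[t0 th] ->] := pos z h h0.
rewrite mulrC mulfK// ltW//; apply: hd; rewrite addrK normrZ.
by apply: le_lt_trans hv; rewrite ler_wpM2r// !gtr0_norm// ltW.
Qed.

End uniform_continuity.

(** * Mollification *)

Section convolution.
Context {R : realType} {N : nat}.
Notation mu := (@lebesgueN R N).
Implicit Types (f g c k : 'rV[R]_N -> R) (x y v z : 'rV[R]_N).

Lemma Cc_unif_continuous U c : Cc U c -> forall e, 0 < e ->
  exists2 d, 0 < d & forall x y, `|x - y| < d -> `|c x - c y| < e.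
Proof.
move=> [cc [K [cK KU c0]]] e e0.
have [d d0 hd] := compact_unif_continuous cK (fun x _ => cc x) e0.
exists d => // x y xy.
have [Kx|nKx] := pselect (K x); first exact: hd.
have [Ky|nKy] := pselect (K y); first by rewrite distrC; apply: hd => //; rewrite distrC.
by rewrite !c0// subr0 normr0.
Qed.

Lemma Rintegral_shift (z : 'rV[R]_N) f : measurable_fun setT f ->
  \int[mu]_x f (x + z) = \int[mu]_x f x.
Proof.
move=> mf; congr fine.
by have := @integral_shift R N z (EFin \o f) ltac:(exact/measurable_EFinP).
Qed.

Lemma itg_shift z f : itg mu setT f -> itg mu setT (fun x => f (x + z)).
Proof.
move=> hf; have mf := itg_measurable hf.
have ms : measurable_fun setT (fun x : 'rV[R]_N => f (x + z)).
  exact: (measurableT_comp mf (@measurable_shift_rV R N z)).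
apply/integrableP; split; first exact/measurable_EFinP.
have /integrableP[_] := hf; apply: le_lt_trans.
have ma : measurable_fun setT (fun x => `|(f x)%:E|%E).
  by apply: measurableT_comp => //; exact/measurable_EFinP.
by rewrite -(@integral_shift R N z _ ma).
Qed.

Section superposition.
Variables (g : 'rV[R]_N -> R) (T : 'rV[R]_N -> 'rV[R]_N).
Hypotheses (hg : itg mu setT g) (mT : measurable_fun setT T).

(* With T = id and T = -id this covers both ways of writing a convolution. *)
Definition super k x : R := \int[mu]_y (g y * k (x + T y)).

Lemma super_itg U k x : Cc U k -> itg mu setT (fun y => g y * k (x + T y)).
Proof.
move=> hk; have [M _ hM] := Cc_bounded hk.
apply: (@itgM_bounded _ _ _ mu _ measurableT M) => //.
have h1 : measurable_fun setT ((@shift_rV R N x) \o T).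
  exact: (measurableT_comp (measurable_shift_rV x) mT).
have mk : measurable_fun [set: 'rV[R]_N] k by exact: Cc_measurable hk.
have := measurableT_comp mk h1.
rewrite [X in measurable_fun _ X -> _](_ : _ = fun y => k (x + T y))//.
by apply/funext => y; rewrite /= /shift_rV addrC.
Qed.

Let G := \int[mu]_y `|g y|.

Let G0 : 0 <= G. Proof. exact: Rintegral_ge0. Qed.

Lemma super_dist (e : R) (h : 'rV[R]_N -> R) : itg mu setT (fun y => g y * h y) ->
  (forall y, `|h y| <= e) -> `|\int[mu]_y (g y * h y)| <= e * G.
Proof.
move=> hi he; rewrite -RintegralZl//; last exact: itg_norm.
apply: abs_Rintegral_le => //.
- exact: itg_measurable hi.
- by move=> y _; rewrite normrM mulrC ler_wpM2r.
- by apply: itgZ => //; exact: itg_norm.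
Qed.

Lemma super_continuous U k : Cc U k -> continuous (super k).
Proof.
move=> hk x; apply: rV_continuousP => e e0.
have G1 : 0 < G + 1 by rewrite ltr_wpDl.
have [d d0 hd] := Cc_unif_continuous hk (divr_gt0 e0 G1).
exists d => // x' xx'; rewrite /super -RintegralB//; try exact: super_itg hk.
under eq_Rintegral do rewrite -mulrBr.
apply: (@le_lt_trans _ _ (e / (G + 1) * G)).
  apply: super_dist.
    have := itgB measurableT (super_itg x hk) (super_itg x' hk).
    by apply: (itg_eq measurableT) => y _; rewrite mulrBr.
  by move=> y; rewrite ltW//; apply: hd; rewrite opprD addrACA subrr addr0.
by rewrite mulrAC ltr_pdivrMr// ltr_pM2l// ltrDl.
Qed.

(** Differentiation under the integral needs no dominated convergence: the difference quotients of
    [k] converge uniformly and [g] is integrable. *)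
Lemma super_derive U k k' v : Cc U k -> Cc U k' ->
  (forall x, is_derive x v k (k' x)) ->
  forall x, is_derive x v (super k) (super k' x).
Proof.
move=> hk hk' dk x.
have G1 : 0 < G + 1 by rewrite ltr_wpDl.
have v1 : 0 < `|v| + 1 by rewrite ltr_wpDl.
apply: is_derive_eps => e e0.
have [d d0 hd] := Cc_unif_continuous hk' (divr_gt0 e0 G1).
exists (d / (`|v| + 1)); first by rewrite divr_gt0.
move=> h hN; rewrite ltr_pdivlMr// => hv.
have hv' : `|h| * `|v| < d by apply: le_lt_trans hv; rewrite ler_wpM2l// lerDl.
have i1 := super_itg (h *: v + x) hk.
have i2 := super_itg x hk.
have i3 := super_itg x hk'.
have i4 : itg mu setT (fun y => h^-1 * (g y * k (h *: v + x + T y) - g y * k (x + T y))).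
  by apply: itgZ => //; exact: itgB.
rewrite /super -RintegralB// -RintegralZl//; last exact: itgB.
rewrite -RintegralB//.
have E y : h^-1 * (g y * k (h *: v + x + T y) - g y * k (x + T y)) - g y * k' (x + T y) =
    g y * (h^-1 * (k (h *: v + (x + T y)) - k (x + T y)) - k' (x + T y)).
  by rewrite addrA; ring.
under eq_Rintegral do rewrite E.
apply: (@le_trans _ _ (e / (G + 1) * G)).
  apply: super_dist.
    by apply: (itg_eq measurableT _ (itgB measurableT i4 i3)) => y _; exact: E.
  by move=> y; exact: (diff_quotient_le dk hd).
by rewrite mulrAC ler_pdivrMr// ler_pM2l// lerDl.
Qed.

End superposition.

Lemma smooth_Cc_derive (U : set 'rV[R]_N) k v : (forall m, Ck m setT k) -> Cc U k ->
  [/\ forall x, is_derive x v k ('D_v k x), forall m, Ck m setT ('D_v k) & Cc U ('D_v k)].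
Proof.
move=> sk hk.
have d0 x : is_derive x v k ('D_v k x).
  by apply: derivableP; have [_ /(_ v)[+ _]] := sk 1%N; exact.
have d1 m : Ck m setT ('D_v k) by have [_ /(_ v)[]] := sk m.+1.
split => //; split; first by move=> x; have [+ _] := d1 0%N; exact.
have [_ [K [cK KU k0]]] := hk; exists K; split => // x nK.
have nK' : nbhs x (~` K).
  apply: open_nbhs_nbhs; split => //.
  by apply: closed_openC; apply: compact_closed.
rewrite -(derive_cst (0 : R) x v); apply: near_eq_derive.
by apply: (@filterS _ (nbhs x) _ _ _ _ nK') => y /k0.
Qed.

Lemma super_Ck (U : set 'rV[R]_N) g T m k : itg mu setT g -> measurable_fun setT T ->
  (forall m, Ck m setT k) -> Cc U k -> Ck m setT (super g T k).
Proof.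
move=> hg mT; elim: m k => [|m IH] k sk hk; split => //;
  try by move=> x _; exact: super_continuous hk x.
move=> v; have [d0 d1 d2] := smooth_Cc_derive v sk hk.
have d3 x := super_derive hg mT hk d2 d0 x.
split; first by move=> x _; have [] := d3 x.
have -> : 'D_v (super g T k) = super g T ('D_v k).
  by apply/funext => x; have [] := d3 x.
exact: IH.
Qed.

Lemma measurable_opp_rV : measurable_fun setT (fun y : 'rV[R]_N => - y).
Proof.
apply: measurable_fun_rV => i.
rewrite [X in measurable_fun _ X](_ : _ = (fun t : R => - t) \o @rV_coors R N i).
  by apply: measurableT_comp; [exact: oppr_measurable|exact: measurable_rV_coors].
by apply/funext => x; rewrite /= /rV_coors mxE.
Qed.

Definition kmass (r : R) : R := \int[mu]_x bumpf r x.

Lemma bumpf_Cc (r : R) : 0 < r -> Cc setT (@bumpf R N r).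
Proof.
move=> r0; split; first by move=> x; have [+ _] := @bumpf_Ck R N 0 r; exact.
exists (cube N r); split => //.
  apply: bounded_closed_compact; last exact: closed_cube.
  exists r; split; first exact: num_real.
  by move=> t rt x hx; apply: rV_norm_le; [lra|move=> i; have := hx i; lra].
move=> x nx; apply: bumpf_eq0 => //; rewrite leNgt; apply/negP => h; apply: nx => i.
by rewrite (le_trans (coord_le_norm x i))// ltW.
Qed.

Lemma Cc_itgT (U : set 'rV[R]_N) c : Cc U c -> itg mu setT c.
Proof.
move=> hc; have [cc [K [cK KU c0]]] := hc; have [M _ hM] := Cc_bounded hc.
have mK := compact_measurable_rV cK.
have fK : (mu K < +oo)%E.
  by apply: lebesgueN_bounded => //; exact: compact_bounded.
have h : itg mu K c by apply: (itg_bounded mK fK) => //; exact: Cc_measurable hc.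
have := (integrable_mkcond (EFin \o c) mK).1 h.
apply: eq_integrable => // x _; rewrite /patch; case: ifPn => // /negP nK /=.
by rewrite c0// => Kx; apply: nK; exact/mem_set.
Qed.

Lemma lebesgueN_cube_gt0 (r : R) : 0 < r -> (0 < mu (cube N r))%E.
Proof.
move=> r0; move: (N) => n; elim: n => [|n IH].
  by rewrite /= diracE mem_set ?lte01// => -[].
rewrite /= /lebesgue_step /pushforward preimage_cons_cube.
have -> : [set t : R | `|t| <= r] = `[- r, r]%classic.
  by apply/seteqP; split => t /=; rewrite in_itv/= ler_norml.
have h : (0 < lebesgue_measure (`[(- r)%R, r]%classic : set R))%E.
  by rewrite lebesgue_measure_itv /= lte_fin ifT -?EFinB ?lte_fin; lra.
rewrite product_measure1E//; last by apply: closed_measurable_rV; exact: closed_cube.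
exact: mule_gt0.
Qed.

(** With zero mass the bump would vanish almost everywhere, although it is positive on a cube of
    positive measure. *)
Lemma kmass_gt0 (r : R) : 0 < r -> 0 < kmass r.
Proof.
move=> r0; have ib := Cc_itgT (bumpf_Cc r0).
rewrite lt_neqAle Rintegral_ge0 ?andbT; last by move=> x _; exact: bumpf_ge0.
apply/eqP => h.
have h0 : \int[mu]_x `|bumpf r x| = 0.
  by rewrite h; apply: eq_Rintegral => x _; rewrite ger0_norm// bumpf_ge0.
have [Z [mZ Z0 hZ]] := Rintegral_norm0_ae measurableT ib h0.
have r2 : 0 < r / 2 by rewrite divr_gt0.
have : (mu (cube N (r / 2)) <= mu Z)%E.
  rewrite le_measure ?inE//; first by apply: closed_measurable_rV; exact: closed_cube.
  move=> x hx; apply: hZ => /= /(_ I) b0.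
  have : 0 < bumpf r x.
    by apply: bumpf_gt0; apply: rV_norm_lt => // i; have := hx i; lra.
  by rewrite b0 ltxx.
by rewrite Z0 leNgt lebesgueN_cube_gt0.
Qed.

Definition rho (r : R) (x : 'rV[R]_N) : R := (kmass r)^-1 * bumpf r x.

Lemma rho_Ck r m : Ck m setT (rho r).
Proof. by apply: CkM; [exact: Ck_cst|exact: bumpf_Ck]. Qed.

Lemma rho_Cc r : 0 < r -> Cc setT (rho r).
Proof. by move=> r0; apply: CcZ; exact: bumpf_Cc. Qed.

Lemma rho_ge0 r x : 0 < r -> 0 <= rho r x.
Proof. by move=> r0; rewrite mulr_ge0 ?bumpf_ge0// invr_ge0 ltW ?kmass_gt0. Qed.

Lemma rhoN r x : rho r (- x) = rho r x.
Proof. by rewrite /rho bumpfN. Qed.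

Lemma rho_eq0 r x : 0 < r -> r <= `|x| -> rho r x = 0.
Proof. by move=> r0 h; rewrite /rho bumpf_eq0// mulr0. Qed.

Lemma rho_mass r : 0 < r -> \int[mu]_x rho r x = 1.
Proof.
move=> r0; rewrite RintegralZl//; first by rewrite mulVf// gt_eqF// kmass_gt0.
exact: Cc_itgT (bumpf_Cc r0).
Qed.

Lemma rho_mass_shift r x : 0 < r -> \int[mu]_y rho r (x - y) = 1.
Proof.
move=> r0; under eq_Rintegral do rewrite -opprB rhoN.
rewrite Rintegral_shift ?rho_mass//; exact: Cc_measurable (rho_Cc r0).
Qed.

Definition moll (r : R) f := super f -%R (rho r).

Lemma mollE r f x : moll r f x = \int[mu]_y (f y * rho r (x - y)).
Proof. by []. Qed.

Lemma moll_itg r f x : 0 < r -> itg mu setT f -> itg mu setT (fun y => f y * rho r (x - y)).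
Proof. by move=> r0 hf; exact: (super_itg hf measurable_opp_rV x (rho_Cc r0)). Qed.

Lemma moll_Ck r f m : 0 < r -> itg mu setT f -> Ck m setT (moll r f).
Proof.
move=> r0 hf; apply: (super_Ck m hf measurable_opp_rV _ (rho_Cc r0)) => k.
exact: rho_Ck.
Qed.

Lemma moll_derive r f v x : 0 < r -> itg mu setT f ->
  is_derive x v (moll r f) (super f -%R ('D_v (rho r)) x).
Proof.
move=> r0 hf; have [d0 _ d2] := smooth_Cc_derive v (rho_Ck r) (rho_Cc r0).
exact: (super_derive hf measurable_opp_rV (rho_Cc r0) d2 d0).
Qed.

Lemma moll_eq0 r f x : 0 < r -> (forall y, `|x - y| < r -> f y = 0) -> moll r f x = 0.
Proof.
move=> r0 f0; rewrite mollE (@eq_Rintegral _ _ _ _ _ (fun=> 0)).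
  by rewrite Rintegral_cst// mul0r.
move=> y _; have [h|h] := ltP `|x - y| r; first by rewrite f0// mul0r.
by rewrite rho_eq0// mulr0.
Qed.

(** Exchanging the roles of kernel and function, by a translation and the evenness of [rho], lets a
    derivative fall on [c] instead of the kernel. *)
Lemma moll_shiftE r c x : Cc setT c -> 0 < r -> moll r c x = super (rho r) id c x.
Proof.
move=> hc r0; rewrite mollE /super.
rewrite -(@Rintegral_shift x (fun y => c y * rho r (x - y))).
  apply: eq_Rintegral => y _; rewrite (addrC y) opprD addrA subrr sub0r rhoN.
  by rewrite mulrC.
exact: itg_measurable (moll_itg x r0 (Cc_itgT hc)).
Qed.

Lemma moll_derive_C1 r c c' v x : 0 < r -> Cc setT c -> Cc setT c' ->
  (forall x, is_derive x v c (c' x)) -> is_derive x v (moll r c) (moll r c' x).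
Proof.
move=> r0 hc hc' dc.
have mid : measurable_fun [set: 'rV[R]_N] (@id 'rV[R]_N) by exact: measurable_id.
have := super_derive (Cc_itgT (rho_Cc r0)) mid hc hc' dc x.
rewrite -moll_shiftE// (_ : super (rho r) id c = moll r c)//.
by apply/funext => y; rewrite moll_shiftE.
Qed.

Lemma moll_unif c e : Cc setT c -> 0 < e ->
  exists2 r0, 0 < r0 & forall r x, 0 < r -> r < r0 -> `|moll r c x - c x| <= e.
Proof.
move=> hc e0; have [d d0 hd] := Cc_unif_continuous hc e0.
exists d => // r x r0 rd.
have i1 := moll_itg x r0 (Cc_itgT hc).
have i2 : itg mu setT (fun y => rho r (x - y)).
  have := itg_shift (- x) (Cc_itgT (rho_Cc r0)).
  by apply: (itg_eq measurableT) => y _; rewrite -rhoN opprB.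
rewrite mollE -[X in _ - X]mulr1 -(rho_mass_shift x r0) -RintegralZl// -RintegralB//; last exact: itgZ.
apply: (@le_trans _ _ (\int[mu]_y (e * rho r (x - y)))); last first.
  by rewrite RintegralZl// rho_mass_shift// mulr1.
apply: abs_Rintegral_le => //.
- by apply: measurable_funB; [exact: itg_measurable i1|exact: itg_measurable (itgZ measurableT _ i2)].
- move=> y _; rewrite -mulrBl normrM (ger0_norm (rho_ge0 _ r0)).
  have [h|h] := ltP `|x - y| r; last by rewrite rho_eq0// !mulr0.
  by rewrite ler_wpM2r ?rho_ge0// ltW// distrC; apply: hd; exact: lt_trans h rd.
- exact: itgZ.
Qed.

Lemma rho_tonelli r f : 0 < r -> itg mu setT f ->
  measurable_fun [set: 'rV[R]_N] (fun x => \int[mu]_y (`|f y| * rho r (x - y))%:E)%E /\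
  (\int[mu]_x \int[mu]_y (`|f y| * rho r (x - y))%:E = \int[mu]_y (`|f y|)%:E)%E.
Proof.
move=> r0 hf; have mf := itg_measurable hf.
pose F (p : 'rV[R]_N * 'rV[R]_N) : \bar R := (`|f p.2| * rho r (p.1 - p.2))%:E.
have mrho : measurable_fun [set: 'rV[R]_N] (rho r) by exact: Cc_measurable (rho_Cc r0).
have mF : measurable_fun setT F.
  apply/measurable_EFinP; apply: measurable_funM.
    by apply: measurableT_comp => //; apply: (measurableT_comp mf); exact: measurable_snd.
  apply: (measurableT_comp mrho).
  apply: measurable_fun_rV => i.
  rewrite (_ : _ \o _ = fun p : 'rV[R]_N * 'rV[R]_N => rV_coors i p.1 - rV_coors i p.2); last first.
    by apply/funext => p; rewrite /= /rV_coors !mxE.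
  by apply: measurable_funB; apply: (measurableT_comp (@measurable_rV_coors R N i));
    [exact: measurable_fst|exact: measurable_snd].
have F0 p : (0 <= F p)%E by rewrite lee_fin mulr_ge0 ?rho_ge0.
have ET := @fubini_tonelli _ _ _ _ R (leb R N) (leb R N) F mF F0.
have E2 : (\int[mu]_y \int[mu]_x F (x, y) = \int[mu]_y (`|f y|)%:E)%E.
  apply: eq_integral => y _; rewrite /F /=.
  have i1 : itg mu setT (fun x => rho r (x - y)).
    exact: itg_shift (Cc_itgT (rho_Cc r0)).
  have i2 : itg mu setT (fun x => `|f y| * rho r (x - y)) := itgZ measurableT _ i1.
  apply: (eq_trans (esym (Rintegral_EFin measurableT i2))); congr (_%:E).
  have := RintegralZl (`|f y|) measurableT i1.
  by rewrite (Rintegral_shift (- y) mrho) (rho_mass r0) mulr1.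
split; last by rewrite -E2; exact: ET.
exact: (@measurable_fun_fubini_tonelli_F _ _ _ _ R (leb R N) F mF F0).
Qed.

(** Tonelli's theorem and the unit mass of the kernel. *)
Lemma moll_contraction r f : 0 < r -> itg mu setT f ->
  itg mu setT (moll r f) /\ \int[mu]_x `|moll r f x| <= \int[mu]_x `|f x|.
Proof.
move=> r0 hf; have mf := itg_measurable hf.
have L x : ((`|moll r f x|)%:E <= \int[mu]_y (`|f y| * rho r (x - y))%:E)%E.
  have i1 : itg mu setT (fun y => `|f y| * rho r (x - y)).
    by apply: moll_itg => //; exact: itg_norm.
  rewrite -(Rintegral_EFin measurableT i1) lee_fin mollE.
  apply: abs_Rintegral_le => //; first exact: itg_measurable (moll_itg x r0 hf).
  by move=> y _; rewrite normrM (ger0_norm (rho_ge0 _ r0)).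
have mm : measurable_fun [set: 'rV[R]_N] (moll r f).
  apply: continuous_measurable_rV; first exact: openT.
  by have [] := moll_Ck 0 r0 hf.
have I1 : (\int[mu]_x (`|moll r f x|)%:E <= \int[mu]_y (`|f y|)%:E)%E.
  have [mE1 <-] := rho_tonelli r0 hf.
  apply: ge0_le_integral => //.
  by apply/measurable_EFinP; exact: measurableT_comp.
have im : itg mu setT (moll r f).
  apply/integrableP; split; first exact/measurable_EFinP.
  apply: le_lt_trans I1 _.
  by have /integrableP[_] := hf.
split => //; rewrite -lee_fin !Rintegral_EFin//; exact: itg_norm.
Qed.

(** Approximate [f] by a continuous [c] in L^1. The contraction property controls the mollification
    of f - c, and that of [c] converges uniformly with supports in a fixed cube. *)
Lemma moll_L1 (U : set 'rV[R]_N) f e : open U -> bounded_set U -> itg mu setT f ->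
  (forall x, ~ U x -> f x = 0) -> 0 < e ->
  exists2 r0, 0 < r0 & forall r, 0 < r -> r < r0 -> \int[mu]_x `|moll r f x - f x| <= e.
Proof.
move=> oU bU hf f0 e0.
have mU := open_measurable_rV oU.
have fU : (mu U < +oo)%E by exact: lebesgueN_bounded.
have fiU : itg mu U f by apply: integrableS hf.
have e4 : 0 < e / 4 by rewrite divr_gt0.
have [c hc ic] := Cc_dense oU bU fU fiU e4.
have [_ [K [cK KU c0]]] := hc.
have hcT : Cc setT c by apply: CcS hc.
have icT := Cc_itgT hcT.
have hfc : itg mu setT (fun x => f x - c x) by exact: itgB.
have icT1 : \int[mu]_x `|f x - c x| <= e / 4.
  apply: le_trans ic; rewrite [leRHS]Rintegral_mkcond.
  rewrite le_eqVlt; apply/orP; left; apply/eqP; apply: eq_Rintegral => x _.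
  rewrite /patch; case: ifPn => // /negP nU.
  have nUx : ~ U x by move=> Ux; apply: nU; exact/mem_set.
  by rewrite f0// c0 ?subr0 ?normr0// => /KU.
have [M [Mr hM]] := bU.
(* Points of [U] have norm at most |M| + 1, so this cube contains everything within distance 1 of
   [U], in particular the support of [c] mollified at a scale below 1. *)
pose B := cube N (`|M| + 2) : set 'rV[R]_N.
have mB : measurable B by apply: closed_measurable_rV; exact: closed_cube.
have fB : (mu B < +oo)%E by exact: lebesgueN_cube.
pose mB' := fine (mu B).
have mB0 : 0 <= mB' by exact: fine_ge0.
have e5 : 0 < e / 4 / (mB' + 1) by rewrite divr_gt0// ltr_wpDl.
have [r0 r00 hr] := moll_unif hcT e5.
exists (Num.min r0 1); first by rewrite lt_min r00 ltr01.
move=> r rpos; rewrite lt_min => /andP[rr0 r1].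
have [im1 lm1] := moll_contraction rpos hfc.
have [im2 _] := moll_contraction rpos icT.
have imf := (moll_contraction rpos hf).1.
have Em x : moll r f x = moll r (fun x => f x - c x) x + moll r c x.
  rewrite !mollE -RintegralD//; try exact: moll_itg.
  by apply: eq_Rintegral => y _; rewrite -mulrDl subrK.
have i3 : itg mu setT (fun x => moll r c x - c x) by exact: itgB.
have out x : ~ B x -> moll r c x - c x = 0.
  move=> nB.
  have h y : `|x - y| < 1 -> ~ U y.
    move=> xy Uy; apply: nB => i; rewrite (le_trans (coord_le_norm x i))//.
    have : `|y| <= `|M| + 1 by apply: hM => //; rewrite (le_lt_trans (ler_norm M))// ltrDl.
    rewrite -(subrK y x) => hy; rewrite (le_trans (ler_normD _ _))//; lra.
  rewrite moll_eq0//; last by move=> y xy; apply: c0 => /KU; apply: h; exact: lt_trans xy r1.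
  by rewrite c0 ?subr0// => /KU; apply: h; rewrite subrr normr0.
have I3 : \int[mu]_x `|moll r c x - c x| <= e / 4.
  have -> : \int[mu]_x `|moll r c x - c x| = \int[mu]_(x in B) `|moll r c x - c x|.
    rewrite [RHS]Rintegral_mkcond; apply: eq_Rintegral => x _.
    rewrite /patch; case: ifPn => // /negP nB.
    by rewrite out ?normr0// => Bx; apply: nB; exact/mem_set.
  apply: (@le_trans _ _ (\int[mu]_(x in B) (e / 4 / (mB' + 1)))).
    apply: le_Rintegral => //.
    - by apply: itg_norm => //; apply: integrableS i3.
    - exact: itg_cst.
    - by move=> x _; exact: hr.
  rewrite Rintegral_cst// -/mB' mulrAC ler_pdivrMr ?ltr_wpDl//.
  by rewrite ler_pM2l// lerDl.
apply: (@le_trans _ _ (\int[mu]_x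
   (`|moll r (fun x => f x - c x) x| + `|moll r c x - c x| + `|f x - c x|))).
  apply: le_Rintegral => //.
  - by apply: itg_norm => //; exact: itgB.
  - by apply: itgD => //; [apply: itgD => //; exact: itg_norm|exact: itg_norm].
  - move=> x _; rewrite Em; set u1 := moll _ _ _; set u2 := moll _ _ _.
    have -> : u1 + u2 - f x = u1 + (u2 - c x) - (f x - c x) by ring.
    by apply: (le_trans (ler_normB _ _)); rewrite lerD2r; exact: ler_normD.
rewrite RintegralD//; [|by apply: itgD => //; exact: itg_norm|exact: itg_norm].
rewrite RintegralD//; [|exact: itg_norm|exact: itg_norm].
lra.
Qed.

End convolution.

(** * Measurability of compositions H(x, f(x)) *)

Section graph_measurability.
Context {R : realType} {N : nat}.

(** An open set of R^N x R is a countable union of rational boxes, and the graph of [f] meets a box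
    above a measurable set. No comparison of the product sigma-algebra with the Borel one is
    involved. *)
Lemma open_graph_measurable (D : set 'rV[R]_N) (f : 'rV[R]_N -> R)
    (O : set ('rV[R]_N * R)) : measurable D -> measurable_fun D f -> open O ->
  measurable (D `&` [set x | O (x, f x)]).
Proof.
move=> mD mf oO.
pose box (q : ('rV[rat]_N * nat) * rat) : set ('rV[R]_N * R) :=
  [set p | rat_box q.1 p.1 /\ `|p.2 - ratr q.2| < q.1.2.+1%:R^-1].
pose A n := if unpickle n is Some q then
  (if `[< box q `<=` O >] then D `&` [set x | box q (x, f x)] else set0) else set0.
have -> : D `&` [set x | O (x, f x)] = \bigcup_n A n.
  apply/seteqP; split => [x [Dx Ox]|x [n _]]; last first.
    rewrite /A; case: unpickle => // q; case: asboolP => // h [Dx bx]; split => //.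
    exact: h.
  have /nbhs_ballP[e /= e0 he] : nbhs (x, f x) O by exact: open_nbhs_nbhs.
  have e2 : 0 < e / 2 by rewrite divr_gt0.
  have [k ke] : exists k : nat, k.+1%:R^-1 < e / 2.
    have := near_infty_natSinv_lt (PosNum e2).
    by move=> [k _ /(_ k (leqnn _))] /= ?; exists k.
  have k0 : (0 : R) < k.+1%:R^-1 by rewrite invr_gt0 ltr0n.
  have rat_near (t : R) : exists q : rat, `|t - ratr q| < k.+1%:R^-1.
    have [q] := @rat_in_itvoo R (t - k.+1%:R^-1) (t + k.+1%:R^-1)
       ltac:(by rewrite ltrBlDr -addrA ltrDl addr_gt0).
    by rewrite in_itv/= => /andP[h1 h2]; exists q; rewrite distrC ltr_distl h1 h2.
  have /choice[q hq] : forall i : 'I_N, exists q : rat, `|x 0 i - ratr q| < k.+1%:R^-1.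
    by move=> i; exact: rat_near.
  have [q' hq'] := rat_near (f x).
  pose p : ('rV[rat]_N * nat) * rat := ((\row_i q i, k), q').
  have hp : box p `<=` O.
    move=> [y s] [/= h1 h2]; apply: he; split; rewrite /=.
      rewrite mx_norm_ball /ball_ /=; apply: rV_norm_lt => // j.
      have := h1 j; rewrite !mxE => h3; rewrite -(subrK (ratr (q j)) (x 0 j)) -addrA.
      rewrite (le_lt_trans (ler_normD _ _))// (distrC (ratr _)).
      move: ke h3 (hq j); move: (k.+1%:R^-1) => c *; lra.
    rewrite -ball_normE /ball_ /= -(subrK (ratr q') (f x)) -addrA (le_lt_trans (ler_normD _ _))//.
    rewrite (distrC (ratr _)); move: ke h2 hq'; rewrite /=; move: (k.+1%:R^-1) => c *; lra.
  exists (pickle p); first exact: I.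
  rewrite /A pickleK; case: asboolP => [_|/(_ hp)[]]; split; first exact: Dx.
  by split => //= i; rewrite mxE; exact: hq.
apply: bigcupT_measurable => n; rewrite /A; case: unpickle => // q.
case: asboolP => // _.
rewrite (_ : D `&` _ = (D `&` rat_box q.1) `&`
   (D `&` f @^-1` `]ratr q.2 - q.1.2.+1%:R^-1, ratr q.2 + q.1.2.+1%:R^-1[%classic)).
  by apply: measurableI; [apply: measurableI => //; exact: measurable_rat_box|exact: mf].
apply/seteqP; split => x.
  by move=> [Dx [/= h1 h2]]; do 2 split => //; rewrite /= in_itv/= -ltr_distl.
by move=> [[Dx h1] [_]]; rewrite /= in_itv/= -ltr_distl => h2; split.
Qed.

Lemma measurable_graph_comp (U D : set 'rV[R]_N) (f : 'rV[R]_N -> R)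
    (H : 'rV[R]_N -> R -> R) : open U -> measurable D -> D `<=` U ->
  measurable_fun D f ->
  (forall x s, U x -> {for (x, s), continuous (fun p : 'rV[R]_N * R => H p.1 p.2)}) ->
  measurable_fun D (fun x => H x (f x)).
Proof.
move=> oU mD DU mf cH.
apply: (measurability _ (RGenOpens.measurableE R)) => _ [_ [a [b ->] <-]].
pose O : set ('rV[R]_N * R) := [set p | U p.1 /\ `]a, b[%classic (H p.1 p.2)].
have oO : open O.
  rewrite openE => -[x s] [/= Ux hx]; rewrite /interior.
  have oi : open (`]a, b[%classic : set R) by exact: interval_open.
  have h1 : nbhs (x, s) ((fun p : 'rV[R]_N * R => H p.1 p.2) @^-1` `]a, b[%classic).
    by apply: (cH x s Ux); exact: open_nbhs_nbhs.
  have h2 : nbhs (x, s) (fst @^-1` U).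
    by apply: (@cvg_fst _ _ _ _ (nbhs_filter s)); exact: open_nbhs_nbhs.
  by apply: filterS2 h1 h2 => p.
rewrite (_ : D `&` _ = D `&` [set x | O (x, f x)]); first exact: open_graph_measurable.
by apply/seteqP; split => x [Dx h]; split => //; [split => //; exact: DU|case: h].
Qed.

End graph_measurability.

(** * Weak derivatives *)

Section weak_partials.
Context {R : realType} {N : nat}.
Notation mu := (@lebesgueN R N).
Notation e_ i := (@basis_rV R N i).
Implicit Types (f g : 'rV[R]_N -> R) (x y : 'rV[R]_N) (i j : 'I_N).

Lemma norm_basis i : `|e_ i| <= 1.
Proof.
apply: rV_norm_le => // j; rewrite !mxE eqxx /=.
by case: (_ == _); rewrite ?normr1 ?normr0.
Qed.

(** Tests that are C^1 in the single direction [e_ i]. Unlike [test_fun], this class is stable under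
    multiplication by C^1 coefficients such as 1 / gamma or the boundary cut-offs. *)
Definition test1 (U : set 'rV[R]_N) i (c c' : 'rV[R]_N -> R) :=
  [/\ Cc U c, Cc U c' & forall x, is_derive x (e_ i) c (c' x)].

Lemma Cc2_support U c c' : Cc U c -> Cc U c' ->
  exists K, [/\ compact K, K `<=` U, forall x, ~ K x -> c x = 0 & forall x, ~ K x -> c' x = 0].
Proof.
move=> [_ [K [cK KU c0]]] [_ [K' [cK' KU' c0']]]; exists (K `|` K'); split.
- exact: compactU.
- by move=> x [/KU|/KU'].
- by move=> x nx; apply: c0 => Kx; apply: nx; left.
- by move=> x nx; apply: c0' => Kx; apply: nx; right.
Qed.

Lemma compact_sub_cube (K : set 'rV[R]_N) : compact K -> exists2 M : R, 0 <= M & K `<=` cube N M.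
Proof.
move=> /compact_bounded[M [Mr hM]]; exists (`|M| + 1); first by rewrite addr_ge0.
move=> x Kx i; rewrite (le_trans (coord_le_norm x i))//.
by apply: hM => //; rewrite (le_lt_trans (ler_norm M))// ltrDl.
Qed.

(** Difference quotients of [c] integrate to 0 by translation invariance, and they converge to c'
    uniformly with supports in a fixed cube. *)
Lemma test1_integral0 U i c c' : test1 U i c c' -> \int[mu]_x c' x = 0.
Proof.
move=> [hc hc' dc]; have [K [cK KU c0 c0']] := Cc2_support hc hc'.
have [M M0 hM] := compact_sub_cube cK.
have ic := Cc_itgT hc; have ic' := Cc_itgT hc'.
pose B := cube N (M + 1) : set 'rV[R]_N.
have mB : measurable B by apply: closed_measurable_rV; exact: closed_cube.
have fB : (mu B < +oo)%E by exact: lebesgueN_cube.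
set m := fine (mu B).
have m0 : 0 <= m by exact: fine_ge0.
apply/eqP; rewrite -normr_le0; apply/ler_addgt0Pl => e e0; rewrite addr0.
have e1 : 0 < e / (m + 1) by rewrite divr_gt0// ltr_wpDl.
have [d d0 hd] := Cc_unif_continuous hc' e1.
(* The bound d/2 serves the modulus of continuity of c'; the bound 1/2 keeps the translated support
   inside the enlarged cube [B]. *)
pose h := Num.min (d / 2) (2^-1).
have h0 : 0 < h by rewrite lt_min divr_gt0//= invr_gt0 ltr0n.
have hd2 : h <= d / 2 by rewrite ge_min lexx.
have h12 : h <= 2^-1 by rewrite ge_min lexx orbT.
have hv : `|h| * `|e_ i| < d.
  rewrite (@le_lt_trans _ _ (`|h| * 1))// ?ler_wpM2l ?norm_basis//.
  rewrite mulr1 gtr0_norm//; lra.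
have hN : h != 0 by rewrite gt_eqF.
have Q := diff_quotient_le dc hd.
have is_ : itg mu setT (fun x => c (x + h *: e_ i)) by exact: itg_shift.
have iq : itg mu setT (fun x => h^-1 * (c (x + h *: e_ i) - c x)).
  by apply: itgZ => //; exact: itgB.
have z : \int[mu]_x (h^-1 * (c (x + h *: e_ i) - c x)) = 0.
  rewrite RintegralZl//; last exact: itgB.
  rewrite RintegralB// Rintegral_shift; last exact: itg_measurable ic.
  by rewrite subrr mulr0.
have -> : \int[mu]_x c' x = - \int[mu]_x (h^-1 * (c (x + h *: e_ i) - c x) - c' x).
  by rewrite RintegralB// z sub0r opprK.
have id : itg mu setT (fun x => h^-1 * (c (x + h *: e_ i) - c x) - c' x) by exact: itgB.
have -> : \int[mu]_x (h^-1 * (c (x + h *: e_ i) - c x) - c' x) =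
    \int[mu]_(x in B) (h^-1 * (c (x + h *: e_ i) - c x) - c' x).
  rewrite [RHS]Rintegral_mkcond; apply: eq_Rintegral => x _.
  rewrite /patch; case: ifPn => // /negP nB.
  have nK w : `|w| <= 1 -> ~ K (x + w).
    move=> w1 /hM Kz; apply: nB; apply/mem_set => j.
    have := Kz j; rewrite mxE => h1; rewrite -[x 0 j](addrK (w 0 j)).
    rewrite (le_trans (ler_normB _ _))// lerD// (le_trans (coord_le_norm _ _))//.
  rewrite !c0; first 1 last.
  - by have := nK 0; rewrite normr0 addr0; apply.
  - apply: nK; rewrite normrZ (@le_trans _ _ (`|h| * 1))// ?ler_wpM2l ?norm_basis//.
    rewrite mulr1 gtr0_norm//; lra.
  by rewrite c0' ?subrr ?mulr0 ?subr0//; have := nK 0; rewrite normr0 addr0; apply.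
rewrite normrN (@le_trans _ _ (\int[mu]_(x in B) (e / (m + 1))))//.
  apply: abs_Rintegral_le => //.
  - by apply: measurable_funTS; exact: itg_measurable id.
  - by move=> x _; rewrite (addrC x); exact: Q.
  - exact: itg_cst.
by rewrite Rintegral_cst// -/m mulrAC ler_pdivrMr ?ltr_wpDl// ler_pM2l// lerDl.
Qed.

Variable Om : set 'rV[R]_N.
Hypotheses (oOm : open Om) (bOm : bounded_set Om).

Let mOm : measurable Om. Proof. exact: open_measurable_rV. Qed.

Lemma smooth_test_fun c : (forall m, Ck m setT c) -> Cc Om c -> test_fun Om c.
Proof.
move=> sc [_ [K [cK KU c0]]].
have clK : closure [set x | c x != 0] `<=` K.
  have E := (closure_id K).1 (compact_closed (@norm_hausdorff _ _) cK); rewrite E.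
  apply: closure_subset => x /= cx; apply: contrapT => nK.
  by move: cx; rewrite c0// eqxx.
split => //; last exact: subset_trans KU.
by apply: subclosed_compact clK => //; exact: closed_closure.
Qed.

Lemma test_fun_Cc c : test_fun Om c -> Cc Om c.
Proof.
move=> [sc cK KU]; split; first by move=> x; have [+ _] := sc 0%N; exact.
exists (closure [set x | c x != 0]); split => // x nx.
apply/eqP; apply: contrapT => /negP cx; apply: nx.
exact: subset_closure.
Qed.

Lemma test_fun_test1 i c : test_fun Om c -> test1 Om i c ('D_(e_ i) c).
Proof.
move=> tc; have hc := test_fun_Cc tc; have [sc _ _] := tc.
by have [d0 _ d2] := smooth_Cc_derive (e_ i) sc hc.
Qed.

(** The point is one compact set carrying [c] and all its mollifications at small scales, so that
    uniform closeness may be integrated against locally integrable functions. *)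
Lemma moll_Cc_approx c : Cc Om c -> exists K, [/\ compact K, K `<=` Om,
  forall x, ~ K x -> c x = 0 &
  forall e, 0 < e -> exists2 r0, 0 < r0 & forall r, 0 < r -> r < r0 ->
    (forall x, ~ K x -> moll r c x = 0) /\ forall x, `|moll r c x - c x| <= e].
Proof.
move=> hc; have [cc [K [cK KU c0]]] := hc.
have [r1 r10 Kr] := compact_sub_shrink oOm cK KU.
have r2 : 0 < r1 / 2 by rewrite divr_gt0.
have hcT : Cc setT c by apply: CcS hc.
exists (shrink Om (r1 / 2)); split.
- exact: compact_shrink.
- exact: shrink_sub.
- move=> x nx; apply: c0 => Kx; apply: nx; apply: shrinkS (Kr _ Kx); lra.
- move=> e e0; have [r0 r00 hr] := moll_unif hcT e0.
  exists (Num.min r0 (r1 / 2)); first by rewrite lt_min r00.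
  move=> r rp; rewrite lt_min => /andP[rr0 rr1]; split; last by move=> x; exact: hr.
  move=> x nx; apply: moll_eq0 => // y xy; apply: c0 => /Kr Ky; apply: nx.
  apply: (@shrink_nbhs _ _ _ (r1 / 2) (r1 / 2) y); last by rewrite distrC; lra.
  by rewrite -splitr.
Qed.

Lemma Rintegral_zero_out (K : set 'rV[R]_N) f : measurable K -> K `<=` Om ->
  (forall x, Om x -> ~ K x -> f x = 0) ->
  \int[mu]_(x in Om) f x = \int[mu]_(x in K) f x.
Proof.
move=> mK KO f0; rewrite Rintegral_mkcond [RHS]Rintegral_mkcond.
apply: eq_Rintegral => x _; rewrite /patch.
have [xK|xK] := boolP (x \in K).
  by rewrite mem_set//; apply: KO; exact/set_mem.
case: ifPn => // /set_mem Ox; apply: f0 => // Kx; move/negP: xK; apply.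
exact/mem_set.
Qed.

Lemma itg_zero_out (K : set 'rV[R]_N) f : measurable K -> K `<=` Om ->
  (forall x, Om x -> ~ K x -> f x = 0) -> itg mu K f -> itg mu Om f.
Proof.
move=> mK KO f0 hf.
apply/(integrable_mkcond (EFin \o f) mOm).2.
have := (integrable_mkcond (EFin \o f) mK).1 hf.
apply: eq_integrable => // x _; rewrite /patch.
have [xK|xK] := boolP (x \in K).
  by rewrite mem_set//; apply: KO; exact/set_mem.
case: ifPn => // /set_mem Ox /=; rewrite f0// => Kx; move/negP: xK; apply.
exact/mem_set.
Qed.

Lemma loc_itg f K : loc_integrable Om f -> compact K -> K `<=` Om -> itg mu K f.
Proof. by move=> [_ h] cK KO; exact: h. Qed.

Lemma loc_itg_Cc f c : loc_integrable Om f -> Cc Om c -> itg mu Om (fun x => f x * c x).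
Proof.
move=> hf hc; have [cc [K [cK KU c0]]] := hc.
have mK := compact_measurable_rV cK.
have [M _ hM] := Cc_bounded hc.
apply: (itg_zero_out mK KU); first by move=> x _ nK; rewrite c0// mulr0.
by apply: (itgM_bounded mK (C := M)) => //; [exact: Cc_measurable hc|exact: loc_itg].
Qed.

Lemma loc_Cc_dist f c c' K (e : R) : loc_integrable Om f -> Cc Om c -> Cc Om c' ->
  compact K -> K `<=` Om -> (forall x, ~ K x -> c x = 0) -> (forall x, ~ K x -> c' x = 0) ->
  (forall x, `|c x - c' x| <= e) ->
  `|\int[mu]_(x in Om) (f x * c x) - \int[mu]_(x in Om) (f x * c' x)| <=
  e * \int[mu]_(x in K) `|f x|.
Proof.
move=> hf hc hc' cK KU c0 c0' he.
have mK := compact_measurable_rV cK.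
have i1 := loc_itg_Cc hf hc; have i2 := loc_itg_Cc hf hc'.
have fK := loc_itg hf cK KU.
rewrite -RintegralB//.
have z x : Om x -> ~ K x -> f x * c x - f x * c' x = 0.
  by move=> _ nK; rewrite c0// c0'// subrr.
rewrite (Rintegral_zero_out mK KU z) -RintegralZl//; last exact: itg_norm.
apply: abs_Rintegral_le => //.
- apply: (measurable_funS mOm KU); exact: itg_measurable (itgB mOm i1 i2).
- by move=> x _; rewrite -mulrBr normrM mulrC ler_wpM2r.
- by apply: itgZ => //; exact: itg_norm.
Qed.

(** Mollification commutes with the derivative, so the mollified pair is a smooth test; both members
    converge uniformly on fixed compact sets, where [f] and [g] are integrable. *)
Lemma weak_test1 i f g c c' : is_weak_partial Om i f g -> test1 Om i c c' ->
  \int[mu]_(x in Om) (f x * c' x) = - \int[mu]_(x in Om) (g x * c x).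
Proof.
move=> [hf hg hfg] [hc hc' dc].
have [K [cK KU c0 aK]] := moll_Cc_approx hc.
have [K' [cK' KU' c0' aK']] := moll_Cc_approx hc'.
have hcT : Cc setT c by apply: CcS hc.
have hcT' : Cc setT c' by apply: CcS hc'.
apply/eqP; rewrite -subr_eq0 opprK -normr_le0; apply/ler_addgt0Pl => e e0; rewrite addr0.
pose I1 := \int[mu]_(x in K) `|g x|; pose I2 := \int[mu]_(x in K') `|f x|.
have I10 : 0 <= I1 by exact: Rintegral_ge0.
have I20 : 0 <= I2 by exact: Rintegral_ge0.
have I3 : 0 < I1 + I2 + 1 by rewrite ltr_wpDl// addr_ge0.
have e1 : 0 < e / (I1 + I2 + 1) by rewrite divr_gt0.
have [r0 r00 hr] := aK _ e1; have [r0' r00' hr'] := aK' _ e1.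
pose r := Num.min r0 r0' / 2.
have m0 : 0 < Num.min r0 r0' by rewrite lt_min r00.
have rp : 0 < r by rewrite divr_gt0.
have rm : r < Num.min r0 r0' by rewrite /r; lra.
move: (rm); rewrite lt_min => /andP[rr0 rr0'].
have [z b] := hr r rp rr0; have [z' b'] := hr' r rp rr0'.
have ic := Cc_itgT hcT.
have smc m : Ck m setT (moll r c) by exact: moll_Ck.
have hmc : Cc Om (moll r c).
  by split; [move=> x; have [+ _] := smc 0%N; exact|exists K].
have hmc' : Cc Om (moll r c').
  split; last by exists K'.
  by move=> x; have [+ _] := moll_Ck 0 rp (Cc_itgT hcT'); exact.
have E := hfg _ (smooth_test_fun smc hmc).
have dE x : 'D_(e_ i) (moll r c) x = moll r c' x.
  by have [] := moll_derive_C1 x rp hcT hcT' dc.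
rewrite (eq_Rintegral _ (g := fun x => f x * moll r c' x)) in E; last first.
  by move=> x _; rewrite dE.
have b1 := loc_Cc_dist hg hmc hc cK KU z c0 b.
have b2 := loc_Cc_dist hf hmc' hc' cK' KU' z' c0' b'.
rewrite E -/I2 in b2; rewrite -/I1 in b1.
move: b1 b2; set A1 := Rintegral _ _ _; set A2 := Rintegral _ _ _; set A3 := Rintegral _ _ _.
move=> b1 b2.
have H : `|A3 + A2| <= e / (I1 + I2 + 1) * (I1 + I2).
  rewrite mulrDr; have -> : A3 + A2 = - ((A1 - A2) + (- A1 - A3)) by ring.
  by rewrite normrN (le_trans (ler_normD _ _))// lerD.
apply: (le_trans H); rewrite mulrAC ler_pdivrMr// ler_pM2l// lerDl//.
Qed.

(* The fundamental lemma of the calculus of variations: h is the L^1 limit of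
   its mollifications, which are integrals against test functions. *)
Lemma loc_integrable_eq0 h : loc_integrable Om h ->
  (forall c, test_fun Om c -> \int[mu]_(x in Om) (h x * c x) = 0) ->
  ae_eq mu Om h (fun=> 0).
Proof.
move=> hh H0.
have step (r : R) : 0 < r -> ae_eq mu (shrink Om (r + r)) h (fun=> 0).
  move=> r0; have rr0 : 0 < r + r by rewrite addr_gt0.
  have mS s : measurable (shrink Om s) by apply: closed_measurable_rV; exact: closed_shrink.
  have SO s : 0 < s -> shrink Om s `<=` Om by exact: shrink_sub.
  have ih : itg mu (shrink Om r) h by apply: loc_itg => //; [exact: compact_shrink|exact: SO].
  pose H := h \_ (shrink Om r).
  have iH : itg mu setT H.
    have := (integrable_mkcond (EFin \o h) (mS r)).1 ih.
    by apply: eq_integrable => // x _; rewrite /H /= /patch; case: ifP.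
  have Hout x : ~ Om x -> H x = 0.
    by move=> nO; rewrite /H /patch memNset// => /(SO _ r0).
  have ih2 : itg mu (shrink Om (r + r)) h.
    by apply: integrableS ih => //; apply: shrinkS; lra.
  apply: Rintegral_norm0_ae => //.
  apply/eqP; rewrite eq_le Rintegral_ge0// andbT.
  apply/ler_addgt0Pl => e e0; rewrite addr0.
  have [r1 r10 hr1] := moll_L1 oOm bOm iH Hout e0.
  pose s := Num.min r r1 / 2.
  have m0 : 0 < Num.min r r1 by rewrite lt_min r0.
  have s0 : 0 < s by rewrite divr_gt0.
  have : s < Num.min r r1 by rewrite /s; lra.
  rewrite lt_min => /andP[sr sr1].
  apply: le_trans (hr1 s s0 sr1).
  have iM := (moll_contraction s0 iH).1.
  have id : itg mu setT (fun x => `|moll s H x - H x|).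
    by apply: itg_norm => //; exact: itgB.
  have mono := Rintegral_mono (mS (r + r)) measurableT (@subsetT _ _) id (fun x _ => normr_ge0 _).
  apply: le_trans mono; rewrite le_eqVlt; apply/orP; left; apply/eqP.
  apply: eq_Rintegral => x /set_mem xS.
  have -> : H x = h x by rewrite /H /patch mem_set//; apply: shrinkS xS; lra.
  suff -> : moll s H x = 0 by rewrite sub0r normrN.
  pose c y := rho s (y - x).
  have cS y : ~ shrink Om r y -> c y = 0.
    move=> ny; apply: rho_eq0 => //; rewrite leNgt; apply/negP => yx; apply: ny.
    by apply: (shrink_nbhs xS); rewrite distrC; lra.
  have sc m : Ck m setT c by apply: Ck_shift; exact: rho_Ck.
  have hc : Cc Om c.
    split; first by move=> y; have [+ _] := sc 0%N; exact.
    by exists (shrink Om r); split => //; [exact: compact_shrink|exact: SO].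
  rewrite mollE -(H0 c (smooth_test_fun sc hc)).
  have z y : Om y -> ~ shrink Om r y -> h y * c y = 0.
    by move=> _ ny; rewrite cS// mulr0.
  rewrite (Rintegral_zero_out (mS r) (SO r r0) z).
  rewrite [RHS]Rintegral_mkcond; apply: eq_Rintegral => y _.
  rewrite /H /patch /c; case: ifP => _; last by rewrite mul0r.
  by rewrite -(rhoN s (y - x)) opprB.
have cov : Om `<=` \bigcup_(n in [set: nat]) shrink Om (n.+1%:R^-1 + n.+1%:R^-1).
  move=> x Ox; have d0 := distC_gt0 oOm Ox.
  have d2 : 0 < distC Om x / 2 by rewrite divr_gt0.
  have := near_infty_natSinv_lt (PosNum d2).
  move=> [k _ /(_ k (leqnn _))] /= hk; exists k => //.
  rewrite /shrink /=; move: hk; move: (k.+1%:R^-1) => t; lra.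
have : mu.-negligible (\bigcup_(n in [set: nat])
   [set x | ~ (shrink Om (n.+1%:R^-1 + n.+1%:R^-1) x -> h x = 0)]).
  apply: negligible_bigcup => n; apply: step.
  by rewrite invr_gt0.
apply: negligibleS => x /= nx.
have [Ox|nO] := pselect (Om x); last by exfalso; apply: nx => /nO.
have [n _ xn] := cov x Ox; exists n => // H; apply: nx => _; exact: H.
Qed.

Lemma loc_integrableB f g : loc_integrable Om f -> loc_integrable Om g ->
  loc_integrable Om (fun x => f x - g x).
Proof.
move=> hf hg; split; first by apply: measurable_funB; [case: hf|case: hg].
move=> K cK KO; apply: itgB; first exact: compact_measurable_rV.
  exact: loc_itg.
exact: loc_itg.
Qed.

Lemma weak_partial_unique i f g g' :
  is_weak_partial Om i f g -> is_weak_partial Om i f g' -> ae_eq mu Om g g'.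
Proof.
move=> [hf hg H] [_ hg' H'].
have : ae_eq mu Om (fun x => g x - g' x) (fun=> 0).
  apply: loc_integrable_eq0; first exact: loc_integrableB.
  move=> c tc; have hc := test_fun_Cc tc.
  under eq_Rintegral do rewrite mulrBl.
  rewrite RintegralB//; try exact: loc_itg_Cc.
  by apply: oppr_inj; rewrite opprB oppr0 -(opprK (Rintegral _ _ _)) -H// -(opprK (Rintegral _ _ _)) -H'// ; ring.
by apply: filterS => x h Ox; apply/eqP; rewrite -subr_eq0; apply/eqP; exact: h.
Qed.

(** Mollify [f] and [g] after restricting them to a compact neighbourhood of [K]. At a point of [K]
    the translated kernel is a test function supported in that neighbourhood, so the derivative of
    one mollification is the other; off [K] nothing is claimed. *)
Lemma weak_partial_approx i f g K e : is_weak_partial Om i f g ->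
  compact K -> K `<=` Om -> 0 < e -> exists F G : 'rV[R]_N -> R,
  [/\ continuous F, continuous G, forall x, K x -> is_derive x (e_ i) F (G x),
      \int[mu]_(x in K) `|F x - f x| <= e & \int[mu]_(x in K) `|G x - g x| <= e].
Proof.
move=> [hf hg hfg] cK KO e0.
have mK := compact_measurable_rV cK.
have [r1 r10 Kr] := compact_sub_shrink oOm cK KO.
pose r := r1 / 2; have r0 : 0 < r by rewrite divr_gt0.
have KS : K `<=` shrink Om r by move=> x /Kr; apply: shrinkS; rewrite /r; lra.
have mS : measurable (shrink Om r) by apply: closed_measurable_rV; exact: closed_shrink.
have SO : shrink Om r `<=` Om by exact: shrink_sub.
have cS : compact (shrink Om r) by exact: compact_shrink.
pose P (h : 'rV[R]_N -> R) := h \_ (shrink Om r).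
have iP h : loc_integrable Om h -> itg mu setT (P h).
  move=> hh; have := (integrable_mkcond (EFin \o h) mS).1 (loc_itg hh cS SO).
  by apply: eq_integrable => // x _; rewrite /P /= /patch; case: ifP.
have Pout h x : ~ Om x -> P h x = 0.
  by move=> nO; rewrite /P /patch memNset// => /SO.
have PK h x : K x -> P h x = h x by move=> Kx; rewrite /P /patch mem_set//; exact: KS.
have if_ := iP _ hf; have ig := iP _ hg.
have [s1 s10 hs1] := moll_L1 oOm bOm if_ (Pout f) e0.
have [s2 s20 hs2] := moll_L1 oOm bOm ig (Pout g) e0.
pose s := Num.min r (Num.min s1 s2) / 2.
have m0 : 0 < Num.min r (Num.min s1 s2) by rewrite !lt_min r0 s10.
have s0 : 0 < s by rewrite divr_gt0.
have : s < Num.min r (Num.min s1 s2) by rewrite /s; lra.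
rewrite !lt_min => /and3P[sr ss1 ss2].
have close h (ih : itg mu setT (P h)) : \int[mu]_x `|moll s (P h) x - P h x| <= e ->
    \int[mu]_(x in K) `|moll s (P h) x - h x| <= e.
  move=> b; apply: le_trans b.
  have iM := (moll_contraction s0 ih).1.
  have id : itg mu setT (fun x => `|moll s (P h) x - P h x|).
    by apply: itg_norm => //; exact: itgB.
  have := Rintegral_mono mK measurableT (@subsetT _ _) id (fun x _ => normr_ge0 _).
  rewrite (@eq_Rintegral _ _ _ _ K (fun x => `|moll s (P h) x - h x|))//.
  by move=> x /set_mem Kx; rewrite PK.
exists (moll s (P f)), (moll s (P g)); split.
- by move=> x; have [+ _] := moll_Ck 0 s0 if_; exact.
- by move=> x; have [+ _] := moll_Ck 0 s0 ig; exact.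
- move=> x Kx.
  suff <- : super (P f) -%R ('D_(e_ i) (rho s)) x = moll s (P g) x by exact: moll_derive.
  have [d0 d1 d2] := smooth_Cc_derive (e_ i) (@rho_Ck R N s) (rho_Cc s0).
  (* The kernel being even, its derivative is odd; this supplies the sign that turns a derivative in
     x - y into one in y. *)
  have dodd z : 'D_(e_ i) (rho s) (- z) = - 'D_(e_ i) (@rho R N s) z.
    have h1 : is_derive (- z) (e_ i) (@rho R N s) (- 'D_(e_ i) (@rho R N s) z).
      have /is_derive_lineE h2 := d0 z.
      apply/is_derive_lineE.
      have -> : (fun h : R => rho s (h *: e_ i - z)) = (fun h => rho s (h *: e_ i + z)) \o -%R.
        by apply/funext => h /=; rewrite -rhoN opprB scaleNr addrC.
      have h3 : is_derive (0 : R) 1 (fun t : R => - t) (-1) by exact: is_deriveN.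
      have h4 : is_derive (- (0 : R)) 1 (fun h : R => rho s (h *: e_ i + z)) ('D_(e_ i) (rho s) z).
        by rewrite oppr0.
      by rewrite -mulrN1; exact: is_derive1_comp h4 h3.
    by have [] := h1.
  pose c y := rho s (y - x).
  have cS0 y : ~ shrink Om r y -> s <= `|y - x|.
    move=> ny; rewrite leNgt; apply/negP => yx; apply: ny.
    by apply: (@shrink_nbhs _ _ _ r r x); [rewrite /r -splitr; exact: Kr|rewrite distrC; lra].
  have sc m : Ck m setT c by apply: Ck_shift; exact: rho_Ck.
  have hc : Cc Om c.
    split; first by move=> y; have [+ _] := sc 0%N; exact.
    by exists (shrink Om r); split => // y /cS0; exact: rho_eq0.
  have dc y : 'D_(e_ i) c y = - 'D_(e_ i) (rho s) (x - y).
    have h1 : is_derive y (e_ i) c ('D_(e_ i) (rho s) (y - x)).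
      have /is_derive_lineE h2 := d0 (y - x).
      by apply/is_derive_lineE; under eq_fun do rewrite /c -addrA.
    by have [_ ->] := h1; rewrite -dodd opprB.
  have E := hfg c (smooth_test_fun sc hc).
  have zz h k : (forall y, ~ shrink Om r y -> k y = 0) ->
      \int[mu]_(y in Om) (h y * k y) = \int[mu]_y (P h y * k y).
    move=> k0; rewrite (Rintegral_zero_out mS SO); last by move=> y _ ny; rewrite k0// mulr0.
    rewrite Rintegral_mkcond; apply: eq_Rintegral => y _.
    by rewrite /P /patch; case: ifP => // _; rewrite mul0r.
  have dcS y : ~ shrink Om r y -> 'D_(e_ i) c y = 0.
    move=> ny.
    have ny' : nbhs y (~` shrink Om r).
      by apply: open_nbhs_nbhs; split => //; apply: closed_openC; exact: closed_shrink.
    rewrite -(derive_cst (0 : R) y (e_ i)); apply: near_eq_derive.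
    by apply: (@filterS _ (nbhs y) _ _ _ _ ny') => t /cS0; exact: rho_eq0.
  rewrite !zz// in E; last by move=> y /cS0; exact: rho_eq0.
  have i1 := super_itg if_ measurable_opp_rV x d2.
  have L : \int[mu]_y (P f y * 'D_(e_ i) c y) = - super (P f) -%R ('D_(e_ i) (rho s)) x.
    rewrite -mulN1r /super -RintegralZl//.
    by apply: eq_Rintegral => y _; rewrite dc; ring.
  have Rr : \int[mu]_y (P g y * c y) = moll s (P g) x.
    by rewrite mollE; apply: eq_Rintegral => y _; rewrite /c -rhoN opprB.
  by rewrite L Rr in E; exact: oppr_inj E.
- exact: close (hs1 s s0 ss1).
- exact: close (hs2 s s0 ss2).
Qed.

End weak_partials.

(** * The chain rule for weak derivatives *)

Section flat_functions.
Context {R : realType} {N : nat}.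
Notation mu := (@lebesgueN R N).
Implicit Types (H : 'rV[R]_N -> R -> R) (U K : set 'rV[R]_N) (f : 'rV[R]_N -> R).

Definition jcont U H := forall x s, U x ->
  {for (x, s), continuous (fun p : 'rV[R]_N * R => H p.1 p.2)}.

Lemma jcont_comp U H f x : jcont U H -> U x -> {for x, continuous f} ->
  {for x, continuous (fun y => H y (f y))}.
Proof.
move=> cH Ux cf.
apply: (@continuous_comp _ _ _ (fun y => (y, f y)) (fun p : 'rV[R]_N * R => H p.1 p.2)).
  exact: (cvg_pair (@cvg_id _ _) cf).
exact: cH.
Qed.

Lemma jcont_snd U H x s : jcont U H -> U x -> {for s, continuous (H x)}.
Proof.
move=> cH Ux.
apply: (@continuous_comp _ _ _ (fun t => (x, t)) (fun p : 'rV[R]_N * R => H p.1 p.2)).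
  exact: (cvg_pair (@cst_continuous _ _ x s) (@cvg_id _ _)).
exact: cH.
Qed.

Lemma jcontM U H1 H2 : jcont U H1 -> jcont U H2 -> jcont U (fun x s => H1 x s * H2 x s).
Proof. by move=> h1 h2 x s Ux; apply: continuousM; [exact: h1|exact: h2]. Qed.

Lemma jcontD U H1 H2 : jcont U H1 -> jcont U H2 -> jcont U (fun x s => H1 x s + H2 x s).
Proof. by move=> h1 h2 x s Ux; apply: continuousD; [exact: h1|exact: h2]. Qed.

Lemma jcont_real U (F : R -> R) H : continuous F -> jcont U H -> jcont U (fun x s => F (H x s)).
Proof.
move=> cF cH x s Ux.
by apply: (continuous_comp (f := fun p : 'rV[R]_N * R => H p.1 p.2)); [exact: cH|exact: cF].
Qed.

Lemma jcont_fst U f : (forall x, U x -> {for x, continuous f}) -> jcont U (fun x _ => f x).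
Proof.
move=> cf x s Ux.
by apply: (continuous_comp (f := @fst _ R) (g := f)); [exact: cvg_fst|exact: cf].
Qed.

Lemma jcont_var U : jcont U (fun _ s => s).
Proof. by move=> x s Ux; exact: cvg_snd. Qed.

Definition clamp (S s : R) := Num.max (- S) (Num.min S s).

(** H(x, .) is constant on either side of [-S, S]; above a compact set it is then bounded and
    uniformly continuous in s, whatever unbounded function is substituted. *)
Definition flat U H S := forall x s, U x -> H x s = H x (clamp S s).

Lemma clamp_in S s : 0 <= S -> clamp S s \in `[-S, S].
Proof. by move=> S0; rewrite in_itv/= /clamp le_max lexx/= ge_max ge_min lexx andbT; lra. Qed.

Lemma clamp_lip S s t : `|clamp S s - clamp S t| <= `|s - t|.
Proof.
rewrite /clamp; case: (lerP S s) => h1; case: (lerP S t) => h2.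
- by rewrite subrr normr0.
- case: (lerP (- S) S) => h3; case: (lerP (- S) t) => h4; rewrite ler_norml;
  have := ler_norm (s - t); have := ler_norm (- (s - t)); rewrite normrN; lra.
- case: (lerP (- S) S) => h3; case: (lerP (- S) s) => h4; rewrite ler_norml;
  have := ler_norm (s - t); have := ler_norm (- (s - t)); rewrite normrN; lra.
- case: (lerP (- S) t) => h3; case: (lerP (- S) s) => h4; rewrite ler_norml;
  have := ler_norm (s - t); have := ler_norm (- (s - t)); rewrite normrN; lra.
Qed.

Lemma flatP U H S : 0 <= S ->
  (forall x s, U x -> S < s -> H x s = H x S) ->
  (forall x s, U x -> s < - S -> H x s = H x (- S)) -> flat U H S.
Proof.
move=> S0 h1 h2 x s Ux; rewrite /clamp; have [sS|sS] := lerP S s.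
  rewrite max_r; last lra.
  by move: sS; rewrite le_eqVlt => /predU1P[->//|]; exact: h1.
by have [|] := lerP => // h; rewrite h2.
Qed.

Lemma jcont_bounded U K H S : compact K -> K `<=` U -> jcont U H ->
  exists2 M, 0 < M & forall x s, K x -> - S <= s <= S -> `|H x s| <= M.
Proof.
move=> cK KU cH.
have cKI : compact (K `*` `[- S, S]%classic) by apply: compact_setX => //; exact: segment_compact.
have : compact ((fun p : 'rV[R]_N * R => H p.1 p.2) @` (K `*` `[- S, S]%classic)).
  apply: continuous_compact => //; apply: continuous_in_subspaceT => -[x s] /set_mem[/= Kx _].
  by apply: cH; exact: KU.
move=> /compact_bounded[M [Mr hM]]; exists (`|M| + 1); first by rewrite ltr_wpDl.
move=> x s Kx hs.
apply: (hM (`|M| + 1)); first by rewrite (le_lt_trans (ler_norm M))// ltrDl.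
by exists (x, s) => //; split => //=; rewrite in_itv/= hs.
Qed.

Lemma flat_bounded U K H S : 0 <= S -> compact K -> K `<=` U -> jcont U H -> flat U H S ->
  exists2 M, 0 < M & forall x s, K x -> `|H x s| <= M.
Proof.
move=> S0 cK KU cH fH; have [M M0 hM] := jcont_bounded S cK KU cH.
exists M => // x s Kx; rewrite fH; last exact: KU.
by apply: hM => //; have := clamp_in s S0; rewrite in_itv.
Qed.

(** A substitute for a Lipschitz bound: uniform continuity when |s - t| < d, and otherwise 2M <= (2M
    / d) |s - t|. *)
Lemma flat_modulus U K H S (k : R) : 0 <= S -> compact K -> K `<=` U -> jcont U H ->
  flat U H S -> 0 < k ->
  exists2 C, 0 <= C & forall x s t, K x -> `|H x s - H x t| <= k + C * `|s - t|.
Proof.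
move=> S0 cK KU cH fH k0; have [M M0 hM] := flat_bounded S0 cK KU cH fH.
have cKI : compact (K `*` `[- S, S]%classic) by apply: compact_setX => //; exact: segment_compact.
have [|d d0 hd] := compact_unif_continuous (f := fun p => H p.1 p.2) cKI _ k0.
  by move=> [x s] [/= Kx _]; apply: cH; exact: KU.
have C0 : 0 <= (M + M) / d by rewrite divr_ge0// ltW// addr_gt0.
exists ((M + M) / d) => // x s t Kx.
have [st|st] := ltP `|s - t| d.
  rewrite (fH x s (KU _ Kx)) (fH x t (KU _ Kx)) (@le_trans _ _ k)//; last first.
    by rewrite lerDl mulr_ge0.
  apply: ltW; apply: (hd (x, clamp S s) (x, clamp S t)); first by split => //=; exact: clamp_in.
  rewrite prod_normE /= subrr normr0 gt_max d0/=.
  exact: le_lt_trans (clamp_lip _ _ _) st.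
rewrite (le_trans (ler_normB _ _))// (@le_trans _ _ (M + M))//; first by rewrite lerD// hM.
apply: (@le_trans _ _ ((M + M) / d * `|s - t|)); last by rewrite lerDr ltW.
rewrite mulrAC ler_pdivlMr// ler_wpM2l//; lra.
Qed.

Lemma L1_tail D (h : 'rV[R]_N -> R) (k : R) : measurable D -> itg mu D h -> 0 < k ->
  exists2 m, 0 < m & \int[mu]_(x in D) Num.max 0 (`|h x| - m) <= k.
Proof.
move=> mD hh k0.
have mh := itg_measurable hh; have hn := itg_norm hh.
have mt n : measurable_fun D (fun x => Num.max 0 (`|h x| - n.+1%:R)).
  apply: measurable_maxr => //; apply: measurable_funB => //.
  exact: itg_measurable hn.
have c0 x : D x -> Num.max 0 (`|h x| - n.+1%:R) @[n --> \oo] --> (0 : R).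
  move=> _; apply: cvg_near_cst.
  have := nbhs_infty_ger `|h x|; apply: filterS => n hn'.
  by apply: max_l; rewrite subr_le0 (le_trans hn')// ler_nat.
have [_ L] := Rintegral_dominated (g := fun x => `|h x|) mD mt c0 hn ltac:(
  by move=> n x _; rewrite ger0_norm ?le_max ?lexx// ge_max normr_ge0/= gerBl).
rewrite Rintegral_cst// mul0r in L.
have /cvgrPdist_lt/(_ _ k0)[n _ /(_ n (leqnn _))] /= := L.
by rewrite sub0r normrN => h1; exists n.+1%:R => //; rewrite (le_trans (ler_norm _))// ltW.
Qed.

Lemma flat_measurable U D H f : open U -> measurable D -> D `<=` U -> jcont U H ->
  measurable_fun D f -> measurable_fun D (fun x => H x (f x)).
Proof. by move=> oU mD DU cH mf; exact: (measurable_graph_comp oU mD DU mf cH). Qed.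

Lemma flat_itg U K H S f h : open U -> 0 <= S -> compact K -> K `<=` U -> jcont U H ->
  flat U H S -> measurable_fun K f -> itg mu K h -> itg mu K (fun x => H x (f x) * h x).
Proof.
move=> oU S0 cK KU cH fH mf hh; have mK := compact_measurable_rV cK.
have [M _ hM] := flat_bounded S0 cK KU cH fH.
apply: (itg_eq mK (f := fun x => h x * H x (f x))); first by move=> x _; rewrite mulrC.
apply: (itgM_bounded mK (C := M)) => //; first exact: (flat_measurable oU).
by move=> x Kx; exact: hM.
Qed.

(** The weight [h] is only integrable: where |h| <= m the modulus of [H] is used, and the tail of
    [h] above [m] is paid for by the bound 2M. The constant depends on [k] but not on [F]. *)
Lemma flat_dist U K H S f h (k : R) : open U -> 0 <= S -> compact K -> K `<=` U -> jcont U H ->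
  flat U H S -> itg mu K f -> itg mu K h -> 0 < k ->
  exists2 C, 0 <= C & forall F, itg mu K F ->
    `|\int[mu]_(x in K) (H x (F x) * h x) - \int[mu]_(x in K) (H x (f x) * h x)| <=
    k + C * \int[mu]_(x in K) `|F x - f x|.
Proof.
move=> oU S0 cK KU cH fH hf hh k0; have mK := compact_measurable_rV cK.
have fK : (mu K < +oo)%E.
  have [M _ hM] := compact_sub_cube cK.
  apply: (le_lt_trans _ (lebesgueN_cube N M)); apply: le_measure; rewrite ?inE//.
  by apply: closed_measurable_rV; exact: closed_cube.
have [M M0 hM] := flat_bounded S0 cK KU cH fH.
have M2 : 0 < M + M by rewrite addr_gt0.
have [m m0 hm] := L1_tail mK hh (divr_gt0 (divr_gt0 k0 (ltr0Sn _ 1)) M2).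
pose a := fine (mu K); have a0 : 0 <= a by exact: fine_ge0.
have b0 : 0 < m * (a + 1) by rewrite mulr_gt0// ltr_wpDl.
have [C C0 hC] := flat_modulus S0 cK KU cH fH (divr_gt0 (divr_gt0 k0 (ltr0Sn _ 1)) b0).
exists (C * m) => [|F hF]; first by rewrite mulr_ge0// ltW.
have mF := itg_measurable hF; have mf := itg_measurable hf.
have i1 := flat_itg oU S0 cK KU cH fH mF hh.
have i2 := flat_itg oU S0 cK KU cH fH mf hh.
have iFf : itg mu K (fun x => `|F x - f x|) := itg_norm (itgB mK hF hf).
have mh := itg_measurable hh.
have it : itg mu K (fun x => Num.max 0 (`|h x| - m)).
  apply: (itg_le mK (g := fun x => `|h x|)); last exact: itg_norm.
    apply: measurable_maxr => //; apply: measurable_funB => //.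
    exact: itg_measurable (itg_norm hh).
  by move=> x _; rewrite ger0_norm ?le_max ?lexx// ge_max normr_ge0/= gerBl ltW.
have j1 : itg mu K (fun=> k / 2 / (m * (a + 1)) * m) by exact: itg_cst.
have j2 := itgZ mK (C * m) iFf; have j3 := itgZ mK (M + M) it.
rewrite -RintegralB//.
apply: (@le_trans _ _ (\int[mu]_(x in K) (k / 2 / (m * (a + 1)) * m + C * m * `|F x - f x| +
   (M + M) * Num.max 0 (`|h x| - m)))).
  apply: abs_Rintegral_le => //; last exact: (itgD mK (itgD mK j1 j2) j3).
    exact: itg_measurable (itgB mK i1 i2).
  move=> x Kx; rewrite -mulrBl normrM.
  have c1 : `|H x (F x) - H x (f x)| <= M + M.
    by rewrite (le_trans (ler_normB _ _))// lerD// hM.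
  have c2 := hC x (F x) (f x) Kx.
  have c3 : 0 <= `|H x (F x) - H x (f x)| by [].
  have q0 : 0 <= k / 2 / (m * (a + 1)) + C * `|F x - f x|.
    by apply: addr_ge0; [apply: divr_ge0; [apply: divr_ge0 => //; exact: ltW|exact: ltW]|exact: mulr_ge0].
  have t0 : 0 <= Num.max 0 (`|h x| - m) by rewrite le_max lexx.
  have hh' : `|h x| <= m + Num.max 0 (`|h x| - m) by rewrite -lerBlDl le_max lexx orbT.
  rewrite (le_trans (ler_wpM2l c3 hh'))// mulrDr lerD//; last exact: ler_wpM2r.
  by rewrite (le_trans (ler_wpM2r (ltW m0) c2))// mulrDl (mulrAC C).
rewrite RintegralD//; last exact: (itgD mK j1 j2).
rewrite RintegralD// Rintegral_cst// -/a !RintegralZl//.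
have e1 : k / 2 / (m * (a + 1)) * m * a <= k / 2.
  rewrite (_ : _ * a = k / 2 * (a / (a + 1))); last by field; rewrite !gt_eqF// ltr_wpDl.
  have k2 : 0 <= k / 2 by rewrite divr_ge0// ltW.
    by apply: ler_piMr => //; rewrite ler_pdivrMr ?ltr_wpDl// mul1r lerDl.
have e2 : (M + M) * \int[mu]_(x in K) Num.max 0 (`|h x| - m) <= k / 2.
  by rewrite mulrC -ler_pdivlMr.
move: e1 e2; set A := \int[mu]_(x in K) `|_|.
have := splitr k; move: (k / 2) => k2; lra.
Qed.

End flat_functions.

(** * The classical chain rule for G(x, F(x)) *)

Section two_variable_chain.
Context {R : realType} {N : nat}.
Implicit Types (G : 'rV[R]_N -> R -> R) (F : 'rV[R]_N -> R) (U : set 'rV[R]_N).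

Lemma real_mvt (f df : R -> R) (a b : R) : (forall t, is_derive t (1 : R) f (df t)) ->
  exists2 c, Num.min a b <= c <= Num.max a b & f b - f a = df c * (b - a).
Proof.
have H (x y : R) : x < y -> (forall t, is_derive t (1 : R) f (df t)) ->
    exists2 c, x <= c <= y & f y - f x = df c * (y - x).
  move=> xy h.
  have hc : {within `[x, y], continuous f}.
    apply: continuous_subspaceT => u.
    by apply/differentiable_continuous/derivable1_diffP; case: (h u).
  have [c] := @MVT R f df x y xy (fun t _ => h t) hc.
  by rewrite in_itv/= => /andP[/ltW c1 /ltW c2] E; exists c => //; rewrite c1 c2.
move=> h; have [ab|ba|->] := ltgtP a b.
- exact: H.
- by have [c hc E] := H b a ba h; exists c => //; rewrite -opprB E; ring.
- by exists b; rewrite ?lexx// !subrr mulr0.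
Qed.

(* y |-> G y (F y) along v: the increment splits into one at fixed F, which is
   the partial derivative of G, and one at fixed y, treated by the mean value theorem. *)
Lemma is_derive_comp2 U G Gx Gs F dF x v : open U -> U x -> jcont U Gs ->
  (forall s, is_derive x v (fun y => G y s) (Gx x s)) ->
  (forall y s, U y -> is_derive s (1 : R) (G y) (Gs y s)) ->
  {for x, continuous F} -> is_derive x v F dF ->
  is_derive x v (fun y => G y (F y)) (Gx x (F x) + Gs x (F x) * dF).
Proof.
move=> oU Ux cGs dGx dGs cF dF_.
have h1 := dGx (F x).
suff h2 : is_derive x v (fun y => G y (F y) - G y (F x)) (Gs x (F x) * dF).
  rewrite (_ : (fun y => _) = (fun y => G y (F x)) + (fun y => G y (F y) - G y (F x))).
    exact: is_deriveD.
  by apply/funext => y /=; rewrite addrC subrK.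
have q1 : h^-1 *: ((F \o shift x) (h *: v) - F x) @[h --> 0^'] --> dF.
  by have [d1 d2] := dF_; rewrite -d2; exact: d1.
have lin : h *: v + x @[h --> (0 : R)^'] --> x.
  have : {for (0 : R), continuous (fun h : R => h *: v + x)}.
    apply: continuousD; last exact: cst_continuous.
    by apply: (@continuousZr_tmp) => //.
  by move=> /continuous_withinNx; rewrite /= scale0r add0r.
have /choice[c hc] : forall h, exists c, U (h *: v + x) ->
    Num.min (F x) (F (h *: v + x)) <= c <= Num.max (F x) (F (h *: v + x)) /\
    G (h *: v + x) (F (h *: v + x)) - G (h *: v + x) (F x) =
    Gs (h *: v + x) c * (F (h *: v + x) - F x).
  move=> h; have [Uh|nU] := pselect (U (h *: v + x)); last by exists 0.
  have [c c1 c2] := real_mvt (F x) (F (h *: v + x)) (fun s => dGs _ s Uh).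
  by exists c.
have Unear : \forall h \near (0 : R)^', U (h *: v + x).
  by apply: lin; exact: open_nbhs_nbhs.
have cF' : F (h *: v + x) @[h --> (0 : R)^'] --> F x.
  by move=> A /cF /lin.
have cc : c h @[h --> (0 : R)^'] --> F x.
  apply/cvgrPdist_lt => e e0; move/cvgrPdist_lt: cF' => /(_ e e0).
  apply: filterS2 Unear => h Uh; have [+ _] := hc h Uh.
  move: (F x) (F (h *: v + x)) (c h) => p q r; rewrite !ltr_norml.
  by case: (lerP p q) => _ /andP[r1 r2] /andP[r3 r4]; apply/andP; split; lra.
have q2 : Gs (h *: v + x) (c h) @[h --> (0 : R)^'] --> Gs x (F x).
  exact: (@cvg_comp _ _ _ (fun h => (h *: v + x, c h)) (fun p => Gs p.1 p.2) _ _ _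
    (cvg_pair lin cc) (cGs x (F x) Ux)).
have q : h^-1 *: (((fun y => G y (F y) - G y (F x)) \o shift x) (h *: v) -
    (G x (F x) - G x (F x))) @[h --> (0 : R)^'] --> Gs x (F x) * dF.
  apply: (@cvg_trans _ (Gs (h *: v + x) (c h) * (h^-1 *: ((F \o shift x) (h *: v) - F x)) @[h --> (0 : R)^'])).
    apply: near_eq_cvg; apply: filterS Unear => h Uh /=.
    have [_ E] := hc h Uh.
    by rewrite subrr subr0 E scalerAr.
  exact: cvgM.
by split; [apply/cvg_ex; exists (Gs x (F x) * dF)|apply/cvg_lim].
Qed.

End two_variable_chain.

Lemma itg_ae_eq d (T : measurableType d) (R : realType) (mu : {measure set T -> \bar R})
    (D : set T) (f g : T -> R) : measurable D -> measurable_fun D g ->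
  ae_eq mu D f g -> itg mu D f -> itg mu D g.
Proof.
move=> mD mg fg hf; have mf := itg_measurable hf.
apply/integrableP; split; first exact/measurable_EFinP.
have [_ +] := integrableP _ _ _ hf; congr (_ < _)%E; apply: ae_eq_integral => //.
- by apply: measurableT_comp => //; exact/measurable_EFinP.
- by apply: measurableT_comp => //; exact/measurable_EFinP.
- by apply: filterS fg => x h Dx /=; rewrite h.
Qed.

(** * Products and compositions with weakly differentiable functions *)

Section weak_calculus.
Context {R : realType} {N : nat}.
Notation mu := (@lebesgueN R N).
Notation e_ i := (@basis_rV R N i).
Implicit Types (f g c : 'rV[R]_N -> R) (x y : 'rV[R]_N) (i j : 'I_N).
Variable Om : set 'rV[R]_N.
Hypotheses (oOm : open Om) (bOm : bounded_set Om).

Let mOm : measurable Om. Proof. exact: open_measurable_rV. Qed.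

Definition cont_on (U : set 'rV[R]_N) f := forall x, U x -> {for x, continuous f}.

Definition C1_on (U : set 'rV[R]_N) i c c' :=
  [/\ cont_on U c, cont_on U c' & forall x, U x -> is_derive x (e_ i) c (c' x)].

(** Differentiability of [c] is required only on a compact set carrying the test, because the
    approximations of [weak_partial_approx] are known to be differentiable only there. *)
Lemma test1_mul_supp i c c' t t' K : cont_on Om c -> cont_on Om c' -> test1 Om i t t' ->
  compact K -> K `<=` Om -> (forall x, ~ K x -> t x = 0) -> (forall x, ~ K x -> t' x = 0) ->
  (forall x, K x -> is_derive x (e_ i) c (c' x)) ->
  test1 Om i (fun x => c x * t x) (fun x => c x * t' x + c' x * t x).
Proof.
move=> cc cc' [ht ht' dt] cK KU t0 t0' dc; split; first exact: CcMl.
  by apply: CcD; exact: CcMl.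
move=> x; have [Ox|nO] := pselect (K x).
  by rewrite (mulrC (c' x)); exact: (is_derive_mul (dc x Ox) (dt x)).
have nK : nbhs x (~` K).
  apply: open_nbhs_nbhs; split => //.
  by apply: closed_openC; apply: compact_closed => //; exact: norm_hausdorff.
rewrite t0 ?t0' ?mulr0 ?addr0 //.
apply: (is_derive_near_eq _ (is_derive_cst (0 : R) x (e_ i))).
by apply: (@filterS _ (nbhs x) _ _ _ _ nK) => y nKy; rewrite t0// mulr0.
Qed.

Lemma test1_mul i c c' t t' : C1_on Om i c c' -> test1 Om i t t' ->
  test1 Om i (fun x => c x * t x) (fun x => c x * t' x + c' x * t x).
Proof.
move=> [cc cc' dc] ht1; have [ht ht' dt] := ht1.
have [K [cK KU t0 t0']] := Cc2_support ht ht'.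
by apply: (@test1_mul_supp _ _ _ _ _ K) => // x /KU; exact: dc.
Qed.

Lemma loc_integrableM_cont f c : loc_integrable Om f -> cont_on Om c ->
  loc_integrable Om (fun x => f x * c x).
Proof.
move=> [mf hf] cc; have mc : measurable_fun Om c by exact: continuous_measurable_rV.
split; first exact: measurable_funM.
move=> K cK KO; have mK := compact_measurable_rV cK.
have [M _ hM] := @jcont_bounded R N Om K (fun x _ => c x) 0 cK KO (jcont_fst cc).
apply: (itgM_bounded mK (C := M)); first exact: measurable_funS mc.
  by move=> x Kx; apply: (hM x 0) => //; rewrite oppr0 lexx.
exact: hf.
Qed.

Lemma loc_integrable_cont c : cont_on Om c -> loc_integrable Om c.
Proof.
move=> cc.
have h1 : loc_integrable Om (fun=> 1 : R).
  split; first exact: measurable_cst.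
  move=> K cK KO; apply: itg_cst; first exact: compact_measurable_rV.
  have [M _ hM] := compact_sub_cube cK.
  apply: (le_lt_trans _ (lebesgueN_cube N M)); apply: le_measure; rewrite ?inE//.
    exact: compact_measurable_rV.
  by apply: closed_measurable_rV; exact: closed_cube.
have := loc_integrableM_cont h1 cc; rewrite (_ : (fun x => 1 * c x) = c)//.
by apply/funext => x; rewrite mul1r.
Qed.

Lemma loc_integrableD f g : loc_integrable Om f -> loc_integrable Om g ->
  loc_integrable Om (fun x => f x + g x).
Proof.
move=> [mf hf] [mg hg]; split; first exact: measurable_funD.
move=> K cK KO; apply: itgD; first exact: compact_measurable_rV.
  exact: hf.
exact: hg.
Qed.

Lemma loc_integrable_ae f g : loc_integrable Om f -> measurable_fun Om g ->
  ae_eq mu Om f g -> loc_integrable Om g.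
Proof.
move=> [mf hf] mg fg; split=> // K cK KO; have mK := compact_measurable_rV cK.
apply: (itg_ae_eq mK _ _ (hf K cK KO)); first exact: measurable_funS mg.
by apply: filterS fg => x h Kx /=; rewrite h//; exact: KO.
Qed.

Lemma Rintegral_ae_mul f g c : loc_integrable Om f -> measurable_fun Om g ->
  ae_eq mu Om f g -> Cc Om c ->
  \int[mu]_(x in Om) (f x * c x) = \int[mu]_(x in Om) (g x * c x).
Proof.
move=> [mf _] mg fg hc; have mc : measurable_fun Om c by exact: Cc_measurable hc.
apply: Rintegral_ae_eq => //; try exact: measurable_funM.
by apply: filterS fg => x h Ox /=; rewrite h.
Qed.

Lemma weak_ae i f g f' g' : is_weak_partial Om i f g ->
  measurable_fun Om f' -> measurable_fun Om g' -> ae_eq mu Om f f' -> ae_eq mu Om g g' ->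
  is_weak_partial Om i f' g'.
Proof.
move=> [hf hg H] mf' mg' ff' gg'; split.
- exact: loc_integrable_ae hf mf' ff'.
- exact: loc_integrable_ae hg mg' gg'.
- move=> t tt; have [ht ht' _] := test_fun_test1 i tt.
  by rewrite -(Rintegral_ae_mul hf mf' ff' ht') -(Rintegral_ae_mul hg mg' gg' ht) H.
Qed.

Lemma weakD i f g f' g' : is_weak_partial Om i f g -> is_weak_partial Om i f' g' ->
  is_weak_partial Om i (fun x => f x + f' x) (fun x => g x + g' x).
Proof.
move=> [hf hg H] [hf' hg' H']; split; try exact: loc_integrableD.
move=> t tt; have [ht ht' _] := test_fun_test1 i tt.
under eq_Rintegral do rewrite mulrDl.
under [in RHS]eq_Rintegral do rewrite mulrDl.
by rewrite !RintegralD//; try exact: loc_itg_Cc; rewrite H// H'// opprD.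
Qed.

Lemma weak_mul i f g c c' : is_weak_partial Om i f g -> C1_on Om i c c' ->
  is_weak_partial Om i (fun x => f x * c x) (fun x => g x * c x + f x * c' x).
Proof.
move=> wf hc; have [hf hg H] := wf; have [cc cc' dc] := hc; split.
- exact: loc_integrableM_cont.
- by apply: loc_integrableD; exact: loc_integrableM_cont.
move=> t tt; have ht1 := test_fun_test1 i tt; have [ht ht' _] := ht1.
have E := weak_test1 oOm bOm wf (test1_mul hc ht1).
have h1 : Cc Om (fun x => c x * t x) by exact: CcMl.
have h2 : Cc Om (fun x => c x * 'D_(e_ i) t x) by exact: CcMl.
have h3 : Cc Om (fun x => c' x * t x) by exact: CcMl.
have i1 := loc_itg_Cc oOm hg h1; have i2 := loc_itg_Cc oOm hf h2.
have i3 := loc_itg_Cc oOm hf h3.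
rewrite (eq_Rintegral _ (g := fun x => f x * (c x * 'D_(e_ i) t x) + f x * (c' x * t x))) in E;
  last by move=> x _; rewrite mulrDr.
rewrite RintegralD// in E.
rewrite (eq_Rintegral _ (g := fun x => f x * (c x * 'D_(e_ i) t x))); last by move=> x _; rewrite mulrA.
rewrite [in RHS](eq_Rintegral _ (g := fun x => g x * (c x * t x) + f x * (c' x * t x))); last first.
  by move=> x _; ring.
by rewrite RintegralD//; move: E => /(canRL (addrK _)) ->; rewrite opprD.
Qed.

Lemma weak_one i : is_weak_partial Om i (fun=> 1) (fun=> 0).
Proof.
split; try by apply: loc_integrable_cont => x _; exact: cst_continuous.
move=> t tt; have ht := test_fun_test1 i tt; have [ht1 ht2 _] := ht.
under eq_Rintegral do rewrite mul1r.
under [in RHS]eq_Rintegral do rewrite mul0r.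
rewrite Rintegral_cst// mul0r oppr0.
rewrite -(test1_integral0 ht) Rintegral_mkcond; apply: eq_Rintegral => x _.
rewrite /patch; case: ifPn => // /negP nO.
have [K [_ KU _ c0]] := Cc2_support ht1 ht2; rewrite c0// => /KU Ox.
by apply: nO; exact/mem_set.
Qed.

Lemma weak_C1 i c c' : C1_on Om i c c' -> is_weak_partial Om i c c'.
Proof.
move=> hc; have := weak_mul (weak_one i) hc.
rewrite (_ : (fun x => 1 * c x) = c); last by apply/funext => x; rewrite mul1r.
rewrite (_ : (fun x => 0 * c x + 1 * c' x) = c')//.
by apply/funext => x; rewrite mul1r mul0r add0r.
Qed.

Lemma weakB i f g f' g' : is_weak_partial Om i f g -> is_weak_partial Om i f' g' ->
  is_weak_partial Om i (fun x => f x - f' x) (fun x => g x - g' x).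
Proof.
move=> h h'; have cN : C1_on Om i (fun=> -1 : R) (fun=> 0).
  by split; try (by move=> x _; exact: cst_continuous); move=> x _; exact: is_derive_cst.
have := weakD h (weak_mul h' cN).
rewrite (_ : (fun x => f x + f' x * -1) = fun x => f x - f' x); last first.
  by apply/funext => x; rewrite mulrN1.
rewrite (_ : (fun x => g x + (g' x * -1 + f' x * 0)) = fun x => g x - g' x)//.
by apply/funext => x; rewrite mulrN1 mulr0 addr0.
Qed.

Lemma weak_sum i (I : Type) (s : seq I) (f g : I -> 'rV[R]_N -> R) :
  (forall k, is_weak_partial Om i (f k) (g k)) ->
  is_weak_partial Om i (fun x => \sum_(k <- s) f k x) (fun x => \sum_(k <- s) g k x).
Proof.
move=> h; elim: s => [|k s IH].
  under eq_fun do rewrite big_nil; under [X in is_weak_partial _ _ _ X]eq_fun do rewrite big_nil.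
  by apply: weak_C1; split; try (by move=> x _; exact: cst_continuous); move=> x _; exact: is_derive_cst.
under eq_fun do rewrite big_cons; under [X in is_weak_partial _ _ _ X]eq_fun do rewrite big_cons.
exact: weakD.
Qed.

Lemma flat_loc_integrable H S f h : 0 <= S -> jcont Om H -> flat Om H S ->
  measurable_fun Om f -> loc_integrable Om h -> loc_integrable Om (fun x => H x (f x) * h x).
Proof.
move=> S0 cH fH mf [mh hh]; split.
  by apply: measurable_funM => //; exact: (flat_measurable oOm mOm (fun _ h => h) cH mf).
move=> K cK KO; apply: (flat_itg oOm S0 cK KO cH fH); last exact: hh.
exact: measurable_funS mf.
Qed.

Lemma chain_error_split (k a1 a2 a3 b1 b2 b3 b3' I1 I2 J3 : R) :
  b1 + b2 + b3' = 0 -> `|b1 - a1| <= k / 6 + I1 -> `|b2 - a2| <= k / 6 + I2 ->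
  `|b3 - a3| <= k / 6 + J3 -> `|a1 + a2 + a3| <= k / 2 + I1 + I2 + J3 + `|b3' - b3|.
Proof.
move=> E; rewrite !ler_norml => /andP[? ?] /andP[? ?] /andP[? ?].
have := ler_norm (b3' - b3); have := ler_norm (- (b3' - b3)); rewrite normrN => ? ?.
by apply/andP; split; lra.
Qed.

(** For the approximation [F] of [f] the identity is exact, being the integral of a derivative. Then
    [flat_dist] compares the three integrals at [F] with those at [f], the weights t', t and g t
    staying fixed, and a last error comes from replacing the derivative of [F] by [g]. *)
Lemma weak_chain i f g G Gx Gs S : 0 <= S -> is_weak_partial Om i f g ->
  jcont Om G -> jcont Om Gx -> jcont Om Gs -> flat Om G S -> flat Om Gx S -> flat Om Gs S ->
  (forall x s, Om x -> is_derive x (e_ i) (fun y => G y s) (Gx x s)) ->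
  (forall x s, Om x -> is_derive s (1 : R) (G x) (Gs x s)) ->
  is_weak_partial Om i (fun x => G x (f x)) (fun x => Gx x (f x) + Gs x (f x) * g x).
Proof.
move=> S0 wf cG cGx cGs fG fGx fGs dGx dGs; have [hf hg _] := wf.
have [mf _] := hf.
have one : loc_integrable Om (fun=> 1 : R).
  by apply: loc_integrable_cont => x _; exact: cst_continuous.
have E1 (H : 'rV[R]_N -> R -> R) : (fun x => H x (f x) * 1) = fun x => H x (f x).
  by apply/funext => x; rewrite mulr1.
split.
- by have := flat_loc_integrable S0 cG fG mf one; rewrite E1.
- apply: loc_integrableD; last exact: (flat_loc_integrable S0).
  by have := flat_loc_integrable S0 cGx fGx mf one; rewrite E1.
move=> t tt; have ht1 := test_fun_test1 i tt; have [ht ht' dt] := ht1.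
have [K [cK KO t0 t0']] := Cc2_support ht ht'.
set t' := 'D_(e_ i) t in ht' ht1 dt t0' *.
have mK := compact_measurable_rV cK.
have fKi := loc_itg hf cK KO; have gKi := loc_itg hg cK KO.
have mfK := itg_measurable fKi.
have [Mt Mt0 hMt] := Cc_bounded ht.
have mt : measurable_fun K t by exact: Cc_measurable ht.
have ti : itg mu K t by apply: integrableS (Cc_itgT ht).
have ti' : itg mu K t' by apply: integrableS (Cc_itgT ht').
have gti : itg mu K (fun x => g x * t x) by apply: (itgM_bounded mK (C := Mt)).
have [M M0 hM] := flat_bounded S0 cK KO cGs fGs.
have Z0 (h : 'rV[R]_N -> R) (h1 : forall x, ~ K x -> h x = 0) :
    \int[mu]_(x in Om) h x = \int[mu]_(x in K) h x.
  by apply: Rintegral_zero_out => // x _; exact: h1.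
have i1 := flat_itg oOm S0 cK KO cG fG mfK ti'.
have i2 := flat_itg oOm S0 cK KO cGx fGx mfK ti.
have i3 := flat_itg oOm S0 cK KO cGs fGs mfK gti.
rewrite Z0; last by move=> x nK; rewrite t0'// mulr0.
rewrite Z0; last by move=> x nK; rewrite t0// mulr0.
rewrite [in RHS](eq_Rintegral _ (g := fun x => Gx x (f x) * t x + Gs x (f x) * (g x * t x))); last first.
  by move=> x _; ring.
rewrite RintegralD//.
apply/eqP; rewrite -subr_eq0 opprK addrA -normr_le0; apply/ler_addgt0Pl => k k0; rewrite addr0.
have k6 : 0 < k / 6 by rewrite divr_gt0.
have [C1 C10 hC1] := flat_dist oOm S0 cK KO cG fG fKi ti' k6.
have [C2 C20 hC2] := flat_dist oOm S0 cK KO cGx fGx fKi ti k6.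
have [C3 C30 hC3] := flat_dist oOm S0 cK KO cGs fGs fKi gti k6.
(* All the factors in front of the L^1 errors; the additional 1 makes [A] positive. *)
pose A := C1 + C2 + C3 + M * Mt + 1.
have A0 : 0 < A by rewrite ltr_wpDl// !addr_ge0// mulr_ge0// ltW.
have e0 : 0 < k / 2 / A by rewrite !divr_gt0.
have [F [Gd [cF cGd dF hF hG]]] := weak_partial_approx oOm bOm wf cK KO e0.
have mF : measurable_fun K F.
  by apply: measurable_funTS; apply: continuous_measurable_rV; [exact: openT|move=> x _; exact: cF].
have Kfin : (mu K < +oo)%E.
  have [B _ hB] := compact_sub_cube cK.
  apply: (le_lt_trans _ (lebesgueN_cube N B)); apply: le_measure; rewrite ?inE//.
  by apply: closed_measurable_rV; exact: closed_cube.
have contK (h : 'rV[R]_N -> R) : continuous h -> itg mu K h.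
  move=> ch.
  have [B _ hB] := @jcont_bounded R N setT K (fun x _ => h x) 0 cK (@subsetT _ _) (jcont_fst (fun x _ => ch x)).
  apply: (itg_bounded mK (C := B) Kfin).
    by apply: measurable_funTS; apply: continuous_measurable_rV; [exact: openT|move=> x _; exact: ch].
  by move=> x Kx; apply: (hB x 0) => //; rewrite oppr0 lexx.
have Fi := contK F cF; have Gdi := contK Gd cGd.
have Gdti : itg mu K (fun x => Gd x * t x) by apply: (itgM_bounded mK (C := Mt)).
have comp (H : 'rV[R]_N -> R -> R) (cH : jcont Om H) : cont_on Om (fun x => H x (F x)).
  by move=> x Ox; apply: (jcont_comp cH Ox); exact: cF.
have dGs' y s (Oy : Om y) := dGs y s Oy.
have T1 := @test1_mul_supp i (fun x => G x (F x)) (fun x => Gx x (F x) + Gs x (F x) * Gd x)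
  t t' K (comp G cG) ltac:(by move=> x Ox; apply: continuousD; [exact: comp|
    apply: continuousM; [exact: comp|exact: cGd]]) ht1 cK KO t0 t0'
  (fun x Kx => is_derive_comp2 oOm (KO _ Kx) cGs (fun s => dGx x s (KO _ Kx)) dGs' (cF x) (dF x Kx)).
have j1 := flat_itg oOm S0 cK KO cG fG mF ti'.
have j2 := flat_itg oOm S0 cK KO cGx fGx mF ti.
have j3 := flat_itg oOm S0 cK KO cGs fGs mF gti.
have j3' := flat_itg oOm S0 cK KO cGs fGs mF Gdti.
have := test1_integral0 T1.
rewrite (_ : \int[mu]_x _ = \int[mu]_(x in K) (G x (F x) * t' x + (Gx x (F x) + Gs x (F x) * Gd x) * t x)); last first.
  rewrite [RHS]Rintegral_mkcond; apply: eq_Rintegral => x _; rewrite /patch.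
  case: ifPn => // /negP nK; have nK' : ~ K x by move=> Kx; apply: nK; exact/mem_set.
  have E0 : t' x = 0 := t0' x nK'.
  by rewrite E0 t0// !mulr0 addr0.
rewrite (eq_Rintegral _ (g := fun x => G x (F x) * t' x + Gx x (F x) * t x + Gs x (F x) * (Gd x * t x))); last first.
  by move=> x _; ring.
rewrite RintegralD//; last exact: itgD.
rewrite RintegralD// => E.
have b := chain_error_split E (hC1 F Fi) (hC2 F Fi) (hC3 F Fi).
have d : `|\int[mu]_(x in K) (Gs x (F x) * (Gd x * t x)) - \int[mu]_(x in K) (Gs x (F x) * (g x * t x))|
    <= M * Mt * \int[mu]_(x in K) `|Gd x - g x|.
  have iGg := itg_norm (itgB mK Gdi gKi).
  rewrite -RintegralB// -RintegralZl//; apply: abs_Rintegral_le => //.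
  - exact: itg_measurable (itgB mK j3' j3).
  - move=> x Kx; rewrite (_ : _ - _ = Gs x (F x) * t x * (Gd x - g x)); last by ring.
    by rewrite !normrM ler_wpM2r// ler_pM// hM.
  - exact: itgZ.
apply: (le_trans b).
have M1 : 0 <= M * Mt by rewrite mulr_ge0// ltW.
have a1 := ler_wpM2l C10 hF; have a2 := ler_wpM2l C20 hF; have a3 := ler_wpM2l C30 hF.
have a4 := ler_wpM2l M1 hG.
have EA : A * (k / 2 / A) = k / 2 by rewrite mulrC divfK// gt_eqF.
have e0' := ltW e0.
apply: (@le_trans _ _ (k / 2 + A * (k / 2 / A))); last by rewrite EA -splitr.
rewrite {1}/A; move: a1 a2 a3 a4 d e0'; move: (k / 2 / A) => e; lra.
Qed.

End weak_calculus.

Lemma abs_close (R : realType) (p q r e : R) :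
  `|q - p| < e / 2 -> `|r - p| < e / 2 -> `|q - r| <= e.
Proof.
rewrite !ltr_norml => /andP[? ?] /andP[? ?]; rewrite ler_norml; apply/andP; split; lra.
Qed.

Lemma diff_swap (V : zmodType) (a b c d : V) : a - b - (c - d) = a - c - (b - d).
Proof. by rewrite !opprD !opprK !addrA; congr (_ + _); rewrite addrAC. Qed.

(** * Symmetry of second derivatives, classical and weak *)

Section schwarz.
Context {R : realType} {V : normedModType R}.

Lemma Ck_is_derive (U : set V) k (f : V -> R) x v : Ck k.+1 U f -> U x -> is_derive x v f ('D_v f x).
Proof. by move=> [_ /(_ v)[h _]] Ux; split => //; exact: h. Qed.

Lemma second_difference (f : V -> R) (v w x : V) (h : R) : Ck 2 setT f -> 0 <= h ->
  exists t s : R, [/\ 0 <= t <= h, 0 <= s <= h &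
    f (h *: v + (h *: w + x)) - f (h *: w + x) - (f (h *: v + x) - f x) =
    'D_w ('D_v f) (s *: w + (t *: v + x)) * h * h].
Proof.
move=> hf h0.
have dv y : is_derive y v f ('D_v f y) by exact: Ck_is_derive hf _.
have dvw y : is_derive y w ('D_v f) ('D_w ('D_v f) y).
  by have [_ /(_ v)[_ h2]] := hf; exact: (Ck_is_derive w (h2 : Ck 1 setT ('D_v f)) I).
have d1 t : is_derive t (1 : R) (fun t : R => f (t *: v + (h *: w + x)) - f (t *: v + x))
    ('D_v f (t *: v + (h *: w + x)) - 'D_v f (t *: v + x)).
  by apply: is_deriveB; exact: is_derive_line.
have [t] := real_mvt 0 h d1; rewrite min_l// max_r// !scale0r !add0r subr0 => ht E.
have d2 s : is_derive s (1 : R) (fun s : R => 'D_v f (s *: w + (t *: v + x)))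
    ('D_w ('D_v f) (s *: w + (t *: v + x))) by exact: is_derive_line.
have [s] := real_mvt 0 h d2; rewrite min_l// max_r// scale0r add0r subr0 => hs E2.
exists t, s; split => //.
rewrite [LHS](_ : _ = f (h *: v + (h *: w + x)) - f (h *: v + x) - (f (h *: w + x) - f x)); last exact: diff_swap.
by rewrite E -E2 (addrCA (h *: w)).
Qed.

(** The second difference is symmetric in [v] and [w], and evaluating it in either order gives a
    mixed derivative at a point near [x]. *)
Lemma Ck_schwarz (f : V -> R) (v w x : V) : Ck 2 setT f ->
  'D_w ('D_v f) x = 'D_v ('D_w f) x.
Proof.
move=> hf.
have cP v' w' : {for x, continuous ('D_w' ('D_v' f))}.
  by have [_ /(_ v')[_ [_ /(_ w')[_ [h _]]]]] := hf; exact: h.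
apply/eqP; rewrite -subr_eq0 -normr_le0; apply/ler_addgt0Pl => e e0; rewrite addr0.
have e2 : 0 < e / 2 by rewrite divr_gt0.
have nb v' w' : exists2 d, 0 < d & forall y, `|x - y| < d ->
    `|'D_w' ('D_v' f) x - 'D_w' ('D_v' f) y| < e / 2.
  have /(@cvgrPdist_lt _ _ _ (nbhs x))/(_ _ e2)/nbhs_ballP[d /= d0 hd] := cP v' w'.
  by exists d => // y xy; apply: hd; rewrite -ball_normE.
have [d1 d10 hd1] := nb v w; have [d2 d20 hd2] := nb w v.
pose d := Num.min d1 d2; have d0 : 0 < d by rewrite lt_min d10.
pose m := `|v| + `|w| + 1; have m0 : 0 < m by rewrite ltr_wpDl// addr_ge0.
pose h := d / m; have h0 : 0 < h by rewrite divr_gt0.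
have near t s v' w' : `|v'| + `|w'| + 1 = m -> 0 <= t <= h -> 0 <= s <= h ->
    `|x - (t *: v' + (s *: w' + x))| < d.
  move=> mE /andP[t0 th] /andP[s0 sh].
  rewrite addrA (addrC _ x) opprD addrA subrr add0r normrN (le_lt_trans (ler_normD _ _))//.
  rewrite !normrZ !ger0_norm//.
  have a1 := ler_wpM2r (normr_ge0 v') th; have a2 := ler_wpM2r (normr_ge0 w') sh.
  apply: (@le_lt_trans _ _ (h * (`|v'| + `|w'|))); first by rewrite mulrDr lerD.
  have -> : d = h * m by rewrite /h divfK// gt_eqF.
  by rewrite ltr_pM2l// -mE ltrDl.
have [t [s [ht hs E]]] := second_difference v w x hf (ltW h0).
have [t' [s' [ht' hs' E']]] := second_difference w v x hf (ltW h0).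
have EE : 'D_w ('D_v f) (s *: w + (t *: v + x)) = 'D_v ('D_w f) (s' *: v + (t' *: w + x)).
  have hN : h != 0 by rewrite gt_eqF.
  apply: (mulIf hN); apply: (mulIf hN).
  have Q : h *: v + (h *: w + x) = h *: w + (h *: v + x) by exact: addrCA.
  rewrite -Q in E'; exact: (etrans (esym E) (etrans (diff_swap _ _ _ _) E')).
have b1 : `|x - (s *: w + (t *: v + x))| < d1.
  apply: lt_le_trans (near _ _ _ _ _ hs ht) _; last by rewrite ge_min lexx.
  by rewrite (addrC `|w|).
have b2 : `|x - (s' *: v + (t' *: w + x))| < d2.
  by apply: lt_le_trans (near _ _ _ _ erefl hs' ht') _; rewrite ge_min lexx orbT.
have := hd2 _ b2; rewrite -EE; exact: abs_close (hd1 _ b1).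
Qed.

End schwarz.

Section mixed_partials.
Context {R : realType} {N : nat}.
Notation mu := (@lebesgueN R N).
Variable Om : set 'rV[R]_N.
Hypotheses (oOm : open Om) (bOm : bounded_set Om).

(** Mixed derivatives of the tests commute, so [gji] is also a weak derivative of [gi] in direction
    [j]; uniqueness concludes. *)
Lemma weak_mixed_partials (i j : 'I_N) (f gi gj gij gji : 'rV[R]_N -> R) :
  is_weak_partial Om i f gi -> is_weak_partial Om j f gj ->
  is_weak_partial Om j gi gij -> is_weak_partial Om i gj gji ->
  ae_eq mu Om gij gji.
Proof.
move=> wi wj wij wji; have [_ hij Hij] := wij; have [_ hji Hji] := wji.
have [_ _ Hi] := wi; have [_ _ Hj] := wj.
suff H : is_weak_partial Om j gi gji by exact: (weak_partial_unique oOm bOm wij H).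
have hgi : loc_integrable Om gi by case: wi.
split; [exact: hgi|exact: hji|] => t tt; have [st _ _] := tt.
have tD k : test_fun Om ('D_(basis_rV R k) t).
  have [_ sd hd] := smooth_Cc_derive (basis_rV R k) st (test_fun_Cc tt).
  apply: (smooth_test_fun sd).
  by have [_ h2 _] := test_fun_test1 k tt.
have E1 := Hi _ (tD j); have E2 := Hj _ (tD i); have E3 := Hji _ tt.
have S x : 'D_(basis_rV R i) ('D_(basis_rV R j) t) x = 'D_(basis_rV R j) ('D_(basis_rV R i) t) x.
  exact: (Ck_schwarz (basis_rV R j) (basis_rV R i) x (st 2%N)).
have ES : \int[mu]_(x in Om) (f x * 'D_(basis_rV R i) ('D_(basis_rV R j) t) x) =
    \int[mu]_(x in Om) (f x * 'D_(basis_rV R j) ('D_(basis_rV R i) t) x).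
  by apply: eq_Rintegral => x _; rewrite S; reflexivity.
rewrite ES in E1.
exact: (etrans (oppr_inj (etrans (esym E1) E2)) E3).
Qed.

End mixed_partials.

(** * Integration by parts against tangential fields *)

Section smooth_step.
Context {R : realType}.

Definition possq (s : R) : R := Num.max 0 s ^+ 2.

Lemma possq_derive (s : R) : is_derive s (1 : R) possq (2 * Num.max 0 s).
Proof.
apply: is_derive_eps => e e0; exists e => // h h0 he.
suff H : `|possq (h *: (1 : R) + s) - possq s - 2 * Num.max 0 s * h| <= h ^+ 2.
  have -> : h^-1 * (possq (h *: (1 : R) + s) - possq s) - 2 * Num.max 0 s =
      h^-1 * (possq (h *: (1 : R) + s) - possq s - 2 * Num.max 0 s * h).
    by rewrite [RHS]mulrBr; congr (_ - _); rewrite mulrCA mulVf ?mulr1.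
  rewrite normrM normrV ?unitfE// ler_pdivrMl ?normr_gt0// (le_trans H)//.
  by rewrite -real_normK ?num_real// expr2 ler_wpM2l// ltW.
rewrite /possq /GRing.scale /= mulr1.
case: (lerP 0 (h + s)) => h1; case: (lerP 0 s) => h2; rewrite ler_norml; apply/andP; split; nra.
Qed.

(** Half a second difference of [possq]: a quadratic spline of class C^1, equal to 0 up to 1 and to
    1 from 3 on, whose derivative is the hat function centred at 2. *)
Definition step (s : R) : R := 2^-1 * possq (s - 1) - possq (s - 2) + 2^-1 * possq (s - 3).
Definition step' (s : R) : R := Num.max 0 (s - 1) - 2 * Num.max 0 (s - 2) + Num.max 0 (s - 3).

Lemma possq_shift_derive (c s : R) : is_derive s (1 : R) (fun s => possq (s - c)) (2 * Num.max 0 (s - c)).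
Proof.
have h : is_derive s (1 : R) (fun s : R => s - c) 1.
  by rewrite -[X in is_derive _ _ _ X]subr0; apply: is_deriveB.
by rewrite -[X in is_derive _ _ _ X]mulr1; exact: (is_derive_comp_real h (possq_derive (s - c))).
Qed.

Lemma step_derive (s : R) : is_derive s (1 : R) step (step' s).
Proof.
have h c k : is_derive s (1 : R) (fun s => k * possq (s - c)) (k * (2 * Num.max 0 (s - c))).
  have := is_derive_mul (is_derive_cst k s (1 : R)) (possq_shift_derive c s).
  by rewrite mulr0 addr0.
have := is_deriveD (is_deriveB (h 1 (2^-1)) (possq_shift_derive 2 s)) (h 3 (2^-1)).
rewrite (_ : _ - _ + _ = step' s)//.
by rewrite /step'; field.
Qed.

Lemma step_bounds (s : R) : 0 <= step s <= 1.
Proof.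
rewrite /step /possq; case: (lerP 0 (s - 1)) => h1; case: (lerP 0 (s - 2)) => h2;
 case: (lerP 0 (s - 3)) => h3; apply/andP; split; nra.
Qed.

Lemma step_le1 (s : R) : s <= 1 -> step s = 0.
Proof. by move=> h; rewrite /step /possq !max_l ?subr_le0//; [ring|lra|lra]. Qed.

Lemma step_ge3 (s : R) : 3 <= s -> step s = 1.
Proof. by move=> h; rewrite /step /possq !max_r ?subr_ge0//; [field|lra|lra]. Qed.

Lemma step'_bounds (s : R) : 0 <= step' s <= 1.
Proof.
rewrite /step'; case: (lerP 0 (s - 1)) => h1; case: (lerP 0 (s - 2)) => h2;
 case: (lerP 0 (s - 3)) => h3; apply/andP; split; lra.
Qed.

Lemma step'_ge3 (s : R) : 3 <= s -> step' s = 0.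
Proof. by move=> h; rewrite /step' !max_r ?subr_ge0//; [ring|lra|lra]. Qed.

Lemma step'_le1 (s : R) : s <= 1 -> step' s = 0.
Proof. by move=> h; rewrite /step' !max_l ?subr_le0//; [ring|lra|lra]. Qed.

Lemma step_continuous : continuous step.
Proof.
move=> s; apply/differentiable_continuous/derivable1_diffP.
by case: (step_derive s).
Qed.

Lemma max0B_continuous (c s : R) : {for s, continuous (fun s : R => Num.max 0 (s - c))}.
Proof.
apply: (@continuous_max _ _ (fun=> 0) (fun s => s - c) s); first exact: cst_continuous.
by apply: continuousB; [exact: cvg_id|exact: cst_continuous].
Qed.

Lemma step'_continuous : continuous step'.
Proof.
move=> s; have h := max0B_continuous.
have h2 : {for s, continuous (fun s : R => 2 * Num.max 0 (s - 2))}.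
  by apply: continuousM; [exact: cst_continuous|exact: h].
exact: (continuousD (continuousB (h 1 s) h2) (h 3 s)).
Qed.

End smooth_step.

Lemma continuous_sum_seq (R : realType) (V : normedModType R) (I : Type) (s : seq I)
    (F : I -> V -> R) (x : V) : (forall k, {for x, continuous (F k)}) ->
  {for x, continuous (fun y => \sum_(k <- s) F k y)}.
Proof.
move=> h; rewrite /prop_for; elim: s => [|k s IH].
  by under eq_fun do rewrite big_nil; exact: cst_continuous.
under eq_fun do rewrite big_cons.
exact: (continuousD (h k) IH).
Qed.

Lemma is_derive_sum_seq (R : realType) (V : normedModType R) (I : Type) (s : seq I)
    (F : I -> V -> R) (dF : I -> R) (x v : V) : (forall k, is_derive x v (F k) (dF k)) ->
  is_derive x v (fun y => \sum_(k <- s) F k y) (\sum_(k <- s) dF k).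
Proof.
move=> h; elim: s => [|k s IH].
  by under eq_fun do rewrite big_nil; rewrite big_nil; exact: is_derive_cst.
under eq_fun do rewrite big_cons.
by rewrite big_cons; exact: is_deriveD.
Qed.

(** * Cut-off near the boundary in one chart *)

Section boundary_layer.
Context {R : realType} {N : nat}.
Notation mu := (@lebesgueN R N).
Notation e_ i := (@basis_rV R N i).
Implicit Types (f g c : 'rV[R]_N -> R) (x y : 'rV[R]_N) (i j : 'I_N).
Variable Om : set 'rV[R]_N.
Hypotheses (oOm : open Om) (bOm : bounded_set Om).

Let mOm : measurable Om. Proof. exact: open_measurable_rV. Qed.

Definition cball x0 (r : R) := [set x : 'rV[R]_N | `|x - x0| <= r].

Lemma closed_cball x0 r : closed (cball x0 r).
Proof.
apply: (@closed_comp _ _ (fun x : 'rV[R]_N => `|x - x0|) [set t | t <= r]) => [x _|].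
  apply: (continuous_comp (f := fun x => x - x0)); last exact: norm_continuous.
  by apply: continuousB; [exact: cvg_id|exact: cst_continuous].
exact: closed_le.
Qed.

Lemma compact_cball x0 r : compact (cball x0 r).
Proof.
apply: bounded_closed_compact; last exact: closed_cball.
exists (`|x0| + r); split; first exact: num_real.
move=> M hM x /= hx.
by rewrite (le_trans _ (ltW hM))// -(subrK x0 x) addrC (le_trans (ler_normD _ _))// lerD2l.
Qed.

Lemma cball_out_nbhs x0 r x : r < `|x - x0| -> nbhs x (~` cball x0 r).
Proof.
move=> h; apply: open_nbhs_nbhs; split; first by apply: closed_openC; exact: closed_cball.
by move=> h'; move: h; rewrite ltNge h'.
Qed.

Lemma bumpf_out x0 (r : R) x : 0 < r -> ~ cball x0 r x -> bumpf r (x - x0) = 0.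
Proof.
by move=> r0 nx; apply: bumpf_eq0 => //; rewrite leNgt; apply/negP => hx; apply: nx; exact: ltW.
Qed.

Lemma bumpf_Cc_at x0 (r : R) : 0 < r -> forall j,
  [/\ forall x, is_derive x (e_ j) (fun y => bumpf r (y - x0)) ('D_(e_ j) (fun y => bumpf r (y - x0)) x),
   Cc setT (fun y => bumpf r (y - x0)) & Cc setT ('D_(e_ j) (fun y => bumpf r (y - x0)))].
Proof.
move=> r0 j.
have sk m : Ck m setT (fun y => bumpf r (y - x0)) by apply: Ck_shift; exact: bumpf_Ck.
have hk : Cc setT (fun y => bumpf r (y - x0)).
  split; first by move=> x; have [+ _] := sk 0%N; exact.
  exists (cball x0 r); split => [|//|x]; first exact: compact_cball.
  exact: bumpf_out.
by have [d0 _ d1] := smooth_Cc_derive (e_ j) sk hk.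
Qed.

Lemma bumpf_derive_out x0 (r : R) j x : 0 < r -> r < `|x - x0| ->
  'D_(e_ j) (fun y => bumpf r (y - x0)) x = 0.
Proof.
move=> r0 hx; rewrite -(derive_cst (0 : R) x (e_ j)); apply: near_eq_derive.
by apply: (@filterS _ (nbhs x) _ _ _ _ (cball_out_nbhs hx)) => y; exact: bumpf_out.
Qed.

Variables (f : 'rV[R]_N -> R) (g Psi Psi' : 'I_N -> 'rV[R]_N -> R) (G : 'rV[R]_N -> R).
Hypotheses (wf : forall j, is_weak_partial Om j f (g j)) (fi : itg mu Om f).
Hypotheses (PsiC1 : forall j, C1_on Om j (Psi j) (Psi' j)).
Variable M : R.
Hypotheses (PsiM : forall j x, Om x -> `|Psi j x| <= M).
Hypotheses (Psi'M : forall j x, Om x -> `|Psi' j x| <= M).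
Hypotheses (Gi : itg mu Om (fun x => \sum_j g j x * Psi j x)).

(* phi is a defining function of Om near x0; at interior points phi = -1 will do. *)
Definition local_chart x0 (r : R) := exists phi (phi' : 'I_N -> 'rV[R]_N -> R) (C : R),
  [/\ continuous phi, forall j, continuous (phi' j) & forall j x, is_derive x (e_ j) phi (phi' j x)] /\
  [/\ 0 <= C, forall y, `|y - x0| <= r -> (Om y <-> phi y < 0) &
      forall y, Om y -> `|y - x0| <= r -> `|\sum_j phi' j y * Psi j y| <= C * `|phi y|].

Section local.
Variables (x0 : 'rV[R]_N) (r : R).
Hypothesis r0 : 0 < r.
Let z x := bumpf r (x - x0).
Let z' j := 'D_(e_ j) z.

Section cut.
Variables (phi : 'rV[R]_N -> R) (phi' : 'I_N -> 'rV[R]_N -> R).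
Hypotheses (cphi : continuous phi) (cphi' : forall j, continuous (phi' j)).
Hypothesis dphi : forall j x, is_derive x (e_ j) phi (phi' j x).
Hypothesis chart : forall y, `|y - x0| <= r -> (Om y <-> phi y < 0).
Variable k : nat.
Let eta x := step (- k.+1%:R * phi x).
Let eta' j x := step' (- k.+1%:R * phi x) * (- k.+1%:R * phi' j x).

Lemma eta_derive j x : is_derive x (e_ j) eta (eta' j x).
Proof.
have h : is_derive x (e_ j) (fun x => - k.+1%:R * phi x) (- k.+1%:R * phi' j x).
  have := is_derive_mul (is_derive_cst (- k.+1%:R : R) x (e_ j)) (dphi j x).
  by rewrite mulr0 addr0.
exact: (is_derive_comp_real h (step_derive _)).
Qed.

(** The factor [eta] vanishes where phi > -1/(k+1), so the product is carried by a compact part of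
    {phi < 0} and hence of [Om]. *)
Lemma cut_test1 j : test1 Om j (fun x => eta x * z x) (fun x => eta x * z' j x + eta' j x * z x).
Proof.
have [dz hz hz'] := bumpf_Cc_at x0 r0 j.
have cs x : {for x, continuous (fun x => - k.+1%:R * phi x)}.
  by apply: continuousM; [exact: cst_continuous|exact: cphi].
have ceta x : {for x, continuous eta}.
  by apply: (continuous_comp (f := fun x => - k.+1%:R * phi x)); [exact: cs|exact: step_continuous].
have ceta' x : {for x, continuous (eta' j)}.
  apply: continuousM.
    by apply: (continuous_comp (f := fun x => - k.+1%:R * phi x)); [exact: cs|exact: step'_continuous].
  by apply: continuousM; [exact: cst_continuous|exact: cphi'].
have h1 : Cc setT (fun x => eta x * z x) by apply: CcMl => //; exact: openT.
have h2 : Cc setT (fun x => eta x * z' j x + eta' j x * z x).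
  by apply: CcD; apply: CcMl => //; exact: openT.
pose K := cball x0 r `&` [set x | phi x <= - k.+1%:R^-1].
have cK : compact K.
  apply: compact_closedI; first exact: compact_cball.
  by apply: (@closed_comp _ _ phi [set t | t <= - k.+1%:R^-1]) => [x _|]; [exact: cphi|exact: closed_le].
have KO : K `<=` Om.
  move=> x [h3 /= h4]; apply/(chart h3); apply: le_lt_trans h4 _.
  by rewrite oppr_lt0 invr_gt0.
have zK x : ~ K x -> ~ cball x0 r x \/ - k.+1%:R * phi x <= 1.
  move=> nK; have [|] := pselect (cball x0 r x); last by left.
  move=> h3; right; have : ~ (phi x <= - k.+1%:R^-1) by move=> h4; apply: nK.
  move/negP; rewrite -ltNge => h4.
  rewrite mulNr -mulrN; move: h4; rewrite ltrNl => /ltW.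
  by rewrite -(ler_pM2l (ltr0Sn _ k)) mulfV.
have out x : ~ cball x0 r x -> z x = 0 /\ z' j x = 0.
  move=> nx; split; first exact: bumpf_out.
  by apply: bumpf_derive_out => //; rewrite ltNge; apply/negP.
split.
- have [c1 _] := h1; split=> //; exists K; split=> // x /zK[/out[-> _]|/step_le1 h]; first by rewrite mulr0.
  by rewrite /eta h mul0r.
- have [c1 _] := h2; split=> //; exists K; split=> // x /zK[/out[-> ->]|h]; first by rewrite !mulr0 addr0.
  by rewrite /eta /eta' step_le1// step'_le1// !mul0r addr0.
- by move=> x; rewrite (mulrC (eta' j x)); exact: (is_derive_mul (eta_derive j x) (dz x)).
Qed.

End cut.
(** The only dangerous term contains (k+1) grad phi . Psi. It is multiplied by step', which vanishes
    where (k+1) |phi| >= 3, while tangency gives |grad phi . Psi| <= C |phi|; the product is bounded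
    by 3C and tends to 0 at every point of [Om]. *)
Lemma local_ibp : local_chart x0 r ->
  itg mu Om (fun x => f x * (\sum_j (Psi' j x * z x + Psi j x * z' j x)) + z x * \sum_j g j x * Psi j x) /\
  \int[mu]_(x in Om) (f x * (\sum_j (Psi' j x * z x + Psi j x * z' j x)) + z x * \sum_j g j x * Psi j x) = 0.
Proof.
move=> [phi [phi' [C [[cphi cphi' dphi] [C0 chart bd]]]]].
pose eta (k : nat) x := step (- k.+1%:R * phi x).
pose b (k : nat) x := step' (- k.+1%:R * phi x) * (- k.+1%:R) * \sum_j phi' j x * Psi j x.
pose A x := \sum_j (Psi' j x * z x + Psi j x * z' j x).
pose Gs x := \sum_j g j x * Psi j x.
pose F (k : nat) x := f x * (eta k x * A x + z x * b k x) + eta k x * z x * Gs x.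
have [B0 B00 hB0] : exists2 B0, 0 < B0 & forall x, `|z x| <= B0.
  apply: (@Cc_bounded _ _ setT).
  split; first by move=> x; have [+ _] := Ck_shift x0 (@bumpf_Ck R N 0 r); exact.
  by exists (cball x0 r); split => [|//|x]; [exact: compact_cball|exact: bumpf_out].
have hz j := bumpf_Cc_at x0 r0 j.
have [B B0' hB] : exists2 B, 0 < B & (forall x, `|z x| <= B) /\ forall j x, `|z' j x| <= B.
  have /choice[bj hbj] : forall j, exists b, 0 < b /\ forall x, `|z' j x| <= b.
    by move=> j; have [_ _ /Cc_bounded[b0 b1 b2]] := hz j; exists b0.
  have s0 j : 0 <= bj j by have [/ltW] := hbj j.
  exists (B0 + \sum_j bj j); first by rewrite ltr_pwDl// sumr_ge0.
  split=> [x|j x]; first by rewrite (le_trans (hB0 x))// lerDl sumr_ge0.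
  have [_ hj] := hbj j; rewrite (le_trans (hj x))// (bigD1 j)//= addrCA lerDl.
  by apply: addr_ge0; [exact: ltW|exact: sumr_ge0].
have [hBz hBz'] := hB.
have mPsi j : measurable_fun Om (Psi j).
  by have [h _ _] := PsiC1 j; exact: continuous_measurable_rV.
have mPsi' j : measurable_fun Om (Psi' j).
  by have [_ h _] := PsiC1 j; exact: continuous_measurable_rV.
have mcont (h : 'rV[R]_N -> R) : continuous h -> measurable_fun Om h.
  by move=> ch; apply: continuous_measurable_rV => // x _; exact: ch.
have cz : continuous z.
  by move=> x; have [+ _] := Ck_shift x0 (@bumpf_Ck R N 0 r); exact.
have mz : measurable_fun Om z by exact: mcont.
have mz' j : measurable_fun Om (z' j).
  by have [_ _ h] := hz j; exact: Cc_measurable h.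
have cs k x : {for x, continuous (fun x => - k.+1%:R * phi x)}.
  by apply: continuousM; [exact: cst_continuous|exact: cphi].
have meta k : measurable_fun Om (eta k).
  apply: mcont => x; apply: (continuous_comp (f := fun x => - k.+1%:R * phi x)); first exact: cs.
  exact: step_continuous.
have mb k : measurable_fun Om (b k).
  apply: measurable_funM.
    apply: measurable_funM; last exact: measurable_cst.
    apply: mcont => x; apply: (continuous_comp (f := fun x => - k.+1%:R * phi x)); [exact: cs|exact: step'_continuous].
  by apply: measurable_sum => j; apply: measurable_funM; [exact: mcont (cphi' j)|exact: mPsi].
have mA : measurable_fun Om A.
  by apply: measurable_sum => j; apply: measurable_funD; apply: measurable_funM.
have mf := itg_measurable fi; have mG := itg_measurable Gi.
have mF k : measurable_fun Om (F k).
  apply: measurable_funD; apply: measurable_funM => //; last exact: measurable_funM.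
  by apply: measurable_funD; apply: measurable_funM.
have out x : ~ cball x0 r x -> z x = 0 /\ forall j, z' j x = 0.
  move=> nx; split; first exact: bumpf_out.
  by move=> j; apply: bumpf_derive_out => //; rewrite ltNge; apply/negP.
have Aout x : ~ cball x0 r x -> A x = 0.
  move=> /out[z0 z0']; apply: big1 => j _; by rewrite z0 z0' !mulr0 addr0.
have lim x : Om x -> F k x @[k --> \oo] --> f x * A x + z x * Gs x.
  move=> Ox; apply: cvg_near_cst.
  have [h|nh] := pselect (cball x0 r x); last first.
    by apply: nearW => k; rewrite /F Aout// (out _ nh).1 ?(mulr0, mul0r, addr0).
  have p0 : 0 < - phi x by rewrite oppr_gt0; apply/(chart x h).
  have := nbhs_infty_ger (3 / (- phi x)); apply: filterS => k hk.
  have h3 : 3 <= - k.+1%:R * phi x.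
    rewrite mulNr -mulrN -ler_pdivrMr// (le_trans hk)// ler_nat//.
  by rewrite /F /eta /b step_ge3// step'_ge3// !mul0r mulr0 addr0 !mul1r.
have M0 x : Om x -> 'I_N -> 0 <= M by move=> Ox j; exact: le_trans (normr_ge0 _) (PsiM j Ox).
(* Dominating function, uniform in k: 3 C B bounds the boundary layer term, and the last term uses
   only the integrability of grad f . Psi, not that of grad f. *)
pose Dm x := `|f x| * (N%:R * (M * B + M * B) + 3 * C * B) + `|Gs x| * B.
have iD : itg mu Om Dm.
  apply: itgD => //; apply: (itg_eq mOm (f := fun x => _ * `|_|)).
  - by move=> x _; exact: mulrC.
  - by apply: itgZ => //; exact: itg_norm.
  - by move=> x _; exact: mulrC.
  - by apply: itgZ => //; exact: itg_norm Gi.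
have Ab x : Om x -> `|A x| <= N%:R * (M * B + M * B).
  move=> Ox; rewrite (le_trans (ler_norm_sum _ _ _))//.
  rewrite (le_trans (ler_sum _ (F := _) (G := fun=> M * B + M * B) _))//; last first.
    by rewrite sumr_const card_ord mulr_natl.
  move=> j _; rewrite (le_trans (ler_normD _ _))// !normrM lerD// ler_pM//.
  - exact: Psi'M.
  - exact: PsiM.
have bb k x : Om x -> `|z x * b k x| <= 3 * C * B.
  move=> Ox; have [h|nh] := pselect (cball x0 r x); last first.
    by rewrite (out _ nh).1 mul0r normr0 !mulr_ge0// ltW.
  have p0 : phi x < 0 by apply/(chart x h).
  rewrite normrM mulrC ler_pM//.
  have [h3|h3] := lerP 3 (- k.+1%:R * phi x).
    by rewrite /b step'_ge3// !mul0r normr0 mulr_ge0.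
  rewrite /b !normrM -mulrA (@le_trans _ _ (1 * (k.+1%:R * (C * `|phi x|))))//.
    have /andP[s0 s1] := step'_bounds (- k.+1%:R * phi x).
    apply: ler_pM => //; first by rewrite ger0_norm.
    by rewrite normrN normr_nat ler_wpM2l//; exact: bd.
  rewrite mul1r mulrCA (mulrC 3) ler_wpM2l// ltr0_norm//.
  by move: h3 => /ltW; rewrite mulNr mulrN.
have dom k x : Om x -> `|F k x| <= Dm x.
  move=> Ox; have /andP[s0 s1] := step_bounds (- k.+1%:R * phi x).
  rewrite (le_trans (ler_normD _ _))// !normrM lerD//.
    rewrite ler_wpM2l// (le_trans (ler_normD _ _))// lerD//; last exact: bb.
    rewrite normrM ger0_norm// (le_trans _ (Ab x Ox))// ler_piMl//.
  rewrite mulrC ler_wpM2l// (ger0_norm s0) (le_trans _ (hBz x))// ler_piMl//.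
have F0 k : \int[mu]_(x in Om) F k x = 0.
  pose eta' j x := step' (- k.+1%:R * phi x) * (- k.+1%:R * phi' j x).
  have T j := test1_mul oOm (PsiC1 j) (cut_test1 cphi cphi' dphi chart k j).
  have E j := weak_test1 oOm bOm (wf j) (T j).
  have [hf' hg'] : loc_integrable Om f /\ forall j, loc_integrable Om (g j).
    split; last by move=> j; have [_ h _] := wf j.
    split; first exact: mf.
    by move=> K cK KO; apply: (integrableS mOm (compact_measurable_rV cK) KO).
  have I1 j := loc_itg_Cc oOm hf' (let: And3 _ h _ := T j in h).
  have I2 j := loc_itg_Cc oOm (hg' j) (let: And3 h _ _ := T j in h).
  transitivity (\sum_j (\int[mu]_(x in Om) (f x * (Psi j x * (eta k x * z' j x + eta' j x * z x) + Psi' j x * (eta k x * z x)))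
     + \int[mu]_(x in Om) (g j x * (Psi j x * (eta k x * z x))))); last first.
    by apply: big1 => j _; rewrite E addNr.
  rewrite (eq_bigr (fun j => \int[mu]_(x in Om)
     (f x * (Psi j x * (eta k x * z' j x + eta' j x * z x) + Psi' j x * (eta k x * z x)) +
      g j x * (Psi j x * (eta k x * z x))))); last first.
    by move=> j _; exact: (esym (RintegralD mOm (I1 j) (I2 j))).
  rewrite -Rintegral_sum//; last by move=> j; exact: itgD.
  apply: eq_Rintegral => x _; rewrite big_split/= -mulr_sumr /F; congr (f x * _ + _).
    rewrite /A /b mulr_sumr mulr_sumr mulr_sumr -big_split/=; apply: eq_bigr => j _.
    by rewrite /eta'; ring.
  by rewrite /Gs mulr_sumr; apply: eq_bigr => j _; ring.
have [iL L] := Rintegral_dominated mOm mF lim iD dom.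
split; first exact: iL.
have L0 : \int[mu]_(x in Om) F k x @[k --> \oo] --> 0.
  by under eq_fun do rewrite F0; exact: cvg_cst.
exact: (cvg_unique _ L L0).
Qed.

End local.

End boundary_layer.

(** * Patching the charts *)

Section partition_of_unity.
Context {R : realType} {N : nat}.
Notation mu := (@lebesgueN R N).
Notation e_ i := (@basis_rV R N i).
Implicit Types (f g c : 'rV[R]_N -> R) (x y : 'rV[R]_N) (i j : 'I_N).
Variable Om : set 'rV[R]_N.
Hypotheses (oOm : open Om) (bOm : bounded_set Om).

Let mOm : measurable Om. Proof. exact: open_measurable_rV. Qed.

Lemma compact_closure_bounded : compact (closure Om).
Proof.
apply: bounded_closed_compact; last exact: closed_closure.
case: bOm => M [Mr hM]; exists M; split => // t tM x clx.
have : closed [set y : 'rV[R]_N | `|y| <= t].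
  apply: (@closed_comp _ _ (fun x : 'rV[R]_N => `|x|) [set s | s <= t]) => [y _|].
    exact: norm_continuous.
  exact: closed_le.
by move=> /closure_id E; have : closure [set y : 'rV[R]_N | `|y| <= t] x;
  [apply: closure_subset clx => y Oy; exact: hM|rewrite -E].
Qed.

Variables (f : 'rV[R]_N -> R) (g Psi Psi' : 'I_N -> 'rV[R]_N -> R).
Hypotheses (wf : forall j, is_weak_partial Om j f (g j)) (fi : itg mu Om f).
Hypotheses (PsiC1 : forall j, C1_on Om j (Psi j) (Psi' j)).
Variable M : R.
Hypotheses (PsiM : forall j x, Om x -> `|Psi j x| <= M).
Hypotheses (Psi'M : forall j x, Om x -> `|Psi' j x| <= M).
Hypotheses (Gi : itg mu Om (fun x => \sum_j g j x * Psi j x)).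

Lemma is_derive_inv c x v d : c x != 0 -> is_derive x v c d ->
  is_derive x v (fun y => (c y)^-1) (- (c x)^-2 * d).
Proof.
move=> c0 dc; apply: (is_derive_comp_real dc).
by have := is_deriveV c0 (is_derive_id (c x) (1 : R)); rewrite /GRing.scale /= mulr1.
Qed.

(** Instead of normalising the bumps, [local_ibp] is applied to the field Psi / S, where S is the
    sum of the bumps of a finite cover; multiplied by the bumps and summed, this field gives back
    Psi. *)
Lemma chart_ibp : (forall x0, exists r, 0 < r /\ local_chart Om Psi x0 r) ->
  \int[mu]_(x in Om) (f x * (\sum_j Psi' j x) + \sum_j g j x * Psi j x) = 0.
Proof.
move=> /choice[r hr]; have r0 x0 := (hr x0).1.
have cB x0 : open [set y : 'rV[R]_N | `|y - x0| < r x0].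
  apply: (@open_comp _ _ (fun x : 'rV[R]_N => `|x - x0|) [set s | s < r x0]) => [y _|].
    apply: (continuous_comp (f := fun x => x - x0)); last exact: norm_continuous.
    by apply: continuousB; [exact: cvg_id|exact: cst_continuous].
  exact: open_lt.
have [D' _ cov] : finite_subset_cover setT (fun x0 => [set y : 'rV[R]_N | `|y - x0| < r x0]) (closure Om).
  have := compact_closure_bounded; rewrite compact_cover; apply => [x0 _|x _]; first exact: cB.
  by exists x => //=; rewrite subrr normr0.
pose s := finmap.enum_fset D'.
pose z k x := bumpf (r k) (x - k); pose z' k j := 'D_(e_ j) (z k).
have hz k j := bumpf_Cc_at k (r0 k) j.
pose S x := \sum_(k <- s) z k x; pose S' j x := \sum_(k <- s) z' k j x.
have z0 k x : 0 <= z k x by exact: bumpf_ge0.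
have S0 x : closure Om x -> 0 < S x.
  move=> /cov[k /= ks hk].
  rewrite /S (big_rem k)//=; apply: (@lt_le_trans _ _ (z k x)); first exact: bumpf_gt0.
  by rewrite lerDl sumr_ge0.
have cz k : continuous (z k).
  by move=> x; have [+ _] := Ck_shift k (@bumpf_Ck R N 0 (r k)); exact.
have cS x : {for x, continuous S} by apply: continuous_sum_seq => k; exact: cz.
have cS' j x : {for x, continuous (S' j)}.
  by apply: continuous_sum_seq => k; have [_ _ [h _]] := hz k j; exact: h.
have dS j x : is_derive x (e_ j) S (S' j x).
  by apply: is_derive_sum_seq => k; have [h _ _] := hz k j; exact: h.
(* The sum of the bumps is positive on the compact closure; a uniform lower bound is what keeps Psi
   / S and its derivatives bounded. *)
have [c c0 hc] : exists2 c, 0 < c & forall x, Om x -> c <= S x.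
  have [/set0P[x1 clx1]|/negPn/eqP E] := boolP (closure Om != set0); last first.
    by exists 1 => // x Ox; have := subset_closure Ox; rewrite E.
  have cw : {within closure Om, continuous S} by apply: continuous_subspaceT => x; exact: cS.
  have [c /set_mem clc hc] := compact_EVT_min (ex_intro _ x1 clx1) compact_closure_bounded cw.
  exists (S c); first exact: S0.
  by move=> x Ox; apply: hc; apply/mem_set; exact: subset_closure.
have SN x : Om x -> S x != 0 by move=> Ox; rewrite gt_eqF// (lt_le_trans c0)// hc.
have [B B0 hB] : exists2 B, 0 <= B & forall j x, `|S' j x| <= B.
  have /choice[bj hbj] : forall k : 'rV[R]_N * 'I_N, exists b, 0 <= b /\ forall x, `|z' k.1 k.2 x| <= b.
    by move=> [k j]; have [_ _ /Cc_bounded[b0 b1 b2]] := hz k j; exists b0; split => //; exact: ltW.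
  exists (\sum_(k <- s) \sum_j bj (k, j)).
    by apply: sumr_ge0 => k _; apply: sumr_ge0 => j _; exact: (hbj (k, j)).1.
  move=> j x; rewrite (le_trans (ler_norm_sum _ _ _))//; apply: ler_sum => k _.
  rewrite (le_trans ((hbj (k, j)).2 x))// (bigD1 j)//= lerDl; apply: sumr_ge0 => i _.
  exact: (hbj (k, i)).1.
pose P1 j x := Psi j x * (S x)^-1.
pose P1' j x := Psi' j x * (S x)^-1 + Psi j x * (- (S x)^-2 * S' j x).
have cSV x : Om x -> {for x, continuous (fun y => (S y)^-1)}.
  by move=> Ox; apply: continuousV; [exact: SN|exact: cS].
have C1 j : C1_on Om j (P1 j) (P1' j).
  have [cP cP' dP] := PsiC1 j; split=> x Ox.
  - by apply: continuousM; [exact: cP|exact: cSV].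
  - apply: continuousD; first by apply: continuousM; [exact: cP'|exact: cSV].
    apply: continuousM; first exact: cP.
    apply: continuousM; last exact: cS'.
    apply: continuousN; apply: continuousV; first by rewrite expf_neq0// SN.
    exact: (continuous_comp (cS x) (@exprn_continuous _ 2 _)).
  - have := is_derive_mul (dP x Ox) (is_derive_inv (SN x Ox) (dS j x)).
    by rewrite [X in is_derive _ _ _ X]addrC [(S x)^-1 * _]mulrC.
have M0 j x : Om x -> 0 <= M by move=> Ox; exact: le_trans (normr_ge0 _) (PsiM j Ox).
have SV x : Om x -> `|(S x)^-1| <= c^-1.
  move=> Ox; have Sx : 0 < S x by exact: lt_le_trans c0 (hc x Ox).
  by rewrite gtr0_norm ?invr_gt0// lef_pV2// hc.
have V0 : 0 <= c^-1 by rewrite invr_ge0 ltW.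
pose M1 := M * c^-1 + M * (c^-1 * c^-1 * B).
have P1M j x : Om x -> `|P1 j x| <= M1.
  move=> Ox; rewrite normrM (@le_trans _ _ (M * c^-1))//.
    by apply: ler_pM => //; [exact: PsiM|exact: SV].
  by rewrite lerDl !mulr_ge0// (M0 j x).
have P1'M j x : Om x -> `|P1' j x| <= M1.
  move=> Ox; rewrite (le_trans (ler_normD _ _))// lerD//.
    by rewrite normrM; apply: ler_pM => //; [exact: Psi'M|exact: SV].
  rewrite normrM; apply: ler_pM => //; first exact: PsiM.
  rewrite normrM; apply: ler_pM => //.
  by rewrite normrN -exprVn normrX expr2; apply: ler_pM => //; exact: SV.
have mS : measurable_fun Om (fun x => (S x)^-1) by exact: continuous_measurable_rV.
have GE x : \sum_j g j x * P1 j x = (\sum_j g j x * Psi j x) * (S x)^-1.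
  by rewrite mulr_suml; apply: eq_bigr => j _; rewrite mulrA.
have G1 : itg mu Om (fun x => \sum_j g j x * P1 j x).
  by under eq_fun do rewrite GE; exact: (itgM_bounded mOm mS SV Gi).
have ch k : local_chart Om P1 k (r k).
  have [_ [phi [phi' [C [h1 [C0 h2 h3]]]]]] := hr k.
  exists phi, phi', (C * c^-1); split; first exact: h1.
  split; [exact: mulr_ge0|exact: h2|] => y Oy yk.
  have -> : \sum_j phi' j y * P1 j y = (\sum_j phi' j y * Psi j y) * (S y)^-1.
    by rewrite mulr_suml; apply: eq_bigr => j _; rewrite mulrA.
  rewrite normrM (mulrAC C); apply: ler_pM => //; first exact: h3.
  exact: SV.
have L k := local_ibp oOm bOm wf fi C1 P1M P1'M G1 (r0 k) (ch k).
pose F k x := f x * (\sum_j (P1' j x * z k x + P1 j x * z' k j x)) + z k x * \sum_j g j x * P1 j x.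
have -> : \int[mu]_(x in Om) (f x * (\sum_j Psi' j x) + \sum_j g j x * Psi j x) =
    \int[mu]_(x in Om) (\sum_(k <- s) F k x).
  apply: eq_Rintegral => x /set_mem Ox.
  rewrite /F big_split/= -mulr_sumr -mulr_suml GE -/(S x); congr (f x * _ + _).
    rewrite exchange_big/=; apply: eq_bigr => j _.
    rewrite big_split/= -!mulr_sumr -/(S x) -/(S' j x) /P1' /P1.
    by field; exact: SN.
  by rewrite mulrCA mulfV ?mulr1//; exact: SN.
rewrite Rintegral_sum//; last by move=> k; have [h _] := L k; exact: h.
by apply: big1 => k _; have [_ h] := L k; exact: h.
Qed.

End partition_of_unity.

(** * Linearity of the derivative in the direction *)

Section directional_linearity.
Context {R : realType} {V : normedModType R}.
Implicit Types (f : V -> R) (x v w : V).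

Lemma Ck1_derive_continuous f v x : Ck 1 setT f -> {for x, continuous ('D_v f)}.
Proof. by move=> [_ /(_ v)[_ [h _]]]; exact: h. Qed.

Lemma line_mvt_le f x v (t : R) : Ck 1 setT f -> exists2 s, `|s| <= `|t| &
  f (t *: v + x) - f x = 'D_v f (s *: v + x) * t.
Proof.
move=> hf.
have d s : is_derive s (1 : R) (fun s : R => f (s *: v + x)) ('D_v f (s *: v + x)).
  by apply: is_derive_line; exact: (Ck_is_derive v hf).
have [s hs] := real_mvt 0 t d; rewrite scale0r add0r subr0 => E; exists s => //.
move: hs; case: (lerP 0 t) => h /andP[h1 h2]; rewrite ler_norml.
  by rewrite (ger0_norm h); apply/andP; split; lra.
by rewrite (ltr0_norm h); apply/andP; split; lra.
Qed.

(** [Ck] speaks of each direction separately; additivity comes from the mean value theorem along [w]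
    and the continuity of the derivative in that direction. *)
Lemma derive_add f x v w : Ck 1 setT f -> 'D_(v + w) f x = 'D_v f x + 'D_w f x.
Proof.
move=> hf; suff h : is_derive x (v + w) f ('D_v f x + 'D_w f x) by case: h.
apply: is_derive_eps => e e0.
have e2 : 0 < e / 2 by rewrite divr_gt0.
have c1 : {for x, continuous ('D_w f)} by exact: Ck1_derive_continuous.
have /(@cvgrPdist_lt _ _ _ (nbhs x))/(_ _ e2)/nbhs_ballP[d1 /= d10 hd1] := c1.
have dv := Ck_is_derive v hf (I : setT x).
have [_ dvE] := dv.
have q1 : h^-1 *: ((f \o shift x) (h *: v) - f x) @[h --> 0^'] --> 'D_v f x.
  by have [d1' d2'] := dv; exact: d1'.
have /cvgrPdist_lt/(_ _ e2)[d2 /= d20 hd2] := q1.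
pose m := `|v| + `|w| + 1; have m0 : 0 < m by rewrite ltr_wpDl// addr_ge0.
exists (Num.min (d1 / m) d2); first by rewrite lt_min divr_gt0.
move=> h h0; rewrite lt_min => /andP[hm hh2].
have [s sh E] := line_mvt_le (h *: v + x) w h hf.
have b1 : `|'D_w f x - 'D_w f (s *: w + (h *: v + x))| < e / 2.
  apply: hd1; rewrite -ball_normE /ball_ /= addrA (addrC _ x) opprD addrA subrr add0r normrN.
  rewrite (le_lt_trans (ler_normD _ _))// !normrZ.
  rewrite (@le_lt_trans _ _ (`|h| * (`|w| + `|v|)))//.
    by rewrite mulrDr lerD2r ler_wpM2r.
  rewrite (@le_lt_trans _ _ (`|h| * m))//; last by rewrite -ltr_pdivlMr.
  by rewrite ler_wpM2l// /m addrC lerDl.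
have b2 : `|'D_v f x - h^-1 * (f (h *: v + x) - f x)| < e / 2.
  have := hd2 h; rewrite /ball_ /= sub0r normrN => /(_ hh2 h0).
  by [].
have EE : h^-1 * (f (h *: (v + w) + x) - f x) =
    'D_w f (s *: w + (h *: v + x)) + h^-1 * (f (h *: v + x) - f x).
  have E2 : h *: (v + w) + x = h *: w + (h *: v + x) by rewrite scalerDr addrA (addrC (h *: w)).
  rewrite E2; move: E; set a1 := f _; set a2 := f _; set a3 := f _; set a4 := 'D_w f _ => E.
  have -> : a1 - a3 = (a1 - a2) + (a2 - a3) by rewrite addrA subrK.
  by rewrite mulrDr E (mulrC a4) mulKf.
rewrite EE; move: b1 b2; move: ('D_w f _) ('D_w f _) ('D_v f x) (h^-1 * _) => p q r t.
rewrite !ltr_norml ler_norml => /andP[? ?] /andP[? ?]; apply/andP; split; lra.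
Qed.

Lemma derive_scale f x v (c : R) : Ck 1 setT f -> 'D_(c *: v) f x = c * 'D_v f x.
Proof.
move=> hf; suff h : is_derive x (c *: v) f (c * 'D_v f x) by case: h.
apply/is_derive_lineE.
have h1 : is_derive (0 : R) (1 : R) (fun h : R => h * c) c.
  have := is_derive_mul (is_derive_id (0 : R) (1 : R)) (is_derive_cst c (0 : R) (1 : R)).
  by rewrite mulr0 add0r mulr1.
have h2 : is_derive (0 * c) (1 : R) (fun h : R => f (h *: v + x)) ('D_v f x).
  by rewrite mul0r; exact: (is_derive_lineE _ _ _ _).1 (Ck_is_derive v hf (I : setT x)).
have := is_derive_comp_real h1 h2; rewrite mulrC.
by under eq_fun do rewrite -scalerA.
Qed.

Lemma derive_sign f x w (q : R) : is_derive x w f q -> 0 < q ->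
  exists2 d, 0 < d & forall t, 0 < t -> t < d -> f x < f (t *: w + x).
Proof.
move=> [h1 h2] q0.
have /cvgrPdist_lt/(_ _ q0)[d /= d0 hd] := (h1 : _ --> 'D_w f x); rewrite h2 in hd.
exists d => // t t0 td; have := hd t; rewrite /ball_ /= sub0r normrN gtr0_norm// => /(_ td).
rewrite gt_eqF// => /(_ isT); rewrite ltr_norml => /andP[_].
rewrite ltrBlDr ltrDl => h; rewrite -subr_gt0; move: h.
by rewrite /GRing.scale /= pmulr_rgt0// invr_gt0.
Qed.

End directional_linearity.

(** * Geometry of a boundary chart *)

Section chart.
Context {R : realType} {N : nat}.
Notation e_ i := (@basis_rV R N i).
Variables (i : 'I_N) (s : bool) (h : 'rV[R]_N.-1 -> R).
Hypothesis hC2 : Ck 2 setT h.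
Let phi := chart_fun i s h.
Let h1 : Ck 1 setT h. Proof. exact: CkW. Qed.

Definition chart_dir (v x : 'rV[R]_N) : R :=
  'D_(col' i v) h (col' i x) - (-1) ^+ s * v 0 i.

Lemma col'_lin (t : R) (v x : 'rV[R]_N) : col' i (t *: v + x) = t *: col' i v + col' i x.
Proof. by apply/rowP => k; rewrite !mxE. Qed.

Lemma chart_is_derive v x : is_derive x v phi (chart_dir v x).
Proof.
apply/is_derive_lineE; rewrite /phi /chart_fun /chart_dir.
have E : (fun t : R => h (col' i (t *: v + x)) - (-1) ^+ s * (t *: v + x) 0 i) =
    (fun t : R => h (t *: col' i v + col' i x)) - (fun t : R => (-1) ^+ s * v 0 i * t + (-1) ^+ s * x 0 i).
  by apply/funext => t; rewrite col'_lin !mxE mulrDr (mulrC t) mulrA.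
rewrite E; apply: is_deriveB; first exact: (is_derive_lineE _ _ _ _).1 (Ck_is_derive _ h1 (I : setT (col' i x))).
have := is_derive_mul (is_derive_cst ((-1) ^+ s * v 0 i) (0 : R) (1 : R)) (is_derive_id (0 : R) (1 : R)).
rewrite mulr0 addr0 mulr1 => H.
by rewrite -[X in is_derive _ _ _ X]addr0; apply: is_deriveD.
Qed.

Lemma chart_dirD v w x : chart_dir (v + w) x = chart_dir v x + chart_dir w x.
Proof.
rewrite /chart_dir; have -> : col' i (v + w) = col' i v + col' i w by apply/rowP => k; rewrite !mxE.
by rewrite derive_add// mxE; ring.
Qed.

Lemma chart_dirZ c v x : chart_dir (c *: v) x = c * chart_dir v x.
Proof.
rewrite /chart_dir; have -> : col' i (c *: v) = c *: col' i v by apply/rowP => k; rewrite !mxE.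
by rewrite derive_scale// mxE; ring.
Qed.

Lemma chart_dir_sum v x : chart_dir v x = \sum_j v 0 j * chart_dir (e_ j) x.
Proof.
have H (r : seq 'I_N) (w : 'I_N -> 'rV[R]_N) : chart_dir (\sum_(j <- r) w j) x = \sum_(j <- r) chart_dir (w j) x.
  elim: r => [|j r IH]; last by rewrite !big_cons chart_dirD IH.
  by rewrite !big_nil; have := chart_dirZ 0 0 x; rewrite scale0r mul0r.
rewrite {1}(row_sum_delta v) H; apply: eq_bigr => j _.
by rewrite -chart_dirZ.
Qed.

(** The outward vertical vector: along it the chart function grows at unit speed and all its
    directional derivatives stay constant. *)
Definition vert : 'rV[R]_N := - (-1) ^+ s *: e_ i.

Lemma col'_vert (t : R) y : col' i (t *: vert + y) = col' i y.
Proof.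
apply/rowP => k; rewrite !mxE eqxx /= eq_sym (negPf (neq_lift _ _)) /=.
by rewrite !mulr0 add0r.
Qed.

Lemma chart_vert (t : R) y : phi (t *: vert + y) = phi y + t.
Proof.
rewrite /phi /chart_fun col'_vert !mxE !eqxx /= mulr1.
rewrite mulrDr opprD addrCA addrC; congr (_ + _).
by rewrite mulrN mulrN opprK mulrCA -expr2 -exprM mulnC exprM sqrrN !expr1n mulr1.
Qed.

Lemma chart_dir_vert (t : R) v y : chart_dir v (t *: vert + y) = chart_dir v y.
Proof. by rewrite /chart_dir col'_vert. Qed.

Lemma chart_dir_vert1 y : chart_dir vert y = 1.
Proof.
have := chart_is_derive vert y => /is_derive_lineE[_ <-].
rewrite (_ : (fun t : R => _) = (fun t : R => phi y + t)); last by apply/funext => t; exact: chart_vert.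
have : is_derive (0 : R) (1 : R) (fun t : R => phi y + t) (0 + 1).
  exact: is_deriveD.
by rewrite add0r => -[_ ->].
Qed.

Lemma col'_continuous_comp (k : 'rV[R]_N.-1 -> R) x : {for col' i x, continuous k} ->
  {for x, continuous (fun y => k (col' i y))}.
Proof.
move=> ck; apply: rV_continuousP => e e0.
have /(@cvgrPdist_lt _ _ _ (nbhs (col' i x)))/(_ _ e0)/nbhs_ballP[d /= d0 hd] := ck.
exists d => // y xy; apply: hd; rewrite -ball_normE /ball_ /=.
apply: rV_norm_lt => // j; rewrite !mxE.
by rewrite (le_lt_trans _ xy)//; have := coord_le_norm (x - y) (lift i j); rewrite !mxE.
Qed.

Lemma chart_continuous : continuous phi.
Proof.
move=> x; have c1 : {for x, continuous (fun y => h (col' i y))}.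
  by apply: col'_continuous_comp; have [c _] := h1; exact: c.
have c2 : {for x, continuous (fun y : 'rV[R]_N => (-1) ^+ s * y 0 i)}.
  by apply: continuousM; [exact: cst_continuous|exact: coord_continuous].
exact: (continuousB c1 c2).
Qed.

Lemma chart_dir_continuous v : continuous (chart_dir v).
Proof.
move=> x; have c1 : {for x, continuous (fun y => 'D_(col' i v) h (col' i y))}.
  exact: (@col'_continuous_comp ('D_(col' i v) h) x (Ck1_derive_continuous h1)).
have c2 : {for x, continuous (fun=> (-1) ^+ s * v 0 i : R)} by exact: cst_continuous.
exact: (continuousB c1 c2).
Qed.

Lemma chart_grad x j : grad phi x 0 j = chart_dir (e_ j) x.
Proof. by rewrite mxE; case: (chart_is_derive (e_ j) x). Qed.

Lemma dot_chart_grad w x : dot w (grad phi x) = chart_dir w x.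
Proof. by rewrite chart_dir_sum; apply: eq_bigr => j _; rewrite chart_grad. Qed.

Lemma enorm_chart_grad_gt0 x : 0 < enorm (grad phi x).
Proof.
rewrite /enorm sqrtr_gt0; have d0 : 0 <= dot (grad phi x) (grad phi x).
  by apply: sumr_ge0 => j _; rewrite -expr2 sqr_ge0.
rewrite lt_neqAle d0 andbT eq_sym; apply/eqP => E.
have z j : grad phi x 0 j = 0.
  have H k : true -> 0 <= grad phi x 0 k * grad phi x 0 k by rewrite -expr2 sqr_ge0.
  by have := psumr_eq0P H E (i := j) isT => /eqP; rewrite mulf_eq0 orbb => /eqP.
have := chart_dir_vert1 x; rewrite -dot_chart_grad /dot big1 => [/eqP|j _]; last by rewrite z mulr0.
by rewrite eq_sym oner_eq0.
Qed.

End chart.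

Lemma dotZr (R : realType) (N : nat) (u v : 'rV[R]_N) (c : R) : dot u (c *: v) = c * dot u v.
Proof. by rewrite /dot mulr_sumr; apply: eq_bigr => j _; rewrite mxE mulrCA. Qed.

(** * Tangential fields satisfy the chart condition *)

Section tangential_fields.
Context {R : realType} {N : nat}.
Notation e_ i := (@basis_rV R N i).
Variable Om : set 'rV[R]_N.
Hypotheses (oOm : open Om) (bOm : bounded_set Om).

Lemma within_closure_nbhs (f : 'rV[R]_N -> R) x e : {within closure Om, continuous f} ->
  closure Om x -> 0 < e ->
  exists2 d, 0 < d & forall y, closure Om y -> `|x - y| < d -> `|f x - f y| < e.
Proof.
move=> cf clx e0.
have /(_ (x : subspace (closure Om))) := cf.
rewrite /continuous_at => /(_ (ball (f x) e)).
have : nbhs (f x) (ball (f x) e) by exact: nbhsx_ballx.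
move=> nb /(_ nb); rewrite nbhs_simpl /= => H.
have : within (closure Om) (nbhs x) (f @^-1` ball (f x) e) by have E := nbhs_subspace_in clx; rewrite E.
rewrite /within /= => /nbhs_ballP[d /= d0 hd]; exists d => // y cly xy.
have := hd y; rewrite -ball_normE /ball_ /= => /(_ xy cly).
by rewrite -ball_normE.
Qed.

Lemma closure_cont_on (f : 'rV[R]_N -> R) : {within closure Om, continuous f} -> cont_on Om f.
Proof.
move=> cf x Ox; apply: rV_continuousP => e e0.
have [d d0 hd] := within_closure_nbhs cf (subset_closure Ox) e0.
have /nbhs_ballP[d' /= d'0 hd'] : nbhs x Om by exact: open_nbhs_nbhs.
exists (Num.min d d'); first by rewrite lt_min d0.
move=> y; rewrite lt_min => /andP[h1 h2]; apply: hd => //; apply: subset_closure.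
by apply: hd'; rewrite -ball_normE.
Qed.

Lemma cont_on_eq (f g : 'rV[R]_N -> R) : (forall x, Om x -> f x = g x) ->
  cont_on Om f -> cont_on Om g.
Proof.
move=> fg cf x Ox; apply: rV_continuousP => e e0.
have /(@cvgrPdist_lt _ _ _ (nbhs x))/(_ _ e0)/nbhs_ballP[d /= d0 hd] := cf x Ox.
have /nbhs_ballP[d' /= d'0 hd'] : nbhs x Om by exact: open_nbhs_nbhs.
exists (Num.min d d'); first by rewrite lt_min d0.
move=> y; rewrite lt_min => /andP[h1 h2]; rewrite -fg// -fg//.
  by apply: hd; rewrite -ball_normE.
by apply: hd'; rewrite -ball_normE.
Qed.

Lemma closure_bounded (f : 'rV[R]_N -> R) : {within closure Om, continuous f} ->
  exists2 M, 0 < M & forall x, closure Om x -> `|f x| <= M.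
Proof.
move=> cf; have cK := compact_closure_bounded bOm.
have [M [Mr hM]] := compact_bounded (continuous_compact cf cK).
exists (`|M| + 1); first by rewrite ltr_wpDl.
move=> x clx; apply: (hM (`|M| + 1)); last by exists x.
by rewrite (le_lt_trans (ler_norm M))// ltrDl.
Qed.

Lemma Ck_closure_derive (k : nat) (f : 'rV[R]_N -> R) v : Ck_closure k.+1 Om f ->
  [/\ forall x, Om x -> is_derive x v f ('D_v f x), cont_on Om ('D_v f) &
      exists2 M, 0 < M & forall x, Om x -> `|'D_v f x| <= M].
Proof.
move=> [_ /(_ v)[d [g [gE cg0]]]].
have cg : {within closure Om, continuous g} by move: cg0; clear; case: k => [|k] [].
split.
- by move=> x Ox; split => //; exact: d.
- exact: cont_on_eq gE (closure_cont_on cg).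
- have [M M0 hM] := closure_bounded cg; exists M => // x Ox.
  by rewrite -gE//; apply: hM; exact: subset_closure.
Qed.

(** The end point lies only in the closure: the mean value theorem is applied on a shorter segment
    inside [Om], and continuity up to the closure covers the remainder. *)
Lemma segment_bound (f : 'rV[R]_N -> R) v x (d M : R) : Ck_closure 1 Om f ->
  (forall y, Om y -> `|'D_v f y| <= M) -> 0 < d ->
  (forall t, 0 <= t -> t < d -> Om (t *: v + x)) -> closure Om (d *: v + x) ->
  `|f (d *: v + x) - f x| <= M * d.
Proof.
move=> hf hM d0 seg cld; have [cf _] := hf; have [df _ _] := Ck_closure_derive v hf.
have M0 : 0 <= M.
  have := seg 0 (lexx _) d0; rewrite scale0r add0r => Ox.
  exact: le_trans (normr_ge0 _) (hM x Ox).
apply/ler_addgt0Pl => e e0.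
have [b b0 hb] := within_closure_nbhs cf cld e0.
pose m := `|v| + 1; have m0 : 0 < m by rewrite ltr_wpDl.
pose r := Num.max (d / 2) (d - b / m / 2).
have bm : 0 < b / m / 2 by rewrite !divr_gt0.
have rd : r < d by rewrite gt_max; apply/andP; split; lra.
have r0 : 0 < r by rewrite lt_max divr_gt0.
have drb : d - r <= b / m / 2 by rewrite lerBlDl -lerBlDr le_max lexx orbT.
have cont : {within `[0, r], continuous (fun t : R => f (t *: v + x))}.
  apply: continuous_in_subspaceT => t /set_mem; rewrite /= in_itv /= => /andP[t0 tr].
  have dt := is_derive_line (df _ (seg t t0 (le_lt_trans tr rd))).
  by apply/differentiable_continuous/derivable1_diffP; case: dt.
have dr t : 0 < t < r -> is_derive (t *: v + x) v f ('D_v f (t *: v + x)).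
  by move=> /andP[t0 tr]; apply: df; apply: seg; [exact: ltW|exact: lt_trans tr rd].
have [t /andP[t0 tr] E] := @line_mvt _ _ f ('D_v f) x v r r0 dr cont.
have E1 : `|f (r *: v + x) - f x| <= M * d.
  rewrite E normrM ler_pM//; first by apply: hM; apply: seg; [exact: ltW|exact: lt_trans tr rd].
  by rewrite gtr0_norm// ltW.
have E2 : `|f (d *: v + x) - f (r *: v + x)| < e.
  apply: hb; first by apply: subset_closure; apply: seg => //; exact: ltW.
  rewrite opprD addrACA subrr addr0 -scalerBl normrZ gtr0_norm ?subr_gt0//.
  rewrite (@le_lt_trans _ _ (b / m / 2 * m))//; first by rewrite ler_pM// ?subr_ge0 ?ltW// /m ltrDl.
  by rewrite mulrAC divfK ?gt_eqF//; lra.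
rewrite -(subrK (f (r *: v + x)) (f (d *: v + x))) -addrA (le_trans (ler_normD _ _))//.
by rewrite lerD// ltW.
Qed.

(* If w were not tangent to {phi = 0}, then w perturbed by an outward vector of
   the second chart would point into Om for the first chart and out of Om for the second. *)
Lemma chart_tangent_unique i s h i' s' h' x w : ~ Om x -> closure Om x ->
  is_chart Om x i s h -> is_chart Om x i' s' h' ->
  chart_dir i' s' h' w x = 0 -> chart_dir i s h w x = 0.
Proof.
move=> nO clx [hC2 ch] [hC2' ch'].
have zero j (b : bool) k : Ck 2 setT k -> (\forall y \near x, Om y <-> chart_fun j b k y < 0) ->
    chart_fun j b k x = 0.
  move=> kC2 near; apply/eqP; rewrite eq_le; apply/andP; split; last first.
    rewrite leNgt; apply/negP => h0; apply: nO.
    by have := @nbhs_singleton _ x _ near => -[_]; exact.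
  rewrite leNgt; apply/negP => h0.
  have c := @chart_continuous _ _ j b k kC2 x.
  have np : nbhs x (fun y => 0 < chart_fun j b k y).
    by apply: (c [set t | 0 < t]); apply: open_nbhs_nbhs; split => //; exact: open_gt.
  have [y [Oy [yp1 yp2]]] := clx _ (filterI near np).
  by have := yp1.1 Oy; move/lt_trans => /(_ _ yp2); rewrite ltxx.
have z := zero _ _ _ hC2 ch; have z' := zero _ _ _ hC2' ch'.
move=> w0; apply/eqP; apply: contrapT => /negP wN.
have [u [u0 uN]] : exists u, chart_dir i' s' h' u x = 0 /\ chart_dir i s h u x < 0.
  have [wp|wn|/eqP we] := ltgtP (chart_dir i s h w x) 0; last by rewrite we in wN.
    by exists w.
  exists (-1 *: w); rewrite (chart_dirZ _ _ hC2) (chart_dirZ _ _ hC2') w0 mulr0; split => //.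
  by rewrite mulN1r oppr_lt0.
pose p := chart_dir i s h (vert i' s') x.
(* Small enough that adding k times the second chart's outward vector to [u] uses up at most half of
   the negative slope in the first chart. *)
pose k := - chart_dir i s h u x / (2 * (`|p| + 1)).
have p1 : 0 < `|p| + 1 by rewrite ltr_wpDl.
have k0 : 0 < k by rewrite divr_gt0 ?oppr_gt0// mulr_gt0.
pose uk := u + k *: vert i' s'.
have q1 : chart_dir i s h uk x < 0.
  rewrite (chart_dirD _ _ hC2) (chart_dirZ _ _ hC2) -/p.
  have : k * p <= - chart_dir i s h u x / 2.
    rewrite (@le_trans _ _ (k * (`|p| + 1)))//.
      by rewrite ler_wpM2l ?(ltW k0)// (le_trans (ler_norm p))// lerDl.
    by rewrite /k invfM mulrA divfK// gt_eqF.
  lra.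
have q2 : chart_dir i' s' h' uk x = k.
  by rewrite (chart_dirD _ _ hC2') (chart_dirZ _ _ hC2') (chart_dir_vert1 _ _ hC2') u0 add0r mulr1.
have d1 : is_derive x uk (fun y => - chart_fun i s h y) (- chart_dir i s h uk x).
  by apply: is_deriveN; exact: chart_is_derive.
have [b1 b10 hb1] := derive_sign d1 ltac:(by rewrite oppr_gt0).
have d2 := chart_is_derive i' s' hC2' uk x; rewrite q2 in d2.
have [b2 b20 hb2] := derive_sign d2 k0.
have nn : nbhs x (fun y => (Om y <-> chart_fun i s h y < 0) /\ (Om y <-> chart_fun i' s' h' y < 0)).
  exact: (@filterI _ (nbhs x) _ _ _ ch ch').
have /nbhs_ballP[b3 /= b30 hb3] := nn.
pose m := `|uk| + 1; have m0 : 0 < m by rewrite ltr_wpDl.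
pose t := Num.min (Num.min b1 b2) (b3 / m) / 2.
have mn : 0 < Num.min (Num.min b1 b2) (b3 / m) by rewrite !lt_min b10 b20 divr_gt0.
have t0 : 0 < t by rewrite divr_gt0.
have : t < Num.min (Num.min b1 b2) (b3 / m) by rewrite /t; lra.
rewrite !lt_min => /andP[/andP[tb1 tb2] tb3].
have [c1 c2] : (Om (t *: uk + x) <-> chart_fun i s h (t *: uk + x) < 0) /\
    (Om (t *: uk + x) <-> chart_fun i' s' h' (t *: uk + x) < 0).
  apply: hb3; rewrite -ball_normE /ball_ /= opprD addrCA subrr addr0 normrN normrZ gtr0_norm//.
  rewrite (@le_lt_trans _ _ (t * m))//; last by rewrite -ltr_pdivlMr.
  by rewrite ler_wpM2l ?(ltW t0)// /m lerDl.
have := hb1 t t0 tb1; have := hb2 t t0 tb2; rewrite z z' oppr0 oppr_gt0 => A B.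
have := c2.1 (c1.2 B); by move/lt_trans => /(_ _ A); rewrite ltxx.
Qed.

(** The chosen [outer_normal] may come from another chart; tangency is carried over by
    [chart_tangent_unique]. *)
Lemma tangent_outer_normal i s h x w : C2_domain Om -> bdry Om x -> is_chart Om x i s h ->
  dot w (outer_normal Om x) = 0 -> chart_dir i s h w x = 0.
Proof.
move=> [_ _ C2] bx ch w0.
have [clx nO] : closure Om x /\ ~ Om x.
  by case: bx => clx nO; split=> // Ox; apply: nO; exact: open_nbhs_nbhs.
have [i' [s' [h' [ch' nE]]]] : is_outer_normal Om x (outer_normal Om x).
  have [i1 [s1 [h1 c1]]] := C2 x bx.
  by apply: (@xgetPex _ 0 [set n | is_outer_normal Om x n]); eexists; exists i1, s1, h1; split.
apply: (chart_tangent_unique nO clx ch ch').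
have [hC2' _] := ch'.
rewrite -(dot_chart_grad _ _ hC2').
have g0 := enorm_chart_grad_gt0 i' s' hC2' x.
move: w0; rewrite nE => w0.
have : (enorm (grad (chart_fun i' s' h') x))^-1 * dot w (grad (chart_fun i' s' h') x) = 0.
  by rewrite -dotZr.
by move=> /eqP; rewrite mulf_eq0 invr_eq0 gt_eqF//= => /eqP.
Qed.

Variable Psi : 'rV[R]_N -> 'rV[R]_N.
Hypothesis Psi_C1 : forall i, Ck_closure 1 Om (fun x => Psi x 0 i).

Lemma field_bound v : exists2 M, 0 < M & forall j x, Om x -> `|'D_v (fun x => Psi x 0 j) x| <= M.
Proof.
have /choice[M hM] : forall j, exists M, 0 < M /\ forall x, Om x -> `|'D_v (fun x => Psi x 0 j) x| <= M.
  by move=> j; have [_ _ [M M0 hM]] := Ck_closure_derive v (Psi_C1 j); exists M.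
exists (1 + \sum_j M j); first by rewrite ltr_pwDl// sumr_ge0// => j _; exact: ltW (hM j).1.
move=> j x Ox; rewrite (le_trans ((hM j).2 x Ox))// (bigD1 j)//= addrCA lerDl addr_ge0//.
by rewrite sumr_ge0// => k _; exact: ltW (hM k).1.
Qed.

(** Move y vertically by -phi(y) to a boundary point y'. There grad phi . Psi vanishes, and grad phi
    takes the same value at y and y', so only the increment of Psi over a segment of length at most
    |phi(y)| remains. *)
Lemma boundary_local_chart x0 : C2_domain Om ->
  (forall x, bdry Om x -> dot (Psi x) (outer_normal Om x) = 0) -> bdry Om x0 ->
  exists r, 0 < r /\ local_chart Om (fun j x => Psi x 0 j) x0 r.
Proof.
move=> C2 tang bx0; have [_ _ /(_ _ bx0)[i [s [h [hC2 near]]]]] := C2.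
have OE : Om° = Om by apply/seteqP; split => [|x Ox]; [exact: interior_subset|exact: open_nbhs_nbhs].
have [clx0 nO0] : closure Om x0 /\ ~ Om x0 by case: bx0; rewrite OE.
pose phi := chart_fun i s h.
have cphi := @chart_continuous _ _ i s h hC2.
have /nbhs_ballP[R0 /= R00 hR0] := near.
have hR x : `|x - x0| < R0 -> (Om x <-> phi x < 0).
  by move=> hx; apply: hR0; rewrite -ball_normE /ball_ /= distrC.
have ball_near x : `|x - x0| < R0 -> nbhs x (fun y => Om y <-> phi y < 0).
  move=> hx; apply/nbhs_ballP; exists (R0 - `|x - x0|); first by rewrite /= subr_gt0.
  move=> y; rewrite -ball_normE /ball_ /= ltrBrDr => hy; apply: hR.
  by rewrite (le_lt_trans _ hy)// (distrC x y) (_ : y - x0 = (y - x) + (x - x0)) ?ler_normD// addrA subrK.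
have z0 : phi x0 <= 0 /\ 0 <= phi x0.
  split; last by rewrite leNgt; apply/negP => h0; apply: nO0; apply/(hR x0) => //; rewrite subrr normr0.
  rewrite leNgt; apply/negP => h0.
  have np : nbhs x0 (fun y => 0 < phi y).
    by apply: (cphi x0 [set t | 0 < t]); apply: open_nbhs_nbhs; split => //; exact: open_gt.
  have [y [Oy [yp1 yp2]]] := clx0 _ (filterI near np).
  by have := yp1.1 Oy; move/lt_trans => /(_ _ yp2); rewrite ltxx.
have {}z0 : phi x0 = 0 by apply/eqP; rewrite eq_le z0.1 z0.2.
have R4 : 0 < R0 / 4 by rewrite divr_gt0.
have /(@cvgrPdist_lt _ _ _ (nbhs x0))/(_ _ R4)/nbhs_ballP[r1 /= r10 hr1] := cphi x0.
(* With |y - x0| <= R0/4 and |phi(y)| < R0/4 the vertical segment from y to the boundary stays in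
   the ball of radius [R0] where the chart is valid. *)
pose r := Num.min (r1 / 2) (R0 / 4).
have r0 : 0 < r by rewrite lt_min R4 divr_gt0.
have rr1 : r < r1 by rewrite gt_min; apply/orP; left; lra.
have rR : r <= R0 / 4 by rewrite ge_min lexx orbT.
have small x : `|x - x0| <= r -> `|phi x| < R0 / 4.
  move=> hx; have := hr1 x; rewrite -/phi z0 sub0r normrN; apply.
  by rewrite -ball_normE /ball_ /= distrC (le_lt_trans hx).
pose v := vert i s : 'rV[R]_N.
have v1 : `|v| <= 1.
  by rewrite /v /vert normrZ normrN normrX normrN1 expr1n mul1r norm_basis.
have [M M0 hM] := field_bound v.
have /choice[B hB] : forall j, exists B, 0 < B /\ forall x, cball x0 r x -> `|chart_dir i s h (e_ j) x| <= B.
  move=> j; have cd := @chart_dir_continuous _ _ i s h hC2 (e_ j).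
  have [B B0 hB] := @jcont_bounded R N setT (cball x0 r) (fun x _ => chart_dir i s h (e_ j) x) 0
    (@compact_cball _ _ x0 r) (@subsetT _ _) (jcont_fst (fun x _ => cd x)).
  by exists B; split => // x hx; apply: (hB x 0) => //; rewrite oppr0 lexx.
exists r; split => //; exists phi, (fun j => chart_dir i s h (e_ j)), (\sum_j B j * M).
split; first by split; [exact: cphi|move=> j; exact: chart_dir_continuous|move=> j x; exact: chart_is_derive].
split.
- by apply: sumr_ge0 => j _; rewrite mulr_ge0// ltW// (hB j).1.
- by move=> y hy; apply: hR; lra.
move=> y Oy hy.
have yR : `|y - x0| < R0 by lra.
have p0 : phi y < 0 by apply/(hR y yR).
pose d := - phi y; have d0 : 0 < d by rewrite oppr_gt0.
have dR : d < R0 / 4 by have := small y hy; rewrite ltr0_norm.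
have shift t : 0 <= t -> t <= d -> `|t *: v + y - x0| < R0.
  move=> t0 td; rewrite -addrA (le_lt_trans (ler_normD _ _))// normrZ ger0_norm//.
  have := ler_wpM2l t0 v1; rewrite mulr1; lra.
have seg t : 0 <= t -> t < d -> Om (t *: v + y).
  move=> t0 td; apply/(hR _ (shift t t0 (ltW td))); have E : phi (t *: v + y) = phi y + t by exact: chart_vert.
  by rewrite E addrC -[phi y]opprK subr_lt0.
pose y' := d *: v + y.
have clf : closure Om y'.
  move=> U /nbhs_ballP[e /= e0 hU].
  pose t := Num.max (d / 2) (d - e / 2).
  have td : t < d by rewrite gt_max; apply/andP; split; lra.
  have t0 : 0 <= t by rewrite le_max; apply/orP; left; lra.
  exists (t *: v + y); split; first exact: seg.
  apply: hU; rewrite -ball_normE /ball_ /= /y' opprD addrACA subrr addr0 -scalerBl normrZ.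
  rewrite gtr0_norm ?subr_gt0// (@le_lt_trans _ _ (d - t))//.
    by rewrite ler_piMr// subr_ge0 ltW.
  have : d - e / 2 <= t by rewrite le_max lexx orbT.
  lra.
have y'R : `|y' - x0| < R0 by apply: shift => //; exact: ltW.
have phiy' : phi y' = 0.
  have E : phi (d *: v + y) = phi y + d by exact: chart_vert.
  by rewrite /y' E /d subrr.
have nOy' : ~ Om y' by move=> /(hR _ y'R); rewrite phiy' ltxx.
have by' : bdry Om y' by split => //; rewrite OE.
have T : chart_dir i s h (Psi y') y' = 0.
  apply: (tangent_outer_normal C2 by'); last exact: tang.
  by split => //; exact: ball_near.
rewrite (chart_dir_sum _ _ hC2) in T.
have -> : \sum_j chart_dir i s h (e_ j) y * Psi y 0 j =
    \sum_j chart_dir i s h (e_ j) y * (Psi y 0 j - Psi y' 0 j).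
  transitivity (\sum_j chart_dir i s h (e_ j) y * Psi y 0 j - \sum_j Psi y' 0 j * chart_dir i s h (e_ j) y').
    by rewrite T subr0.
  rewrite -sumrB; apply: eq_bigr => j _.
  by rewrite /y' chart_dir_vert; ring.
rewrite (le_trans (ler_norm_sum _ _ _))// mulr_suml; apply: ler_sum => j _.
rewrite normrM -mulrA; apply: ler_pM => //; first exact: (hB j).2.
have S := segment_bound (Psi_C1 j) (hM j) d0 seg clf.
by rewrite distrC (ltr0_norm p0); exact: S.
Qed.

Lemma C2_local_chart x0 : C2_domain Om ->
  (forall x, bdry Om x -> dot (Psi x) (outer_normal Om x) = 0) ->
  exists r, 0 < r /\ local_chart Om (fun j x => Psi x 0 j) x0 r.
Proof.
move=> C2 tang.
have cst_chart (c : R) : c != 0 -> nbhs x0 (fun y => Om y <-> c < 0) ->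
    exists r, 0 < r /\ local_chart Om (fun j x => Psi x 0 j) x0 r.
  move=> c0 /nbhs_ballP[d /= d0 hd]; exists (d / 2); split; first by rewrite divr_gt0.
  exists (fun=> c), (fun _ _ => 0), 0; split.
    split; [by move=> x; exact: cst_continuous|by move=> j x; exact: cst_continuous|].
    by move=> j x; exact: is_derive_cst.
  split; [by []| |].
    by move=> y hy; apply: hd; rewrite -ball_normE /ball_ /= distrC; lra.
  by move=> y _ _; rewrite big1 ?normr0 ?mul0r// => j _; rewrite mul0r.
have [clx|nclx] := pselect (closure Om x0); last first.
  apply: (cst_chart 1); first exact: oner_neq0.
  have : nbhs x0 (~` closure Om).
    by apply: open_nbhs_nbhs; split => //; apply: closed_openC; exact: closed_closure.
  apply: (@filterS _ (nbhs x0)) => y ny; rewrite ltNge ler01; split => // Oy.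
  by exfalso; apply: ny; exact: subset_closure.
have [Ox|nOx] := pselect (Om x0).
  apply: (cst_chart (-1)); first by rewrite oppr_eq0 oner_neq0.
  have : nbhs x0 Om by exact: open_nbhs_nbhs.
  by apply: (@filterS _ (nbhs x0)) => y Oy; split => // _; rewrite oppr_lt0.
apply: boundary_local_chart => //; split => // /interior_subset.
exact: nOx.
Qed.

Notation mu := (@lebesgueN R N).

Lemma tangential_ibp f (g : 'I_N -> 'rV[R]_N -> R) : C2_domain Om ->
  (forall x, bdry Om x -> dot (Psi x) (outer_normal Om x) = 0) ->
  (forall j, is_weak_partial Om j f (g j)) -> itg mu Om f ->
  itg mu Om (fun x => \sum_j g j x * Psi x 0 j) ->
  \int[mu]_(x in Om) (f x * (\sum_j 'D_(e_ j) (fun y => Psi y 0 j) x) + \sum_j g j x * Psi x 0 j) = 0.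
Proof.
move=> C2 tang wf fi Gi.
have PC1 j : C1_on Om j (fun x => Psi x 0 j) ('D_(e_ j) (fun y => Psi y 0 j)).
  have [d c _] := Ck_closure_derive (e_ j) (Psi_C1 j).
  by split => //; have [cf _] := Psi_C1 j; exact: closure_cont_on.
have /choice[M hM] : forall j, exists M, 0 < M /\ forall x, Om x -> `|Psi x 0 j| <= M /\
    `|'D_(e_ j) (fun y => Psi y 0 j) x| <= M.
  move=> j; have [_ _ [M1 M10 hM1]] := Ck_closure_derive (e_ j) (Psi_C1 j).
  have [cf _] := Psi_C1 j; have [M2 M20 hM2] := closure_bounded cf.
  exists (M1 + M2); split; first by rewrite addr_gt0.
  move=> x Ox; split.
    by rewrite (le_trans (hM2 x (subset_closure Ox)))// lerDr ltW.
  by rewrite (le_trans (hM1 x Ox))// lerDl ltW.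
have leM j : M j <= \sum_k M k.
  by rewrite (bigD1 j)//= lerDl; apply: sumr_ge0 => k _; exact: ltW (hM k).1.
apply: (chart_ibp oOm bOm wf fi PC1 (M := \sum_k M k)) => //.
- by move=> j x Ox; exact: le_trans ((hM j).2 x Ox).1 (leM j).
- by move=> j x Ox; exact: le_trans ((hM j).2 x Ox).2 (leM j).
- by move=> x0; exact: C2_local_chart.
Qed.

End tangential_fields.

(** * Vector measures and their polar decomposition *)

Section euclidean_norm.
Context {R : realType} {N : nat}.
Implicit Types u v : 'rV[R]_N.

Lemma dot_ge0 u : 0 <= dot u u.
Proof. by apply: sumr_ge0 => i _; rewrite -expr2 sqr_ge0. Qed.

Lemma enorm_ge0 u : 0 <= enorm u.
Proof. exact: sqrtr_ge0. Qed.

Lemma enorm_sq u : enorm u ^+ 2 = dot u u.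
Proof. by rewrite sqr_sqrtr// dot_ge0. Qed.

Lemma dotC u v : dot u v = dot v u.
Proof. by apply: eq_bigr => i _; rewrite mulrC. Qed.

Lemma dotDr u v w : dot u (v + w) = dot u v + dot u w.
Proof. by rewrite /dot -big_split/=; apply: eq_bigr => i _; rewrite mxE mulrDr. Qed.

Lemma dot_eq0 u : dot u u = 0 -> u = 0.
Proof.
move=> E; apply/rowP => j; rewrite mxE.
have H k : true -> 0 <= u 0 k * u 0 k by rewrite -expr2 sqr_ge0.
by have := psumr_eq0P H E (i := j) isT => /eqP; rewrite mulf_eq0 orbb => /eqP.
Qed.

Lemma dot_le u v : dot u v <= enorm u * enorm v.
Proof.
have [u0|u0] := eqVneq (enorm u) 0.
  have /dot_eq0 -> : dot u u = 0 by rewrite -enorm_sq u0 expr0n.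
  by rewrite /dot big1 ?mulr_ge0 ?enorm_ge0// => i _; rewrite mxE mul0r.
have [v0|v0] := eqVneq (enorm v) 0.
  have /dot_eq0 -> : dot v v = 0 by rewrite -enorm_sq v0 expr0n.
  by rewrite /dot big1 ?mulr_ge0 ?enorm_ge0// => i _; rewrite mxE mulr0.
have p : 0 < enorm u * enorm v by rewrite mulr_gt0// lt_neqAle eq_sym ?u0 ?v0 enorm_ge0.
have := dot_ge0 (enorm v *: u - enorm u *: v).
have E : dot (enorm v *: u - enorm u *: v) (enorm v *: u - enorm u *: v) =
    enorm v ^+ 2 * dot u u + enorm u ^+ 2 * dot v v - 2 * (enorm u * enorm v) * dot u v.
  rewrite /dot !mulr_sumr -big_split/= -sumrB; apply: eq_bigr => i _; rewrite !mxE; ring.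
rewrite E -!enorm_sq.
have -> : enorm v ^+ 2 * enorm u ^+ 2 + enorm u ^+ 2 * enorm v ^+ 2 - 2 * (enorm u * enorm v) * dot u v =
   2 * (enorm u * enorm v) * (enorm u * enorm v - dot u v) by ring.
by rewrite pmulr_rge0 ?subr_ge0// mulr_gt0.
Qed.

Lemma enormD u v : enorm (u + v) <= enorm u + enorm v.
Proof.
rewrite -(@ler_pXn2r _ 2)// ?nnegrE ?addr_ge0 ?enorm_ge0//.
rewrite sqrrD !enorm_sq dotDr dotC dotDr (dotC (u + v)) dotDr (dotC v u).
have := dot_le u v; lra.
Qed.

Lemma enormZ (c : R) u : 0 <= c -> enorm (c *: u) = c * enorm u.
Proof.
move=> c0; rewrite /enorm (_ : dot (c *: u) (c *: u) = c ^+ 2 * dot u u); last first.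
  by rewrite /dot mulr_sumr; apply: eq_bigr => i _; rewrite !mxE; ring.
by rewrite sqrtrM ?sqr_ge0// sqrtr_sqr ger0_norm.
Qed.

Lemma enorm_le_sum u : enorm u <= \sum_i `|u 0 i|.
Proof.
have s0 : 0 <= \sum_i `|u 0 i| by apply: sumr_ge0.
rewrite -(@ler_pXn2r _ 2)// ?nnegrE ?enorm_ge0// enorm_sq expr2 mulr_suml; apply: ler_sum => i _.
rewrite (le_trans (ler_norm _))// normrM ler_wpM2l// (bigD1 i)//= lerDl.
by apply: sumr_ge0.
Qed.

Lemma coord_le_enorm u i : `|u 0 i| <= enorm u.
Proof.
rewrite -(@ler_pXn2r _ 2)// ?nnegrE ?enorm_ge0// enorm_sq real_normK ?num_real//.
rewrite /dot (bigD1 i)//= -expr2 lerDl; apply: sumr_ge0 => k _; by rewrite -expr2 sqr_ge0.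
Qed.

Lemma measurable_enorm d (T : measurableType d) (D : set T) (f : 'I_N -> T -> R) :
  (forall j, measurable_fun D (f j)) -> measurable_fun D (fun x => enorm (\row_j f j x)).
Proof.
move=> mf; rewrite (_ : (fun x => _) = (@Num.sqrt R) \o (fun x => \sum_j f j x * f j x)).
  apply: (measurable_comp measurableT) => //; first by apply: continuous_measurable_fun; exact: sqrt_continuous.
  by apply: measurable_sum => j; exact: measurable_funM.
by apply/funext => x; rewrite /= /enorm; congr Num.sqrt; apply: eq_bigr => j _; rewrite !mxE.
Qed.

End euclidean_norm.

(** * Charges with a density *)

Section charge_densities.
Context d {T : measurableType d} {R : realType}.
Implicit Types (nu : {charge set T -> \bar R}) (lam : {sigma_finite_measure set T -> \bar R}).

Definition has_density nu (lam : {measure set T -> \bar R}) f := itg lam setT f /\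
  forall A, measurable A -> nu A = (\int[lam]_(x in A) (f x)%:E)%E.

Lemma has_density_fine nu (lam : {measure set T -> \bar R}) f A : has_density nu lam f ->
  measurable A -> fine (nu A) = \int[lam]_(x in A) f x.
Proof. by move=> [_ h] mA; rewrite h. Qed.

Lemma density_dominates nu (lam : {measure set T -> \bar R}) f : has_density nu lam f -> nu `<< lam.
Proof.
move=> [hf h]; apply/null_content_dominatesP => A mA A0.
rewrite h//; apply: null_set_integral => //.
by apply/measurable_EFinP; apply: measurable_funTS; exact: itg_measurable hf.
Qed.

Lemma RN_density nu lam : nu `<< lam -> has_density nu lam (fun x => fine (Radon_Nikodym nu lam x)).
Proof.
move=> h; have E x : (fine (Radon_Nikodym nu lam x))%:E = Radon_Nikodym nu lam x.
  by rewrite fineK// Radon_Nikodym_fin_num.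
split.
  rewrite /itg (_ : EFin \o _ = Radon_Nikodym nu lam); first exact: Radon_Nikodym_integrable.
  by apply/funext => x /=; exact: E.
move=> A mA; rewrite (Radon_Nikodym_integral h mA).
by apply: eq_integral => x _; rewrite E.
Qed.

Lemma finite_measure_copy (m : {measure set T -> \bar R}) : (m setT < +oo)%E ->
  exists mu : {finite_measure set T -> \bar R}, forall A, mu A = m A.
Proof.
move=> h; exists (mfrestr measurableT h : {finite_measure set T -> \bar R}) => A.
by rewrite /= /mfrestr /mrestr setIT.
Qed.

(** The dominating measure is the sum of the variations of the charges. *)
Lemma common_dominating n (nu : 'I_n -> {charge set T -> \bar R}) :
  exists lam : {finite_measure set T -> \bar R}, forall j, nu j `<< lam.
Proof.
elim: n nu => [|n IH] nu; first by exists mzero => -[].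
have [lam hlam] := IH (fun j => nu (lift ord0 j)).
have [P [Q h]] := Hahn_decomposition (nu ord0).
pose m : {measure set T -> \bar R} := measure_add lam (charge_variation h).
have mD A : m A = (lam A + charge_variation h A)%E by exact: measure_addE.
have [mu hmu] : exists mu : {finite_measure set T -> \bar R}, forall A, mu A = m A.
  apply: finite_measure_copy; rewrite mD lte_add_pinfty//.
    by rewrite ltey_eq fin_num_measure.
  by rewrite ltey_eq fin_num_measure.
have mE A : mu A = 0%E -> lam A = 0%E /\ charge_variation h A = 0%E.
  rewrite hmu mD => /eqP; rewrite padde_eq0// => /andP[/eqP ? /eqP ?].
  by split.
exists mu => j; have [j' ->|->] := unliftP ord0 j.
  apply/null_content_dominatesP => A mA /mE[l0 _].
  by have /null_content_dominatesP := hlam j'; exact.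
apply/null_content_dominatesP => A mA /mE[_ c0].
apply/eqP; rewrite -abse_eq0 eq_le abse_ge0 andbT -c0; exact: abse_charge_variation.
Qed.

(** Both Jordan parts are dominated by [lam], and the difference of their densities is [f] almost
    everywhere, whatever Hahn decomposition was selected. *)
Lemma charge_integralE nu lam f (phi : T -> R) : has_density nu lam f -> measurable_fun setT phi ->
  (exists M, forall x, `|phi x| <= M) ->
  charge_integral nu phi = \int[lam]_x (phi x * f x).
Proof.
move=> hd mphi [M hM]; have nl := density_dominates hd; have [fi hf] := hd.
rewrite /charge_integral; case: cid => P hP; case: cid => Q h.
have pl := jordan_pos_dominates h nl; have ql := jordan_neg_dominates h nl.
have key (m : {finite_measure set T -> \bar R}) : m `<< lam -> exists g,
    has_density (charge_of_finite_measure m) lam g /\ \int[m]_x phi x = \int[lam]_x (phi x * g x).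
  move=> ml; have hg := RN_density (ml : charge_of_finite_measure m `<< lam).
  exists (fun x => fine (Radon_Nikodym (charge_of_finite_measure m) lam x)); split => //.
  have ip : itg m setT phi.
    apply: (itg_bounded measurableT (C := M)) => //; first by rewrite ltey_eq fin_num_measure.
  congr fine; rewrite -(Radon_Nikodym_change_of_variables ml measurableT ip).
  apply: eq_integral => x _ /=; rewrite EFinM fineK//.
  exact: Radon_Nikodym_fin_num.
have [g1 [[i1 h1] E1]] := key (jordan_pos h) pl; have [g2 [[i2 h2] E2]] := key (jordan_neg h) ql.
rewrite E1 E2.
have bi g : itg lam setT g -> itg lam setT (fun x => phi x * g x).
  move=> gi; apply: (itg_eq measurableT (f := fun x => g x * phi x)); first by move=> x _; rewrite mulrC.
  exact: (itgM_bounded measurableT (C := M)).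
have j1 := bi _ i1; have j2 := bi _ i2; have j := bi _ fi.
rewrite -RintegralB//; apply: Rintegral_ae_eq => //.
- exact: itg_measurable (itgB measurableT j1 j2).
- exact: itg_measurable j.
have : ae_eq lam setT (EFin \o (fun x => g1 x - g2 x)) (EFin \o f).
  apply: integral_ae_eq => //; first exact: (itgB measurableT i1 i2).
    by apply/measurable_EFinP; exact: itg_measurable fi.
  move=> A _ mA; rewrite -hf// (jordan_decomp h mA) /cadd/= cscaleN1.
  have a1 : itg lam A g1 by apply: integrableS i1.
  have a2 : itg lam A g2 by apply: integrableS i2.
  under eq_integral do rewrite EFinB.
  rewrite integralB//=.
  by rewrite -(h1 A mA) -(h2 A mA).
by apply: filterS => x /(_ I)[E] _; rewrite -E mulrBr.
Qed.

End charge_densities.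

(** * The total variation of a vector measure and its polar decomposition *)

Section total_variation.
Context d {T : measurableType d} {R : realType} {N : nat}.
Implicit Types (lam : {finite_measure set T -> \bar R}).
Variable D : 'I_N -> {charge set T -> \bar R}.

Section density.
Variables (lam : {finite_measure set T -> \bar R}) (f : 'I_N -> T -> R).
Hypothesis hf : forall j, has_density (D j) lam (f j).
Let e x := enorm (\row_j f j x).

Let fj_itg j A : measurable A -> itg lam A (f j).
Proof. by move=> mA; apply: integrableS (hf j).1. Qed.

Lemma enorm_density_itg : itg lam setT e.
Proof.
apply: (itg_le measurableT (g := fun x => \sum_j `|f j x|)).
- by apply: measurable_enorm => j; exact: itg_measurable (hf j).1.
- move=> x _; rewrite ger0_norm ?enorm_ge0// (le_trans (enorm_le_sum _))//.
  by apply: ler_sum => j _; rewrite mxE.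
- by apply: itg_sum => // j; apply: itg_norm; exact: (hf j).1.
Qed.

Let e_itg A : measurable A -> itg lam A e.
Proof. by move=> mA; apply: integrableS enorm_density_itg. Qed.

Let lam_fin A : measurable A -> (lam A < +oo)%E.
Proof. by move=> mA; rewrite ltey_eq fin_num_measure. Qed.

Let vec A : 'rV[R]_N := \row_j fine (D j A).

(** Pair the vector D(A) with itself and apply Cauchy-Schwarz under the integral. *)
Lemma enorm_charge_le A : measurable A -> enorm (vec A) <= \int[lam]_(x in A) e x.
Proof.
move=> mA; have [E|E] := eqVneq (enorm (vec A)) 0.
  by rewrite E; apply: Rintegral_ge0 => x _; exact: enorm_ge0.
have p : 0 < enorm (vec A) by rewrite lt_neqAle eq_sym E enorm_ge0.
rewrite -(ler_pM2l p) -expr2 enorm_sq.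
have -> : dot (vec A) (vec A) = \int[lam]_(x in A) (\sum_j vec A 0 j * f j x).
  rewrite Rintegral_sum//; last by move=> j; apply: itgZ => //; exact: fj_itg.
  apply: eq_bigr => j _; rewrite RintegralZl//; last exact: fj_itg.
  by congr (_ * _); rewrite mxE (has_density_fine (hf j) mA).
rewrite -RintegralZl//; last exact: e_itg.
have i1 : itg lam A (fun x => \sum_j vec A 0 j * f j x).
  by apply: itg_sum => // j; apply: itgZ => //; exact: fj_itg.
apply: (le_Rintegral mA i1); first by apply: itgZ => //; exact: e_itg.
move=> x _; rewrite (le_trans _ (dot_le (vec A) (\row_j f j x)))//.
by rewrite /dot le_eqVlt; apply/orP; left; apply/eqP; apply: eq_bigr => j _; rewrite [in RHS]mxE [in RHS]mxE mxE.
Qed.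

(** Where the density is within [k] of a constant vector, replacing it by that vector costs N k
    lam(A), once under the integral and once in D(A). *)
Lemma enorm_charge_ge A (c : 'I_N -> R) (k : R) : measurable A -> 0 <= k ->
  (forall x j, A x -> `|f j x - c j| <= k) ->
  \int[lam]_(x in A) e x <= enorm (vec A) + 2 * N%:R * k * fine (lam A).
Proof.
move=> mA k0 hc; set m := fine (lam A).
have m0 : 0 <= m by exact: fine_ge0.
have sumk (g : 'I_N -> R) b : (forall j, `|g j| <= b) -> \sum_j `|g j| <= N%:R * b.
  move=> h; rewrite (le_trans (ler_sum _ (F := _) (G := fun=> b) _))//.
  by rewrite sumr_const card_ord mulr_natl.
have h1 : \int[lam]_(x in A) e x <= (enorm (\row_j c j) + N%:R * k) * m.
  have -> : (enorm (\row_j c j) + N%:R * k) * m = \int[lam]_(x in A) (enorm (\row_j c j) + N%:R * k).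
    by rewrite Rintegral_cst.
  apply: (le_Rintegral mA (e_itg mA)); first by apply: itg_cst => //; exact: lam_fin.
  move=> x Ax; rewrite /e (_ : \row_j f j x = \row_j c j + \row_j (f j x - c j)); last first.
    by apply/rowP => j; rewrite !mxE addrC subrK.
  rewrite (le_trans (enormD _ _))// lerD2l (le_trans (enorm_le_sum _))//.
  by apply: sumk => j; rewrite mxE; exact: hc.
have h2 : enorm (\row_j c j) * m <= enorm (vec A) + N%:R * (k * m).
  rewrite mulrC -enormZ// (_ : m *: _ = vec A + (m *: \row_j c j - vec A)); last by rewrite addrC subrK.
  rewrite (le_trans (enormD _ _))// lerD2l (le_trans (enorm_le_sum _))//.
  apply: sumk => j; rewrite !mxE (has_density_fine (hf j) mA).
  have -> : m * c j = \int[lam]_(x in A) c j by rewrite Rintegral_cst// mulrC.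
  have -> : k * m = \int[lam]_(x in A) k by rewrite Rintegral_cst.
  rewrite -RintegralB//; [|by apply: itg_cst => //; exact: lam_fin|exact: fj_itg].
  apply: (abs_Rintegral_le mA); last by apply: itg_cst => //; exact: lam_fin.
  - by apply: measurable_funB => //; exact: itg_measurable (fj_itg _ mA).
  - by move=> x Ax; rewrite distrC; exact: hc.
apply: (le_trans h1); rewrite mulrDl.
have -> : 2 * N%:R * k * m = N%:R * (k * m) + N%:R * k * m by ring.
by rewrite addrA lerD2r.
Qed.

(** The upper bound holds piece by piece for every partition. For the lower bound, [B] is
    partitioned into countably many cells on which the density is close to a rational vector. *)
Lemma vector_variation_density B : measurable B ->
  vector_variation D B = (\int[lam]_(x in B) (e x)%:E)%E.
Proof.
move=> mB; apply/eqP; rewrite eq_le; apply/andP; split.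
  apply: ge_ereal_sup => _ [F [mF tF FB] <-].
  have sub k : (\int[lam]_(x in F k) (e x)%:E)%E = (\int[lam]_(x in F k) e x)%:E.
    by rewrite Rintegral_EFin//; exact: e_itg.
  rewrite -FB ge0_integral_bigcup//; last 2 first.
  - by apply/measurable_EFinP; apply: measurable_funTS; exact: itg_measurable enorm_density_itg.
  - by move=> x _; rewrite lee_fin enorm_ge0.
  apply: lee_nneseries => [k _ _|k _]; first by rewrite lee_fin enorm_ge0.
  by rewrite sub lee_fin; exact: enorm_charge_le.
have me : measurable_fun setT e by exact: itg_measurable enorm_density_itg.
apply/lee_addgt0Pr => r r0.
set m := fine (lam B).
have m0 : 0 <= m by exact: fine_ge0.
(* The errors of all cells then add up to at most [r]; the 1 covers the case of a null set [B]. *)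
pose k := r / (2 * N%:R * m + 1).
have den : 0 < 2 * N%:R * m + 1 by rewrite ltr_wpDl// !mulr_ge0.
have k0 : 0 < k by rewrite divr_gt0.
pose cell (q : 'rV[rat]_N) := [set x | forall j, `|f j x - ratr (q 0 j)| <= k].
have mcell q : measurable (cell q).
  rewrite (_ : cell q = \bigcap_(j in [set: 'I_N]) [set x | `|f j x - ratr (q 0 j)| <= k]); last first.
    by apply/seteqP; split => [x h j _|x h j]; [exact: h|exact: h].
  apply: fin_bigcap_measurable => // j _.
  have h : measurable_fun setT (fun x => `|f j x - ratr (q 0 j)|).
    by apply: measurableT_comp => //; apply: measurable_funB => //; exact: itg_measurable (hf j).1.
  by have := measurable_fun_le measurableT h (measurable_cst k); rewrite setTI.
pose A n := B `&` (if unpickle n is Some q then cell q else set0).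
have mA n : measurable (A n) by apply: measurableI => //; case: unpickle.
pose F := seqDU A.
have FA n : F n `<=` A n by move=> x [].
have mF n : measurable (F n).
  by apply: measurableD => //; apply: bigsetU_measurable.
have tF : trivIset setT F by exact: trivIset_seqDU.
have UF : \bigcup_n F n = B.
  rewrite -seqDU_bigcup_eq; apply/seteqP; split => [x [n _ []]//|x Bx].
  have /choice[q hq] : forall j, exists q : rat, `|f j x - ratr q| <= k.
    move=> j; have [q] := @rat_in_itvoo R (f j x - k) (f j x + k) ltac:(by rewrite ltrBlDr -addrA ltrDl addr_gt0).
    by rewrite in_itv/= => /andP[h1 h2]; exists q; rewrite distrC ltW// ltr_distl h1 h2.
  exists (pickle (\row_j q j)) => //; split => //; rewrite pickleK => j; rewrite mxE; exact: hq.
apply: (@le_trans _ _ (\sum_(0 <= n <oo) (enorm (vec (F n)))%:E + r%:E)%E); last first.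
  by rewrite leeD2r//; apply: ereal_sup_ubound; exists F.
rewrite -{1}UF ge0_integral_bigcup//; last 2 first.
- by apply/measurable_EFinP; exact: measurable_funTS.
- by move=> x _; rewrite lee_fin enorm_ge0.
apply: (@le_trans _ _ (\sum_(0 <= n <oo) ((enorm (vec (F n)))%:E + (2 * N%:R * k)%:E * lam (F n)))%E).
  apply: lee_nneseries => [n _ _|n _]; first by apply: integral_ge0 => x _; rewrite lee_fin enorm_ge0.
  have -> : (\int[lam]_(x in F n) (e x)%:E)%E = (\int[lam]_(x in F n) e x)%:E.
    by rewrite Rintegral_EFin//; exact: e_itg.
  rewrite -(fineK (fin_num_measure lam _ (mF n))) -EFinM -EFinD lee_fin.
  have : A n `<=` A n by []. rewrite {1}/A.
  case E : (unpickle n) => [q|] _; last first.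
    have F0 : F n = set0 by apply/seteqP; split => // x /FA; rewrite /A E setI0.
    rewrite F0 Rintegral_set0; apply: addr_ge0; first exact: enorm_ge0.
    by apply: mulr_ge0; [apply: mulr_ge0; [exact: mulr_ge0|exact: ltW]|exact: (fine_ge0 (measure_ge0 lam set0))].
  apply: (enorm_charge_ge (c := fun j => ratr (q 0 j)) (mF n) (ltW k0)) => x j /FA.
  by rewrite /A E => -[_]; exact.
rewrite nneseriesD//; last 2 first.
- by move=> n _ _; rewrite lee_fin enorm_ge0.
- have c0 : 0 <= 2 * N%:R * k by apply: mulr_ge0; [exact: mulr_ge0|exact: ltW].
  by move=> n _ _; rewrite mule_ge0// lee_fin.
rewrite leeD2l// nneseriesZl//.
have -> : (\sum_(0 <= i <oo) lam (F i))%E = lam B.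
  by apply/cvg_lim => //; rewrite -UF; exact: measure_sigma_additive.
rewrite -(fineK (fin_num_measure lam _ mB)) -/m -EFinM lee_fin.
rewrite /k mulrA mulrAC ler_pdivrMr// mulrAC -/m (mulrC _ r) ler_pM2l//.
by rewrite lerDl.
Qed.

End density.
(** The variation is the finite measure with density |f| with respect to a common dominating
    measure, so the defining choice in [tv_measure] succeeds. *)
Lemma tv_measureE B : measurable B -> tv_measure D B = vector_variation D B.
Proof.
rewrite /tv_measure; case: pselect => [exmu|nex]; first by case: (cid exmu) => mu /= h; exact: h.
exfalso; apply: nex; have [lam hlam] := common_dominating D.
have hf j := RN_density (hlam j).
have ei := enorm_density_itg hf.
pose e x := enorm (\row_j fine (Radon_Nikodym (D j) lam x)).
have pos A : (0 <= induced_charge ei A)%E by apply: integral_ge0 => x _; rewrite lee_fin enorm_ge0.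
have [|mu hmu] := @finite_measure_copy _ _ _ (measure_of_charge _ pos).
  rewrite /= /measure_of_charge/= /induced_charge.
  exact: (integral_fune_lt_pinfty measurableT ei).
by exists mu => A mA; rewrite hmu (vector_variation_density hf mA).
Qed.

Definition tv_normal j x := fine (Radon_Nikodym (D j) (tv_measure D) x).

Lemma tv_normal_density j : has_density (D j) (tv_measure D) (tv_normal j).
Proof.
apply: RN_density; apply/null_content_dominatesP => A mA tv0.
have {tv0} : vector_variation D A = 0%E by rewrite -(tv_measureE mA).
have [lam hlam] := common_dominating D.
have hf i := RN_density (hlam i).
rewrite (vector_variation_density hf mA) => E.
have mj : measurable_fun A (EFin \o fun x => fine (Radon_Nikodym (D j) lam x)).
  by apply: measurable_funTS; apply/measurable_EFinP; exact: itg_measurable (hf j).1.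
rewrite (hf j).2//; apply/eqP; rewrite -abse_eq0; apply/eqP/le_anti/andP; split; last exact: abse_ge0.
rewrite -E; apply: (le_trans (le_abse_integral _ mA mj)).
apply: ge0_le_integral => //.
- by apply: measurableT_comp.
- by apply/measurable_EFinP; apply: measurable_funTS; exact: itg_measurable (enorm_density_itg hf).
- move=> x _; rewrite /= lee_fin.
  by have := coord_le_enorm (\row_i fine (Radon_Nikodym (D i) lam x)) j; rewrite mxE.
Qed.

(** Take the variation itself as reference measure: the integral of |n| over A is then the variation
    of A, for every measurable A. *)
Lemma tv_normal_norm1 : ae_eq (tv_measure D) setT (fun x => enorm (\row_j tv_normal j x)) (fun=> 1).
Proof.
have hf := tv_normal_density; have ei := enorm_density_itg hf.
have : ae_eq (tv_measure D) setT (EFin \o (fun x => enorm (\row_j tv_normal j x))) (EFin \o (fun=> 1)).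
  apply: (integral_ae_eq measurableT ei) => [|A _ mA]; first exact/measurable_EFinP.
  rewrite -(vector_variation_density hf mA) -tv_measureE//.
  by rewrite /= integral_cst// mul1e.
by apply: filterS => x /(_ I)[].
Qed.

Lemma charge_integral_tv j (phi : T -> R) : measurable_fun setT phi ->
  (exists M, forall x, `|phi x| <= M) ->
  charge_integral (D j) phi = \int[tv_measure D]_x (phi x * tv_normal j x).
Proof. exact: charge_integralE (tv_normal_density j). Qed.

End total_variation.

(** * Distributional gradients and the phase indicator *)

Section distributional_gradient.
Context {R : realType} {N : nat}.
Notation mu := (@lebesgueN R N).
Notation e_ i := (@basis_rV R N i).
Implicit Types (f g c : 'rV[R]_N -> R) (x y : 'rV[R]_N) (i j : 'I_N).
Variable Om : set 'rV[R]_N.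
Hypotheses (oOm : open Om) (bOm : bounded_set Om).

Let mOm : measurable Om. Proof. exact: open_measurable_rV. Qed.

Section one_gradient.
Variables (f : 'rV[R]_N -> R) (D : 'I_N -> {charge set 'rV[R]_N -> \bar R}).
Hypothesis hD : is_distr_grad Om f D.
Hypothesis hf : loc_integrable Om f.
Let P := tv_measure D.
Let n := tv_normal D.

Lemma tv_out : P (~` Om) = 0%E.
Proof.
have mC : measurable (~` Om) by exact: measurableC.
rewrite (tv_measureE D mC) /vector_variation.
apply/eqP; rewrite eq_le; apply/andP; split.
  apply: ge_ereal_sup => _ [F [mF tF FB] <-].
  rewrite eseries0// => k _ _; congr (_%:E).
  rewrite (_ : \row_i _ = 0) /enorm; first by rewrite /dot big1 ?sqrtr0// => i _; rewrite mxE mul0r.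
  apply/rowP => i; rewrite !mxE hD.1//.
  have -> : F k `&` Om = set0.
    apply/seteqP; split => // x [Fx Ox]; have : (~` Om) x by rewrite -FB; exists k.
    exact.
  by rewrite charge0.
apply: (le_trans (measure_ge0 P (~` Om))); rewrite le_eqVlt; apply/orP; left; apply/eqP.
exact: (tv_measureE D mC).
Qed.

Lemma tv_Rintegral h : measurable_fun setT h ->
  \int[P]_x h x = \int[P]_(x in Om) h x.
Proof.
move=> mh; rewrite [RHS]Rintegral_mkcond; apply: Rintegral_ae_eq => //.
  apply: (measurable_restrict h mOm measurableT).1; rewrite setTI.
  exact: measurable_funTS.
exists (~` Om); split; [exact: measurableC|exact: tv_out|].
move=> x /= nx Ox; apply: nx => _; rewrite /patch mem_set//.
Qed.

Lemma tv_normal_itg j A : measurable A -> itg P A (n j).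
Proof. by move=> mA; apply: integrableS (tv_normal_density D j).1. Qed.

Lemma distr_grad_smooth j c : test_fun Om c ->
  \int[mu]_(x in Om) (f x * 'D_(e_ j) c x) = - \int[P]_(x in Om) (c x * n j x).
Proof.
move=> tc; have hc := test_fun_Cc tc; have [M M0 hM] := Cc_bounded hc.
have mc : measurable_fun setT c by exact: Cc_measurable hc.
rewrite hD.2//; congr (- _).
rewrite (charge_integral_tv D j mc); last by exists M.
rewrite tv_Rintegral//; apply: measurable_funM => //.
by apply: itg_measurable (tv_normal_itg j measurableT).
Qed.

(** The mollification argument of [weak_test1], with the right-hand side taken against the finite
    measure [P]. *)
Lemma distr_grad_test1 j c c' : test1 Om j c c' ->
  \int[mu]_(x in Om) (f x * c' x) = - \int[P]_(x in Om) (c x * n j x).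
Proof.
move=> [hc hc' dc].
have [K [cK KU c0 aK]] := moll_Cc_approx oOm bOm hc.
have [K' [cK' KU' c0' aK']] := moll_Cc_approx oOm bOm hc'.
have hcT : Cc setT c by apply: CcS hc.
have hcT' : Cc setT c' by apply: CcS hc'.
apply/eqP; rewrite -subr_eq0 opprK -normr_le0; apply/ler_addgt0Pl => e e0; rewrite addr0.
pose I1 := \int[P]_(x in Om) `|n j x|; pose I2 := \int[mu]_(x in K') `|f x|.
have I10 : 0 <= I1 by exact: Rintegral_ge0.
have I20 : 0 <= I2 by exact: Rintegral_ge0.
have I3 : 0 < I1 + I2 + 1 by rewrite ltr_wpDl// addr_ge0.
have e1 : 0 < e / (I1 + I2 + 1) by rewrite divr_gt0.
have [r0 r00 hr] := aK _ e1; have [r0' r00' hr'] := aK' _ e1.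
pose r := Num.min r0 r0' / 2.
have m0 : 0 < Num.min r0 r0' by rewrite lt_min r00.
have rp : 0 < r by rewrite divr_gt0.
have : r < Num.min r0 r0' by rewrite /r; lra.
rewrite lt_min => /andP[rr0 rr0'].
have [z b] := hr r rp rr0; have [z' b'] := hr' r rp rr0'.
have ic := Cc_itgT hcT.
have smc m : Ck m setT (moll r c) by exact: moll_Ck.
have hmc : Cc Om (moll r c).
  by split; [move=> x; have [+ _] := smc 0%N; exact|exists K].
have hmc' : Cc Om (moll r c').
  split; last by exists K'.
  by move=> x; have [+ _] := moll_Ck 0 rp (Cc_itgT hcT'); exact.
have E := distr_grad_smooth j (smooth_test_fun smc hmc).
have dE x : 'D_(e_ j) (moll r c) x = moll r c' x.
  by have [] := moll_derive_C1 x rp hcT hcT' dc.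
rewrite (eq_Rintegral _ (g := fun x => f x * moll r c' x)) in E; last first.
  by move=> x _; rewrite dE.
have b2 := loc_Cc_dist oOm hf hmc' hc' cK' KU' z' c0' b'.
rewrite E -/I2 in b2.
have nO := tv_normal_itg j mOm.
have ci g : Cc Om g -> itg P Om (fun x => g x * n j x).
  move=> hg; have [M _ hM] := Cc_bounded hg.
  apply: (itg_eq mOm (f := fun x => n j x * g x)); first by move=> x _; rewrite mulrC.
  by apply: (itgM_bounded mOm (C := M)) => //; exact: Cc_measurable hg.
have i1 := ci _ hmc; have i2 := ci _ hc.
have b1 : `|\int[P]_(x in Om) (moll r c x * n j x) - \int[P]_(x in Om) (c x * n j x)| <=
    e / (I1 + I2 + 1) * I1.
  rewrite -RintegralB// -RintegralZl//; last exact: itg_norm.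
  apply: abs_Rintegral_le => //.
  - exact: itg_measurable (itgB mOm i1 i2).
  - by move=> x _; rewrite -mulrBl normrM ler_wpM2r.
  - by apply: itgZ => //; exact: itg_norm.
move: b1 b2; set A1 := Rintegral _ _ _; set A2 := Rintegral _ _ _; set A3 := Rintegral _ _ _.
move=> b1 b2.
have H : `|A3 + A2| <= e / (I1 + I2 + 1) * (I1 + I2).
  rewrite mulrDr; have -> : A3 + A2 = - ((A1 - A2) + (- A1 - A3)) by ring.
  by rewrite normrN (le_trans (ler_normD _ _))// lerD.
apply: (le_trans H); rewrite mulrAC ler_pdivrMr// ler_pM2l// lerDl//.
Qed.

End one_gradient.

Lemma charge_integral_cadd (nu1 nu2 : {charge set 'rV[R]_N -> \bar R}) (phi : 'rV[R]_N -> R) :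
  measurable_fun setT phi -> (exists M, forall x, `|phi x| <= M) ->
  charge_integral (cadd nu1 nu2) phi = charge_integral nu1 phi + charge_integral nu2 phi.
Proof.
move=> mphi bphi; have [lam hlam] := common_dominating (fun j : 'I_2 => if j == 0 then nu1 else nu2).
have h1 := RN_density (hlam 0 : nu1 `<< lam); have h2 := RN_density (hlam 1 : nu2 `<< lam).
set f1 := (fun x => fine _) in h1; set f2 := (fun x => fine _) in h2.
have h : has_density (cadd nu1 nu2) lam (fun x => f1 x + f2 x).
  split; first exact: (itgD measurableT h1.1 h2.1).
  move=> A mA; transitivity (nu1 A + nu2 A)%E; first by [].
  rewrite (h1.2 A mA) (h2.2 A mA).
  under [RHS]eq_integral do rewrite EFinD.
  rewrite integralD//; first by apply: integrableS h1.1.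
  by apply: integrableS h2.1.
rewrite (charge_integralE h1)// (charge_integralE h2)// (charge_integralE h)//.
have [M hM] := bphi.
have bi g : itg lam setT g -> itg lam setT (fun x => phi x * g x).
  move=> gi; apply: (itg_eq measurableT (f := fun x => g x * phi x)); first by move=> x _; rewrite mulrC.
  exact: (itgM_bounded measurableT (C := M)).
rewrite -RintegralD//; [|exact: bi h1.1|exact: bi h2.1].
by apply: eq_Rintegral => x _; rewrite mulrDr.
Qed.

Lemma induced_density (m : {measure set 'rV[R]_N -> \bar R}) (h : 'rV[R]_N -> R)
    (hi : m.-integrable setT (EFin \o h)) : has_density (induced_charge hi) m h.
Proof. by split. Qed.

Lemma itg_restrict (m : {measure set 'rV[R]_N -> \bar R}) h :
  itg m Om h -> itg m setT (h \_ Om).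
Proof.
move=> hh; have := (integrable_mkcond (EFin \o h) mOm).1 hh.
by apply: eq_integrable => // x _; rewrite /= /patch; case: ifP.
Qed.

Lemma Rintegral_restrict (m : {measure set 'rV[R]_N -> \bar R}) (phi h : 'rV[R]_N -> R) :
  \int[m]_x (phi x * (h \_ Om) x) = \int[m]_(x in Om) (phi x * h x).
Proof.
rewrite [RHS]Rintegral_mkcond; apply: eq_Rintegral => x _; rewrite /patch.
by case: ifP => // _; rewrite mulr0.
Qed.

Lemma induced_restrict (m : {measure set 'rV[R]_N -> \bar R}) h
    (hi : m.-integrable setT (EFin \o (h \_ Om))) B : measurable B ->
  induced_charge hi B = induced_charge hi (B `&` Om).
Proof.
move=> mB; rewrite /induced_charge [RHS]integral_mkcondr.
apply: eq_integral => x _; rewrite /patch /=.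
by case: ifP.
Qed.

Lemma phase_algebra (al be ch p p' g : R) : be - al != 0 ->
  ch * p' = (be * ch + al * (1 - ch)) * ((be - al)^-1 * p' + - (be - al)^-2 * g * p) -
    al * ((be - al)^-1 * p' + - (be - al)^-2 * g * p) + ch * (g * ((be - al)^-1 * p)).
Proof. by move=> h; field. Qed.

(** The quotient rule for chi_A = (u_A - a) / gamma: the gradient measure of u_A divided by gamma,
    plus an absolutely continuous part. The test phi / gamma is C^1 only, which is why
    [distr_grad_test1] is needed. *)
Lemma phase_distr_grad a b (a' b' : 'I_N -> 'rV[R]_N -> R) (A : set 'rV[R]_N) (M dl : R) :
  (forall j, C1_on Om j a (a' j)) -> (forall j, C1_on Om j b (b' j)) ->
  (forall j x, Om x -> `|a' j x| <= M) -> (forall j x, Om x -> `|b' j x| <= M) ->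
  0 < dl -> (forall x, Om x -> dl <= b x - a x) -> measurable A ->
  BV Om (phase_fun a b A) -> exists D, is_distr_grad Om (\1_A : 'rV[R]_N -> R) D.
Proof.
move=> aC1 bC1 aM bM dl0 hdl mA [ui [Du hDu]].
set uA := phase_fun a b A in ui hDu.
pose P := tv_measure Du; pose n := tv_normal Du.
pose gi x := (b x - a x)^-1.
have gN x : Om x -> b x - a x != 0 by move=> Ox; rewrite gt_eqF// (lt_le_trans dl0)// hdl.
pose g' j x := b' j x - a' j x.
have gC1 j : C1_on Om j (fun x => b x - a x) (g' j).
  have [ca ca' da] := aC1 j; have [cb cb' db] := bC1 j; split=> x Ox.
  - by apply: continuousB; [exact: cb|exact: ca].
  - by apply: continuousB; [exact: cb'|exact: ca'].
  - by have da1 := da x Ox; have db1 := db x Ox; exact: is_deriveB.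
pose gi' j x := - (b x - a x)^-2 * g' j x.
have giC1 j : C1_on Om j gi (gi' j).
  have [cg cg' dg] := gC1 j; split=> x Ox.
  - by apply: continuousV; [exact: gN|exact: cg].
  - apply: continuousM; last exact: cg'.
    apply: continuousN; apply: continuousV; first by rewrite expf_neq0// gN.
    exact: (continuous_comp (cg x Ox) (@exprn_continuous _ 2 _)).
  - by apply: is_derive_inv; [exact: gN|exact: dg].
have giB x : Om x -> `|gi x| <= dl^-1.
  move=> Ox; have g0 : 0 < b x - a x by exact: lt_le_trans (hdl x Ox).
  by rewrite gtr0_norm ?invr_gt0// lef_pV2// hdl.
pose chi : 'rV[R]_N -> R := \1_A.
have chiB x : `|chi x| <= 1 by rewrite /chi indicE; case: (_ \in _); rewrite ?normr1 ?normr0.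
have mchi : measurable_fun Om chi by exact: measurable_indic.
have fOm : (mu Om < +oo)%E by exact: lebesgueN_bounded.
(* Density of the absolutely continuous part, that is -(D_j a + chi_A D_j gamma) / gamma. *)
pose k2 j x := - ((a' j x + chi x * g' j x) * gi x).
have contm h : cont_on Om h -> measurable_fun Om h by move=> ch; exact: continuous_measurable_rV.
have mgi j : measurable_fun Om gi by have [c _ _] := giC1 j; exact: contm.
have mk2 j : measurable_fun Om (k2 j).
  have [_ ca' _] := aC1 j; have [_ cg' _] := gC1 j.
  apply: measurableT_comp => //; apply: measurable_funM; last exact: mgi j.
  apply: measurable_funD; first exact: contm.
  by apply: measurable_funM => //; exact: contm.
have i2 j : itg mu Om (k2 j).
  apply: (itg_bounded mOm (C := (M + (M + M)) * dl^-1) fOm (mk2 j)) => x Ox.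
  rewrite normrN normrM ler_pM//; last exact: giB.
  rewrite (le_trans (ler_normD _ _))// lerD//; first exact: aM.
  rewrite normrM (@le_trans _ _ (1 * `|g' j x|))// ?ler_wpM2r// mul1r.
  by rewrite (le_trans (ler_normB _ _))// lerD ?aM ?bM.
have i1 j : itg P Om (fun x => n j x * gi x).
  by apply: (itgM_bounded mOm (C := dl^-1)) => //; [exact: mgi j|exact: tv_normal_itg].
pose D j := cadd (induced_charge (itg_restrict (i1 j))) (induced_charge (itg_restrict (i2 j))).
exists D; split.
  move=> j B mB.
  exact: (f_equal2 (fun u v => (u + v)%E) (induced_restrict (itg_restrict (i1 j)) mB)
    (induced_restrict (itg_restrict (i2 j)) mB)).
move=> j phi tphi.
have hphi := test_fun_Cc tphi; have [Mp _ hMp] := Cc_bounded hphi.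
have mphi : measurable_fun setT phi by exact: Cc_measurable hphi.
have ht := test_fun_test1 j tphi; have [_ hphi' _] := ht.
set phi' := 'D_(e_ j) phi in ht hphi' *.
have -> : charge_integral (D j) phi =
    \int[P]_(x in Om) (phi x * (n j x * gi x)) + \int[mu]_(x in Om) (phi x * k2 j x).
  rewrite /D charge_integral_cadd//; last by exists Mp.
  congr (_ + _).
    rewrite (charge_integralE (lam := P) (induced_density (itg_restrict (i1 j))) mphi); last by exists Mp.
    exact: Rintegral_restrict.
  rewrite (charge_integralE (lam := leb R N) (induced_density (itg_restrict (i2 j))) mphi); last by exists Mp.
  exact: Rintegral_restrict.
have T := test1_mul oOm (giC1 j) ht; have [hc hc' _] := T.
have luA : loc_integrable Om uA.
  split; first exact: itg_measurable ui.
  by move=> K cK KO; apply: integrableS ui => //; exact: compact_measurable_rV.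
have E1 := distr_grad_test1 hDu luA T.
have E2 := weak_test1 oOm bOm (weak_C1 oOm bOm (aC1 j)) T.
have la : loc_integrable Om a by have [c _ _] := aC1 j; exact: loc_integrable_cont.
have la' : loc_integrable Om (a' j) by have [_ c _] := aC1 j; exact: loc_integrable_cont.
have lchi : loc_integrable Om chi.
  split; first exact: mchi.
  move=> K cK KO; have mK := compact_measurable_rV cK.
  apply: (itg_bounded mK (C := 1)) => //.
    by apply: le_lt_trans fOm; apply: le_measure; rewrite ?inE.
  exact: measurable_funS mchi.
have hd : Cc Om (fun x => g' j x * (gi x * phi x)).
  have [_ c _] := gC1 j; have [c2 _ _] := giC1 j.
  by apply: CcMl => //; exact: CcMl.
have j1 := loc_itg_Cc oOm luA hc'; have j2 := loc_itg_Cc oOm la hc'.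
have j3 := loc_itg_Cc oOm lchi hd; have j4 := loc_itg_Cc oOm la' hc.
rewrite (eq_Rintegral _ (g := fun x => (uA x * (gi x * phi' x + gi' j x * phi x) -
    a x * (gi x * phi' x + gi' j x * phi x)) + chi x * (g' j x * (gi x * phi x)))); last first.
  move=> x /set_mem Ox; exact: (phase_algebra _ _ _ _ (gN x Ox)).
rewrite RintegralD//; last exact: (itgB mOm j1 j2).
rewrite RintegralB// E1 E2.
rewrite [X in _ = - (_ + X)](eq_Rintegral _ (g := fun x => -1 * (a' j x * (gi x * phi x) + chi x * (g' j x * (gi x * phi x))))); last first.
  by move=> x _; rewrite /k2; ring.
rewrite RintegralZl//; last exact: (itgD mOm j4 j3).
rewrite RintegralD//.
rewrite [X in _ = - (X + _)](eq_Rintegral _ (g := fun x => gi x * phi x * n j x)); last first.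
  by move=> x _; ring.
ring.
Qed.

Lemma distr_grad_spec f : (exists D, is_distr_grad Om f D) -> is_distr_grad Om f (distr_grad Om f).
Proof. by rewrite /distr_grad; case: pselect => // ex _; case: (cid ex). Qed.

(** [distr_grad] is a choice depending on the predicate [is_distr_grad Om f]; functions that agree
    almost everywhere define the same predicate, hence literally the same charges. *)
Lemma distr_grad_ae f g : measurable_fun Om f -> measurable_fun Om g -> ae_eq mu Om f g ->
  distr_grad Om f = distr_grad Om g.
Proof.
move=> mf mg fg; suff E : is_distr_grad Om f = is_distr_grad Om g by rewrite /distr_grad E.
have I phi j : test_fun Om phi -> \int[mu]_(x in Om) (f x * 'D_(e_ j) phi x) =
    \int[mu]_(x in Om) (g x * 'D_(e_ j) phi x).
  move=> tphi; have [_ h _] := test_fun_test1 j tphi.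
  have mh : measurable_fun Om ('D_(e_ j) phi) by exact: Cc_measurable h.
  apply: (Rintegral_ae_eq mOm (measurable_funM mf mh) (measurable_funM mg mh)).
  by apply: filterS fg => x H Ox /=; rewrite H.
apply/funext => D; apply/propext; split=> -[h1 h2]; split=> // j phi tphi.
  by rewrite -I// h2.
by rewrite I// h2.
Qed.

(** The set selected inside [energy] may differ from [A], but only by a null set since the wells are
    distinct. *)
Lemma energy_phase W a b (A : set 'rV[R]_N) : measurable A -> A `<=` Om ->
  (forall x, Om x -> a x != b x) -> BV Om (phase_fun a b A) ->
  energy Om W a b (phase_fun a b A) = (\int[perimeter_measure Om A]_(x in Om) (sigma W a b x)%:E)%E.
Proof.
move=> mA AO ab bv; rewrite /energy; case: pselect => [ex|nex]; last first.
  exfalso; apply: nex; exists A; split => //.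
  exact: ae_eq_refl.
case: (cid ex) => A' [mA' _ AA' _] /=.
rewrite /perimeter_measure (@distr_grad_ae \1_A' \1_A)//.
apply: filterS AA' => x /= H Ox; have := H Ox; rewrite /phase_fun !indicE.
have := ab x Ox; case: (x \in A); case: (x \in A') => //=; rewrite ?(mulr1, mulr0, subrr, subr0, addr0, add0r).
  by move=> /eqP h E; exfalso; apply: h.
by move=> /eqP h E; exfalso; apply: h.
Qed.

End distributional_gradient.

(** * Primitives depending on a parameter *)

Section primitives.
Context {R : realType}.
Notation leb := (@lebesgue_measure R).
Implicit Types k : R -> R.

Lemma real_mvt_local (f df : R -> R) (a b : R) :
  (forall t, Num.min a b <= t <= Num.max a b -> is_derive t (1 : R) f (df t)) ->
  exists2 c, Num.min a b <= c <= Num.max a b & f b - f a = df c * (b - a).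
Proof.
have H (x y : R) : x < y -> (forall t, x <= t <= y -> is_derive t (1 : R) f (df t)) ->
    exists2 c, x <= c <= y & f y - f x = df c * (y - x).
  move=> xy h.
  have hc : {within `[x, y], continuous f}.
    apply: continuous_in_subspaceT => u /set_mem; rewrite /= in_itv /= => hu.
    by apply/differentiable_continuous/derivable1_diffP; case: (h u hu).
  have hd t : t \in `]x, y[ -> is_derive t (1 : R) f (df t).
    by rewrite in_itv /= => /andP[t1 t2]; apply: h; rewrite !ltW.
  have [c] := @MVT R f df x y xy hd hc.
  by rewrite in_itv/= => /andP[/ltW c1 /ltW c2] E; exists c => //; rewrite c1 c2.
move=> h; have [ab|ba|E] := ltgtP a b.
- by apply: (H a b ab) => t ht; apply: h; rewrite (min_l (ltW ab)) (max_r (ltW ab)).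
- have [|c hc E] := H b a ba; first by move=> t ht; apply: h; rewrite (min_r (ltW ba)) (max_l (ltW ba)).
  by exists c => //; rewrite -opprB E; ring.
- by rewrite -E; exists a; rewrite ?minxx ?maxxx ?lexx// !subrr mulr0.
Qed.

(* equal to 1 on [0, 1] and supported in [-1, 2] *)
Definition theta (s : R) : R := Num.max 0 (Num.min 1 (Num.min (1 + s) (2 - s))).

Lemma theta_bounds s : 0 <= theta s <= 1.
Proof. by rewrite /theta le_max lexx ge_max ler01 ge_min lexx. Qed.

Lemma theta1 s : 0 <= s <= 1 -> theta s = 1.
Proof.
move=> /andP[s0 s1]; rewrite /theta min_l ?max_r//.
by rewrite le_min; apply/andP; split; lra.
Qed.

Lemma theta_out s : ~~ (-1 <= s <= 2) -> theta s = 0.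
Proof.
rewrite negb_and -!ltNge => h; rewrite /theta max_l// ge_min; apply/orP; right.
by rewrite ge_min; case/orP: h => h; apply/orP; [left|right]; lra.
Qed.

Lemma theta_continuous : continuous theta.
Proof.
move=> s.
have c1 : {for s, continuous (fun s : R => 1 + s)}.
  by apply: continuousD; [exact: cst_continuous|exact: cvg_id].
have c2 : {for s, continuous (fun s : R => 2 - s)}.
  by apply: continuousB; [exact: cst_continuous|exact: cvg_id].
have k0 : {for s, continuous (fun=> 0 : R)} by exact: cst_continuous.
have k1 : {for s, continuous (fun=> 1 : R)} by exact: cst_continuous.
exact: (continuous_max k0 (continuous_min k1 (continuous_min c1 c2))).
Qed.

(** The oriented integral from 0 to [v], for [v] of either sign; it is applied to integrands
    supported in [-1, 2]. *)
Definition prim k (v : R) : R := \int[leb]_(s in `]-oo, v]) k s - \int[leb]_(s in `]-oo, 0]) k s.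

Lemma prim0 k : prim k 0 = 0.
Proof. by rewrite /prim subrr. Qed.

Lemma prim_derive k : continuous k -> (forall s, ~~ (-1 <= s <= 2) -> k s = 0) ->
  forall v, is_derive v (1 : R) (prim k) (k v).
Proof.
move=> ck k0 v.
have i12 : leb.-integrable `[-1, 2] (EFin \o k).
  by apply: continuous_compact_integrable; [exact: segment_compact|exact: continuous_subspaceT].
have iT : leb.-integrable setT (EFin \o k).
  have mI : measurable (`[-1, 2]%classic : set (measurableTypeR R)) by exact: measurable_itv.
  have := (@integrable_mkcond _ (measurableTypeR R) R leb _ (EFin \o k) mI).1 i12.
  apply: eq_integrable => // x _; rewrite /patch; case: ifPn => // /negP nx /=.
  by rewrite k0//; apply/negP => h; apply: nx; apply/mem_set; rewrite /= in_itv.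
have i : leb.-integrable [set` Interval -oo%O (BRight (v + 1))] (EFin \o k).
  by apply: integrableS iT.
have [d E] := @continuous_FTC1 R k -oo%O v (v + 1) ltac:(by rewrite ltrDl) i (ltNyr _) (ck v).
have h : is_derive v (1 : R) (fun x => \int[leb]_(t in [set` Interval -oo%O (BRight x)]) k t) (k v).
  by rewrite -E derive1E; exact: DeriveDef d erefl.
have := is_deriveB h (is_derive_cst (\int[leb]_(s in `]-oo, 0]) k s) v (1 : R)).
by rewrite subr0.
Qed.

Lemma primitive_bound (K k : R -> R) (e v : R) : (forall s, is_derive s (1 : R) K (k s)) -> K 0 = 0 ->
  (forall s, `|k s| <= e) -> `|K v| <= e * `|v|.
Proof.
move=> dK K0 hk; have [c _] := real_mvt 0 v dK; rewrite K0 !subr0 => ->.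
by rewrite normrM ler_wpM2r.
Qed.

End primitives.

(** * Regularity of primitives in the parameter *)

Section parametric_primitive.
Context {R : realType} {N : nat}.
Notation e_ i := (@basis_rV R N i).
Variables (U : set 'rV[R]_N) (j : 'I_N) (k kx : 'rV[R]_N -> R -> R).
Hypotheses (oU : open U) (ck : jcont U k) (ckx : jcont U kx).
Hypotheses (k0 : forall x s, ~~ (-1 <= s <= 2) -> k x s = 0)
  (kx0 : forall x s, ~~ (-1 <= s <= 2) -> kx x s = 0).
Hypothesis dk : forall x s, U x -> is_derive x (e_ j) (fun y => k y s) (kx x s).

(** Uniformity in s over the whole line comes from the support in [-1, 2], compact and independent
    of x. *)
Lemma jcont_unif_near (h : 'rV[R]_N -> R -> R) x : jcont U h ->
  (forall x s, ~~ (-1 <= s <= 2) -> h x s = 0) -> U x -> forall e, 0 < e ->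
  exists2 d, 0 < d & forall y, `|x - y| < d -> U y /\ forall s, `|h x s - h y s| < e.
Proof.
move=> ch h0 Ux e e0.
have cK : compact ([set x] `*` `[(-1 : R), 2]%classic).
  by apply: compact_setX; [exact: compact_set1|exact: segment_compact].
have [|d d0 hd] := compact_unif_continuous (f := fun p => h p.1 p.2) cK _ e0.
  by move=> [y s] [/= -> _]; exact: ch.
have /nbhs_ballP[d' /= d'0 hd'] : nbhs x U by exact: open_nbhs_nbhs.
exists (Num.min d d'); first by rewrite lt_min d0.
move=> y; rewrite lt_min => /andP[yd yd']; split; first by apply: hd'; rewrite -ball_normE.
move=> s; have [hs|hs] := boolP (-1 <= s <= 2); last by rewrite !h0// subrr normr0.
apply: (hd (x, s) (y, s)); first by split => //=; rewrite in_itv.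
by rewrite prod_normE /= subrr normr0 gt_max d0 yd.
Qed.

Lemma param_prim_derive x v : U x -> is_derive v (1 : R) (prim (k x)) (k x v).
Proof.
move=> Ux; apply: prim_derive; last exact: k0.
by move=> s; exact: jcont_snd ck Ux.
Qed.

Lemma param_prim_jcont : jcont U (fun x v => prim (k x) v).
Proof.
move=> x v Ux; apply/(@cvgrPdist_lt _ _ _ (nbhs (x, v))) => e e0.
have e2 : 0 < e / 2 by rewrite divr_gt0.
have v2 : 0 < e / 2 / (`|v| + 1) by rewrite divr_gt0// ltr_wpDl.
have [d d0 hd] := jcont_unif_near ck k0 Ux v2.
have cv : {for v, continuous (prim (k x))}.
  by apply/differentiable_continuous/derivable1_diffP; case: (param_prim_derive v Ux).
have /cvgrPdist_lt/(_ _ e2)/nbhs_ballP[d1 /= d10 hd1] := cv.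
have n1 : nbhs x (fun y => `|x - y| < d).
  by apply/nbhs_ballP; exists d => //= y; rewrite -ball_normE.
have n2 : nbhs v (fun w => `|v - w| < Num.min d1 1).
  by apply/nbhs_ballP; exists (Num.min d1 1); [rewrite /= lt_min d10 ltr01|move=> y; rewrite -ball_normE].
exists ([set y | `|x - y| < d], [set w | `|v - w| < Num.min d1 1]); first by split.
move=> [y w] [/= xy]; rewrite lt_min => /andP[vw vw1].
have [Uy kxy] := hd y xy.
have dB s : is_derive s (1 : R) (fun s => prim (k x) s - prim (k y) s) (k x s - k y s).
  by have d1' := param_prim_derive s Ux; have d2' := param_prim_derive s Uy; exact: is_deriveB.
have b1 : `|prim (k x) w - prim (k y) w| <= e / 2 / (`|v| + 1) * `|w|.
  apply: (primitive_bound w dB); first by rewrite !prim0 subrr.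
  by move=> s; exact: ltW.
have w1 : `|w| <= `|v| + 1.
  by rewrite -(subKr v w) (le_trans (ler_normB _ _))// lerD2l ltW.
have b1' : `|prim (k x) w - prim (k y) w| <= e / 2.
  by rewrite (le_trans b1)// (le_trans (ler_wpM2l (ltW v2) w1))// divfK// gt_eqF// ltr_wpDl.
have b2 : `|prim (k x) v - prim (k x) w| < e / 2.
  by apply: hd1; rewrite -ball_normE.
rewrite -(subrK (prim (k x) w) (prim (k x) v)) -addrA (le_lt_trans (ler_normD _ _))//.
by rewrite [ltRHS](splitr e) ltr_leD.
Qed.

(** The error of the difference quotient is itself a primitive in [v], of a function that the mean
    value theorem along [e_ j] makes uniformly small; [primitive_bound] then replaces
    differentiation under the integral. *)
Lemma param_prim_dx x v : U x ->
  is_derive x (e_ j) (fun y => prim (k y) v) (prim (kx x) v).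
Proof.
move=> Ux; apply: is_derive_eps => e e0.
have v1 : 0 < `|v| + 1 by rewrite ltr_wpDl.
have e1 : 0 < e / (`|v| + 1) by rewrite divr_gt0.
have [d d0 hd] := jcont_unif_near ckx kx0 Ux e1.
exists d => // h hN hh.
have near t : `|t| <= `|h| -> U (t *: e_ j + x) /\ forall s, `|kx x s - kx (t *: e_ j + x) s| < e / (`|v| + 1).
  move=> th; apply: hd; rewrite opprD addrCA subrr addr0 normrN normrZ.
  rewrite (le_lt_trans _ hh)// (le_trans (ler_wpM2l (normr_ge0 t) (norm_basis j)))//.
  by rewrite mulr1.
have Uh := (near h (lexx _)).1.
have dkx s : is_derive s (1 : R) (prim (kx x)) (kx x s).
  by apply: prim_derive; [move=> u; exact: jcont_snd ckx Ux|exact: kx0].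
have dD s : is_derive s (1 : R) (fun s => h^-1 * (prim (k (h *: e_ j + x)) s - prim (k x) s) - prim (kx x) s)
    (h^-1 * (k (h *: e_ j + x) s - k x s) - kx x s).
  have d1 := param_prim_derive s Uh; have d2 := param_prim_derive s Ux; have d3 := dkx s.
  have dm := is_derive_mul (is_derive_cst h^-1 s (1 : R)) (is_deriveB d1 d2).
  rewrite mulr0 addr0 in dm; exact: (is_deriveB dm d3).
have b : `|h^-1 * (prim (k (h *: e_ j + x)) v - prim (k x) v) - prim (kx x) v| <= e / (`|v| + 1) * `|v|.
  apply: (primitive_bound v dD); first by rewrite !prim0 !subrr mulr0 subrr.
  move=> s.
  have dl t : Num.min 0 h <= t <= Num.max 0 h ->
      is_derive t (1 : R) (fun t : R => k (t *: e_ j + x) s) (kx (t *: e_ j + x) s).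
    move=> ht; have th : `|t| <= `|h|.
      move: ht; case: (lerP 0 h) => h0 /andP[t1 t2]; rewrite ler_norml.
        by rewrite ger0_norm//; apply/andP; split; lra.
      by rewrite ltr0_norm//; apply/andP; split; lra.
    exact: (is_derive_line (dk s (near t th).1)).
  have [c hc] := real_mvt_local dl; rewrite scale0r add0r subr0 => ->.
  have ch : `|c| <= `|h|.
    move: hc; case: (lerP 0 h) => h0 /andP[t1 t2]; rewrite ler_norml.
      by rewrite ger0_norm//; apply/andP; split; lra.
    by rewrite ltr0_norm//; apply/andP; split; lra.
  rewrite mulrCA mulVf// mulr1 distrC; apply: ltW; exact: (near c ch).2.
rewrite (le_trans b)// mulrAC ler_pdivrMr// ler_wpM2l ?(ltW e0)// lerDl//.
Qed.

(** The interval [-3, 3] is a symmetric one containing the support [-1, 2] of the integrand. *)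
Lemma param_prim_flat : flat U (fun x v => prim (k x) v) 3.
Proof.
have dl x t : U x -> is_derive t (1 : R) (prim (k x)) (k x t) by exact: param_prim_derive.
apply: flatP => // x s Ux hs; apply/eqP; rewrite -subr_eq0.
  have [c] := real_mvt_local (fun t _ => dl x t Ux : is_derive t (1 : R) (prim (k x)) (k x t)) (a := 3) (b := s).
  rewrite (min_l (ltW hs)) => /andP[c3 _] ->.
  rewrite k0 ?mul0r// negb_and -!ltNge; apply/orP; right; lra.
have [c] := real_mvt_local (fun t _ => dl x t Ux : is_derive t (1 : R) (prim (k x)) (k x t)) (a := -3) (b := s).
rewrite (max_l (ltW hs)) => /andP[_ c3] ->.
rewrite k0 ?mul0r// negb_and -!ltNge; apply/orP; left; lra.
Qed.

End parametric_primitive.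

(** * Consequences of the assumptions on the potential *)

Section chart_bounds.
Context {R : realType} {N : nat}.
Notation e_ i := (@basis_rV R N i).
Variable Om : set 'rV[R]_N.
Hypothesis Om_C2 : C2_domain Om.

Lemma open_C2_domain : open Om. Proof. by case: Om_C2. Qed.
Lemma bounded_C2_domain : bounded_set Om. Proof. by case: Om_C2. Qed.

(* Points of Om near the boundary are moved along the vertical direction of a
   chart into a compact subset of Om; the derivative bound controls the variation. *)
Lemma C2_domain_bounded (Q : 'rV[R]_N -> R -> R) (Qx : 'I_N -> 'rV[R]_N -> R -> R) (S M : R) :
  jcont Om Q -> (forall j x s, Om x -> is_derive x (e_ j) (fun y => Q y s) (Qx j x s)) ->
  (forall j x s, Om x -> - S <= s <= S -> `|Qx j x s| <= M) ->
  exists2 C, 0 < C & forall x s, Om x -> - S <= s <= S -> `|Q x s| <= C.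
Proof.
move=> cQ dQ hQ.
have oOm := open_C2_domain.
have cl : compact (closure Om) by exact: (compact_closure_bounded bounded_C2_domain).
have loc x0 : closure Om x0 -> exists r C : R, 0 < r /\
    forall y, `|x0 - y| < r -> Om y -> forall s, - S <= s <= S -> `|Q y s| <= C.
  move=> cx0; have [Ox0|nOx0] := pselect (Om x0).
    have /nbhs_ballP[d /= d0 hd] : nbhs x0 Om by exact: open_nbhs_nbhs.
    have KO : cball x0 (d / 2) `<=` Om.
      move=> y hy; apply: hd; rewrite -ball_normE /= distrC (le_lt_trans hy)//; lra.
    have [C C0 hC] := jcont_bounded S (@compact_cball R N x0 (d / 2)) KO cQ.
    exists (d / 2), C; split; first by rewrite divr_gt0.
    by move=> y xy _ s hs; apply: hC => //; rewrite /cball /= distrC ltW.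
  have bx0 : bdry Om x0 by split => // /interior_subset.
  have [_ _ /(_ _ bx0)[i [sg [h [hC2 /nbhs_ballP[d /= d0 hd]]]]]] := Om_C2.
  have chart y : `|x0 - y| < d -> (Om y <-> chart_fun i sg h y < 0).
    by move=> xy; apply: hd; rewrite -ball_normE.
  pose r := d / 3; have r0 : 0 < r by rewrite divr_gt0.
  pose c : R := (-1) ^+ sg.
  have c1 : `|c| = 1 by rewrite /c normrX normrN1 expr1n.
  (* [z t y] is y moved inwards by t, that is against [vert], so the chart function decreases by
     t. *)
  pose z t y : 'rV[R]_N := (t * c) *: e_ i + y.
  have zE t y : z t y = (- t) *: vert i sg + y.
    by rewrite /z /vert scalerA mulNr mulrN opprK.
  have zphi t y : chart_fun i sg h (z t y) = chart_fun i sg h y - t.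
    by rewrite zE chart_vert.
  have zd t y : `|z t y - y| <= `|t|.
    rewrite /z addrK normrZ normrM c1 mulr1 -[leRHS]mulr1.
    by rewrite ler_wpM2l// norm_basis.
  pose K := cball x0 (r + r) `&` [set y | chart_fun i sg h y <= - r].
  have cK : compact K.
    have cH : closed [set y | chart_fun i sg h y <= - r].
      apply: (@closed_comp _ _ _ [set t : R | t <= - r]) => [y _|]; first exact: chart_continuous.
      exact: closed_le.
    by apply: (subclosed_compact _ (@compact_cball R N x0 (r + r))) => [|y []//]; apply: closedI => //; exact: closed_cball.
  have KO : K `<=` Om.
    move=> y [/= yx0 yphi]; apply/chart; last by rewrite (le_lt_trans yphi)// oppr_lt0.
    by rewrite distrC (le_lt_trans yx0)// /r; lra.
  have [C C0 hC] := jcont_bounded S cK KO cQ.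
  exists r, (C + M * r); split => // y xy Oy s hs.
  have yphi : chart_fun i sg h y < 0 by apply/chart => //; rewrite (lt_trans xy)// /r; lra.
  have zx t : 0 <= t <= r -> `|z t y - x0| < r + r.
    move=> /andP[t0 tr]; rewrite -(subrK y (z t y)) -addrA (le_lt_trans (ler_normD _ _))//.
    by rewrite ler_ltD ?(le_trans (zd t y))// ?ger0_norm// distrC.
  have zO t : 0 <= t <= r -> Om (z t y).
    move=> ht; apply/chart; last by rewrite zphi; move/andP: ht => [t0 _]; lra.
    by rewrite distrC (lt_trans (zx t ht))// /r; lra.
  have Kz : K (z r y).
    have rr : 0 <= r <= r by rewrite ltW//=.
    by split => /=; [rewrite /cball /= ltW// zx|rewrite zphi; lra].
  have dz t : 0 <= t <= r -> is_derive t (1 : R) (fun t => Q (z t y) s) (Qx i (z t y) s * c).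
    move=> ht.
    have d1 : is_derive (t * c) (1 : R) (fun t => Q (t *: e_ i + y) s) (Qx i (z t y) s).
      exact: (is_derive_line (dQ i (z t y) s (zO t ht))).
    have d2 : is_derive t (1 : R) (fun t : R => t * c) c.
      have := is_derive_mul (is_derive_id t (1 : R)) (is_derive_cst c t (1 : R)).
      by rewrite mulr0 add0r mulr1.
    exact: (is_derive_comp_real d2 d1).
  have dz' t : Num.min 0 r <= t <= Num.max 0 r -> is_derive t (1 : R) (fun t => Q (z t y) s) (Qx i (z t y) s * c).
    by rewrite (min_l (ltW r0)) (max_r (ltW r0)); exact: dz.
  have [t] := real_mvt_local dz'; rewrite (min_l (ltW r0)) (max_r (ltW r0)) => ht.
  rewrite {2}/z mul0r scale0r add0r subr0 => E.
  have -> : Q y s = Q (z r y) s - Qx i (z t y) s * c * r by rewrite -E opprB addrC subrK.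
  rewrite (le_trans (ler_normB _ _))// lerD//; first exact: hC.
  by rewrite normrM [`|r|]gtr0_norm// ler_wpM2r ?(ltW r0)// normrM c1 mulr1; apply: hQ => //; exact: zO.
(* Local bounds become a global one by compactness of the closure, the bound itself being the
   parameter that tends to +oo. *)
have /compact_near_coveringP/(_ R (pinfty_nbhs R) (fun M y => Om y -> forall s, - S <= s <= S -> `|Q y s| <= M)) := cl.
case.
  move=> x0 /loc[r [C [r0 hr]]].
  exists ([set y | `|x0 - y| < r], [set M | C < M]).
    split => /=; last by exists C; split => //; exact: num_real.
    by apply/nbhs_ballP; exists r => //= y; rewrite -ball_normE.
  move=> [y M'] [/= xy CM] Oy s hs; exact: le_trans (hr _ xy Oy _ hs) (ltW CM).
move=> C [_ hC]; exists (`|C| + 1); first by rewrite ltr_wpDl.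
move=> x s Ox; apply: (hC (`|C| + 1)) => //; last exact: subset_closure.
by rewrite (le_lt_trans (ler_norm C))// ltrDl.
Qed.

Lemma continuous_ext_jcont (F : 'rV[R]_N -> R -> R) : continuous_ext Om F -> jcont Om F.
Proof.
move=> [G [cG GF]] x s Ox.
have oOm := open_C2_domain.
have nU : nbhs (x, s) (Om `*` setT : set ('rV[R]_N * R)).
  by exists (Om, setT) => //; split; [exact: open_nbhs_nbhs|exact: filterT].
have nA : (closure Om `*` [set: R])° (x, s).
  by apply: filterS nU => -[y t] [/= Oy _]; split => //; exact: subset_closure.
have c : {for (x, s), continuous G}.
  have /subspace_continuousP/(_ (x, s)) := cG.
  by rewrite (within_interior nA); apply; split => //; exact: subset_closure.
have E : \forall p \near (x, s), G p = F p.1 p.2.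
  by apply: filterS nU => -[y t] [/= Oy _]; exact: GF.
rewrite /prop_for /continuous_at /= -GF//.
exact: cvg_trans (near_eq_cvg E) c.
Qed.

Lemma continuous_ext_bounded (F : 'rV[R]_N -> R -> R) (S : R) : continuous_ext Om F ->
  exists2 C, 0 < C & forall x s, Om x -> - S <= s <= S -> `|F x s| <= C.
Proof.
move=> [G [cG GF]].
have cl : compact (closure Om) by exact: (compact_closure_bounded bounded_C2_domain).
have cK : compact (closure Om `*` `[- S, S]%classic) by apply: compact_setX => //; exact: segment_compact.
have cG' : {within closure Om `*` `[- S, S]%classic, continuous G}.
  by apply: continuous_subspaceW cG => -[x s] [].
have [M [Mr hM]] := compact_bounded (continuous_compact cG' cK).
exists (`|M| + 1); first by rewrite ltr_wpDl.
move=> x s Ox hs; rewrite -GF//; apply: (hM (`|M| + 1)).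
  by rewrite (le_lt_trans (ler_norm M))// ltrDl.
by exists (x, s) => //; split; [exact: subset_closure|rewrite /= in_itv].
Qed.

End chart_bounds.

(** * The normalised potential *)

Section potential_facts.
Context {R : realType} {N : nat}.
Notation e_ i := (@basis_rV R N i).
Variables (Om : set 'rV[R]_N) (W : 'rV[R]_N -> R -> R) (a b : 'rV[R]_N -> R).
Hypotheses (Om_C2 : C2_domain Om) (pot : potential Om W a b).
Let oOm : open Om := open_C2_domain Om_C2.

Definition gam (x : 'rV[R]_N) : R := b x - a x.
Definition gamx j (x : 'rV[R]_N) : R := 'D_(e_ j) b x - 'D_(e_ j) a x.
Definition sqW (x : 'rV[R]_N) (v : R) : R := Num.sqrt (W_norm W a b x v).
Definition sqWx j (x : 'rV[R]_N) (v : R) : R := 'D_(e_ j) (fun y => sqW y v) x.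
Definition sqWxx j k (x : 'rV[R]_N) (v : R) : R := 'D_(e_ k) ('D_(e_ j) (fun y => sqW y v)) x.
Definition Wpair (p : 'rV[R]_N * R) : R := W p.1 p.2.
Definition Wx j (x : 'rV[R]_N) (s : R) : R := 'D_(e_ j, 0) Wpair (x, s).
Definition Ws (x : 'rV[R]_N) (s : R) : R := 'D_(0, 1) Wpair (x, s).

Lemma gam_bound : exists2 dl, 0 < dl & forall x, Om x -> dl <= gam x.
Proof.
have := pot_sep pot; set m := ereal_inf _ => m0.
have lb x : Om x -> (m <= (gam x)%:E)%E by move=> Ox; apply: ereal_inf_lbound; exists x.
move: m0 lb; case: m => [r||] m0 lb //.
- by exists r => [|x /lb]; rewrite -?lte_fin// lee_fin.
(* An infimum equal to +oo means that [Om] is empty. *)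
- by exists 1 => // x /lb.
Qed.

Lemma W_jcont : jcont Om W.
Proof. by move=> x s Ox; have [c _] := pot_C2 pot; exact: (c (x, s) (conj Ox I)). Qed.

Lemma Wd_jcont v : jcont Om (fun x s => 'D_v Wpair (x, s)).
Proof.
move=> x s Ox; have [_ /(_ v)[_ [/(_ (x, s) (conj Ox I))]]] := pot_C2 pot.
rewrite /prop_for /continuous_at => c _.
have -> : (fun p : 'rV[R]_N * R => 'D_v Wpair (p.1, p.2)) = 'D_v Wpair by apply/funext => -[].
exact: c.
Qed.

Lemma Wpair_derive v x s : Om x -> is_derive (x, s) v Wpair ('D_v Wpair (x, s)).
Proof.
move=> Ox; apply: (@Ck_is_derive _ _ (Om `*` setT) 1%N) => //; exact: pot_C2 pot.
Qed.

Lemma Wx_derive j x s : Om x -> is_derive x (e_ j) (fun y => W y s) (Wx j x s).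
Proof.
move=> Ox; apply: (is_derive_lineE _ _ _ _).2.
have := (is_derive_lineE _ _ _ _).1 (Wpair_derive (e_ j, 0) s Ox).
suff -> : (fun h : R => Wpair (h *: (e_ j, 0 : R) + (x, s))) = (fun h => W (h *: e_ j + x) s) by [].
by apply/funext => h; rewrite /Wpair /=; congr W; rewrite scaler0 add0r.
Qed.

Lemma Ws_derive x s : Om x -> is_derive s (1 : R) (W x) (Ws x s).
Proof.
move=> Ox; apply: (is_derive_lineE _ _ _ _).2.
have := (is_derive_lineE _ _ _ _).1 (Wpair_derive (0, 1) s Ox).
suff -> : (fun h : R => Wpair (h *: (0, 1 : R) + (x, s))) = (fun h => W x (h *: (1 : R) + s)) by [].
by apply/funext => h; rewrite /Wpair /=; congr W; rewrite scaler0 add0r.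
Qed.

Lemma Ck_closure_C1_on k f : Ck_closure k.+1 Om f -> forall j, C1_on Om j f ('D_(e_ j) f).
Proof.
move=> hf j; have [cf _] := hf; have [df cdf _] := Ck_closure_derive oOm (bounded_C2_domain Om_C2) (e_ j) hf.
by split => //; exact: (closure_cont_on oOm).
Qed.

Lemma a_C1 j : C1_on Om j a ('D_(e_ j) a). Proof. exact: Ck_closure_C1_on (pot_aC2 pot) j. Qed.
Lemma b_C1 j : C1_on Om j b ('D_(e_ j) b). Proof. exact: Ck_closure_C1_on (pot_bC2 pot) j. Qed.

Lemma C1_onB j (f g f' g' : 'rV[R]_N -> R) : C1_on Om j f f' -> C1_on Om j g g' ->
  C1_on Om j (fun x => f x - g x) (fun x => f' x - g' x).
Proof.
move=> [cf cf' df] [cg cg' dg]; split => x Ox.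
- by have c1 := cf x Ox; have c2 := cg x Ox; exact: (continuousB c1 c2).
- by have c1 := cf' x Ox; have c2 := cg' x Ox; exact: (continuousB c1 c2).
- by have d1 := df x Ox; have d2 := dg x Ox; exact: (is_deriveB d1 d2).
Qed.

Lemma gam_C1 j : C1_on Om j gam (gamx j).
Proof. exact: C1_onB (b_C1 j) (a_C1 j). Qed.

Lemma wells_cont_on x : Om x -> cont_on Om a /\ cont_on Om gam.
Proof.
move=> Ox; have ca : cont_on Om a by apply: (closure_cont_on oOm); case: (pot_aC2 pot).
have cb : cont_on Om b by apply: (closure_cont_on oOm); case: (pot_bC2 pot).
split => // y Oy; have c1 := ca y Oy; have c2 := cb y Oy; exact: (continuousB c2 c1).
Qed.

Lemma sqW_jcont : jcont Om sqW.
Proof.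
have c : jcont Om (W_norm W a b).
  move=> x v Ox; have [ca cg] := wells_cont_on Ox.
  have c1 := jcont_fst ca (s := v) Ox.
  have c2 := jcontM (jcont_fst cg) (@jcont_var _ _ Om) (s := v) Ox.
  have c3 : {for (x, v), continuous (fun p : 'rV[R]_N * R => a p.1 + gam p.1 * p.2)} by exact: continuousD c1 c2.
  apply: (@continuous_comp _ _ _ (fun p : 'rV[R]_N * R => (p.1, a p.1 + gam p.1 * p.2)) (fun p : 'rV[R]_N * R => W p.1 p.2)).
    exact: (cvg_pair (@cvg_fst _ _ _ _ _) c3).
  exact: W_jcont.
exact: (jcont_real (@sqrt_continuous R) c).
Qed.

Lemma sqWx_jcont j : jcont Om (sqWx j).
Proof. by apply: (continuous_ext_jcont Om_C2); case: (pot_sqrt_dx pot j). Qed.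

Lemma sqWxx_jcont j k : jcont Om (sqWxx j k).
Proof. by apply: (continuous_ext_jcont Om_C2); case: (pot_sqrt_dxx pot j k). Qed.

Lemma sqWx_derive j x v : Om x -> is_derive x (e_ j) (fun y => sqW y v) (sqWx j x v).
Proof. by move=> Ox; split => //; case: (pot_sqrt_dx pot j) => /(_ x v Ox). Qed.

Lemma sqWxx_derive j k x v : Om x -> is_derive x (e_ k) (fun y => sqWx j y v) (sqWxx j k x v).
Proof. by move=> Ox; split => //; case: (pot_sqrt_dxx pot j k) => /(_ x v Ox). Qed.

Lemma W_ge0 x s : Om x -> 0 <= W x s. Proof. exact: (pot_ge0 pot). Qed.

Lemma sqW_ge0 x v : 0 <= sqW x v. Proof. exact: sqrtr_ge0. Qed.

Lemma sqW_sq x v : Om x -> sqW x v ^+ 2 = W x (a x + gam x * v).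
Proof. by move=> Ox; rewrite sqr_sqrtr//; exact: W_ge0. Qed.

Lemma sqWx_le : exists2 C, 0 < C & forall j x v, Om x -> `|sqWx j x v| <= C * sqW x v.
Proof.
have [C [C0 hC]] := pot_sqrt_dx_le pot; exists C => // j x v Ox.
by have := coord_le_enorm (grad (fun y => sqW y v) x) j; rewrite mxE => /le_trans; apply; exact: hC.
Qed.

Lemma sqW0 x : Om x -> sqW x 0 = 0.
Proof.
move=> Ox; rewrite /sqW /W_norm mulr0 addr0.
by have -> : W x (a x) = 0; [apply/(pot_eq0 pot) => //; left|rewrite sqrtr0].
Qed.

Lemma sqW1 x : Om x -> sqW x 1 = 0.
Proof.
move=> Ox; rewrite /sqW /W_norm mulr1 addrC subrK.
by have -> : W x (b x) = 0; [apply/(pot_eq0 pot) => //; right|rewrite sqrtr0].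
Qed.

(** Continuity up to the closure is assumed only for the derivatives of sqrt(W_n) in x; the bound on
    sqrt(W_n) itself is deduced from them by [C2_domain_bounded]. *)
Lemma sqW_bounded : exists2 C, 0 < C & forall x v, Om x -> -3 <= v <= 3 -> `|sqW x v| <= C.
Proof.
have h j := continuous_ext_bounded Om_C2 3 (pot_sqrt_dx pot j).2.
have [M hM] : exists M, forall j x v, Om x -> -3 <= v <= 3 -> `|sqWx j x v| <= M.
  have /choice[M hM] : forall j, exists M, 0 < M /\ forall x v, Om x -> -3 <= v <= 3 -> `|sqWx j x v| <= M.
    by move=> j; have [M M0 hM] := h j; exists M.
  exists (\sum_j M j) => j x v Ox hv; rewrite (le_trans ((hM j).2 x v Ox hv))//.
  by rewrite (bigD1 j)//= lerDl sumr_ge0// => k _; exact: ltW (hM k).1.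
exact: (C2_domain_bounded Om_C2 sqW_jcont sqWx_derive hM).
Qed.

(* Differentiate W(x, a(x) + gamma(x) v) = sqW(x, v)^2 in x in two ways. *)
Lemma sqW_chain j x s v : Om x -> s = a x + gam x * v ->
  Wx j x s + Ws x s * ('D_(e_ j) a x + v * gamx j x) = 2 * sqW x v * sqWx j x v.
Proof.
move=> Ox ->.
have [ca _ da] := a_C1 j; have [cg _ dg] := gam_C1 j.
have dF : is_derive x (e_ j) (fun y => a y + gam y * v) ('D_(e_ j) a x + v * gamx j x).
  have d1 := da x Ox; have d2 := is_derive_mul (dg x Ox) (is_derive_cst v x (e_ j)).
  have := is_deriveD d1 d2; rewrite mulr0 add0r.
  by apply.
have cF : {for x, continuous (fun y => a y + gam y * v)}.
  have c1 := ca x Ox; have c2 := cg x Ox; have c3 : {for x, continuous (fun=> v)} by exact: cst_continuous.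
  have c4 := continuousM c2 c3; exact: (continuousD c1 c4).
have d1 := is_derive_comp2 oOm Ox (@Wd_jcont (0, 1)) (fun s => Wx_derive j s Ox)
  (fun y s Oy => Ws_derive s Oy) cF dF.
have d2 : is_derive x (e_ j) (fun y => sqW y v * sqW y v) (sqW x v * sqWx j x v + sqW x v * sqWx j x v).
  by have d := sqWx_derive j v Ox; exact: (is_derive_mul d d).
have d3 : is_derive x (e_ j) (fun y => W y (a y + gam y * v)) (sqW x v * sqWx j x v + sqW x v * sqWx j x v).
  apply: is_derive_near_eq d2.
  by apply: filterS (open_nbhs_nbhs (conj oOm Ox)) => y Oy; rewrite -expr2 sqW_sq.
have E1 := @derive_val _ _ _ _ _ _ _ d1; have E2 := @derive_val _ _ _ _ _ _ _ d3.
have tw (p r : R) : 2 * p * r = p * r + p * r by ring.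
rewrite tw; exact: (etrans (esym E1) E2).
Qed.

Lemma W_coercive : exists2 C, 0 < C & forall x s, Om x -> s ^+ 2 <= C * (W x s + C).
Proof.
have [C [C0 hC]] := pot_coercive pot; exists C => // x s Ox.
have := hC x s Ox; rewrite real_normK ?num_real// lerBlDr => h.
by rewrite -ler_pdivrMl.
Qed.

Lemma W_large (K : R) : exists2 S, 0 <= S & forall x s, Om x -> S <= `|s| -> K <= W x s.
Proof.
have [C C0 hC] := W_coercive.
exists (1 + C * (`|K| + C)); first by apply: addr_ge0 => //; apply: mulr_ge0; [exact: ltW|apply: addr_ge0 => //; exact: ltW].
move=> x s Ox hs; have := hC x s Ox.
have h1 : C * (`|K| + C) <= s ^+ 2.
  have S1 : 1 <= `|s| by apply: le_trans hs; rewrite lerDl; apply: mulr_ge0; [exact: ltW|apply: addr_ge0 => //; exact: ltW].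
  rewrite -real_normK ?num_real// expr2.
  apply: (@le_trans _ _ `|s|); first by rewrite (le_trans _ hs)// lerDr.
  by rewrite -[leLHS]mulr1 ler_wpM2l.
move=> h2; have := le_trans h1 h2; rewrite ler_pM2l// lerD2r => h3.
exact: le_trans (ler_norm K) h3.
Qed.

(** The substitution s = a + gamma v, carried out by exhibiting a primitive. The factor [theta] is
    invisible because it equals 1 on [0, 1]. *)
Lemma sigma_integral x : Om x -> \int[@lebesgue_measure R]_(s in `[a x, b x]) Num.sqrt (2 * W x s) =
  gam x * prim (fun v => Num.sqrt 2 * sqW x v * theta v) 1.
Proof.
move=> Ox; have [dl dl0 hdl] := gam_bound; have g0 : 0 < gam x := lt_le_trans dl0 (hdl x Ox).
pose k v := Num.sqrt 2 * sqW x v * theta v.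
have ck : continuous k.
  move=> v; have c1 := jcont_snd sqW_jcont Ox (s := v); have c2 := @theta_continuous R v.
  have c3 : {for v, continuous (fun=> Num.sqrt 2 : R)} by exact: cst_continuous.
  have c4 := continuousM c3 c1; exact: (continuousM c4 c2).
have k0 s : ~~ (-1 <= s <= 2) -> k s = 0 by move=> hs; rewrite /k theta_out// mulr0.
have dk := prim_derive ck k0.
pose F s := gam x * prim k ((gam x)^-1 * (s - a x)).
have dF s : is_derive s (1 : R) F (k ((gam x)^-1 * (s - a x))).
  have d1 : is_derive s (1 : R) (fun s => (gam x)^-1 * (s - a x)) (gam x)^-1.
    have := is_derive_mul (is_derive_cst (gam x)^-1 s (1 : R)) (is_deriveB (is_derive_id s (1 : R)) (is_derive_cst (a x) s (1 : R))).
    by rewrite mulr0 addr0 subr0 mulr1.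
  have := is_derive_mul (is_derive_cst (gam x) s (1 : R)) (is_derive_comp_real d1 (dk _)).
  by rewrite mulr0 addr0 mulrCA divff ?mulr1// gt_eqF.
have ab : a x < b x by rewrite -subr_gt0.
have kE s : a x <= s <= b x -> k ((gam x)^-1 * (s - a x)) = Num.sqrt (2 * W x s).
  move=> /andP[as_ sb]; rewrite /k theta1 ?mulr1; last first.
    apply/andP; split; first by rewrite mulr_ge0 ?invr_ge0 ?subr_ge0// ltW.
    by rewrite ler_pdivrMl// mulr1 lerB.
  rewrite sqrtrM// /sqW /W_norm -/(gam x) mulrA divff ?gt_eqF// mul1r addrC subrK//.
have cW : {within `[a x, b x], continuous (fun s => Num.sqrt (2 * W x s))}.
  apply: continuous_subspaceT => s.
  have c1 := jcont_snd W_jcont Ox (s := s); have c3 : {for s, continuous (fun=> 2 : R)} by exact: cst_continuous.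
  have c4 := continuousM c3 c1.
  by apply: (continuous_comp c4); exact: sqrt_continuous.
have cF : continuous F.
  by move=> s; apply/differentiable_continuous/derivable1_diffP; case: (dF s).
have LR : derivable_oo_LRcontinuous F (a x) (b x).
  split; first by move=> s _; case: (dF s).
  - exact: cvg_at_right_filter (cF _).
  - exact: cvg_at_left_filter (cF _).
have F' : {in `]a x, b x[, F^`()%classic =1 (fun s => Num.sqrt (2 * W x s))}.
  move=> s; rewrite in_itv /= => /andP[as_ sb]; rewrite derive1E.
  by rewrite (@derive_val _ _ _ _ _ _ _ (dF s)) kE// !ltW.
rewrite /Rintegral (continuous_FTC2 ab cW LR F') /=.
rewrite /F subrr mulr0 prim0 mulr0 subr0 -/(gam x) mulVf ?gt_eqF//.
Qed.

End potential_facts.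

(** * Primitives in the normalised variable *)

Section profiles.
Context {R : realType} {N : nat}.
Notation e_ i := (@basis_rV R N i).
Variable Om : set 'rV[R]_N.
Hypothesis oOm : open Om.
Variables (H : 'rV[R]_N -> R -> R) (Hx : 'I_N -> 'rV[R]_N -> R -> R).
Hypotheses (cH : jcont Om H) (cHx : forall j, jcont Om (Hx j)).
Hypothesis dH : forall j x s, Om x -> is_derive x (e_ j) (fun y => H y s) (Hx j x s).

(** The cut-off makes the primitive flat in v, as [weak_chain] requires; its value at v = 1 is still
    the full integral of K between the wells. *)
Definition profile (K : 'rV[R]_N -> R -> R) x v := prim (fun s => K x s * theta s) v.

Lemma jcont_theta K : jcont Om K -> jcont Om (fun x s => K x s * theta s).
Proof. by move=> cK; apply: jcontM => //; apply: (jcont_real (@theta_continuous R)); exact: jcont_var. Qed.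

Lemma theta_mul_out (K : 'rV[R]_N -> R -> R) x s : ~~ (-1 <= s <= 2) -> K x s * theta s = 0.
Proof. by move=> hs; rewrite theta_out// mulr0. Qed.

Lemma theta_flat K : flat Om (fun x s => K x s * theta s) 3.
Proof.
by apply: flatP => // x s Ox hs; rewrite !theta_mul_out// negb_and -!ltNge; apply/orP; (try by left; lra); right; lra.
Qed.

Lemma theta_dx j x s : Om x -> is_derive x (e_ j) (fun y => H y s * theta s) (Hx j x s * theta s).
Proof.
move=> Ox; have := is_derive_mul (dH j s Ox) (is_derive_cst (theta s) x (e_ j)).
by rewrite mulr0 add0r mulrC.
Qed.

Lemma profile_jcont K : jcont Om K -> jcont Om (profile K).
Proof. by move=> /jcont_theta cK; apply: (param_prim_jcont oOm cK); exact: theta_mul_out. Qed.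

Lemma profile_flat K : jcont Om K -> flat Om (profile K) 3.
Proof. by move=> /jcont_theta cK; exact: (param_prim_flat cK (@theta_mul_out K)). Qed.

Lemma profile_dx j x v : Om x -> is_derive x (e_ j) (fun y => profile H y v) (profile (Hx j) x v).
Proof.
have h y s : Om y -> is_derive y (e_ j) (fun y => H y s * theta s) (Hx j y s * theta s) by exact: theta_dx.
move=> Ox.
exact: (@param_prim_dx _ _ Om j (fun x s => H x s * theta s) (fun x s => Hx j x s * theta s) oOm
  (jcont_theta cH) (jcont_theta (@cHx j)) (@theta_mul_out H) (@theta_mul_out (Hx j)) h x v Ox).
Qed.

Lemma profile_ds x v : Om x -> is_derive v (1 : R) (profile H x) (H x v * theta v).
Proof. by exact: (param_prim_derive (jcont_theta cH) (@theta_mul_out H)). Qed.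

Lemma profile0 K x : profile K x 0 = 0. Proof. exact: prim0. Qed.

Lemma profile_cont_on K v : jcont Om K -> cont_on Om (fun x => profile K x v).
Proof.
move=> cK x Ox; apply: (jcont_comp (profile_jcont cK) Ox (f := fun=> v)); exact: cst_continuous.
Qed.

Lemma profile_C1 j v : C1_on Om j (fun x => profile H x v) (fun x => profile (Hx j) x v).
Proof. by split; [exact: profile_cont_on|exact: profile_cont_on|move=> x; exact: profile_dx]. Qed.

Lemma profile_bound (C v : R) x : Om x -> (forall s, -3 <= s <= 3 -> `|H x s| <= C) -> `|profile H x v| <= C * `|v|.
Proof.
move=> Ox hC; apply: (primitive_bound v (fun s => profile_ds s Ox)); first exact: profile0.
have C0 : 0 <= C by apply: le_trans (normr_ge0 _) (hC 0 _); lra.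
move=> s; have [hs|hs] := boolP (-1 <= s <= 2); last by rewrite theta_mul_out// normr0.
have /andP[t0 t1] := theta_bounds s.
rewrite normrM -[leRHS]mulr1 ler_pM//; first by apply: hC; lra.
by rewrite ger0_norm.
Qed.

End profiles.

(** * The variation as an integral *)

Section truncation.
Context {R : realType}.

(* s for s <= 1, constant for s >= 2 *)
Definition beta (s : R) : R := s - 2^-1 * possq (s - 1) + 2^-1 * possq (s - 2).
Definition beta' (s : R) : R := 1 - Num.max 0 (s - 1) + Num.max 0 (s - 2).

Lemma beta_derive (s : R) : is_derive s (1 : R) beta (beta' s).
Proof.
have d c := is_derive_mul (is_derive_cst (2^-1 : R) s (1 : R)) (possq_shift_derive c s).
have := is_deriveD (is_deriveB (is_derive_id s (1 : R)) (d 1)) (d 2).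
by rewrite !mulr0 !addr0 !mulKf ?pnatr_eq0.
Qed.

Lemma beta'_continuous : continuous beta'.
Proof.
move=> s; have c1 := @max0B_continuous R 1 s; have c2 := @max0B_continuous R 2 s.
have c0 : {for s, continuous (fun=> 1 : R)} by exact: cst_continuous.
have c3 := continuousB c0 c1; exact: (continuousD c3 c2).
Qed.

Lemma beta_continuous : continuous beta.
Proof.
by move=> s; apply/differentiable_continuous/derivable1_diffP; case: (beta_derive s).
Qed.

Lemma beta'_bounds (s : R) : 0 <= beta' s <= 1.
Proof.
rewrite /beta'; have [h1|h1] := lerP (s - 1) 0; have [h2|h2] := lerP (s - 2) 0; apply/andP; split; lra.
Qed.

Lemma beta_le1 (s : R) : s <= 1 -> beta s = s.
Proof.
by move=> s1; rewrite /beta /possq !max_l ?subr_le0//; [ring|lra].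
Qed.

Lemma beta'_le1 (s : R) : s <= 1 -> beta' s = 1.
Proof.
by move=> s1; rewrite /beta' !max_l ?subr_le0//; [ring|lra].
Qed.

Lemma beta'_ge2 (s : R) : 2 <= s -> beta' s = 0.
Proof.
by move=> s2; rewrite /beta' !max_r ?subr_ge0//; [ring|lra].
Qed.

Lemma beta_ge2 (s : R) : 2 <= s -> beta s = 3 / 2.
Proof.
by move=> s2; rewrite /beta /possq !max_r ?subr_ge0//; [field|lra].
Qed.

Lemma beta_bounds (s : R) : 0 <= s -> 0 <= beta s <= s.
Proof.
move=> s0; rewrite /beta /possq; have [h1|h1] := lerP (s - 1) 0; have [h2|h2] := lerP (s - 2) 0; apply/andP; split; nra.
Qed.

(** The identity up to K and constant from 2K on, with derivative between 0 and 1 whatever K is. *)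
Definition trunc (K s : R) : R := K * beta (s / K).

Lemma trunc_derive (K s : R) : 0 < K -> is_derive s (1 : R) (trunc K) (beta' (s / K)).
Proof.
move=> K0; have d0 : is_derive s (1 : R) (fun s => s / K) K^-1.
  have := is_derive_mul (is_derive_id s (1 : R)) (is_derive_cst K^-1 s (1 : R)).
  by rewrite mulr0 add0r mulr1.
have := is_derive_mul (is_derive_cst K s (1 : R)) (is_derive_comp_real d0 (beta_derive _)).
by rewrite mulr0 addr0 mulrCA divff ?mulr1// gt_eqF.
Qed.

Lemma scale_continuous (K : R) : continuous (fun s : R => s / K).
Proof.
move=> s; have c1 : {for s, continuous (fun s : R => s)} by exact: cvg_id.
have c2 : {for s, continuous (fun=> K^-1 : R)} by exact: cst_continuous.
exact: (continuousM c1 c2).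
Qed.

Lemma trunc_continuous (K : R) : continuous (trunc K).
Proof.
move=> s; have c1 : {for s, continuous (fun=> K : R)} by exact: cst_continuous.
have c2 : {for s, continuous (fun s : R => beta (s / K))}.
  by apply: (continuous_comp (scale_continuous (K := K) (x := s))); exact: beta_continuous.
exact: (continuousM c1 c2).
Qed.

Lemma trunc'_continuous (K : R) : continuous (fun s : R => beta' (s / K)).
Proof.
by move=> s; apply: (continuous_comp (scale_continuous (K := K) (x := s))); exact: beta'_continuous.
Qed.

Lemma trunc_bounds (K s : R) : 0 < K -> 0 <= s -> 0 <= trunc K s <= s.
Proof.
move=> K0 s0; have /beta_bounds/andP[h1 h2] : 0 <= s / K by rewrite divr_ge0// ltW.
rewrite /trunc mulr_ge0 ?(ltW K0)//=.
by rewrite -[leRHS](divfK (lt0r_neq0 K0)) mulrC ler_pM2r.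
Qed.

Lemma trunc_le (K s : R) : 0 < K -> s <= K -> trunc K s = s.
Proof. by move=> K0 sK; rewrite /trunc beta_le1 ?ler_pdivrMr ?mul1r// mulrC divfK// gt_eqF. Qed.

Lemma trunc'_le (K s : R) : 0 < K -> s <= K -> beta' (s / K) = 1.
Proof. by move=> K0 sK; rewrite beta'_le1// ler_pdivrMr ?mul1r. Qed.

Lemma trunc_ge (K s : R) : 0 < K -> 2 * K <= s -> trunc K s = K * (3 / 2).
Proof. by move=> K0 sK; rewrite /trunc beta_ge2// ler_pdivlMr. Qed.

Lemma trunc'_ge (K s : R) : 0 < K -> 2 * K <= s -> beta' (s / K) = 0.
Proof. by move=> K0 sK; rewrite beta'_ge2// ler_pdivlMr. Qed.

End truncation.

(** * Integration by parts for unbounded densities *)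

Section truncated_ibp.
Context {R : realType} {N : nat}.
Notation mu := (@lebesgueN R N).
Notation e_ i := (@basis_rV R N i).
Variable Om : set 'rV[R]_N.
Hypothesis Om_C2 : C2_domain Om.
Let oOm : open Om := open_C2_domain Om_C2.
Let bOm : bounded_set Om := bounded_C2_domain Om_C2.
Let mOm : measurable Om := open_measurable_rV oOm.
Variable Psi : 'rV[R]_N -> 'rV[R]_N.
Hypothesis Psi_C1 : forall i, Ck_closure 1 Om (fun x => Psi x 0 i).
Hypothesis Psi_tan : forall x, bdry Om x -> dot (Psi x) (outer_normal Om x) = 0.

Definition divg (x : 'rV[R]_N) : R := \sum_j 'D_(e_ j) (fun y => Psi y 0 j) x.

Lemma cont_on_sum (I : Type) (s : seq I) (h : I -> 'rV[R]_N -> R) : (forall i, cont_on Om (h i)) ->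
  cont_on Om (fun x => \sum_(i <- s) h i x).
Proof. by move=> ch x Ox; apply: continuous_sum_seq => i; exact: ch. Qed.

Lemma cont_on_measurable f : cont_on Om f -> measurable_fun Om f.
Proof. exact: continuous_measurable_rV. Qed.

Lemma divg_cont : cont_on Om divg.
Proof. by apply: cont_on_sum => j; case: (Ck_closure_derive oOm bOm (e_ j) (@Psi_C1 j)). Qed.

Lemma divg_bound : exists2 M, 0 <= M & forall x, Om x -> `|divg x| <= M.
Proof.
have /choice[M hM] : forall j, exists M, 0 < M /\ forall x, Om x -> `|'D_(e_ j) (fun y => Psi y 0 j) x| <= M.
  by move=> j; have [_ _ [M M0 hM]] := Ck_closure_derive oOm bOm (e_ j) (@Psi_C1 j); exists M.
exists (\sum_j M j); first by apply: sumr_ge0 => j _; exact: ltW (hM j).1.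
move=> x Ox; rewrite (le_trans (ler_norm_sum _ _ _))//.
by apply: ler_sum => j _; exact: (hM j).2.
Qed.

(* [weak_chain] only differentiates G(x, f) when G(x, .) is constant near
   infinity, whence the truncations, removed by dominated convergence. *)
Lemma trunc_ibp f (g : 'I_N -> 'rV[R]_N -> R) : (forall x, Om x -> 0 <= f x) -> itg mu Om f ->
  measurable_fun Om (fun x => \sum_j g j x * Psi x 0 j) ->
  (forall K j, 0 < K -> is_weak_partial Om j (fun x => trunc K (f x)) (fun x => beta' (f x / K) * g j x)) ->
  itg mu Om (fun x => \sum_j g j x * Psi x 0 j) ->
  \int[mu]_(x in Om) (f x * divg x + \sum_j g j x * Psi x 0 j) = 0.
Proof.
move=> f0 fi mG wf Gi; have [M M0 hM] := divg_bound.
have mf := itg_measurable fi.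
have mdiv := cont_on_measurable divg_cont.
pose F n x := trunc n.+1%:R (f x) * divg x + beta' (f x / n.+1%:R) * \sum_j g j x * Psi x 0 j.
have K0 n : 0 < n.+1%:R :> R by rewrite ltr0n.
have mtr n : measurable_fun Om (fun x => trunc n.+1%:R (f x)).
  exact: (measurableT_comp (continuous_measurable_fun (@trunc_continuous R n.+1%:R)) mf).
have mtr' n : measurable_fun Om (fun x => beta' (f x / n.+1%:R)).
  exact: (measurableT_comp (continuous_measurable_fun (@trunc'_continuous R n.+1%:R)) mf).
have mF n : measurable_fun Om (F n) by apply: measurable_funD; apply: measurable_funM.
have tb n x : Om x -> `|trunc n.+1%:R (f x)| <= f x.
  by move=> Ox; have /andP[h1 h2] := trunc_bounds (K0 n) (f0 x Ox); rewrite ger0_norm.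
have bb n x : `|beta' (f x / n.+1%:R)| <= 1.
  by have /andP[h1 h2] := beta'_bounds (f x / n.+1%:R); rewrite ger0_norm.
have gi : itg mu Om (fun x => M * f x + `|\sum_j g j x * Psi x 0 j|).
  by apply: (itgD mOm); [exact: (itgZ mOm)|exact: itg_norm].
have Fcvg x : Om x -> F n x @[n --> \oo] --> f x * divg x + \sum_j g j x * Psi x 0 j.
  move=> Ox; apply: cvg_near_cst.
  near=> n.
  have fn : f x <= n.+1%:R.
    rewrite (@le_trans _ _ n%:R)// ?ler_nat//; near: n; exact: nbhs_infty_ger.
  by rewrite /F trunc_le// trunc'_le// mul1r.
have Fb n x : Om x -> `|F n x| <= M * f x + `|\sum_j g j x * Psi x 0 j|.
  move=> Ox; rewrite /F (le_trans (ler_normD _ _))// lerD// normrM.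
    by rewrite mulrC ler_pM//; [exact: hM|exact: tb].
  by rewrite -[leRHS]mul1r ler_wpM2r.
have [_ cF] := Rintegral_dominated mOm mF Fcvg gi Fb.
have F0 n : \int[mu]_(x in Om) F n x = 0.
  have ti : itg mu Om (fun x => trunc n.+1%:R (f x)) by apply: (itg_le mOm _ _ fi) => // x; exact: tb.
  have E x : \sum_j (beta' (f x / n.+1%:R) * g j x) * Psi x 0 j = beta' (f x / n.+1%:R) * \sum_j g j x * Psi x 0 j.
    by rewrite mulr_sumr; apply: eq_bigr => j _; rewrite mulrA.
  have gi' : itg mu Om (fun x => \sum_j (beta' (f x / n.+1%:R) * g j x) * Psi x 0 j).
    apply: (itg_eq mOm (f := fun x => (\sum_j g j x * Psi x 0 j) * beta' (f x / n.+1%:R))).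
      by move=> x _; rewrite E mulrC.
    by apply: (itgM_bounded mOm (C := 1)) => // x _.
  have := tangential_ibp oOm bOm Psi_C1 Om_C2 Psi_tan (fun j => wf n.+1%:R j (K0 n)) ti gi'.
  by move=> <-; apply: eq_Rintegral => x _; rewrite /F E.
have {}cF : (fun=> 0 : R) @ \oo --> \int[mu]_(x in Om) (f x * divg x + \sum_j g j x * Psi x 0 j).
  by move: cF; under eq_cvg do rewrite F0.
exact: (cvg_unique _ cF (cvg_cst 0)).
Unshelve. all: by end_near. Qed.

End truncated_ibp.

Section weak_truncations.
Context {R : realType} {N : nat}.
Notation e_ i := (@basis_rV R N i).
Variable Om : set 'rV[R]_N.
Hypothesis Om_C2 : C2_domain Om.
Let oOm : open Om := open_C2_domain Om_C2.
Let bOm : bounded_set Om := bounded_C2_domain Om_C2.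

(** As H >= 2K for large |s|, its truncation is constant and the derivatives vanish there:
    everything is flat and [weak_chain] applies. *)
Lemma weak_trunc (H : 'rV[R]_N -> R -> R) Hx Hs i f g (K : R) : 0 < K ->
  jcont Om H -> jcont Om Hx -> jcont Om Hs ->
  (forall x s, Om x -> is_derive x (e_ i) (fun y => H y s) (Hx x s)) ->
  (forall x s, Om x -> is_derive s (1 : R) (H x) (Hs x s)) ->
  (exists2 S, 0 <= S & forall x s, Om x -> S <= `|s| -> 2 * K <= H x s) ->
  is_weak_partial Om i f g ->
  is_weak_partial Om i (fun x => trunc K (H x (f x)))
    (fun x => beta' (H x (f x) / K) * (Hx x (f x) + Hs x (f x) * g x)).
Proof.
move=> K0 cH cHx cHs dHx dHs [S S0 hS] wf.
have big x s : Om x -> S < s \/ s < - S -> 2 * K <= H x s.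
  move=> Ox h; apply: hS => //; case: h => h; first by rewrite (le_trans (ltW h))// ler_norm.
  by rewrite -normrN (le_trans _ (ler_norm _))// lerNr ltW.
have big' x : Om x -> 2 * K <= H x S /\ 2 * K <= H x (- S).
  by move=> Ox; split; apply: hS => //; rewrite ?normrN ger0_norm.
have flat_of (Q : 'rV[R]_N -> R -> R) : (forall x s, Om x -> 2 * K <= H x s -> Q x s = Q x S) -> flat Om Q S.
  move=> hQ; apply: flatP => // x s Ox hs; first by apply: hQ => //; apply: big => //; left.
  by rewrite (hQ x s) ?(hQ x (- S))//; [exact: (big' x Ox).2|apply: big => //; right].
have c1 := jcont_real (@trunc_continuous R K) cH.
have c0 := jcont_real (@trunc'_continuous R K) cH.
have c2 := jcontM c0 cHx; have c3 := jcontM c0 cHs.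
have f1 : flat Om (fun x s => trunc K (H x s)) S.
  by apply: flat_of => x s Ox hs; rewrite !trunc_ge//; exact: (big' x Ox).1.
have f2 : flat Om (fun x s => beta' (H x s / K) * Hx x s) S.
  by apply: flat_of => x s Ox hs; rewrite !trunc'_ge ?mul0r//; exact: (big' x Ox).1.
have f3 : flat Om (fun x s => beta' (H x s / K) * Hs x s) S.
  by apply: flat_of => x s Ox hs; rewrite !trunc'_ge ?mul0r//; exact: (big' x Ox).1.
have d1 x s : Om x -> is_derive x (e_ i) (fun y => trunc K (H y s)) (beta' (H x s / K) * Hx x s).
  by move=> Ox; exact: (is_derive_comp_real (dHx x s Ox) (trunc_derive _ K0)).
have d2 x s : Om x -> is_derive s (1 : R) (fun s => trunc K (H x s)) (beta' (H x s / K) * Hs x s).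
  by move=> Ox; exact: (is_derive_comp_real (dHs x s Ox) (trunc_derive _ K0)).
have w := weak_chain oOm bOm S0 wf c1 c2 c3 f1 f2 f3 d1 d2.
have <- // : (fun x => beta' (H x (f x) / K) * Hx x (f x) + beta' (H x (f x) / K) * Hs x (f x) * g x) =
  (fun x => beta' (H x (f x) / K) * (Hx x (f x) + Hs x (f x) * g x)).
by apply/funext => x; rewrite mulrDr mulrA.
Qed.

Lemma weak_trunc_sq i f g (K : R) : 0 < K -> is_weak_partial Om i f g ->
  is_weak_partial Om i (fun x => trunc K (f x ^+ 2)) (fun x => beta' (f x ^+ 2 / K) * (2 * f x * g x)).
Proof.
move=> K0 wf.
have c1 : jcont Om (fun _ s => s ^+ 2) by exact: jcontM (@jcont_var _ _ Om) (@jcont_var _ _ Om).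
have c2 : jcont Om (fun _ _ => 0) by move=> x s _; exact: cst_continuous.
have c3 : jcont Om (fun _ s => 2 * s).
  by apply: jcontM; [move=> x s _; exact: cst_continuous|exact: jcont_var].
have d1 (x : 'rV[R]_N) (s : R) : Om x -> is_derive x (e_ i) (fun=> s ^+ 2) 0 by move=> _; exact: is_derive_cst.
have d2 (x : 'rV[R]_N) (s : R) : Om x -> is_derive s (1 : R) (fun s => s ^+ 2) (2 * s).
  move=> _; have := is_derive_mul (is_derive_id s (1 : R)) (is_derive_id s (1 : R)).
  by rewrite mulr1 -mulr2n mulr_natl.
have d3 : exists2 S : R, 0 <= S & forall (x : 'rV[R]_N) (s : R), Om x -> S <= `|s| -> 2 * K <= s ^+ 2.
  exists (2 * K + 1); first by rewrite addr_ge0// mulr_ge0// ltW.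
  move=> _ s _ hs; rewrite -real_normK ?num_real// expr2; nra.
have w := weak_trunc K0 c1 c2 c3 d1 d2 d3 wf.
have <- // : (fun x => beta' (f x ^+ 2 / K) * (0 + 2 * f x * g x)) = (fun x => beta' (f x ^+ 2 / K) * (2 * f x * g x)).
by apply/funext => x; rewrite add0r.
Qed.

Lemma weak_trunc_W W a b i f g (K : R) : potential Om W a b -> 0 < K -> is_weak_partial Om i f g ->
  is_weak_partial Om i (fun x => trunc K (W x (f x)))
    (fun x => beta' (W x (f x) / K) * (Wx W i x (f x) + Ws W x (f x) * g x)).
Proof.
move=> pot K0 wf.
have cx : jcont Om (Wx W i) := @Wd_jcont _ _ _ _ _ _ pot (e_ i, 0).
have cs : jcont Om (Ws W) := @Wd_jcont _ _ _ _ _ _ pot (0, 1).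
have dx x s (Ox : Om x) := Wx_derive pot i s Ox; have ds x s (Ox : Om x) := Ws_derive pot s Ox.
exact: (weak_trunc K0 (W_jcont pot) cx cs dx ds (W_large pot (2 * K)) wf).
Qed.

End weak_truncations.

(** * Square integrable functions and Sobolev representatives *)

Section square_integrable.
Context {R : realType} {N : nat}.
Notation mu := (@lebesgueN R N).
Variable Om : set 'rV[R]_N.
Hypotheses (oOm : open Om) (bOm : bounded_set Om).
Let mOm : measurable Om := open_measurable_rV oOm.
Implicit Types f g c : 'rV[R]_N -> R.

Lemma L2_measurable f : L2 Om f -> measurable_fun Om f. Proof. by case. Qed.

Lemma L2_sq f : L2 Om f -> itg mu Om (fun x => f x ^+ 2). Proof. by case. Qed.

Lemma L2_mul f g : L2 Om f -> L2 Om g -> itg mu Om (fun x => f x * g x).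
Proof.
move=> [mf hf] [mg hg]; apply: (itg_le mOm (g := fun x => f x ^+ 2 + g x ^+ 2)).
- exact: measurable_funM.
- move=> x _; rewrite normrM -(real_normK (num_real (f x))) -(real_normK (num_real (g x))).
  move: (normr_ge0 (f x)) (normr_ge0 (g x)); nra.
- exact: (itgD mOm).
Qed.

Lemma L2D f g : L2 Om f -> L2 Om g -> L2 Om (fun x => f x + g x).
Proof.
move=> hf hg; have fg := L2_mul hf hg; case: hf hg => mf hf [mg hg]; split; first exact: measurable_funD.
have := itgD mOm (itgD mOm hf hg) (itgZ mOm 2 fg).
by apply: (itg_eq mOm) => x _; ring.
Qed.

Lemma L2M_bounded f c (M : R) : L2 Om f -> measurable_fun Om c -> (forall x, Om x -> `|c x| <= M) ->
  L2 Om (fun x => f x * c x).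
Proof.
move=> [mf hf] mc hM; split; first exact: measurable_funM.
have h := itgM_bounded mOm (C := M ^+ 2) (measurable_funX 2 mc) _ hf.
apply: (itg_eq mOm) (h _) => [x _|x Ox]; first by rewrite exprMn.
by rewrite normrX lerXn2r ?nnegrE// ?(le_trans (normr_ge0 _) (hM x Ox))//; exact: hM.
Qed.

Lemma L2_bounded c (M : R) : measurable_fun Om c -> (forall x, Om x -> `|c x| <= M) -> L2 Om c.
Proof.
move=> mc hM; split => //; apply: (itg_bounded mOm (C := M ^+ 2)); first exact: lebesgueN_bounded.
  exact: measurable_funX.
move=> x Ox; rewrite normrX lerXn2r ?nnegrE// ?(le_trans (normr_ge0 _) (hM x Ox))//; exact: hM.
Qed.

Lemma L2_itg f : L2 Om f -> itg mu Om f.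
Proof.
move=> hf; have h1 : L2 Om (fun=> 1 : R) by apply: (L2_bounded (M := 1)) => // x _; rewrite normr1.
by have := L2_mul hf h1; apply: (itg_eq mOm) => x _; rewrite mulr1.
Qed.

Lemma L2_ae f g : measurable_fun Om g -> ae_eq mu Om f g -> L2 Om f -> L2 Om g.
Proof.
move=> mg fg [mf hf]; split => //; apply: (itg_ae_eq mOm) hf; first exact: measurable_funX.
by apply: filterS fg => x h Ox; rewrite h.
Qed.

Lemma weak_measurable i f g : is_weak_partial Om i f g -> measurable_fun Om f /\ measurable_fun Om g.
Proof. by case=> -[? _] [? _] _. Qed.

Lemma ae_eq_reflx (f : 'rV[R]_N -> R) : ae_eq mu Om f f.
Proof. exact: ae_eq_refl. Qed.

Lemma Hk_L2 k f : Hk k Om f -> L2 Om f. Proof. by case: k => [|k] []. Qed.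

Lemma Hk_ae k f g : measurable_fun Om g -> ae_eq mu Om f g -> Hk k Om f -> Hk k Om g.
Proof.
move=> mg fg; case: k => [|k] [hf h]; (split; first exact: L2_ae hf); first by [].
move=> i; have [g' [wg' hg']] := h i; exists g'; split => //.
by apply: (weak_ae oOm wg') => //; [exact: (weak_measurable wg').2|exact: ae_eq_reflx].
Qed.

Lemma weak_partialP i f g : is_weak_partial Om i f g ->
  is_weak_partial Om i f (weak_partial Om i f) /\ ae_eq mu Om g (weak_partial Om i f).
Proof.
move=> w; have w' : is_weak_partial Om i f (weak_partial Om i f).
  by rewrite /weak_partial; apply: (@xgetPex _ (cst 0) [set g | is_weak_partial Om i f g]); exists g.
by split => //; exact: (weak_partial_unique oOm bOm w w').
Qed.

Lemma Hk_weak k f i : Hk k.+1 Om f ->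
  is_weak_partial Om i f (weak_partial Om i f) /\ Hk k Om (weak_partial Om i f).
Proof.
move=> [_ /(_ i)[g [wg hg]]]; have [w e] := weak_partialP wg; split => //.
by apply: Hk_ae hg => //; exact: (weak_measurable w).2.
Qed.

End square_integrable.

(** * Pointwise expansion of the first variation *)

Section variation_formula.
Context {R : realType} {N : nat}.
Notation mu := (@lebesgueN R N).
Notation e_ i := (@basis_rV R N i).
Variable Om : set 'rV[R]_N.
Hypotheses (oOm : open Om) (bOm : bounded_set Om).
Let mOm : measurable Om := open_measurable_rV oOm.
Variables (a g : 'rV[R]_N -> R) (aj gj : 'I_N -> 'rV[R]_N -> R) (ajj gjj : 'I_N -> 'I_N -> 'rV[R]_N -> R).
Hypotheses (aC1 : forall j, C1_on Om j a (aj j)) (gC1 : forall j, C1_on Om j g (gj j)).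
Hypotheses (ajC1 : forall j i, C1_on Om i (aj j) (ajj j i)) (gjC1 : forall j i, C1_on Om i (gj j) (gjj j i)).
Hypotheses (cg : cont_on Om g) (g0 : forall x, Om x -> g x != 0).
Variables (Ps : 'I_N -> 'rV[R]_N -> R) (Psj : 'I_N -> 'I_N -> 'rV[R]_N -> R).
Hypothesis PsC1 : forall j i, C1_on Om i (Ps j) (Psj j i).
Variables (u : 'rV[R]_N -> R) (uj : 'I_N -> 'rV[R]_N -> R) (ujj : 'I_N -> 'I_N -> 'rV[R]_N -> R).
Hypotheses (wu : forall i, is_weak_partial Om i u (uj i)) (wuj : forall i j, is_weak_partial Om j (uj i) (ujj i j)).

Let v x := (u x - a x) / g x.
Let vj i x := (uj i x - aj i x) * (g x)^-1 + (u x - a x) * (- (g x)^-2 * gj i x).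
(** This is gamma D_j v written without division; [zz j i] is its weak derivative in direction i. *)
Let z j x := uj j x - aj j x - v x * gj j x.
Let zz j i x := ujj j i x - ajj j i x - (vj i x * gj j x + v x * gjj j i x).

Lemma inv_C1 i : C1_on Om i (fun x => (g x)^-1) (fun x => - (g x)^-2 * gj i x).
Proof.
have [_ cg' dg] := gC1 i; split => x Ox.
- by apply: (@continuousV _ _ g) => //; [exact: g0|exact: (@cg x Ox)].
- have c1 := @cg x Ox; have c2 := continuousM c1 c1.
  have c3 : {for x, continuous (fun y => (g y * g y)^-1)}.
    by apply: (@continuousV _ _ (fun y => g y * g y)) => //; rewrite mulf_neq0// g0.
  have c4 := continuousN c3; have c5 := cg' x Ox; have c6 := continuousM c4 c5.
  exact: c6.
- by apply: is_derive_inv; [exact: g0|exact: dg].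
Qed.

Lemma weak_v i : is_weak_partial Om i v (vj i).
Proof.
have w1 := weakB oOm bOm (wu i) (weak_C1 oOm bOm (aC1 i)).
exact: (weak_mul oOm bOm w1 (inv_C1 i)).
Qed.

Lemma weak_z j i : is_weak_partial Om i (z j) (zz j i).
Proof.
have w1 := weakB oOm bOm (wuj j i) (weak_C1 oOm bOm (ajC1 j i)).
exact: (weakB oOm bOm w1 (weak_mul oOm bOm (weak_v i) (gjC1 j i))).
Qed.

Lemma weak_direction i : is_weak_partial Om i (fun x => \sum_j z j x * Ps j x)
  (fun x => \sum_j (zz j i x * Ps j x + z j x * Psj j i x)).
Proof. by apply: (weak_sum oOm bOm) => j; exact: (weak_mul oOm bOm (weak_z j i) (PsC1 j i)). Qed.

Lemma ae_all_ord (P : 'I_N -> 'rV[R]_N -> Prop) : (forall i, {ae mu, forall x, Om x -> P i x}) ->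
  {ae mu, forall x, Om x -> forall i, P i x}.
Proof.
move=> h; have : {ae mu, forall x, forall n : nat, forall i : 'I_N, n = i :> nat -> Om x -> P i x}.
  apply: ae_foralln => n; have [nN|nN] := ltnP n N.
    by apply: filterS (h (Ordinal nN)) => x hx i ni; have -> : i = Ordinal nN; [exact/val_inj|].
  by apply: aeW => x i ni; move: nN; rewrite ni leqNgt ltn_ord.
by apply: filterS => x hx Ox i; exact: (hx i i).
Qed.

(** [variation_dir] is built on the selected representative of grad v, so it agrees with the
    explicit formula only almost everywhere, and its measurability is a separate matter. *)
Lemma variation_dir_ae (Psi : 'rV[R]_N -> 'rV[R]_N) b : (forall x j, Psi x 0 j = Ps j x) ->
  (forall x, b x - a x = g x) ->
  ae_eq mu Om (variation_dir Om a b Psi u) (fun x => \sum_j z j x * Ps j x) /\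
  measurable_fun Om (variation_dir Om a b Psi u).
Proof.
move=> PsE gE.
have vE : (fun y => (u y - a y) / (b y - a y)) = v by apply/funext => x; rewrite gE.
have h j := weak_partialP oOm bOm (weak_v j).
split.
  have := ae_all_ord (fun j => (h j).2); apply: filterS => x hx Ox.
  rewrite /variation_dir gE /dot mulr_sumr; apply: eq_bigr => j _.
  rewrite mxE vE PsE -(hx Ox j) mulrA; congr (_ * _).
  rewrite /vj /z /v; move: (g0 Ox); move: (g x) (u x) (a x) (uj j x) (aj j x) (gj j x) => G U A Uj Aj Gj G0.
  by field.
rewrite (_ : variation_dir _ _ _ _ _ = fun x => g x * \sum_j weak_partial Om j v x * Ps j x); last first.
  by apply/funext => x; rewrite /variation_dir gE /dot vE; congr (_ * _); apply: eq_bigr => j _; rewrite mxE PsE.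
apply: measurable_funM.
  exact: continuous_measurable_rV.
apply: measurable_sum => j; apply: measurable_funM; first exact: (weak_measurable (h j).1).2.
by have [cP _ _] := PsC1 j j; exact: continuous_measurable_rV.
Qed.

(** [var_c] and [var_d] gather what D_i of the direction contains without derivatives of u, split
    into the part free of v and the coefficient of v. *)
Definition var_c i x := \sum_j (- ajj j i x * Ps j x + (g x)^-1 * aj i x * gj j x * Ps j x - aj j x * Psj j i x).
Definition var_d i x := \sum_j ((g x)^-1 * gj i x * gj j x * Ps j x - gjj j i x * Ps j x - gj j x * Psj j i x).

(* The last three lines collect what is not a derivative of the energy density: the
   explicit x-dependence of W_n, the stress eps D_i u D_j u, and lower order terms. *)
Lemma variation_density_ae (W : 'rV[R]_N -> R -> R) b (Psi : 'rV[R]_N -> 'rV[R]_N) (eps : R) (wx Qj : 'I_N -> 'rV[R]_N -> R) :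
  (forall x j, Psi x 0 j = Ps j x) -> (forall x, b x - a x = g x) ->
  (forall i, uj i = weak_partial Om i u) ->
  (forall x j, Om x -> wx j x + 'D_1 (W x) (u x) * (aj j x + v x * gj j x) = Qj j x) ->
  ae_eq mu Om (variation_density Om W a b Psi eps u) (fun x =>
    eps^-1 * (\sum_j (wx j x + 'D_1 (W x) (u x) * uj j x) * Ps j x) +
    eps / 2 * (\sum_i \sum_j 2 * uj i x * ujj i j x * Ps j x) -
    eps^-1 * (\sum_j Qj j x * Ps j x) +
    eps * (\sum_i \sum_j (uj i x * uj j x * Psj j i x - uj i x ^+ 2 * (gj j x / g x * Ps j x))) +
    eps * (\sum_i uj i x * (var_c i x + v x * var_d i x))).
Proof.
move=> PsE gE ujE wE.
have [Ye mY] := variation_dir_ae PsE gE.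
have wY i : is_weak_partial Om i (variation_dir Om a b Psi u)
    (fun x => \sum_j (zz j i x * Ps j x + z j x * Psj j i x)).
  apply: (weak_ae oOm (weak_direction i)) => //.
  - exact: (weak_measurable (weak_direction i)).2.
  - by apply: filterS Ye => x h Ox; rewrite h.
  - exact: ae_eq_reflx.
have eY := ae_all_ord (fun i => (weak_partialP oOm bOm (wY i)).2).
have sym i : {ae mu, forall x, Om x -> forall j, ujj j i x = ujj i j x}.
  apply: ae_all_ord => j.
  exact: (weak_mixed_partials oOm bOm (wu j) (wu i) (wuj j i) (wuj i j)).
have := ae_all_ord (P := fun i x => forall j, ujj j i x = ujj i j x) sym.
apply: filterS2 (filterI Ye eY) => x [Yx eYx] sx Ox.
have {}Yx := Yx Ox; have {}eYx := eYx Ox; have {}sx := sx Ox.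
rewrite /variation_density Yx /dot.
have -> : \sum_(i < N) weak_grad Om u x 0 i * weak_grad Om (variation_dir Om a b Psi u) x 0 i =
    \sum_i uj i x * \sum_j (zz j i x * Ps j x + z j x * Psj j i x).
  by apply: eq_bigr => i _; rewrite !mxE -(eYx i) ujE.
move: (wE x) => {wE eYx Yx}; move: ('D_1 (W x) (u x)) => ws wE.
have -> : eps^-1 * ws * \sum_j z j x * Ps j x =
    eps^-1 * (\sum_j (wx j x + ws * uj j x) * Ps j x) - eps^-1 * (\sum_j Qj j x * Ps j x).
  rewrite -mulrBr -sumrB -mulrA; congr (_ * _); rewrite mulr_sumr; apply: eq_bigr => j _.
  by rewrite -(wE j Ox) /z; ring.
have -> : eps * \sum_i uj i x * \sum_j (zz j i x * Ps j x + z j x * Psj j i x) =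
    eps / 2 * (\sum_i \sum_j 2 * uj i x * ujj i j x * Ps j x) +
    eps * (\sum_i \sum_j (uj i x * uj j x * Psj j i x - uj i x ^+ 2 * (gj j x / g x * Ps j x))) +
    eps * (\sum_i uj i x * (var_c i x + v x * var_d i x)).
  have -> : eps / 2 * (\sum_i \sum_j 2 * uj i x * ujj i j x * Ps j x) =
      eps * (\sum_i \sum_j uj i x * ujj i j x * Ps j x).
    rewrite -mulrA; congr (_ * _); rewrite mulr_sumr; apply: eq_bigr => i _.
    rewrite mulr_sumr; apply: eq_bigr => j _; by field.
  rewrite -!mulrDr -!big_split /=; congr (_ * _); apply: eq_bigr => i _.
  rewrite /var_c /var_d !mulr_sumr -!big_split /= !mulr_sumr -!big_split /=; apply: eq_bigr => j _.
  rewrite /zz /z /vj /v sx -exprVn.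
  by move: (g x)^-1 => r; ring.
by ring.
Qed.

End variation_formula.

Lemma Rintegral_lin5 d (T : measurableType d) (R : realType) (mu : {measure set T -> \bar R}) (D : set T)
    (f1 f2 f3 f4 f5 : T -> R) (k1 k2 k3 k4 k5 : R) : measurable D ->
  itg mu D f1 -> itg mu D f2 -> itg mu D f3 -> itg mu D f4 -> itg mu D f5 ->
  \int[mu]_(x in D) (k1 * f1 x + k2 * f2 x - k3 * f3 x + k4 * f4 x + k5 * f5 x) =
  k1 * \int[mu]_(x in D) f1 x + k2 * \int[mu]_(x in D) f2 x - k3 * \int[mu]_(x in D) f3 x +
  k4 * \int[mu]_(x in D) f4 x + k5 * \int[mu]_(x in D) f5 x.
Proof.
move=> mD i1 i2 i3 i4 i5.
have j1 := itgZ mD k1 i1; have j2 := itgZ mD k2 i2; have j3 := itgZ mD k3 i3.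
have j4 := itgZ mD k4 i4; have j5 := itgZ mD k5 i5.
have l1 := itgD mD j1 j2; have l2 := itgB mD l1 j3; have l3 := itgD mD l2 j4.
by rewrite (RintegralD mD l3 j5) (RintegralD mD l2 j4) (RintegralB mD l1 j3) (RintegralD mD j1 j2) !RintegralZl.
Qed.

(** * The first variation after integration by parts *)

Section variation_integrals.
Context {R : realType} {N : nat}.
Notation mu := (@lebesgueN R N).
Notation e_ i := (@basis_rV R N i).
Variables (Om : set 'rV[R]_N) (W : 'rV[R]_N -> R -> R) (a b : 'rV[R]_N -> R).
Hypotheses (Om_C2 : C2_domain Om) (pot : potential Om W a b).
Let oOm : open Om := open_C2_domain Om_C2.
Let bOm : bounded_set Om := bounded_C2_domain Om_C2.
Let mOm : measurable Om := open_measurable_rV oOm.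
Notation g := (gam a b).
Notation gj := (gamx a b).
Implicit Types f c u : 'rV[R]_N -> R.

Lemma fin_bound (I : finType) (f : I -> 'rV[R]_N -> R) :
  (forall i, exists2 M, 0 < M & forall x, Om x -> `|f i x| <= M) ->
  exists2 M, 0 < M & forall i x, Om x -> `|f i x| <= M.
Proof.
move=> h; have /choice[M hM] : forall i, exists M, 0 < M /\ forall x, Om x -> `|f i x| <= M.
  by move=> i; have [M M0 hM] := h i; exists M.
exists (1 + \sum_i M i); first by rewrite ltr_pwDl// sumr_ge0// => i _; exact: ltW (hM i).1.
move=> i x Ox; rewrite (le_trans ((hM i).2 x Ox))// (bigD1 i)//= addrCA lerDl addr_ge0//.
by rewrite sumr_ge0// => k _; exact: ltW (hM k).1.
Qed.

Definition bounded_cont c := cont_on Om c /\ exists2 M, 0 < M & forall x, Om x -> `|c x| <= M.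

Lemma bounded_contM c c' : bounded_cont c -> bounded_cont c' -> bounded_cont (fun x => c x * c' x).
Proof.
move=> [h [M M0 hM]] [h' [M' M'0 hM']]; split.
  by move=> x Ox; have c1 := h x Ox; have c2 := h' x Ox; exact: (continuousM c1 c2).
exists (M * M') => [|x Ox]; first exact: mulr_gt0.
by rewrite normrM ler_pM//; [exact: hM|exact: hM'].
Qed.

Lemma bounded_contN c : bounded_cont c -> bounded_cont (fun x => - c x).
Proof.
move=> [h [M M0 hM]]; split.
  by move=> x Ox; have c1 := h x Ox; exact: (continuousN c1).
by exists M => // x Ox; rewrite normrN; exact: hM.
Qed.

Lemma bounded_contD c c' : bounded_cont c -> bounded_cont c' -> bounded_cont (fun x => c x + c' x).
Proof.
move=> [h [M M0 hM]] [h' [M' M'0 hM']]; split.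
  by move=> x Ox; have c1 := h x Ox; have c2 := h' x Ox; exact: (continuousD c1 c2).
exists (M + M') => [|x Ox]; first exact: addr_gt0.
by rewrite (le_trans (ler_normD _ _))// lerD//; [exact: hM|exact: hM'].
Qed.

Lemma bounded_contB c c' : bounded_cont c -> bounded_cont c' -> bounded_cont (fun x => c x - c' x).
Proof. by move=> h /bounded_contN; exact: bounded_contD. Qed.

Lemma bounded_cont0 : bounded_cont (fun=> 0).
Proof. by split; [move=> x _; exact: cst_continuous|exists 1 => // x _; rewrite normr0]. Qed.

Lemma bounded_cont_sum (I : Type) (s : seq I) (h : I -> 'rV[R]_N -> R) : (forall i, bounded_cont (h i)) ->
  bounded_cont (fun x => \sum_(i <- s) h i x).
Proof.
move=> H; elim: s => [|i s IH].
  rewrite (_ : (fun x => _) = (fun=> 0)); first exact: bounded_cont0.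
  by apply/funext => x; rewrite big_nil.
rewrite (_ : (fun x => _) = (fun x => h i x + \sum_(i <- s) h i x)); first exact: bounded_contD.
by apply/funext => x; rewrite big_cons.
Qed.

Lemma bounded_cont_measurable c : bounded_cont c -> measurable_fun Om c.
Proof. by case=> h _; exact: continuous_measurable_rV. Qed.

Lemma itgM_bounded_cont f c : bounded_cont c -> itg mu Om f -> itg mu Om (fun x => f x * c x).
Proof.
by move=> hc; have [_ [M _ hM]] := hc; apply: (itgM_bounded mOm (C := M)) => //; exact: bounded_cont_measurable.
Qed.

Lemma Ck_closure_bounded_cont k f v : Ck_closure k.+1 Om f -> bounded_cont f /\ bounded_cont ('D_v f).
Proof.
move=> hf; have [_ c2 b2] := Ck_closure_derive oOm bOm v hf; split; split => //.
  by apply: (closure_cont_on oOm); case: hf.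
have [M M0 hM] := closure_bounded bOm hf.1; exists M => // x Ox; apply: hM; exact: subset_closure.
Qed.

Lemma Ck2_closure f : Ck_closure 2 Om f -> exists f2 : 'I_N -> 'I_N -> 'rV[R]_N -> R,
  forall j i, C1_on Om i ('D_(e_ j) f) (f2 j i) /\ bounded_cont (f2 j i).
Proof.
move=> [_ h].
have H j : exists f2 : 'I_N -> 'rV[R]_N -> R, forall i, C1_on Om i ('D_(e_ j) f) (f2 i) /\ bounded_cont (f2 i).
  have [_ [G [GE cG0]]] := h (e_ j); have cG : Ck_closure 1 Om G := cG0.
  exists (fun i => 'D_(e_ i) G) => i; have [dG c2 _] := Ck_closure_derive oOm bOm (e_ i) cG.
  have [[cg _] bg] := Ck_closure_bounded_cont (e_ i) cG; split => //; split => //.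
    exact: (cont_on_eq oOm GE cg).
  move=> x Ox; apply: is_derive_near_eq (dG x Ox).
  by apply: filterS (open_nbhs_nbhs (conj oOm Ox)); exact: GE.
by have /choice[f2 hf2] := H; exists f2.
Qed.

Lemma gam_bounded_cont : [/\ bounded_cont g, forall j, bounded_cont (gj j) & bounded_cont (fun x => (g x)^-1)].
Proof.
have ha := Ck_closure_bounded_cont _ (pot_aC2 pot); have hb := Ck_closure_bounded_cont _ (pot_bC2 pot).
have hg : bounded_cont g by apply: bounded_contB; [exact: (hb 0).1|exact: (ha 0).1].
split => //; first by move=> j; apply: bounded_contB; [exact: (hb _).2|exact: (ha _).2].
have [dl dl0 hdl] := gam_bound pot; split.
  move=> x Ox; apply: (@continuousV _ _ g); last exact: hg.1.
  by rewrite gt_eqF// (lt_le_trans dl0 (hdl x Ox)).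
exists dl^-1; first by rewrite invr_gt0.
move=> x Ox; have g0 := lt_le_trans dl0 (hdl x Ox).
rewrite ger0_norm; last by rewrite invr_ge0 ltW.
by rewrite lef_pV2 ?posrE//; exact: hdl.
Qed.

Variable Psi : 'rV[R]_N -> 'rV[R]_N.
Hypothesis Psi_C1 : forall i, Ck_closure 1 Om (fun x => Psi x 0 i).
Hypothesis Psi_tan : forall x, bdry Om x -> dot (Psi x) (outer_normal Om x) = 0.

Definition Psid j i x := 'D_(e_ i) (fun y => Psi y 0 j) x.

Lemma Psi_bounded_cont : (forall j, bounded_cont (fun x => Psi x 0 j)) /\ (forall j i, bounded_cont (Psid j i)).
Proof.
have h j i := Ck_closure_bounded_cont (e_ i) (@Psi_C1 j); split => [j|j i]; first exact: (h j j).1.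
exact: (h j i).2.
Qed.

Lemma divg_bounded_cont : bounded_cont (divg Psi).
Proof. by apply: bounded_cont_sum => j; exact: Psi_bounded_cont.2. Qed.

Definition normalized u x := (u x - a x) / g x.

Lemma normalized_measurable u : measurable_fun Om u -> measurable_fun Om (normalized u).
Proof.
move=> mu_; have [_ _ ig] := gam_bounded_cont; apply: measurable_funM; last exact: bounded_cont_measurable.
by apply: measurable_funB => //; apply: bounded_cont_measurable; exact: (Ck_closure_bounded_cont 0 (pot_aC2 pot)).1.
Qed.

Lemma normalizedK u x : Om x -> u x = a x + g x * normalized u x.
Proof.
move=> Ox; have [dl dl0 hdl] := gam_bound pot.
by rewrite /normalized mulrCA divff ?mulr1 ?gt_eqF ?(lt_le_trans dl0 (hdl x Ox))// addrC subrK.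
Qed.

Lemma normalized_L2 u : L2 Om u -> L2 Om (normalized u).
Proof.
move=> hu; have [_ _ ig] := gam_bounded_cont; have [_ [M M0 hM]] := ig.
apply: (L2M_bounded oOm (M := M)) => //; last exact: bounded_cont_measurable.
have [ha _] := Ck_closure_bounded_cont 0 (pot_aC2 pot).
have ha' := bounded_contN ha; have [_ [M' M'0 hM']] := ha'.
by apply: (L2D oOm) => //; apply: (L2_bounded oOm bOm (M := M')) => //; exact: bounded_cont_measurable.
Qed.

Lemma sqW_normalized u x : Om x -> sqW W a b x (normalized u x) ^+ 2 = W x (u x).
Proof. by move=> Ox; rewrite (sqW_sq pot)// -normalizedK. Qed.

Lemma sqW_mul_itg u (H : 'rV[R]_N -> R -> R) c (C : R) : measurable_fun Om u ->
  itg mu Om (fun x => W x (u x)) -> jcont Om H -> (forall x v, Om x -> `|H x v| <= C * sqW W a b x v) ->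
  bounded_cont c ->
  itg mu Om (fun x => 2 * sqW W a b x (normalized u x) * H x (normalized u x) * c x).
Proof.
move=> mu_ iw cH hC hc; have mv := normalized_measurable mu_.
have mq := flat_measurable oOm mOm (fun _ h => h) (sqW_jcont Om_C2 pot) mv.
have mH := flat_measurable oOm mOm (fun _ h => h) cH mv.
apply: itgM_bounded_cont => //; apply: (itg_le mOm _ _ (itgZ mOm (2 * C) iw)).
  by apply: measurable_funM => //; apply: measurable_funM.
move=> x Ox; rewrite !normrM (ger0_norm (sqW_ge0 _ _ _ _ _)) ger0_norm// -(sqW_normalized u Ox).
have := hC x (normalized u x) Ox; have := sqW_ge0 W a b x (normalized u x).
move: (sqW _ _ _ _ _) `|H _ _| => p h p0 hp; rewrite expr2 -!mulrA ler_wpM2l//.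
by rewrite (le_trans (ler_wpM2l p0 hp))// !mulrA [p * C]mulrC.
Qed.

Lemma HkW k f : Hk k.+1 Om f -> Hk k Om f.
Proof.
elim: k f => [|k IH] f [h1 h2]; split => // i.
by have [w [h3 h4]] := h2 i; exists w; split => //; exact: IH.
Qed.

(** The two derivative terms are traded for integrals against div Psi, so that only quantities
    bounded by the energy remain. The coefficients [c] and [d] depend neither on [u] nor on
    [eps]. *)
Lemma variation_integral : exists c d : 'I_N -> 'rV[R]_N -> R,
  [/\ forall i, bounded_cont (c i), forall i, bounded_cont (d i) & forall u eps,
  0 < eps -> Hk 2 Om u -> itg mu Om (fun x => W x (u x)) ->
  itg mu Om (variation_density Om W a b Psi eps u) ->
  \int[mu]_(x in Om) variation_density Om W a b Psi eps u x =
  - (eps^-1 * \int[mu]_(x in Om) (W x (u x) * divg Psi x)) -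
  eps / 2 * (\sum_i \int[mu]_(x in Om) (weak_partial Om i u x * weak_partial Om i u x * divg Psi x)) -
  eps^-1 * (\sum_j \int[mu]_(x in Om) (2 * sqW W a b x (normalized u x) * sqWx W a b j x (normalized u x) * Psi x 0 j)) +
  eps * (\sum_i \sum_j (\int[mu]_(x in Om) (weak_partial Om i u x * weak_partial Om j u x * Psid j i x) -
    \int[mu]_(x in Om) (weak_partial Om i u x * weak_partial Om i u x * (gj j x / g x * Psi x 0 j)))) +
  eps * (\sum_i \int[mu]_(x in Om) (weak_partial Om i u x * (c i x + normalized u x * d i x)))].
Proof.
have [a2 ha2] := Ck2_closure (pot_aC2 pot); have [b2 hb2] := Ck2_closure (pot_bC2 pot).
pose aj j := 'D_(e_ j) a; pose g2 j i x := b2 j i x - a2 j i x.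
have ajC1 j i : C1_on Om i (aj j) (a2 j i) by exact: (ha2 j i).1.
have gjC1 j i : C1_on Om i (gj j) (g2 j i) by exact: C1_onB (hb2 j i).1 (ha2 j i).1.
have aC1 j : C1_on Om j a (aj j) by exact: (a_C1 Om_C2 pot j).
have gC1 j : C1_on Om j g (gj j) by exact: (gam_C1 Om_C2 pot j).
have [bg bgj big] := gam_bounded_cont.
have baj j : bounded_cont (aj j) by exact: (Ck_closure_bounded_cont (e_ j) (pot_aC2 pot)).2.
have ba2 j i := (ha2 j i).2; have bg2 j i : bounded_cont (g2 j i) := bounded_contB (hb2 j i).2 (ha2 j i).2.
have [bP bPd] := Psi_bounded_cont.
have PsC1 j i : C1_on Om i (fun x => Psi x 0 j) (Psid j i) by exact: (Ck_closure_C1_on Om_C2 (@Psi_C1 j) i).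
have g0 x : Om x -> g x != 0.
  by move=> Ox; have [dl dl0 hdl] := gam_bound pot; rewrite gt_eqF// (lt_le_trans dl0 (hdl x Ox)).
have chain j x s t : Om x -> s = a x + g x * t ->
    Wx W j x s + Ws W x s * (aj j x + t * gj j x) = 2 * sqW W a b x t * sqWx W a b j x t.
  exact: (sqW_chain Om_C2 pot).
move: aj ajC1 aC1 baj chain g2 gjC1 bg2 => aj ajC1 aC1 baj chain g2 gjC1 bg2.
pose Ps (j : 'I_N) (x : 'rV[R]_N) : R := Psi x 0 j.
exists (var_c g aj gj a2 Ps Psid), (var_d g gj g2 Ps Psid).
have bc i : bounded_cont (var_c g aj gj a2 Ps Psid i).
  apply: bounded_cont_sum => j.
  have h1 := bounded_contM (bounded_contN (ba2 j i)) (bP j).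
  have h2 := bounded_contM (bounded_contM (bounded_contM big (baj i)) (bgj j)) (bP j).
  exact: (bounded_contB (bounded_contD h1 h2) (bounded_contM (baj j) (bPd j i))).
have bd i : bounded_cont (var_d g gj g2 Ps Psid i).
  apply: bounded_cont_sum => j.
  have h1 := bounded_contM (bounded_contM (bounded_contM big (bgj i)) (bgj j)) (bP j).
  exact: (bounded_contB (bounded_contB h1 (bounded_contM (bg2 j i) (bP j))) (bounded_contM (bgj j) (bPd j i))).
split => // u eps eps0 hu iw iD.
pose v := normalized u.
pose uj i := weak_partial Om i u; pose ujj i j := weak_partial Om j (uj i).
have wu i : is_weak_partial Om i u (uj i) := (Hk_weak oOm bOm i hu).1.
have Hj i : Hk 1 Om (uj i) := (Hk_weak oOm bOm i hu).2.
have wuj i j : is_weak_partial Om j (uj i) (ujj i j) := (Hk_weak oOm bOm j (Hj i)).1.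
have L2j i : L2 Om (uj i) := Hk_L2 (Hj i).
have L2jj i j : L2 Om (ujj i j) := Hk_L2 (Hk_weak oOm bOm j (Hj i)).2.
have L2u : L2 Om u := Hk_L2 hu.
have L2v : L2 Om v := normalized_L2 L2u.
have mu_ := L2_measurable L2u.
have dW x : Om x -> 'D_1 (W x) (u x) = Ws W x (u x).
  by move=> Ox; have d := Ws_derive pot (u x) Ox; exact: derive_val.
have wE x j : Om x -> Wx W j x (u x) + 'D_1 (W x) (u x) * (aj j x + v x * gj j x) =
    2 * sqW W a b x (v x) * sqWx W a b j x (v x).
  by move=> Ox; rewrite dW//; apply: chain => //; exact: normalizedK.
have De := variation_density_ae oOm bOm aC1 gC1 ajC1 gjC1 bg.1 g0 PsC1 wu wuj eps
  (fun x j => erefl) (fun x => erefl) (fun i => erefl) wE.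
pose T1 x := \sum_j (Wx W j x (u x) + Ws W x (u x) * uj j x) * Ps j x.
pose T2 x := \sum_i \sum_j 2 * uj i x * ujj i j x * Ps j x.
pose T3 x := \sum_j 2 * sqW W a b x (v x) * sqWx W a b j x (v x) * Ps j x.
pose T4 x := \sum_i \sum_j (uj i x * uj j x * Psid j i x - uj i x ^+ 2 * (gj j x / g x * Ps j x)).
pose T5 x := \sum_i uj i x * (var_c g aj gj a2 Ps Psid i x + v x * var_d g gj g2 Ps Psid i x).
have {}De : ae_eq mu Om (variation_density Om W a b Psi eps u)
    (fun x => eps^-1 * T1 x + eps / 2 * T2 x - eps^-1 * T3 x + eps * T4 x + eps * T5 x).
  by apply: filterS De => x h Ox; rewrite (h Ox) (dW x Ox).
have bq j : bounded_cont (fun x => gj j x / g x * Ps j x).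
  exact: (bounded_contM (bounded_contM (bgj j) big) (bP j)).
have iij i j c : bounded_cont c -> itg mu Om (fun x => uj i x * uj j x * c x).
  by move=> hc; apply: itgM_bounded_cont => //; exact: (L2_mul oOm).
have i22 i j : itg mu Om (fun x => 2 * uj i x * ujj i j x * Ps j x).
  have h := itgZ mOm 2 (L2_mul oOm (L2j i) (L2jj i j)).
  by apply: (itg_eq mOm) (itgM_bounded_cont (bP j) h) => x _; rewrite (mulrA 2).
have i2i i : itg mu Om (fun x => \sum_j 2 * uj i x * ujj i j x * Ps j x) by exact: (itg_sum mOm).
have i2 : itg mu Om T2 by exact: (itg_sum mOm).
have [C C0 hC] := sqWx_le pot.
have i3j j : itg mu Om (fun x => 2 * sqW W a b x (v x) * sqWx W a b j x (v x) * Ps j x).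
  exact: (sqW_mul_itg mu_ iw (@sqWx_jcont _ _ _ _ _ _ Om_C2 pot j) (hC j) (bP j)).
have i3 : itg mu Om T3 by exact: (itg_sum mOm).
have i4b i j : itg mu Om (fun x => uj i x ^+ 2 * (gj j x / g x * Ps j x)).
  by apply: (itg_eq mOm) (iij i i _ (bq j)) => x _; rewrite expr2.
have i4a i j := iij i j _ (bPd j i).
have i4ij i j := itgB mOm (i4a i j) (i4b i j).
have i4i i := itg_sum mOm (index_enum 'I_N) (i4ij i).
have i4 : itg mu Om T4 by exact: (itg_sum mOm (index_enum 'I_N) i4i).
have i5i i : itg mu Om (fun x => uj i x * (var_c g aj gj a2 Ps Psid i x + v x * var_d g gj g2 Ps Psid i x)).
  have h1 := itgM_bounded_cont (bc i) (L2_itg oOm bOm (L2j i)).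
  have h2 := itgM_bounded_cont (bd i) (L2_mul oOm (L2j i) L2v).
  by apply: (itg_eq mOm) (itgD mOm h1 h2) => x _; rewrite mulrDr mulrA.
have i5 : itg mu Om T5 by exact: (itg_sum mOm).
have mT1 : measurable_fun Om T1.
  apply: measurable_sum => j; apply: measurable_funM; last exact: (bounded_cont_measurable (bP j)).
  have m1 := flat_measurable oOm mOm (fun _ h => h) (@Wd_jcont _ _ _ _ _ _ pot (e_ j, 0)) mu_.
  have m2 := flat_measurable oOm mOm (fun _ h => h) (@Wd_jcont _ _ _ _ _ _ pot (0, 1)) mu_.
  exact: (measurable_funD m1 (measurable_funM m2 (L2_measurable (L2j j)))).
(* No growth bound on d_u W makes this term integrable by itself; it is what remains of the
   integrable variation density once the other four terms are removed. *)
have i1 : itg mu Om T1.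
  have h2 := itgZ mOm (eps / 2) i2; have h3 := itgZ mOm eps^-1 i3.
  have h4 := itgZ mOm eps i4; have h5 := itgZ mOm eps i5.
  have h := itgZ mOm eps (itgB mOm (itgB mOm (itgD mOm (itgB mOm iD h2) h3) h4) h5).
  apply: (itg_ae_eq mOm mT1 _ h); apply: filterS De => x hx Ox; rewrite (hx Ox).
  move: (T1 x) (T2 x) (T3 x) (T4 x) (T5 x) => t1 t2 t3 t4 t5.
  by field; rewrite gt_eqF.
have mD := itg_measurable iD.
have mR : measurable_fun Om (fun x => eps^-1 * T1 x + eps / 2 * T2 x - eps^-1 * T3 x + eps * T4 x + eps * T5 x).
  have l1 := itgD mOm (itgZ mOm eps^-1 i1) (itgZ mOm (eps / 2) i2).
  have l2 := itgB mOm l1 (itgZ mOm eps^-1 i3).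
  have l3 := itgD mOm (itgD mOm l2 (itgZ mOm eps i4)) (itgZ mOm eps i5).
  exact: itg_measurable l3.
rewrite (Rintegral_ae_eq mOm mD mR De) (Rintegral_lin5 _ _ _ _ _ mOm i1 i2 i3 i4 i5).
have bdv := divg_bounded_cont.
have E1 : \int[mu]_(x in Om) T1 x = - \int[mu]_(x in Om) (W x (u x) * divg Psi x).
  have h := trunc_ibp Om_C2 Psi_C1 Psi_tan (f := fun x => W x (u x)) (g := fun j x => Wx W j x (u x) + Ws W x (u x) * uj j x)
    (fun x Ox => W_ge0 pot (u x) Ox) iw mT1 (fun K j K0 => weak_trunc_W Om_C2 pot K0 (wu j)) i1.
  apply/eqP; rewrite -addr_eq0 addrC; apply/eqP.
  exact: (etrans (esym (RintegralD mOm (itgM_bounded_cont bdv iw) i1)) h).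
have E2 : \int[mu]_(x in Om) T2 x = - \sum_i \int[mu]_(x in Om) (uj i x * uj i x * divg Psi x).
  rewrite (Rintegral_sum mOm)// -sumrN; apply: eq_bigr => i _.
  have i0 : itg mu Om (fun x => uj i x ^+ 2) := L2_sq (L2j i).
  have h := trunc_ibp Om_C2 Psi_C1 Psi_tan (f := fun x => uj i x ^+ 2) (g := fun j x => 2 * uj i x * ujj i j x)
    (fun x _ => sqr_ge0 (uj i x)) i0 (itg_measurable (i2i i)) (fun K j K0 => weak_trunc_sq Om_C2 K0 (wuj i j)) (i2i i).
  apply/eqP; rewrite -addr_eq0 addrC; apply/eqP.
  exact: (etrans (esym (RintegralD mOm (itgM_bounded_cont bdv i0) (i2i i))) h).
rewrite E1 E2 (Rintegral_sum mOm _ i3j) (Rintegral_sum mOm (index_enum 'I_N) i4i) (Rintegral_sum mOm _ i5i).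
rewrite !mulrN; congr (_ + eps * _ + _); apply: eq_bigr => i _.
rewrite (Rintegral_sum mOm (index_enum 'I_N) (i4ij i)); apply: eq_bigr => j _.
by rewrite (RintegralB mOm (i4a i j) (i4b i j)).
Qed.

End variation_integrals.

(** * Limits of the energy terms *)

Section right_limits.
Context {R : realType}.
Implicit Types (f h : R -> R) (l m k : R).

Lemma rcvgD f h l m : f e @[e --> 0^'+] --> l -> h e @[e --> 0^'+] --> m ->
  f e + h e @[e --> 0^'+] --> l + m.
Proof. exact: cvgD. Qed.

Lemma rcvgN f l : f e @[e --> 0^'+] --> l -> - f e @[e --> 0^'+] --> - l.
Proof. exact: cvgN. Qed.

Lemma rcvgB f h l m : f e @[e --> 0^'+] --> l -> h e @[e --> 0^'+] --> m ->
  f e - h e @[e --> 0^'+] --> l - m.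
Proof. exact: cvgB. Qed.

Lemma rcvgZ k f l : f e @[e --> 0^'+] --> l -> k * f e @[e --> 0^'+] --> k * l.
Proof. by move=> h; apply: cvgM => //; exact: cvg_cst. Qed.

Lemma rcvg_sum (I : Type) (s : seq I) (F : I -> R -> R) (l : I -> R) :
  (forall i, F i e @[e --> 0^'+] --> l i) ->
  \sum_(i <- s) F i e @[e --> 0^'+] --> \sum_(i <- s) l i.
Proof.
move=> h; elim: s => [|i s IH].
  rewrite big_nil (_ : (fun e => _) = (fun=> 0)); first exact: cvg_cst.
  by apply/funext => e; rewrite big_nil.
rewrite big_cons (_ : (fun e => _) = (fun e => F i e + \sum_(i <- s) F i e)); first exact: rcvgD.
by apply/funext => e; rewrite big_cons.
Qed.

Lemma rcvg_near f h l : (\forall e \near 0^'+, f e = h e) -> f e @[e --> 0^'+] --> l -> h e @[e --> 0^'+] --> l.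
Proof. by move=> /near_eq_cvg fh; exact: cvg_trans. Qed.

Lemma rcvg_le f l : (forall k, 0 < k -> \forall e \near 0^'+, `|f e - l| <= k) -> f e @[e --> 0^'+] --> l.
Proof. by move=> h; apply/cvgrPdist_le => k /h; apply: filterS => e; rewrite distrC. Qed.

Lemma rcvg_dist f l k : f e @[e --> 0^'+] --> l -> 0 < k -> \forall e \near 0^'+, `|f e - l| <= k.
Proof. by move=> /cvgrPdist_le h /h; apply: filterS => e; rewrite distrC. Qed.

Lemma rcvg_eq f l m : f e @[e --> 0^'+] --> l -> l = m -> f e @[e --> 0^'+] --> m.
Proof. by move=> h <-. Qed.

End right_limits.

(** * Limits along a sequence with converging energy *)

Section profile_limits.
Context {R : realType} {N : nat}.
Notation mu := (@lebesgueN R N).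
Notation e_ i := (@basis_rV R N i).
Variables (Om : set 'rV[R]_N) (W : 'rV[R]_N -> R -> R) (a b : 'rV[R]_N -> R).
Hypotheses (Om_C2 : C2_domain Om) (pot : potential Om W a b).
Let oOm : open Om := open_C2_domain Om_C2.
Let bOm : bounded_set Om := bounded_C2_domain Om_C2.
Let mOm : measurable Om := open_measurable_rV oOm.
Notation g := (gam a b).
Notation gj := (gamx a b).
Notation q := (sqW W a b).
Variables (u : R -> 'rV[R]_N -> R) (A : set 'rV[R]_N).
Hypothesis u_H2 : forall eps, 0 < eps -> Hk 2 Om (u eps).
Hypothesis mA : measurable A.
Variables (P : {finite_measure set 'rV[R]_N -> \bar R}) (n : 'I_N -> 'rV[R]_N -> R).
Hypothesis mn : forall j, measurable_fun Om (n j).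
Hypothesis n1 : forall x, \sum_j n j x ^+ 2 = 1.
Hypothesis chiP : forall j T T', test1 Om j T T' ->
  \int[mu]_(x in Om) (\1_A x * T' x) = - \int[P]_(x in Om) (T x * n j x).
Let v eps := normalized a b (u eps).
Let w eps x := W x (u eps x).
Let ui eps i := weak_partial Om i (u eps).
Let en eps x := eps^-1 * w eps x + eps / 2 * \sum_i ui eps i x ^+ 2.
Hypothesis v_lim : (\int[mu]_(x in Om) `|v eps x - \1_A x|) @[eps --> 0^'+] --> (0 : R).
Variable Emax : R.
Hypothesis en_le : \forall eps \near (0 : R)^'+, [/\ 0 < eps, itg mu Om (w eps) & \int[mu]_(x in Om) en eps x <= Emax].

Lemma eps_near : \forall eps \near (0 : R)^'+, 0 < eps.
Proof. exact: nbhs_right_gt. Qed.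

Lemma u_L2 eps : 0 < eps -> L2 Om (u eps).
Proof. by move=> /u_H2; exact: Hk_L2. Qed.

Lemma v_L2 eps : 0 < eps -> L2 Om (v eps).
Proof. by move=> /u_L2; exact: (normalized_L2 Om_C2 pot). Qed.

Lemma ui_weak eps i : 0 < eps -> is_weak_partial Om i (u eps) (ui eps i) /\ L2 Om (ui eps i).
Proof. by move=> /u_H2 h; have [w1 /Hk_L2 h1] := Hk_weak oOm bOm i h. Qed.

Lemma indic_itgO : itg mu Om (\1_A : 'rV[R]_N -> R).
Proof.
apply: (itg_bounded mOm (C := 1)); [exact: lebesgueN_bounded|exact: measurable_indic|].
by move=> x _; rewrite indicE; case: (x \in A); rewrite ?normr1 ?normr0.
Qed.

(** Flatness makes L^1 convergence of v sufficient, without any growth condition. *)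
Lemma flat_cvg H (h : 'rV[R]_N -> R) : jcont Om H -> flat Om H 3 -> Cc Om h ->
  \int[mu]_(x in Om) (H x (v eps x) * h x) @[eps --> 0^'+] --> \int[mu]_(x in Om) (H x (\1_A x) * h x).
Proof.
move=> cH fH hc; have [_ [K [cK KO hK]]] := hc.
have mK := compact_measurable_rV cK.
have hi : itg mu K h by apply: (loc_itg (loc_integrable_cont oOm _)) => // x _; exact: hc.1.
have Ai : itg mu K (\1_A : 'rV[R]_N -> R) by exact: integrableS indic_itgO.
have S0 : (0 : R) <= 3 by [].
apply/cvgrPdist_le => k k0; have k2 : 0 < k / 2 by rewrite divr_gt0.
have [C C0 hC] := flat_dist oOm S0 cK KO cH fH Ai hi k2.
have k3 : 0 < k / 2 / (C + 1) by rewrite divr_gt0// ltr_wpDl.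
have /cvgrPdist_le/(_ _ k3) := v_lim.
have := eps_near; apply: filterS2 => eps eps0; rewrite sub0r normrN => hv.
have vi : itg mu Om (v eps) by exact: (L2_itg oOm bOm (v_L2 eps0)).
have z (F : 'rV[R]_N -> R) : \int[mu]_(x in Om) (H x (F x) * h x) = \int[mu]_(x in K) (H x (F x) * h x).
  by apply: Rintegral_zero_out => // x _ /hK ->; rewrite mulr0.
rewrite distrC !z (le_trans (hC _ (integrableS _ _ KO vi)))//.
rewrite [leRHS](splitr k) lerD2l.
have l : \int[mu]_(x in K) `|v eps x - \1_A x| <= \int[mu]_(x in Om) `|v eps x - \1_A x|.
  apply: Rintegral_mono => //; apply: itg_norm; apply: (itgB mOm) => //; exact: indic_itgO.
have {}hv := le_trans (ler_norm _) hv.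
rewrite (le_trans (ler_wpM2l C0 (le_trans l hv)))// mulrCA -[leRHS]mulr1 ler_wpM2l ?(ltW k2)//.
by rewrite ler_pdivrMr ?mul1r ?lerDl// ltr_wpDl.
Qed.

Lemma flat_Cc_itg H (f h : 'rV[R]_N -> R) : jcont Om H -> flat Om H 3 -> measurable_fun Om f -> Cc Om h ->
  itg mu Om (fun x => H x (f x) * h x).
Proof.
move=> cH fH mf hc; have [_ [K [cK KO hK]]] := hc.
have mK := compact_measurable_rV cK.
have hi : itg mu K h by apply: (loc_itg (loc_integrable_cont oOm _)) => // x _; exact: hc.1.
apply: (itg_zero_out oOm mK KO) => [x _ /hK ->|]; first by rewrite mulr0.
by apply: (flat_itg oOm _ cK KO cH fH) => //; exact: measurable_funS mf.
Qed.

Definition good eps := [/\ 0 < eps, itg mu Om (w eps) & \int[mu]_(x in Om) en eps x <= Emax].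

Lemma ui_sq_itg eps i : 0 < eps -> itg mu Om (fun x => ui eps i x ^+ 2).
Proof. by move=> /(ui_weak i)[_ /L2_sq]. Qed.

Lemma en_itg eps : good eps -> itg mu Om (en eps).
Proof.
move=> [eps0 iw _]; apply: (itgD mOm); apply: (itgZ mOm) => //.
by apply: (itg_sum mOm) => i; exact: ui_sq_itg.
Qed.

Lemma w_sq eps x : Om x -> w eps x = q x (v eps x) ^+ 2.
Proof. by move=> Ox; rewrite /v (sqW_normalized pot). Qed.

Lemma ui_le_en eps i x : 0 < eps -> Om x -> eps^-1 * w eps x + eps / 2 * ui eps i x ^+ 2 <= en eps x.
Proof.
move=> eps0 Ox; rewrite /en lerD2l ler_wpM2l ?divr_ge0 ?(ltW eps0)// (bigD1 i)//= lerDl.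
by apply: sumr_ge0 => k _; exact: sqr_ge0.
Qed.

Lemma w_ge0 eps x : Om x -> 0 <= w eps x.
Proof. by move=> Ox; rewrite w_sq// sqr_ge0. Qed.

Lemma young (s p y : R) : 0 < s -> 0 <= p -> 0 <= y -> p * y <= s^-1 * p ^+ 2 + s / 2 * y ^+ 2.
Proof.
move=> s0 p0 y0; have : 0 <= s^-1 * (p - s / 2 * y) ^+ 2 + s / 4 * y ^+ 2.
  by apply: addr_ge0; apply: mulr_ge0; rewrite ?sqr_ge0 ?invr_ge0 ?divr_ge0 ?ltW.
have -> : s^-1 * (p - s / 2 * y) ^+ 2 + s / 4 * y ^+ 2 = s^-1 * p ^+ 2 + s / 2 * y ^+ 2 - p * y.
  by field; rewrite gt_eqF.
by rewrite subr_ge0.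
Qed.

Lemma qui_le_en eps i x : 0 < eps -> Om x -> q x (v eps x) * `|ui eps i x| <= en eps x.
Proof.
move=> eps0 Ox; apply: le_trans (ui_le_en i eps0 Ox).
rewrite w_sq// -(real_normK (num_real (ui eps i x))); apply: young => //; exact: sqW_ge0.
Qed.

Lemma en_ge0 eps x : 0 < eps -> Om x -> 0 <= en eps x.
Proof.
move=> eps0 Ox; rewrite /en addr_ge0// mulr_ge0 ?divr_ge0 ?invr_ge0 ?(ltW eps0)//; first exact: w_ge0.
by apply: sumr_ge0 => k _; exact: sqr_ge0.
Qed.

Lemma v_measurable eps : 0 < eps -> measurable_fun Om (v eps).
Proof. by move=> /v_L2 /L2_measurable. Qed.

Lemma ui_measurable eps i : 0 < eps -> measurable_fun Om (ui eps i).
Proof. by move=> /(ui_weak i)[_ /L2_measurable]. Qed.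

Lemma Emax_ge0 : 0 <= Emax.
Proof.
have [eps [eps0 _ h]] := filter_ex en_le; apply: le_trans h.
by apply: Rintegral_ge0 => x; exact: en_ge0.
Qed.

Lemma P_lty : (P Om < +oo)%E.
Proof. by rewrite ltey_eq fin_num_measure. Qed.

Lemma P_itg (f : 'rV[R]_N -> R) M : measurable_fun Om f -> (forall x, Om x -> `|f x| <= M) -> itg P Om f.
Proof.
move=> mf hM; apply: (itg_bounded mOm (C := M)) => //.
exact: P_lty.
Qed.

Lemma n_le1 j x : `|n j x| <= 1.
Proof.
have : n j x ^+ 2 <= 1.
  by rewrite -(n1 x) (bigD1 j)//= lerDl sumr_ge0// => k _; exact: sqr_ge0.
by rewrite -(real_normK (num_real (n j x))) -[X in _ <= X -> _](expr1n R 2) ler_pXn2r ?nnegrE.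
Qed.

(** The bound by sqrt(W_n) has two effects: H vanishes at both wells, and |H D_i u| is dominated by
    the energy density. It is met by sqrt(W_n) and by its derivatives in x. *)
Definition admissible (H : 'rV[R]_N -> R -> R) (Hx : 'I_N -> 'rV[R]_N -> R -> R) (C : R) :=
  [/\ 0 < C, jcont Om H, forall j, jcont Om (Hx j),
     forall j x s, Om x -> is_derive x (e_ j) (fun y => H y s) (Hx j x s) &
     forall x s, Om x -> `|H x s| <= C * q x s].

(** * Weak limits of H(x, v) grad u *)

Section admissible_integrand.
Variables (H : 'rV[R]_N -> R -> R) (Hx : 'I_N -> 'rV[R]_N -> R -> R) (C : R).
Hypothesis adm : admissible H Hx C.
Let h x := g x * profile H x 1.

Lemma admissible0 x : Om x -> H x 0 = 0 /\ H x 1 = 0.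
Proof.
have [_ _ _ _ hC] := adm => Ox; have := hC x 0 Ox; have := hC x 1 Ox.
by rewrite (sqW0 pot)// (sqW1 pot)// mulr0 !normr_le0 => /eqP -> /eqP ->.
Qed.

Lemma profile_bounded_cont : bounded_cont Om h.
Proof.
have [C0 cH cHx dH hC] := adm; have [bg _ _] := gam_bounded_cont Om_C2 pot.
apply: bounded_contM => //; split; first exact: profile_cont_on.
have [Q Q0 hQ] := sqW_bounded Om_C2 pot; exists (C * Q) => [|x Ox]; first exact: mulr_gt0.
have := @profile_bound _ _ _ H cH (C * Q) 1 x Ox; rewrite normr1 mulr1; apply => s hs.
by rewrite (le_trans (hC x s Ox))// ler_pM2l// (le_trans (ler_norm _))// hQ.
Qed.

(* H theta(v) D_j v is the derivative of x |-> profile H x v(x), up to a term without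
   derivatives of v; so it can be tested against T using only v -> chi_A in L^1. *)
Lemma profile_cvg_test1 j T T' : test1 Om j T T' ->
  \int[mu]_(x in Om) (H x (v eps x) * theta (v eps x) * ui eps j x * T x) @[eps --> 0^'+] -->
  \int[P]_(x in Om) (h x * T x * n j x).
Proof.
move=> hT; have [C0 cH cHx dH hC] := adm.
have [cg0 _ dg] := gam_C1 Om_C2 pot j; have gC1 k := gam_C1 Om_C2 pot k; have aC1 k := a_C1 Om_C2 pot k.
have ht0 := test1_mul oOm (gC1 j) hT.
pose t0 x := g x * T x; pose t1 x := g x * T' x + gj j x * T x.
have cG := profile_jcont oOm cH; have cGj := profile_jcont oOm (@cHx j).
have fG := profile_flat cH; have fGj := profile_flat (@cHx j).
have cHt := jcont_theta cH; have fHt := @theta_flat _ _ Om H.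
(* Since D_j u = gamma D_j v + D_j a + v D_j gamma, this is the part of H theta D_j u free of
   derivatives of v. *)
pose K x s := H x s * theta s * ('D_(e_ j) a x + s * gj j x).
have cK : jcont Om K.
  apply: jcontM => //; have [_ caj _] := aC1 j; have [_ cgj _] := gC1 j.
  by apply: jcontD; [exact: jcont_fst|apply: jcontM; [exact: jcont_var|exact: jcont_fst]].
have fK : flat Om K 3.
  apply: flatP => // x s Ox hs; rewrite /K !theta_mul_out ?mul0r//.
  - by rewrite negb_and -!ltNge; apply/orP; right; lra.
  - by rewrite negb_and -!ltNge; apply/orP; right; lra.
  - by rewrite negb_and -!ltNge; apply/orP; left; lra.
  - by rewrite negb_and -!ltNge; apply/orP; left; lra.
have [cT _ _] := hT; have [ct0 ct1 _] := ht0.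
have l1 := flat_cvg cG fG ct1; have l2 := flat_cvg cGj fGj ct0; have l3 := flat_cvg cK fK cT.
have L := rcvgD (rcvgN (rcvgD l1 l2)) l3.
have mchi : measurable_fun Om (\1_A : 'rV[R]_N -> R) := itg_measurable indic_itgO.
have chi01 x : (\1_A x : R) = 0 \/ (\1_A x : R) = 1.
  by rewrite indicE; case: (x \in A); [right|left].
(* In the limit v takes only the values 0 and 1, where H vanishes. *)
have E3 : \int[mu]_(x in Om) (K x (\1_A x) * T x) = 0.
  transitivity (\int[mu]_(x in Om) (0 : R)); last by rewrite Rintegral_cst// mul0r.
  apply: eq_Rintegral => x /set_mem Ox.
  by rewrite /K; have [H0 H1] := admissible0 Ox; case: (chi01 x) => ->; rewrite ?H0 ?H1 !mul0r.
(* A profile evaluated at chi_A is chi_A times its value at 1, so both integrals together are a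
   Gauss-Green formula for chi_A with the test profile(H, 1) gamma T. *)
have E12 : \int[mu]_(x in Om) (profile H x (\1_A x) * t1 x) + \int[mu]_(x in Om) (profile (Hx j) x (\1_A x) * t0 x) =
    - \int[P]_(x in Om) (h x * T x * n j x).
  rewrite -(RintegralD mOm (flat_Cc_itg cG fG mchi ct1) (flat_Cc_itg cGj fGj mchi ct0)).
  have := chiP (test1_mul oOm (profile_C1 oOm cH cHx dH j 1) ht0).
  have -> : \int[P]_(x in Om) (profile H x 1 * (g x * T x) * n j x) = \int[P]_(x in Om) (h x * T x * n j x).
    by apply: eq_Rintegral => x _; rewrite /h mulrA (mulrC (g x)).
  move=> <-; apply: eq_Rintegral => x _.
  by case: (chi01 x) => ->; rewrite ?profile0 ?mul0r ?mul1r ?addr0.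
have El (p1 p2 p3 p4 : R) : p1 + p2 = - p4 -> p3 = 0 -> - (p1 + p2) + p3 = p4.
  by move=> -> ->; rewrite opprK addr0.
have {}L := rcvg_eq L (El _ _ _ _ E12 E3).
apply: rcvg_near L; apply: filterS eps_near => eps eps0.
have g0 x : Om x -> g x != 0.
  by move=> Ox; have [dl dl0 hdl] := gam_bound pot; rewrite gt_eqF// (lt_le_trans dl0 (hdl x Ox)).
have mv := L2_measurable (v_L2 eps0).
have wv := weak_v oOm bOm aC1 gC1 cg0 g0 (fun i => (ui_weak i eps0).1) j.
have S0 : (0 : R) <= 3 by [].
have dGx x s : Om x -> is_derive x (e_ j) (fun y => profile H y s) (profile (Hx j) x s).
  exact: (profile_dx oOm cH cHx dH j).
have dGs x s : Om x -> is_derive s (1 : R) (profile H x) (H x s * theta s).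
  exact: (profile_ds cH).
have wG := weak_chain oOm bOm S0 wv cG cGj cHt fG fGj fHt dGx dGs.
have [_ lG _] := wG.
have iG := loc_itg_Cc oOm lG ct0.
have F := weak_test1 oOm bOm wG ht0.
have iGj := flat_Cc_itg cGj fGj mv ct0; have iK := flat_Cc_itg cK fK mv cT.
rewrite /= opprD F opprK -(RintegralB mOm iG iGj) -(RintegralD mOm (itgB mOm iG iGj) iK).
apply: eq_Rintegral => x /set_mem Ox /=.
rewrite /t0 /K /v /normalized -exprVn.
have := g0 x Ox; move: (profile (Hx j) x _) (H x _) (theta _) => p Hh th.
rewrite -/(ui eps j x); move: (ui eps j x) ('D_(e_ j) a x) (gj j x) (u eps x) (a x) (T x) (g x) => uj aj gjx ux ax Tx gx gx0.
by field.
Qed.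

Lemma Hui_le M eps j c x : good eps -> Om x -> `|c x| <= M ->
  `|H x (v eps x) * theta (v eps x) * ui eps j x * c x| <= C * M * en eps x.
Proof.
move=> [eps0 _ _] Ox cM; have [C0 _ _ _ hC] := adm; have /andP[t0 t1] := theta_bounds (v eps x).
rewrite !normrM [`|theta _|]ger0_norm// (mulrAC C) -mulrA.
have := hC x (v eps x) Ox; have := qui_le_en j eps0 Ox; have := normr_ge0 (c x).
have := normr_ge0 (H x (v eps x)); have := normr_ge0 (ui eps j x); have := sqW_ge0 W a b x (v eps x).
move: (q x _) `|H x _| `|ui eps j x| `|c x| (theta _) (en eps x) t0 t1 cM C0 => Q HH U c0 t E t0 t1 cM C0 Q0 U0 H0 c00 QE HQ.
have h1 : HH * t * U <= C * E.
  apply: (@le_trans _ _ (C * Q * U)); last by rewrite -mulrA ler_wpM2l// ltW.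
  by rewrite ler_wpM2r// (le_trans _ HQ)// ler_piMr.
rewrite mulrA; apply: ler_pM => //; apply: mulr_ge0 => //; exact: mulr_ge0.
Qed.

Lemma Hui_measurable eps j : 0 < eps -> measurable_fun Om (fun x => H x (v eps x) * theta (v eps x) * ui eps j x).
Proof.
move=> eps0; have [C0 cH _ _ _] := adm; apply: measurable_funM; last exact: ui_measurable.
exact: (flat_measurable oOm mOm (fun _ h => h) (jcont_theta cH) (v_measurable eps0)).
Qed.

Lemma Hui_itg (M : R) eps j (c : 'rV[R]_N -> R) : good eps -> measurable_fun Om c -> (forall x, Om x -> `|c x| <= M) ->
  itg mu Om (fun x => H x (v eps x) * theta (v eps x) * ui eps j x * c x) /\
  `|\int[mu]_(x in Om) (H x (v eps x) * theta (v eps x) * ui eps j x * c x)| <= C * M * \int[mu]_(x in Om) en eps x.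
Proof.
move=> ge mc cM; have [eps0 _ _] := ge; have ie := itgZ mOm (C * M) (en_itg ge).
have m : measurable_fun Om (fun x => H x (v eps x) * theta (v eps x) * ui eps j x * c x) :=
  measurable_funM (Hui_measurable j eps0) mc.
have le x (Ox : Om x) := Hui_le j ge Ox (cM x Ox).
split; first exact: (itg_le mOm m le ie).
have := abs_Rintegral_le mOm m le ie; rewrite RintegralZl//; exact: en_itg.
Qed.

Lemma profile_P_itg (c : 'rV[R]_N -> R) M j : measurable_fun Om c -> (forall x, Om x -> `|c x| <= M) ->
  itg P Om (fun x => h x * c x * n j x).
Proof.
have hb := profile_bounded_cont; have [_ [B B0 hB]] := hb => mc cM.
apply: (@P_itg _ (B * M)).
  by apply: measurable_funM => //; apply: measurable_funM => //; exact: (bounded_cont_measurable Om_C2 hb).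
move=> x Ox; rewrite normrM -[leRHS]mulr1; apply: ler_pM => //; last exact: n_le1.
by rewrite normrM; apply: ler_pM => //; [exact: hB|exact: cM].
Qed.

(** Continuous tests are reached by mollifying T: the error is uniform in [eps] because |H D_j u| is
    bounded by the energy density, and on the limit side because [P] is finite. *)
Lemma profile_cvg j T : Cc Om T ->
  \int[mu]_(x in Om) (H x (v eps x) * theta (v eps x) * ui eps j x * T x) @[eps --> 0^'+] -->
  \int[P]_(x in Om) (h x * T x * n j x).
Proof.
move=> hT; apply: rcvg_le => k k0; have [C0 _ _ _ _] := adm.
have hb := profile_bounded_cont; have [_ [B B0 hB]] := hb.
pose PO := fine (P Om).
have PO0 : 0 <= PO by rewrite fine_ge0.
have h1 : 0 <= C * Emax by apply: mulr_ge0; [exact: ltW|exact: Emax_ge0].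
have h2 : 0 <= B * PO by apply: mulr_ge0 => //; exact: ltW.
have D0 : 0 < C * Emax + B * PO + 1 by rewrite ltr_wpDl// addr_ge0.
pose d := k / 3 / (C * Emax + B * PO + 1).
have d0 : 0 < d by rewrite !divr_gt0.
have dk : d * (C * Emax) <= k / 3 /\ d * (B * PO) <= k / 3.
  have h3 : 0 <= k / 3 by rewrite divr_ge0// ltW.
  by split; rewrite /d mulrAC ler_pdivrMr// ler_wpM2l//; lra.
have [K [cK KO TK hK]] := moll_Cc_approx oOm bOm hT.
have [r0 r00 hr] := hK d d0.
have r2 : 0 < r0 / 2 by rewrite divr_gt0.
have [mT dT] : (forall x, ~ K x -> moll (r0 / 2) T x = 0) /\ forall x, `|moll (r0 / 2) T x - T x| <= d.
  by apply: hr => //; lra.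
set T' := moll (r0 / 2) T in mT dT.
have iT : itg mu setT T by exact: (Cc_itgT hT).
have sT m : Ck m setT T' by exact: moll_Ck.
have cT' : Cc Om T'.
  split; first by move=> x; have [] := sT 0%N => c _; exact: c.
  by exists K.
have [T'd _ T'c] := smooth_Cc_derive (e_ j) sT cT'.
have t1 : test1 Om j T' ('D_(e_ j) T') by split.
have k3 : 0 < k / 3 by rewrite divr_gt0.
have [M M0 hM] := Cc_bounded hT; have [M' M'0 hM'] := Cc_bounded cT'.
have mTO : measurable_fun Om T by exact: (Cc_measurable hT).
have mT'O : measurable_fun Om T' by exact: (Cc_measurable cT').
apply: filterS2 en_le (rcvg_dist (profile_cvg_test1 t1) k3) => eps ge.
have [i1 _] := Hui_itg j ge mTO (fun x _ => hM x).
have [i2 _] := Hui_itg j ge mT'O (fun x _ => hM' x).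
have dT' x : Om x -> `|T x - T' x| <= d by move=> _; rewrite distrC.
have [i3 b3] := Hui_itg j ge (measurable_funB mTO mT'O) dT'.
have p1 := profile_P_itg j mTO (fun x _ => hM x); have p2 := profile_P_itg j mT'O (fun x _ => hM' x).
have p3 := profile_P_itg j (measurable_funB mTO mT'O) dT'.
have E1 : \int[mu]_(x in Om) (H x (v eps x) * theta (v eps x) * ui eps j x * T x) =
    \int[mu]_(x in Om) (H x (v eps x) * theta (v eps x) * ui eps j x * T' x) +
    \int[mu]_(x in Om) (H x (v eps x) * theta (v eps x) * ui eps j x * (T x - T' x)).
  by rewrite -(RintegralD mOm i2 i3); apply: eq_Rintegral => x _ /=; rewrite mulrBr addrC subrK.
have E2 : \int[P]_(x in Om) (h x * T x * n j x) = \int[P]_(x in Om) (h x * T' x * n j x) +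
    \int[P]_(x in Om) (h x * (T x - T' x) * n j x).
  by rewrite -(RintegralD mOm p2 p3); apply: eq_Rintegral => x _ /=; rewrite mulrBr mulrBl addrC subrK.
have b4 : `|\int[P]_(x in Om) (h x * (T x - T' x) * n j x)| <= k / 3.
  have ic : itg P Om (fun=> d * B) by apply: (@P_itg _ `|d * B|) => //; exact: measurable_cst.
  have := abs_Rintegral_le mOm (itg_measurable p3) _ ic.
  move=> /(_ _)/le_trans; apply; last by rewrite Rintegral_cst// -mulrA dk.2.
  move=> x Ox; rewrite normrM -[leRHS]mulr1; apply: ler_pM => //; last exact: n_le1.
  by rewrite normrM mulrC; apply: ler_pM => //; [exact: dT'|exact: hB].
have b3' : `|\int[mu]_(x in Om) (H x (v eps x) * theta (v eps x) * ui eps j x * (T x - T' x))| <= k / 3.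
  rewrite (le_trans b3)// (le_trans _ dk.1)// [d * _]mulrC mulrAC ler_wpM2r ?(ltW d0)// ler_wpM2l ?(ltW C0)//.
  by case: ge.
rewrite E1 E2; move: (\int[mu]_(x in Om) _) (\int[P]_(x in Om) _) (\int[mu]_(x in Om) _) (\int[P]_(x in Om) _) b3' b4 => p r s t b3' b4 b5.
have -> : p + s - (r + t) = (p - r) + s - t by ring.
rewrite (le_trans (ler_normB _ _))// (le_trans (lerD (ler_normD _ _) (lexx _)))//.
have -> : k = k / 3 + k / 3 + k / 3 by field.
by rewrite !lerD.
Qed.

End admissible_integrand.

(** Approximate n componentwise by a continuous c and divide by max(1, |c|). As |n| = 1, this moves
    c by at most |c - n|, so the approximation survives while |X| <= 1 is gained. *)
Lemma unit_field tau : 0 < tau -> exists X : 'I_N -> 'rV[R]_N -> R,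
  [/\ forall i, Cc Om (X i), forall x, \sum_i X i x ^+ 2 <= 1 &
      \int[P]_(x in Om) \sum_i `|X i x - n i x| <= tau].
Proof.
move=> tau0; pose N1 : R := N.+1%:R; have N10 : 0 < N1 by rewrite ltr0n.
(* Summing the component errors of X costs a factor N + 1, and there are N components to
   approximate. *)
pose e := tau / N1 / N1; have e0 : 0 < e by rewrite !divr_gt0.
have fP := P_lty.
have ni i : itg P Om (n i) by apply: (P_itg (M := 1)) => // x _; exact: n_le1.
have /choice[c hc] : forall i, exists c, Cc Om c /\ \int[P]_(x in Om) `|n i x - c x| <= e.
  by move=> i; have [c c1 c2] := Cc_dense oOm bOm fP (ni i) e0; exists c.
pose L x := enorm (\row_i c i x); pose m x := Num.max 1 (L x).
have m1 x : 1 <= m x by rewrite le_max lexx.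
have m0 x : 0 < m x := lt_le_trans ltr01 (m1 x).
have L2 x : L x ^+ 2 = \sum_i c i x ^+ 2.
  by rewrite /L enorm_sq /dot; apply: eq_bigr => i _; rewrite !mxE expr2.
have cc i : continuous (c i) := (hc i).1.1.
have cm : continuous m.
  move=> x; have c1 : {for x, continuous (fun=> 1 : R)} by exact: cst_continuous.
  have c2 : {for x, continuous (fun x => \sum_i c i x ^+ 2)}.
    apply: continuous_sum_seq => i; have h := cc i x; exact: (continuousM h h).
  have c3 : {for x, continuous L}.
    have -> : L = Num.sqrt \o (fun x => \sum_i c i x ^+ 2).
      by apply/funext => y; rewrite /= -L2 sqrtr_sqr ger0_norm// enorm_ge0.
    by apply: continuous_comp => //; exact: sqrt_continuous.
  exact: (continuous_max c1 c3).
have cmV x : {for x, continuous (fun x => (m x)^-1)}.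
  by apply: (@continuousV _ _ m); [rewrite gt_eqF|exact: cm].
pose X i x := (m x)^-1 * c i x.
have XCc i : Cc Om (X i) by apply: CcMl (hc i).1 => // x _; exact: cmV.
have S0 x : 0 <= \sum_i `|n i x - c i x| by apply: sumr_ge0.
have Lm x : L x <= 1 + \sum_i `|n i x - c i x|.
  have -> : L x = enorm ((\row_i n i x) + \row_i (c i x - n i x)).
    by congr enorm; apply/rowP => i; rewrite !mxE addrC subrK.
  rewrite (le_trans (enormD _ _))// lerD//.
    have h1 : enorm (\row_i n i x) ^+ 2 = 1.
      by rewrite enorm_sq /dot -[RHS](n1 x); apply: eq_bigr => i _; rewrite !mxE expr2.
    by rewrite -(ler_pXn2r (ltn0Sn 1)) ?nnegrE ?enorm_ge0// h1 expr1n.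
  rewrite (le_trans (enorm_le_sum _))//; apply: ler_sum => i _; rewrite mxE distrC//.
have mS x : m x - 1 <= \sum_i `|n i x - c i x|.
  by rewrite lerBlDl /m ge_max Lm lerDl S0.
have XB i x : `|X i x - n i x| <= `|n i x - c i x| + \sum_i `|n i x - c i x|.
  have tri (p r s : R) : `|p - r| <= `|r - s| + `|p - s|.
    by have := ler_distD s p r; rewrite (distrC s r) [leRHS]addrC.
  apply: le_trans (tri _ _ (c i x)) _; rewrite lerD2l.
  have -> : X i x - c i x = - ((m x - 1) * (c i x / m x)).
    by rewrite /X; field; rewrite gt_eqF.
  rewrite normrN normrM ger0_norm ?subr_ge0//; apply: le_trans (mS x).
  rewrite -[leRHS]mulr1 ler_wpM2l ?subr_ge0// normrM [`|(m x)^-1|]ger0_norm ?invr_ge0 ?(ltW (m0 x))//.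
  rewrite ler_pdivrMr// mul1r; have := coord_le_enorm (\row_i c i x) i; rewrite mxE => /le_trans; apply.
  by rewrite le_max lexx orbT.
exists X; split => //.
  move=> x; have -> : \sum_i X i x ^+ 2 = (L x / m x) ^+ 2.
    by rewrite exprMn L2 mulr_suml; apply: eq_bigr => i _; rewrite /X exprMn mulrC.
  rewrite expr_le1// ?divr_ge0 ?enorm_ge0 ?(ltW (m0 x))// ler_pdivrMr// mul1r.
  by rewrite le_max lexx orbT.
have ci i : itg P Om (fun x => `|n i x - c i x|).
  apply: itg_norm; apply: (itgB mOm) => //; apply: Cc_itg (hc i).1 => //.
have Si := itg_sum mOm (index_enum 'I_N) ci.
have Xi : itg P Om (fun x => \sum_i `|X i x - n i x|).
  apply: (itg_sum mOm) => i; apply: itg_norm; apply: (itgB mOm) => //; exact: Cc_itg (XCc i).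
have le1 : \int[P]_(x in Om) \sum_i `|X i x - n i x| <= \int[P]_(x in Om) (N1 * \sum_i `|n i x - c i x|).
  apply: (le_Rintegral mOm Xi); first exact: (itgZ mOm).
  move=> x _; apply: (@le_trans _ _ (\sum_i (`|n i x - c i x| + \sum_i `|n i x - c i x|))).
    by apply: ler_sum => i _; exact: XB.
  by rewrite big_split/= sumr_const card_ord /N1 -natr1 mulrDl mul1r addrC mulr_natl.
rewrite (le_trans le1)// (RintegralZl _ mOm Si) (Rintegral_sum mOm)//.
apply: (@le_trans _ _ (N1 * \sum_(i < N) e)).
  by rewrite ler_wpM2l ?(ltW N10)//; apply: ler_sum => i _; exact: (hc i).2.
rewrite sumr_const card_ord -mulr_natl mulrA -[leRHS](divfK (lt0r_neq0 (mulr_gt0 N10 N10))) /e.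
rewrite -[tau / N1 / N1]mulrA -invfM mulrC ler_wpM2l//; first by rewrite divr_ge0 ?ltW// mulr_gt0.
by rewrite ler_wpM2l ?(ltW N10)// ler_nat.
Qed.

Let H0 x s := Num.sqrt 2 * q x s.
Let H0x j x s := Num.sqrt 2 * sqWx W a b j x s.

Lemma admissibleZ k H Hx C : 0 < k -> admissible H Hx C ->
  admissible (fun x s => k * H x s) (fun j x s => k * Hx j x s) (k * C).
Proof.
move=> k0 [C0 cH cHx dH hC]; have ck : jcont Om (fun _ _ => k) by move=> x s _; exact: cst_continuous.
split => [|||j x s Ox|x s Ox]; first exact: mulr_gt0.
- exact: jcontM.
- by move=> j; apply: jcontM => //; exact: cHx.
- have := is_derive_mul (is_derive_cst k x (e_ j)) (dH j x s Ox).
  by rewrite mulr0 addr0.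
- by rewrite normrM (gtr0_norm k0) -mulrA ler_pM2l//; exact: hC.
Qed.

Lemma admissible_sqW : admissible q (sqWx W a b) 1.
Proof.
split => //; first exact: (sqW_jcont Om_C2 pot).
- by move=> j; exact: (sqWx_jcont Om_C2 pot).
- by move=> j x s; exact: (sqWx_derive pot).
- by move=> x s _; rewrite mul1r ger0_norm// sqW_ge0.
Qed.

Lemma admissible_sqWx j : exists C, admissible (sqWx W a b j) (sqWxx W a b j) C.
Proof.
have [C C0 hC] := sqWx_le pot; exists C; split => //; first exact: (sqWx_jcont Om_C2 pot).
- by move=> k; exact: (sqWxx_jcont Om_C2 pot).
- by move=> k x s; exact: (sqWxx_derive pot).
- by move=> x s; exact: hC.
Qed.

Lemma sqrt2_gt0 : 0 < Num.sqrt 2 :> R. Proof. by rewrite sqrtr_gt0. Qed.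

Lemma adm0 : admissible H0 H0x (Num.sqrt 2 * 1).
Proof. exact: admissibleZ sqrt2_gt0 admissible_sqW. Qed.

Let sig x := g x * profile H0 x 1.
Hypothesis en_cvg : (\int[mu]_(x in Om) en eps x) @[eps --> 0^'+] --> \int[P]_(x in Om) sig x.

(** * The excess of the energy over a test field *)

Section residual.
Variable X : 'I_N -> 'rV[R]_N -> R.
Hypotheses (XCc : forall i, Cc Om (X i)) (X1 : forall x, \sum_i X i x ^+ 2 <= 1).

Let th eps x := theta (v eps x).
Definition resid eps i x := Num.sqrt eps * ui eps i x - Num.sqrt 2 * q x (v eps x) / Num.sqrt eps * th eps x * X i x.
Definition defect eps x := eps^-1 * w eps x * (1 - th eps x ^+ 2 * \sum_i X i x ^+ 2).
(* Completing the square turns [en - \sum_i H0 theta (D_i u) X_i] into a sum of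
   nonnegative terms ([excessE]): the deviation of sqrt eps grad u from
   its optimal profile in the direction X, and a loss due to |X| < 1 or theta < 1. *)
Definition excess eps x := 2^-1 * (\sum_i resid eps i x ^+ 2) + defect eps x.

Lemma X_le1 i x : `|X i x| <= 1.
Proof.
have h : X i x ^+ 2 <= 1.
  by rewrite (le_trans _ (X1 x))// (bigD1 i)//= lerDl sumr_ge0// => k _; exact: sqr_ge0.
by rewrite -(real_normK (num_real (X i x))) -[X in _ <= X](expr1n R 2) ler_pXn2r ?nnegrE in h.
Qed.

(** Here |X| <= 1 is essential: it makes the excess a sum of nonnegative terms, each of which is
    then small when the excess is. *)
Lemma defect_factor eps x : 0 <= 1 - th eps x ^+ 2 * \sum_i X i x ^+ 2.
Proof.
have /andP[t0 t1] := theta_bounds (v eps x); rewrite subr_ge0 -[leRHS]mulr1.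
by apply: ler_pM => //; [exact: sqr_ge0|apply: sumr_ge0 => i _; exact: sqr_ge0|rewrite expr_le1].
Qed.

Lemma defect_ge0 eps x : 0 < eps -> Om x -> 0 <= defect eps x.
Proof.
by move=> eps0 Ox; rewrite mulr_ge0 ?defect_factor// mulr_ge0 ?w_ge0// invr_ge0 ltW.
Qed.

Lemma resid_le eps i x : 0 < eps -> Om x -> resid eps i x ^+ 2 <= 2 * excess eps x.
Proof.
move=> eps0 Ox; rewrite /excess mulrDr mulVKf ?pnatr_eq0// (bigD1 i)//= -addrA lerDl addr_ge0//.
  by apply: sumr_ge0 => k _; exact: sqr_ge0.
by rewrite mulr_ge0// defect_ge0.
Qed.

Lemma defect_le eps x : defect eps x <= excess eps x.
Proof. by rewrite lerDr mulr_ge0 ?invr_ge0// sumr_ge0// => k _; exact: sqr_ge0. Qed.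

Lemma sqrt2_sq : Num.sqrt 2 ^+ 2 = 2 :> R. Proof. by rewrite sqr_sqrtr. Qed.

Lemma sqrt_eps (eps : R) : 0 < eps -> 0 < Num.sqrt eps /\ Num.sqrt eps ^+ 2 = eps.
Proof. by move=> e0; rewrite sqrtr_gt0 sqr_sqrtr ?ltW. Qed.

Lemma square_expand (se Q t U Y s2 : R) : se != 0 -> s2 ^+ 2 = 2 ->
  (se * U - s2 * Q / se * t * Y) ^+ 2 =
  se ^+ 2 * U ^+ 2 - 2 * (s2 * Q * t * U * Y) + 2 * (Q ^+ 2 / se ^+ 2 * t ^+ 2) * Y ^+ 2.
Proof.
move=> se0 E.
have -> : (se * U - s2 * Q / se * t * Y) ^+ 2 =
  se ^+ 2 * U ^+ 2 - 2 * (s2 * Q * t * U * Y) + s2 ^+ 2 * (Q ^+ 2 / se ^+ 2 * t ^+ 2) * Y ^+ 2 by field.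
by rewrite E.
Qed.

Lemma excessE eps x : 0 < eps -> Om x ->
  excess eps x = en eps x - \sum_i H0 x (v eps x) * th eps x * ui eps i x * X i x.
Proof.
move=> eps0 Ox; have [se0 se2] := sqrt_eps eps0.
rewrite /excess /defect /en w_sq//.
have -> : \sum_i resid eps i x ^+ 2 = eps * (\sum_i ui eps i x ^+ 2) -
    2 * (\sum_i H0 x (v eps x) * th eps x * ui eps i x * X i x) +
    2 * (q x (v eps x) ^+ 2 / eps * th eps x ^+ 2) * \sum_i X i x ^+ 2.
  rewrite !mulr_sumr -sumrB -big_split /=; apply: eq_bigr => i _.
  by rewrite /resid (square_expand _ _ _ _ (lt0r_neq0 se0) sqrt2_sq) se2.
move: (\sum_i ui eps i x ^+ 2) (\sum_i H0 x (v eps x) * th eps x * ui eps i x * X i x) (\sum_i X i x ^+ 2).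
move: (q x _) (th eps x) => Q t s1 s2 s3.
by field; rewrite gt_eqF.
Qed.

Lemma excess_itg eps : good eps -> itg mu Om (excess eps) /\
  \int[mu]_(x in Om) excess eps x = \int[mu]_(x in Om) en eps x -
    \sum_i \int[mu]_(x in Om) (H0 x (v eps x) * th eps x * ui eps i x * X i x).
Proof.
move=> ge; have [eps0 _ _] := ge.
have iX i : itg mu Om (fun x => H0 x (v eps x) * th eps x * ui eps i x * X i x).
  exact: (Hui_itg adm0 i ge (Cc_measurable (XCc i)) (fun x _ => X_le1 i x)).1.
have iS := itg_sum mOm (index_enum 'I_N) iX.
have iD := itgB mOm (en_itg ge) iS.
split; first by apply: (itg_eq mOm) iD => x Ox; rewrite excessE.
rewrite -(Rintegral_sum mOm _ iX) -(RintegralB mOm (en_itg ge) iS).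
by apply: eq_Rintegral => x /set_mem Ox; rewrite excessE.
Qed.

Lemma excess_cvg : (\int[mu]_(x in Om) excess eps x) @[eps --> 0^'+] -->
  \int[P]_(x in Om) sig x - \sum_i \int[P]_(x in Om) (sig x * X i x * n i x).
Proof.
have L1 := @rcvg_sum R _ (index_enum 'I_N)
  (fun i eps => \int[mu]_(x in Om) (H0 x (v eps x) * theta (v eps x) * ui eps i x * X i x))
  (fun i => \int[P]_(x in Om) (sig x * X i x * n i x)) (fun i => profile_cvg adm0 (j := i) (XCc i)).
have L := rcvgB en_cvg L1.
apply: rcvg_near L; apply: filterS en_le => eps ge.
by rewrite (excess_itg ge).2.
Qed.

Lemma resid_measurable eps i : 0 < eps -> measurable_fun Om (resid eps i).
Proof.
move=> eps0; have [_ cH0 _ _ _] := adm0.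
have m1 : measurable_fun Om (fun x => H0 x (v eps x) * th eps x) :=
  flat_measurable oOm mOm (fun _ h => h) (jcont_theta cH0) (v_measurable eps0).
have m2 := ui_measurable i eps0.
have m3 : measurable_fun Om (X i) := Cc_measurable (XCc i).
have mc k : measurable_fun Om (fun=> k : R) by exact: measurable_cst.
have m := measurable_funB (measurable_funM (mc (Num.sqrt eps)) m2)
  (measurable_funM (measurable_funM (mc (Num.sqrt eps)^-1) m1) m3).
rewrite (_ : resid eps i = fun x => Num.sqrt eps * ui eps i x - (Num.sqrt eps)^-1 * (H0 x (v eps x) * th eps x) * X i x) //.
by apply/funext => x; rewrite /resid /H0; ring.
Qed.

End residual.

Lemma sig_bounded_cont : bounded_cont Om sig. Proof. exact: profile_bounded_cont adm0. Qed.

(* Energy convergence makes the excess of X tend to \int sigma (1 - n.X) d|grad chi_A|,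
   which is small when X is close to n. *)
Lemma good_field tau : 0 < tau -> exists X : 'I_N -> 'rV[R]_N -> R,
  [/\ forall i, Cc Om (X i), forall x, \sum_i X i x ^+ 2 <= 1,
      \int[P]_(x in Om) \sum_i `|X i x - n i x| <= tau &
      \forall eps \near 0^'+, good eps /\ \int[mu]_(x in Om) excess X eps x <= tau ^+ 2].
Proof.
move=> tau0; have sb := sig_bounded_cont; have [_ [S S0 hS]] := sb.
(* With |sigma| <= S the limit of the excess is at most S t <= tau^2 / 2, and convergence accounts
   for the other half. The excess has to be of order tau^2 because Young's inequality will divide it
   by tau. *)
pose t := Num.min tau (tau ^+ 2 / 2 / S).
have t2 : 0 < tau ^+ 2 / 2 by rewrite divr_gt0// exprn_gt0.
have t0 : 0 < t by rewrite lt_min tau0 divr_gt0.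
have [X [XCc X1 hX]] := unit_field t0.
exists X; split => //; first by rewrite (le_trans hX)// ge_min lexx.
apply: filterS2 en_le (rcvg_dist (excess_cvg XCc X1) t2) => eps ge he; split => //.
have msig : measurable_fun Om sig := bounded_cont_measurable Om_C2 sb.
have mX i : measurable_fun Om (X i) := Cc_measurable (XCc i).
have isX i : itg P Om (fun x => sig x * X i x * n i x).
  exact: (profile_P_itg adm0 i (mX i) (fun x _ => X_le1 X1 i x)).
have isn : itg P Om sig := P_itg msig hS.
have iXn : itg P Om (fun x => \sum_i `|X i x - n i x|).
  apply: (itg_sum mOm) => i; apply: itg_norm; apply: (itgB mOm); first exact: (Cc_itg oOm P_lty (XCc i)).
  by apply: (P_itg (M := 1)) => // x _; exact: n_le1.
have lim : \int[P]_(x in Om) sig x - \sum_i \int[P]_(x in Om) (sig x * X i x * n i x) <= tau ^+ 2 / 2.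
  rewrite -(Rintegral_sum mOm _ isX) -(RintegralB mOm isn (itg_sum mOm _ isX)).
  apply: (@le_trans _ _ (\int[P]_(x in Om) (S * \sum_i `|X i x - n i x|))).
    apply: (le_Rintegral mOm); [exact: (itgB mOm isn (itg_sum mOm _ isX))|exact: (itgZ mOm)|].
    move=> x Ox.
    have -> : sig x - \sum_i sig x * X i x * n i x = sig x * \sum_i (n i x - X i x) * n i x.
      rewrite -[X in X - _]mulr1 -(n1 x) !mulr_sumr -sumrB; apply: eq_bigr => i _; ring.
    rewrite (le_trans (ler_norm _))// normrM ler_pM//; first exact: hS.
    rewrite (le_trans (ler_norm_sum _ _ _))//; apply: ler_sum => i _.
    by rewrite normrM distrC -[leRHS]mulr1 ler_wpM2l// n_le1.
  rewrite (RintegralZl _ mOm iXn) (le_trans (ler_wpM2l (ltW S0) hX))//.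
  by rewrite mulrC -ler_pdivlMr// ge_min lexx orbT.
have := le_trans (ler_norm _) he; rewrite lerBlDr => /le_trans; apply.
by rewrite [leRHS](splitr (tau ^+ 2)) lerD2l.
Qed.

Lemma ui_sq_le eps i x : 0 < eps -> Om x -> eps * ui eps i x ^+ 2 <= 2 * en eps x.
Proof.
move=> eps0 Ox; have := ui_le_en i eps0 Ox; have := w_ge0 eps Ox.
have : 0 <= eps^-1 * w eps x by rewrite mulr_ge0 ?w_ge0// invr_ge0 ltW.
lra.
Qed.

(** * Errors made by inserting the optimal profile *)

Section field_estimates.
Variables (X : 'I_N -> 'rV[R]_N -> R) (tau : R).
Hypotheses (tau0 : 0 < tau) (XCc : forall i, Cc Om (X i)) (X1 : forall x, \sum_i X i x ^+ 2 <= 1).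
Hypothesis hX : \int[P]_(x in Om) \sum_i `|X i x - n i x| <= tau.

Lemma field_dist (f : 'rV[R]_N -> R) B : measurable_fun Om f -> 0 <= B ->
  (forall x, Om x -> `|f x| <= B * \sum_i `|X i x - n i x|) -> `|\int[P]_(x in Om) f x| <= B * tau.
Proof.
move=> mf B0 hf.
have iXn : itg P Om (fun x => \sum_i `|X i x - n i x|).
  apply: (itg_sum mOm) => i; apply: itg_norm; apply: (itgB mOm); first exact: (Cc_itg oOm P_lty (XCc i)).
  by apply: (P_itg (M := 1)) => // x _; exact: n_le1.
have := abs_Rintegral_le mOm mf hf (itgZ mOm B iXn); rewrite (RintegralZl _ mOm iXn) => /le_trans; apply.
exact: ler_wpM2l.
Qed.

Lemma young_tau (p y : R) : `|p * y| <= tau * p ^+ 2 + tau^-1 * y ^+ 2.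
Proof.
have h (a' b' : R) : 0 <= a' -> 0 <= b' -> a' * b' <= tau * a' ^+ 2 + tau^-1 * b' ^+ 2.
  move=> a0 b0; have t0 : 0 < tau^-1 by rewrite invr_gt0.
  have := young t0 a0 b0; rewrite invrK => /le_trans; apply; rewrite lerD2l.
  by rewrite ler_wpM2r ?sqr_ge0//; lra.
by rewrite normrM -(real_normK (num_real p)) -(real_normK (num_real y)); exact: h.
Qed.

(** Young's inequality with weight tau: tau times the energy plus 1/tau times an excess of size
    tau^2. *)
Lemma resid_product eps i j M (c : 'rV[R]_N -> R) : good eps -> \int[mu]_(x in Om) excess X eps x <= tau ^+ 2 ->
  measurable_fun Om c -> 0 <= M -> (forall x, Om x -> `|c x| <= M) ->
  itg mu Om (fun x => Num.sqrt eps * ui eps i x * resid X eps j x * c x) /\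
  `|\int[mu]_(x in Om) (Num.sqrt eps * ui eps i x * resid X eps j x * c x)| <= 2 * M * (Emax + 1) * tau.
Proof.
move=> ge ex mc M0 cM; have [eps0 _ eE] := ge; have [se0 se2] := sqrt_eps eps0.
have [iex _] := excess_itg XCc X1 ge; have ie := en_itg ge.
have m : measurable_fun Om (fun x => Num.sqrt eps * ui eps i x * resid X eps j x * c x).
  have m1 := measurable_funM (@measurable_cst _ _ _ _ Om (Num.sqrt eps)) (ui_measurable i eps0).
  exact: (measurable_funM (measurable_funM m1 (resid_measurable XCc j eps0)) mc).
have bnd x : Om x -> `|Num.sqrt eps * ui eps i x * resid X eps j x * c x| <=
    (2 * M * tau) * en eps x + (2 * M / tau) * excess X eps x.
  move=> Ox; rewrite normrM.
  have h := young_tau (Num.sqrt eps * ui eps i x) (resid X eps j x).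
  have h1 := ui_sq_le i eps0 Ox; have h2 := resid_le X1 j eps0 Ox.
  rewrite exprMn se2 in h.
  apply: (@le_trans _ _ ((tau * (2 * en eps x) + tau^-1 * (2 * excess X eps x)) * M)).
    apply: ler_pM => //; last exact: cM.
    apply: le_trans h _; apply: lerD; apply: ler_wpM2l => //; first exact: ltW.
    by rewrite invr_ge0 ltW.
  by rewrite le_eqVlt; apply/orP; left; apply/eqP; ring.
have ib := itgD mOm (itgZ mOm (2 * M * tau) ie) (itgZ mOm (2 * M / tau) iex).
split; first exact: (itg_le mOm m bnd ib).
apply: le_trans (abs_Rintegral_le mOm m bnd ib) _.
rewrite (RintegralD mOm (itgZ mOm _ ie) (itgZ mOm _ iex)) (RintegralZl _ mOm ie) (RintegralZl _ mOm iex).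
apply: (@le_trans _ _ (2 * M * tau * Emax + 2 * M / tau * tau ^+ 2)).
  apply: lerD; apply: ler_wpM2l => //; first by rewrite !mulr_ge0// ltW.
  by rewrite divr_ge0 ?mulr_ge0// ltW.
by rewrite le_eqVlt; apply/orP; left; apply/eqP; field; rewrite gt_eqF.
Qed.

Lemma product_expand (k s2 h t se U Q Y e : R) : se != 0 -> se ^+ 2 = e -> s2 ^+ 2 = 2 ->
  k * (s2 * h * t / se * Y) * (se * U - s2 * Q / se * t * Y) =
  s2 * h * t * U * (k * Y) - k * (2 * h * t ^+ 2 * Q / e) * Y ^+ 2.
Proof.
move=> se0 <- E.
have -> : k * (s2 * h * t / se * Y) * (se * U - s2 * Q / se * t * Y) =
  s2 * h * t * U * (k * Y) - k * (s2 ^+ 2 * h * t ^+ 2 * Q / se ^+ 2) * Y ^+ 2 by field.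
by rewrite E.
Qed.

(** The difference is a term carrying the factor 1 - theta^2 |X|^2, bounded by the defect since |H|
    <= C sqrt(W_n), minus the products of an optimal profile with the residuals, bounded by Young's
    inequality with weight tau. *)
Lemma defect_product H Hx C eps M (c : 'rV[R]_N -> R) : admissible H Hx C -> good eps ->
  \int[mu]_(x in Om) excess X eps x <= tau ^+ 2 -> tau <= 1 ->
  measurable_fun Om c -> 0 <= M -> (forall x, Om x -> `|c x| <= M) ->
  `|eps^-1 * \int[mu]_(x in Om) (2 * q x (v eps x) * H x (v eps x) * c x) -
    \sum_i \int[mu]_(x in Om) (Num.sqrt 2 * H x (v eps x) * theta (v eps x) * ui eps i x * (c x * X i x))| <=
  2 * C * M * (1 + N%:R * (Emax + 1)) * tau.
Proof.
move=> adm ge ex tau1 mc M0 cM; have [eps0 iw eE] := ge; have [se0 se2] := sqrt_eps eps0.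
have [C0 cH _ _ hC] := adm; have adm2 := admissibleZ sqrt2_gt0 adm.
have [iex _] := excess_itg XCc X1 ge; have ie := en_itg ge.
have mX i : measurable_fun Om (X i) := Cc_measurable (XCc i).
have cXM i x : Om x -> `|c x * X i x| <= M.
  by move=> Ox; rewrite normrM -[leRHS]mulr1; apply: ler_pM => //; [exact: cM|exact: X_le1].
have iT i := (Hui_itg adm2 i ge (measurable_funM mc (mX i)) (cXM i)).1.
have mq := flat_measurable oOm mOm (fun _ h => h) (sqW_jcont Om_C2 pot) (v_measurable eps0).
have mH := flat_measurable oOm mOm (fun _ h => h) cH (v_measurable eps0).
have i0 : itg mu Om (fun x => 2 * q x (v eps x) * H x (v eps x) * c x).
  apply: (itgM_bounded mOm (C := M) mc cM); apply: (itg_le mOm _ _ (itgZ mOm (2 * C) iw)).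
    by apply: measurable_funM => //; apply: measurable_funM => //; exact: measurable_cst.
  move=> x Ox; rewrite w_sq// !normrM (ger0_norm (sqW_ge0 _ _ _ _ _)) ger0_norm//.
  have := hC x (v eps x) Ox; have := sqW_ge0 W a b x (v eps x).
  move: (q x _) `|H x _| => p h p0 hp; rewrite expr2 -!mulrA ler_wpM2l//.
  by rewrite (le_trans (ler_wpM2l p0 hp))// !mulrA [p * C]mulrC.
rewrite -(RintegralZl _ mOm i0) -(Rintegral_sum mOm _ iT) -(RintegralB mOm (itgZ mOm _ i0) (itg_sum mOm _ iT)).
have iD := itgB mOm (itgZ mOm eps^-1 i0) (itg_sum mOm (index_enum 'I_N) iT).
(* In [K1] the first summand comes from the defect and the second from the N residual products;
   after integration the bound is K1 tau^2 + K2 Emax, and tau <= 1 absorbs a remaining tau^2. *)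
pose K1 := 2 * C * M + 2 * C * M * N%:R / tau; pose K2 := 2 * C * M * N%:R * tau.
have CM0 : 0 <= C * M by rewrite mulr_ge0// ltW.
have bnd x : Om x -> `|eps^-1 * (2 * q x (v eps x) * H x (v eps x) * c x) -
    \sum_i Num.sqrt 2 * H x (v eps x) * theta (v eps x) * ui eps i x * (c x * X i x)| <=
    K1 * excess X eps x + K2 * en eps x.
  move=> Ox.
  pose S3 := \sum_i X i x ^+ 2; pose t := theta (v eps x); pose Hv := H x (v eps x); pose Q := q x (v eps x).
  have E : eps^-1 * (2 * Q * Hv * c x) - \sum_i Num.sqrt 2 * Hv * t * ui eps i x * (c x * X i x) =
      c x * (2 * Hv * (eps^-1 * Q * (1 - t ^+ 2 * S3))) -
      \sum_i c x * (Num.sqrt 2 * Hv * t / Num.sqrt eps * X i x) * resid X eps i x.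
    have -> : \sum_i c x * (Num.sqrt 2 * Hv * t / Num.sqrt eps * X i x) * resid X eps i x =
        (\sum_i Num.sqrt 2 * Hv * t * ui eps i x * (c x * X i x)) - c x * (2 * Hv * t ^+ 2 * Q / eps) * S3.
      rewrite /S3 mulr_sumr -sumrB; apply: eq_bigr => i _; rewrite /resid -/Q -/t.
      exact: product_expand (lt0r_neq0 se0) se2 sqrt2_sq.
    by rewrite -/t; ring.
  rewrite E; apply: le_trans (ler_normB _ _) _.
  have Q0 : 0 <= Q := sqW_ge0 W a b x (v eps x).
  have HQ : `|Hv| <= C * Q := hC x (v eps x) Ox.
  have /andP[t0 t1] := theta_bounds (v eps x).
  have f0 := defect_factor X1 eps x; rewrite -/t -/S3 in f0.
  have ex0 : 0 <= excess X eps x by apply: le_trans (defect_le X eps x); exact: (defect_ge0 X1).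
  have en0 := en_ge0 eps0 Ox.
  have d1 : `|c x * (2 * Hv * (eps^-1 * Q * (1 - t ^+ 2 * S3)))| <= 2 * C * M * excess X eps x.
    have z0 : 0 <= eps^-1 * Q * (1 - t ^+ 2 * S3) by rewrite !mulr_ge0 ?invr_ge0 ?(ltW eps0).
    rewrite normrM (normrM (2 * Hv)) (ger0_norm z0) (normrM 2) [`|2|]ger0_norm//.
    have hd : eps^-1 * (Q * Q) * (1 - t ^+ 2 * S3) <= excess X eps x.
      by have := defect_le X eps x; rewrite /defect w_sq// expr2.
    apply: (@le_trans _ _ (M * (2 * (C * Q) * (eps^-1 * Q * (1 - t ^+ 2 * S3))))).
      have l1 : 0 <= 2 * `|Hv| * (eps^-1 * Q * (1 - t ^+ 2 * S3)) by apply: mulr_ge0 => //; exact: mulr_ge0.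
      apply: (ler_pM (normr_ge0 _) l1 (cM x Ox)); apply: (ler_wpM2r z0).
      exact: (ler_wpM2l (ler0n R 2) HQ).
    have -> : M * (2 * (C * Q) * (eps^-1 * Q * (1 - t ^+ 2 * S3))) =
      2 * C * M * (eps^-1 * (Q * Q) * (1 - t ^+ 2 * S3)) by ring.
    by rewrite ler_wpM2l// -mulrA mulr_ge0.
  have d2 i : `|c x * (Num.sqrt 2 * Hv * t / Num.sqrt eps * X i x) * resid X eps i x| <=
      2 * C * M / tau * excess X eps x + 2 * C * M * tau * en eps x.
    have h1 := resid_le X1 i eps0 Ox.
    have h2 := young_tau (Num.sqrt 2 * Q / Num.sqrt eps) (resid X eps i x).
    have h3 : (Num.sqrt 2 * Q / Num.sqrt eps) ^+ 2 <= 2 * en eps x.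
      rewrite !exprMn exprVn se2 sqrt2_sq -mulrA ler_wpM2l// mulrC.
      have := ui_le_en i eps0 Ox; rewrite w_sq// -/Q; apply: le_trans.
      by rewrite lerDl mulr_ge0 ?sqr_ge0// divr_ge0// ltW.
    have s20 := sqrt2_gt0.
    have sV0 : 0 < (Num.sqrt eps)^-1 by rewrite invr_gt0.
    have b3 : `|c x * (Num.sqrt 2 * Hv * t / Num.sqrt eps * X i x)| <= M * C * (Num.sqrt 2 * Q / Num.sqrt eps).
      rewrite normrM -(mulrA M); apply: (ler_pM (normr_ge0 _) (normr_ge0 _) (cM x Ox)).
      rewrite !normrM (gtr0_norm s20) (gtr0_norm sV0) (ger0_norm t0).
      have X1' := X_le1 X1 i x; have HV0 := normr_ge0 Hv; have XV0 := normr_ge0 (X i x).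
      apply: (@le_trans _ _ (Num.sqrt 2 * (C * Q) * 1 / Num.sqrt eps * 1)); last first.
        by rewrite le_eqVlt; apply/orP; left; apply/eqP; ring.
      have nn1 := mulr_ge0 (ltW s20) HV0; have nn3 := mulr_ge0 (mulr_ge0 nn1 t0) (ltW sV0).
      exact: (ler_pM nn3 XV0 (ler_wpM2r (ltW sV0) (ler_pM nn1 t0 (ler_wpM2l (ltW s20) HQ) t1)) X1').
    rewrite normrM; apply: le_trans (ler_wpM2r (normr_ge0 _) b3) _.
    have z0 : 0 <= Num.sqrt 2 * Q / Num.sqrt eps by rewrite !mulr_ge0// ltW.
    rewrite normrM (ger0_norm z0) in h2.
    rewrite -(mulrA (M * C)).
    apply: (@le_trans _ _ (M * C * (tau * (2 * en eps x) + tau^-1 * (2 * excess X eps x)))).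
      rewrite ler_wpM2l//; first by rewrite mulrC.
      apply: le_trans h2 _; apply: lerD; apply: ler_wpM2l => //; first exact: ltW.
      by rewrite invr_ge0 ltW.
    by rewrite le_eqVlt; apply/orP; left; apply/eqP; ring.
  apply: (@le_trans _ _ (2 * C * M * excess X eps x +
      \sum_(i < N) (2 * C * M / tau * excess X eps x + 2 * C * M * tau * en eps x))).
    apply: lerD => //; apply: le_trans (ler_norm_sum _ _ _) _; apply: ler_sum => i _; exact: d2.
  rewrite sumr_const card_ord -mulr_natl /K1 /K2.
  by rewrite le_eqVlt; apply/orP; left; apply/eqP; ring.
have ib := itgD mOm (itgZ mOm K1 iex) (itgZ mOm K2 ie).
apply: le_trans (abs_Rintegral_le mOm (itg_measurable iD) bnd ib) _.
rewrite (RintegralD mOm (itgZ mOm _ iex) (itgZ mOm _ ie)) (RintegralZl _ mOm ie) (RintegralZl _ mOm iex).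
have N0 : 0 <= N%:R :> R by rewrite ler0n.
have CM2 : 0 <= 2 * C * M by rewrite -mulrA mulr_ge0.
apply: (@le_trans _ _ (K1 * tau ^+ 2 + K2 * Emax)).
  apply: lerD; apply: ler_wpM2l => //; last by rewrite /K2 !mulr_ge0// ltW.
  by rewrite /K1 addr_ge0// !mulr_ge0 ?invr_ge0// ltW.
have -> : K1 * tau ^+ 2 + K2 * Emax = 2 * C * M * (tau * (tau + N%:R * (Emax + 1))).
  by rewrite /K1 /K2; field; rewrite gt_eqF.
have -> : 2 * C * M * (1 + N%:R * (Emax + 1)) * tau = 2 * C * M * (tau * (1 + N%:R * (Emax + 1))) by ring.
by rewrite ler_wpM2l// ler_wpM2l ?(ltW tau0)// lerD2r.
Qed.

End field_estimates.

Lemma CcX c X : bounded_cont Om c -> Cc Om X -> Cc Om (fun x => c x * X x).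
Proof. by move=> [hc _]; apply: CcMl. Qed.

Lemma tri3 (p r s t k1 k2 k3 : R) : `|p - r| <= k1 -> `|r - s| <= k2 -> `|s - t| <= k3 -> `|p - t| <= k1 + k2 + k3.
Proof.
move=> h1 h2 h3; have -> : p - t = (p - r) + (r - s) + (s - t) by ring.
by rewrite (le_trans (ler_normD _ _))// lerD// (le_trans (ler_normD _ _))// lerD.
Qed.

Lemma grad_expand (se Ui Uj s2 Q t Y k : R) : se != 0 ->
  se ^+ 2 * (Ui * Uj * k) = se * Ui * (se * Uj - s2 * Q / se * t * Y) * k + s2 * Q * t * Ui * (k * Y).
Proof. by move=> se0; field. Qed.

(* Replace one factor sqrt(eps) D_j u by its optimal profile; what is left is linear
   in grad u and passes to the limit by [profile_cvg]. *)
Lemma grad_limit i j c : bounded_cont Om c ->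
  eps * \int[mu]_(x in Om) (ui eps i x * ui eps j x * c x) @[eps --> 0^'+] -->
  \int[P]_(x in Om) (sig x * n i x * n j x * c x).
Proof.
move=> hc; apply: rcvg_le => k k0; have [_ [M M0 hM]] := hc; have [_ [S S0 hS]] := sig_bounded_cont.
have mc := bounded_cont_measurable Om_C2 hc; have ms := bounded_cont_measurable Om_C2 sig_bounded_cont.
have E0 := Emax_ge0.
(* The three summands are the residual error, the error of the convergence at fixed X, and the error
   of replacing X by n; tau is chosen so that D tau = k. *)
pose D := 2 * M * (Emax + 1) + 1 + S * M.
have D0 : 0 < D by rewrite /D addr_gt0 ?mulr_gt0// addr_gt0// !mulr_gt0// ltr_wpDl.
pose tau := k / D; have tau0 : 0 < tau by rewrite divr_gt0.
have [X [XCc X1 hX near_]] := good_field tau0.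
have cT := CcX hc (XCc j).
have mX l : measurable_fun Om (X l) := Cc_measurable (XCc l).
apply: filterS2 near_ (rcvg_dist (profile_cvg adm0 (j := i) cT) tau0) => eps [ge ex] pd.
have [eps0 _ _] := ge; have [se0 se2] := sqrt_eps eps0.
have [i1 b1] := resid_product tau0 XCc X1 i j ge ex mc (ltW M0) hM.
have cXM x : Om x -> `|c x * X j x| <= M.
  move=> Ox; rewrite normrM -[leRHS]mulr1.
  exact: (ler_pM (normr_ge0 _) (normr_ge0 _) (hM x Ox) (X_le1 X1 j x)).
have i2 := (Hui_itg adm0 i ge (measurable_funM mc (mX j)) cXM).1.
have E : eps * \int[mu]_(x in Om) (ui eps i x * ui eps j x * c x) =
    \int[mu]_(x in Om) (Num.sqrt eps * ui eps i x * resid X eps j x * c x) +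
    \int[mu]_(x in Om) (H0 x (v eps x) * theta (v eps x) * ui eps i x * (c x * X j x)).
  rewrite -(RintegralD mOm i1 i2) -(RintegralZl _ mOm); last first.
    apply: itgM_bounded_cont => //; exact: (L2_mul oOm (ui_weak i eps0).2 (ui_weak j eps0).2).
  apply: eq_Rintegral => x _ /=; rewrite /resid /H0 -[X in X * (_ * _ * _)]se2.
  exact: grad_expand (lt0r_neq0 se0).
have i3 := profile_P_itg adm0 i (measurable_funM mc (mX j)) cXM.
have nM x : Om x -> `|c x * n j x| <= M.
  move=> Ox; rewrite normrM -[leRHS]mulr1.
  exact: (ler_pM (normr_ge0 _) (normr_ge0 _) (hM x Ox) (n_le1 j x)).
have i4 := profile_P_itg adm0 i (measurable_funM mc (mn j)) nM.
have b3 : `|\int[P]_(x in Om) (sig x * (c x * X j x) * n i x) -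
    \int[P]_(x in Om) (sig x * n i x * n j x * c x)| <= S * M * tau.
  have -> : \int[P]_(x in Om) (sig x * n i x * n j x * c x) = \int[P]_(x in Om) (sig x * (c x * n j x) * n i x).
    by apply: eq_Rintegral => x _; ring.
  rewrite -(RintegralB mOm i3 i4); apply: (field_dist XCc hX).
  - exact: itg_measurable (itgB mOm i3 i4).
  - by rewrite mulr_ge0// ltW.
  - move=> x Ox; have -> : sig x * (c x * X j x) * n i x - sig x * (c x * n j x) * n i x =
      (sig x * c x) * ((X j x - n j x) * n i x) by ring.
    rewrite normrM; apply: ler_pM => //.
      by rewrite normrM; exact: (ler_pM (normr_ge0 _) (normr_ge0 _) (hS x Ox) (hM x Ox)).
    apply: (@le_trans _ _ `|X j x - n j x|).
      by rewrite normrM -[leRHS]mulr1 ler_wpM2l// n_le1.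
    by rewrite (bigD1 j)//= lerDl sumr_ge0.
have b1' : `|eps * \int[mu]_(x in Om) (ui eps i x * ui eps j x * c x) -
    \int[mu]_(x in Om) (H0 x (v eps x) * theta (v eps x) * ui eps i x * (c x * X j x))| <= 2 * M * (Emax + 1) * tau.
  by rewrite E addrK.
apply: le_trans (tri3 b1' pd b3) _.
have -> : k = D * tau by rewrite /tau mulrC divfK// gt_eqF.
by rewrite /D le_eqVlt; apply/orP; left; apply/eqP; ring.
Qed.

(** One factor sqrt(W_n / eps) is exchanged for a component of sqrt(eps) grad u along X, which makes
    the expression linear in grad u. For H = sqrt(W_n) this is one half of equipartition; for H =
    d_x sqrt(W_n) it treats the explicit x-dependence of the potential. *)
Lemma potential_limit H Hx C c : admissible H Hx C -> bounded_cont Om c ->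
  eps^-1 * \int[mu]_(x in Om) (2 * q x (v eps x) * H x (v eps x) * c x) @[eps --> 0^'+] -->
  \int[P]_(x in Om) (g x * profile (fun x s => Num.sqrt 2 * H x s) x 1 * c x).
Proof.
move=> adm hc; apply: rcvg_le => k k0; have [C0 _ _ _ _] := adm.
have adm2 := admissibleZ sqrt2_gt0 adm.
pose h x := g x * profile (fun x s => Num.sqrt 2 * H x s) x 1.
have hb : bounded_cont Om h := profile_bounded_cont adm2.
have [_ [M M0 hM]] := hc; have [_ [S S0 hS]] := hb.
have mc := bounded_cont_measurable Om_C2 hc; have mh := bounded_cont_measurable Om_C2 hb.
have E0 := Emax_ge0.
pose D := 2 * C * M * (1 + N%:R * (Emax + 1)) + 1 + S * M.
have D0 : 0 < D.
  rewrite /D addr_gt0 ?mulr_gt0// ltr_wpDl// !mulr_ge0 ?(ltW C0) ?(ltW M0)// addr_ge0// mulr_ge0// addr_ge0//.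
pose tau := Num.min 1 (k / D); have tau0 : 0 < tau by rewrite lt_min ltr01 divr_gt0.
have tau1 : tau <= 1 by rewrite ge_min lexx.
have [X [XCc X1 hX near_]] := good_field tau0.
have mX l : measurable_fun Om (X l) := Cc_measurable (XCc l).
have L := @rcvg_sum R _ (index_enum 'I_N)
  (fun i eps => \int[mu]_(x in Om) (Num.sqrt 2 * H x (v eps x) * theta (v eps x) * ui eps i x * (c x * X i x)))
  (fun i => \int[P]_(x in Om) (h x * (c x * X i x) * n i x))
  (fun i => profile_cvg adm2 (j := i) (CcX hc (XCc i))).
apply: filterS2 near_ (rcvg_dist L tau0) => eps [ge ex] pd.
have b1 := defect_product tau0 XCc X1 adm ge ex tau1 mc (ltW M0) hM.
have cXM i x : Om x -> `|c x * X i x| <= M.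
  move=> Ox; rewrite normrM -[leRHS]mulr1.
  exact: (ler_pM (normr_ge0 _) (normr_ge0 _) (hM x Ox) (X_le1 X1 i x)).
have i3 i := profile_P_itg adm2 i (measurable_funM mc (mX i)) (cXM i).
have hcM x : Om x -> `|h x * c x| <= S * M.
  by move=> Ox; rewrite normrM; exact: (ler_pM (normr_ge0 _) (normr_ge0 _) (hS x Ox) (hM x Ox)).
have i4 : itg P Om (fun x => h x * c x) := P_itg (measurable_funM mh mc) hcM.
have b3 : `|\sum_i \int[P]_(x in Om) (h x * (c x * X i x) * n i x) - \int[P]_(x in Om) (h x * c x)| <= S * M * tau.
  have iS := itg_sum mOm (index_enum 'I_N) i3.
  rewrite -(Rintegral_sum mOm _ i3) -(RintegralB mOm iS i4); apply: (field_dist XCc hX).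
  - exact: itg_measurable (itgB mOm iS i4).
  - by rewrite mulr_ge0// ltW.
  - move=> x Ox; have -> : \sum_i h x * (c x * X i x) * n i x - h x * c x =
        (h x * c x) * \sum_i (X i x - n i x) * n i x.
      rewrite -[X in _ - X]mulr1 -(n1 x) !mulr_sumr -sumrB; apply: eq_bigr => i _; ring.
    rewrite normrM; apply: (ler_pM (normr_ge0 _) (normr_ge0 _) (hcM x Ox)).
    rewrite (le_trans (ler_norm_sum _ _ _))//; apply: ler_sum => i _.
    by rewrite normrM -[leRHS]mulr1 ler_wpM2l// n_le1.
apply: le_trans (tri3 b1 pd b3) _.
apply: (@le_trans _ _ (D * tau)).
  by rewrite /D le_eqVlt; apply/orP; left; apply/eqP; ring.
by rewrite mulrC -ler_pdivlMr// ge_min lexx orbT.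
Qed.

(** Quadratic coercivity of W, transported to the normalised variable; it is what makes terms linear
    in v negligible. *)
Lemma v_sq_le : exists2 K, 0 < K & forall eps x, Om x -> v eps x ^+ 2 <= K * (w eps x + 1).
Proof.
have [C C0 hC] := W_coercive pot; have [_ _ [_ [G G0 hG]]] := gam_bounded_cont Om_C2 pot.
have [_ [B B0 hB]] := (Ck_closure_bounded_cont Om_C2 0 (pot_aC2 pot)).1.
exists (2 * G ^+ 2 * (C + C ^+ 2 + B ^+ 2)) => [|eps x Ox].
  by rewrite !mulr_gt0 ?exprn_gt0// !addr_gt0 ?exprn_gt0.
have h1 := hC x (u eps x) Ox; have w0 := w_ge0 eps Ox; rewrite -/(w eps x) in h1.
have h2 : (g x)^-1 ^+ 2 <= G ^+ 2.
  by rewrite -(real_normK (num_real _)) ler_pXn2r ?nnegrE ?(ltW G0)//; exact: hG.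
have h3 : a x ^+ 2 <= B ^+ 2.
  by rewrite -(real_normK (num_real _)) ler_pXn2r ?nnegrE ?(ltW B0)//; exact: hB.
rewrite /v /normalized exprMn.
have h4 : (u eps x - a x) ^+ 2 <= 2 * (C * (w eps x + C) + B ^+ 2).
  have := sqr_ge0 (u eps x + a x); move: h1 h3; move: (u eps x) (a x) (w eps x) => U A' w' h1 h3 h.
  have -> : (U - A') ^+ 2 = 2 * (U ^+ 2 + A' ^+ 2) - (U + A') ^+ 2 by ring.
  rewrite lerBlDr; apply: (@le_trans _ _ (2 * (C * (w' + C) + B ^+ 2))); last by rewrite lerDl.
  by rewrite ler_wpM2l// lerD.
rewrite mulrC; apply: (@le_trans _ _ (G ^+ 2 * (2 * (C * (w eps x + C) + B ^+ 2)))).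
  exact: (ler_pM (sqr_ge0 _) (sqr_ge0 _) h2 h4).
have -> : 2 * G ^+ 2 * (C + C ^+ 2 + B ^+ 2) * (w eps x + 1) =
  G ^+ 2 * (2 * (C * (w eps x + C) + B ^+ 2)) + G ^+ 2 * (2 * (C + (C ^+ 2 + B ^+ 2) * w eps x)) by ring.
rewrite lerDl; apply: mulr_ge0; first exact: sqr_ge0.
apply: mulr_ge0 => //; apply: addr_ge0; first exact: ltW.
by apply: mulr_ge0 => //; apply: addr_ge0; exact: sqr_ge0.
Qed.

(** The energy bounds sqrt(eps) D_i u and, by coercivity, v in L^2; a factor sqrt(eps) is left
    over. *)
Lemma lower_order i c d : bounded_cont Om c -> bounded_cont Om d ->
  eps * \int[mu]_(x in Om) (ui eps i x * (c x + v eps x * d x)) @[eps --> 0^'+] --> (0 : R).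
Proof.
move=> hc hd; apply: rcvg_le => k k0.
have [_ [M1 M10 hM1]] := hc; have [_ [M2 M20 hM2]] := hd; pose M := M1 + M2.
have M0 : 0 < M by rewrite addr_gt0.
have [K K0 hK] := v_sq_le; have E0 := Emax_ge0.
pose V := fine (mu Om); have V0 : 0 <= V by rewrite fine_ge0.
pose D := M * ((4 + K) * Emax + (1 + K) * V) + 1.
have D0 : 0 < D by rewrite ltr_wpDl// mulr_ge0 ?(ltW M0)// addr_ge0// mulr_ge0// addr_ge0// ltW.
have r0 : 0 < (k / D) ^+ 2 by rewrite exprn_gt0// divr_gt0.
(* So that sqrt(eps) D <= k; the condition eps <= 1 below gives W <= W / eps, which is part of the
   energy density. *)
have n1' : \forall eps \near (0 : R)^'+, eps <= (k / D) ^+ 2 by exact: nbhs_right_le.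
have n2' : \forall eps \near (0 : R)^'+, eps <= 1 by exact: nbhs_right_le.
apply: filterS2 (filterI n1' n2') en_le => eps [er e1] ge.
have [eps0 _ eE] := ge; have [se0 se2] := sqrt_eps eps0; have ie := en_itg ge.
have mc := bounded_cont_measurable Om_C2 hc; have md := bounded_cont_measurable Om_C2 hd.
have muO : (mu Om < +oo)%E by exact: lebesgueN_bounded.
have mi : measurable_fun Om (fun x => ui eps i x * (c x + v eps x * d x)).
  exact: (measurable_funM (ui_measurable i eps0) (measurable_funD mc (measurable_funM (v_measurable eps0) md))).
pose F x := eps^-1 * (Num.sqrt eps * M) * ((4 + K) * en eps x + (1 + K)).
have bnd x : Om x -> `|ui eps i x * (c x + v eps x * d x)| <= F x.
  move=> Ox.
  have hu : eps * ui eps i x ^+ 2 <= 2 * en eps x := ui_sq_le i eps0 Ox.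
  have hw : w eps x <= en eps x.
    have := ui_le_en i eps0 Ox; apply: le_trans; apply: (@le_trans _ _ (eps^-1 * w eps x)).
      by rewrite -[leLHS]mul1r ler_wpM2r ?w_ge0// invf_ge1.
    by rewrite lerDl mulr_ge0 ?sqr_ge0// divr_ge0// ltW.
  have hv : v eps x ^+ 2 <= K * (en eps x + 1).
    by rewrite (le_trans (hK eps x Ox))// ler_wpM2l ?(ltW K0)// lerD2r.
  have hcd : `|c x + v eps x * d x| <= M * (1 + `|v eps x|).
    rewrite (le_trans (ler_normD _ _))// normrM /M.
    have := hM1 x Ox; have := hM2 x Ox; have := normr_ge0 (v eps x); have := normr_ge0 (c x); have := normr_ge0 (d x).
    move: `|c x| `|d x| `|v eps x| => c' d' v' *; nra.
  have hse : Num.sqrt eps * `|ui eps i x| * (1 + `|v eps x|) <= (4 + K) * en eps x + (1 + K).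
    have E1 : (Num.sqrt eps * `|ui eps i x|) ^+ 2 <= 2 * en eps x.
      by rewrite exprMn se2 real_normK ?num_real.
    have E2 : `|v eps x| ^+ 2 <= K * (en eps x + 1) by rewrite real_normK ?num_real.
    move: E1 E2; move: (Num.sqrt eps * `|ui eps i x|) `|v eps x| (en eps x) => p y E E1 E2.
    have := sqr_ge0 (p - 1); have := sqr_ge0 (p - y); move: E1 E2; rewrite !expr2; nra.
  have -> : F x = eps^-1 * Num.sqrt eps * (M * ((4 + K) * en eps x + (1 + K))) by rewrite /F; ring.
  rewrite normrM; apply: le_trans (ler_wpM2l (normr_ge0 _) hcd) _.
  have -> : `|ui eps i x| * (M * (1 + `|v eps x|)) =
      eps^-1 * Num.sqrt eps * (M * (Num.sqrt eps * `|ui eps i x| * (1 + `|v eps x|))).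
    have -> : eps^-1 * Num.sqrt eps * (M * (Num.sqrt eps * `|ui eps i x| * (1 + `|v eps x|))) =
      eps^-1 * Num.sqrt eps ^+ 2 * (M * (`|ui eps i x| * (1 + `|v eps x|))) by ring.
    by rewrite se2 mulVf ?gt_eqF// mul1r; ring.
  by rewrite ler_wpM2l ?mulr_ge0 ?invr_ge0 ?(ltW eps0) ?(ltW se0)// ler_wpM2l// ltW.
have i1 : itg mu Om (fun=> 1 + K) by exact: itg_cst.
have iF0 := itgD mOm (itgZ mOm (4 + K) ie) i1.
have iF : itg mu Om F := itgZ mOm _ iF0.
have h := abs_Rintegral_le mOm mi bnd iF.
rewrite subr0 normrM (gtr0_norm eps0); apply: le_trans (ler_wpM2l (ltW eps0) h) _.
rewrite (RintegralZl _ mOm iF0) (RintegralD mOm (itgZ mOm _ ie) i1) (RintegralZl _ mOm ie) Rintegral_cst//.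
rewrite !mulrA mulfV ?gt_eqF// mul1r.
apply: (@le_trans _ _ (Num.sqrt eps * (M * ((4 + K) * Emax + (1 + K) * V)))).
  rewrite -mulrA ler_wpM2l ?(ltW se0)// ler_wpM2l ?(ltW M0)// lerD2r.
  by apply: ler_wpM2l => //; apply: addr_ge0 => //; exact: ltW.
apply: (@le_trans _ _ (k / D * D)); last by rewrite divfK// gt_eqF.
apply: ler_pM; rewrite ?(ltW se0)//.
- by rewrite mulr_ge0 ?(ltW M0)// addr_ge0// mulr_ge0// addr_ge0// ltW.
- by rewrite -(ler_pXn2r (ltn0Sn 1)) ?nnegrE ?(ltW se0) ?divr_ge0 ?(ltW D0) ?(ltW k0)// se2.
- by rewrite lerDl.
Qed.

End profile_limits.

(** * Passing to the limit in the first variation *)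

Section limit_of_variations.
Context {R : realType} {N : nat}.
Notation mu := (@lebesgueN R N).
Notation e_ i := (@basis_rV R N i).
Variables (Om : set 'rV[R]_N) (W : 'rV[R]_N -> R -> R) (a b : 'rV[R]_N -> R).
Hypotheses (Om_C2 : C2_domain Om) (pot : potential Om W a b).
Let oOm : open Om := open_C2_domain Om_C2.
Let bOm : bounded_set Om := bounded_C2_domain Om_C2.
Let mOm : measurable Om := open_measurable_rV oOm.
Notation g := (gam a b).
Notation gj := (gamx a b).
Notation q := (sqW W a b).

Definition sigma_profile x := g x * profile (fun x s => Num.sqrt 2 * q x s) x 1.
Definition sqWx_profile j x := g x * profile (fun x s => Num.sqrt 2 * sqWx W a b j x s) x 1.

Lemma sigmaE x : Om x -> sigma W a b x = sigma_profile x.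
Proof. exact: (sigma_integral Om_C2 pot). Qed.

(** The product rule for sigma = gamma times a profile at 1. The two summands appear in the limit
    from different sources: the first from the quadratic gradient term with grad gamma / gamma, the
    second from d_x W_n. *)
Lemma sigma_derive j x : Om x ->
  is_derive x (e_ j) (sigma W a b) (gj j x / g x * sigma_profile x + sqWx_profile j x).
Proof.
move=> Ox; have [_ cH cHx dH _] := adm0 Om_C2 pot.
have [_ _ dg] := gam_C1 Om_C2 pot j.
have d := is_derive_mul (dg x Ox) (profile_dx oOm cH cHx dH j 1 Ox).
have [dl dl0 hdl] := gam_bound pot.
have g0 : g x != 0 by rewrite gt_eqF// (lt_le_trans dl0 (hdl x Ox)).
have -> : gj j x / g x * sigma_profile x + sqWx_profile j x =
    g x * profile (fun x s => Num.sqrt 2 * sqWx W a b j x s) x 1 +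
    profile (fun x s => Num.sqrt 2 * q x s) x 1 * gj j x.
  rewrite /sigma_profile /sqWx_profile; move: (profile _ x 1) (profile _ x 1) => p1 p2.
  by field.
apply: is_derive_near_eq d.
by apply: filterS (open_nbhs_nbhs (conj oOm Ox)) => y Oy; rewrite sigmaE.
Qed.

Lemma sigma_profile_bounded_cont : bounded_cont Om sigma_profile.
Proof. exact: (profile_bounded_cont Om_C2 pot (adm0 Om_C2 pot)). Qed.

Lemma sqWx_profile_bounded_cont j : bounded_cont Om (sqWx_profile j).
Proof.
have [C adm] := admissible_sqWx Om_C2 pot j.
have h := profile_bounded_cont Om_C2 pot (admissibleZ (@sqrt2_gt0 R) adm).
exact: h.
Qed.

Variables (u : R -> 'rV[R]_N -> R) (A : set 'rV[R]_N).
Hypothesis u_H2 : forall eps, 0 < eps -> Hk 2 Om (u eps).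
Hypothesis mA : measurable A.
Variables (P : {finite_measure set 'rV[R]_N -> \bar R}) (n : 'I_N -> 'rV[R]_N -> R).
Hypothesis mn : forall j, measurable_fun Om (n j).
Hypothesis n1 : forall x, \sum_j n j x ^+ 2 = 1.
Hypothesis chiP : forall j T T', test1 Om j T T' ->
  \int[mu]_(x in Om) (\1_A x * T' x) = - \int[P]_(x in Om) (T x * n j x).
Hypothesis v_lim : (\int[mu]_(x in Om) `|normalized a b (u eps) x - \1_A x|) @[eps --> 0^'+] --> (0 : R).
Let en eps x := eps^-1 * W x (u eps x) + eps / 2 * \sum_i weak_partial Om i (u eps) x ^+ 2.
Variable Emax : R.
Hypothesis en_le : \forall eps \near (0 : R)^'+,
  [/\ 0 < eps, itg mu Om (fun x => W x (u eps x)) & \int[mu]_(x in Om) en eps x <= Emax].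
Hypothesis en_cvg : (\int[mu]_(x in Om) en eps x) @[eps --> 0^'+] --> \int[P]_(x in Om) sigma_profile x.
Variable Psi : 'rV[R]_N -> 'rV[R]_N.
Hypothesis Psi_C1 : forall i, Ck_closure 1 Om (fun x => Psi x 0 i).
Hypothesis Psi_tan : forall x, bdry Om x -> dot (Psi x) (outer_normal Om x) = 0.
Hypothesis int_defined : \forall eps \near (0 : R)^'+, itg mu Om (variation_density Om W a b Psi eps (u eps)).

Definition bounded_meas (f : 'rV[R]_N -> R) := measurable_fun Om f /\ exists M, forall x, Om x -> `|f x| <= M.

Lemma bounded_measM f h : bounded_meas f -> bounded_meas h -> bounded_meas (fun x => f x * h x).
Proof.
move=> [mf [M hM]] [mh [M' hM']]; split; first exact: measurable_funM.
by exists (M * M') => x Ox; rewrite normrM; apply: ler_pM => //; [exact: hM|exact: hM'].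
Qed.

Lemma bounded_cont_meas c : bounded_cont Om c -> bounded_meas c.
Proof. by move=> hc; split; [exact: (bounded_cont_measurable Om_C2)|case: hc => _ [M _ hM]; exists M]. Qed.

Lemma n_bounded_meas j : bounded_meas (n j).
Proof. by split => //; exists 1 => x _; exact: (n_le1 n1). Qed.

Lemma bounded_meas_itg f : bounded_meas f -> itg P Om f.
Proof. by move=> [mf [M hM]]; exact: (P_itg Om_C2 P mf hM). Qed.

Lemma variation_limit :
  \int[mu]_(x in Om) variation_density Om W a b Psi eps (u eps) x @[eps --> 0^'+] -->
  - (\int[P]_(x in Om) (sigma_profile x * (divg Psi x - \sum_i \sum_j n i x * n j x * Psid Psi j i x))) -
  (\int[P]_(x in Om) (\sum_j (gj j x / g x * sigma_profile x + sqWx_profile j x) * Psi x 0 j)).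
Proof.
have [c [d [hc hd hI]]] := variation_integral Om_C2 pot Psi_C1 Psi_tan.
have bs := sigma_profile_bounded_cont.
have bdv := divg_bounded_cont Om_C2 Psi_C1.
have [bP bPd] := Psi_bounded_cont Om_C2 Psi_C1.
have [_ bgj big] := gam_bounded_cont Om_C2 pot.
have bq j : bounded_cont Om (fun x => gj j x / g x * Psi x 0 j).
  exact: (bounded_contM (bounded_contM (bgj j) big) (bP j)).
pose v eps := normalized a b (u eps); pose ui eps i := weak_partial Om i (u eps).
have GL i j k (hk : bounded_cont Om k) :
    eps * \int[mu]_(x in Om) (ui eps i x * ui eps j x * k x) @[eps --> 0^'+] -->
    \int[P]_(x in Om) (sigma_profile x * n i x * n j x * k x).
  exact: (grad_limit Om_C2 pot u_H2 mA mn n1 chiP v_lim en_le en_cvg hk).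
have PL H Hx C k (adm : admissible Om W a b H Hx C) (hk : bounded_cont Om k) :
    eps^-1 * \int[mu]_(x in Om) (2 * q x (v eps x) * H x (v eps x) * k x) @[eps --> 0^'+] -->
    \int[P]_(x in Om) (g x * profile (fun x s => Num.sqrt 2 * H x s) x 1 * k x).
  exact: (potential_limit Om_C2 pot u_H2 mA mn n1 chiP v_lim en_le en_cvg adm hk).
have LO i : eps * \int[mu]_(x in Om) (ui eps i x * (c i x + v eps x * d i x)) @[eps --> 0^'+] --> (0 : R).
  exact: (lower_order Om_C2 pot u_H2 en_le i (hc i) (hd i)).
have PLj j : eps^-1 * \int[mu]_(x in Om) (2 * q x (v eps x) * sqWx W a b j x (v eps x) * Psi x 0 j) @[eps --> 0^'+] -->
    \int[P]_(x in Om) (sqWx_profile j x * Psi x 0 j).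
  by have [C adm] := admissible_sqWx Om_C2 pot j; exact: (PL _ _ _ _ adm (bP j)).
have PL0 := PL _ _ _ _ (admissible_sqW Om_C2 pot) bdv.
pose ord := index_enum 'I_N.
(* Equipartition: the potential part and the gradient part ([LB]) each contribute one half of the
   integral of sigma div Psi. *)
have LA := rcvgZ (k := 2^-1) PL0.
have LB0 := @rcvg_sum R _ ord (fun i eps => eps * \int[mu]_(x in Om) (ui eps i x * ui eps i x * divg Psi x))
  (fun i => \int[P]_(x in Om) (sigma_profile x * n i x * n i x * divg Psi x)) (fun i => GL i i _ bdv).
have LB := rcvgZ (k := 2^-1) LB0.
have LC := @rcvg_sum R _ ord
  (fun j eps => eps^-1 * \int[mu]_(x in Om) (2 * q x (v eps x) * sqWx W a b j x (v eps x) * Psi x 0 j))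
  (fun j => \int[P]_(x in Om) (sqWx_profile j x * Psi x 0 j)) PLj.
pose D1 i j eps := eps * \int[mu]_(x in Om) (ui eps i x * ui eps j x * Psid Psi j i x) -
  eps * \int[mu]_(x in Om) (ui eps i x * ui eps i x * (gj j x / g x * Psi x 0 j)).
pose D2 i j := \int[P]_(x in Om) (sigma_profile x * n i x * n j x * Psid Psi j i x) -
  \int[P]_(x in Om) (sigma_profile x * n i x * n i x * (gj j x / g x * Psi x 0 j)).
have LD0 i j : D1 i j eps @[eps --> 0^'+] --> D2 i j := rcvgB (GL i j _ (bPd j i)) (GL i i _ (bq j)).
have LD1 i := @rcvg_sum R _ ord (D1 i) (D2 i) (LD0 i).
have LD := @rcvg_sum R _ ord (fun i eps => \sum_(j <- ord) D1 i j eps) (fun i => \sum_(j <- ord) D2 i j) LD1.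
have LE := @rcvg_sum R _ ord (fun i eps => eps * \int[mu]_(x in Om) (ui eps i x * (c i x + v eps x * d i x)))
  (fun=> 0) LO.
have L := rcvgD (rcvgD (rcvgB (rcvgB (rcvgN LA) LB) LC) LD) LE.
pose X0 := \int[P]_(x in Om) (sigma_profile x * divg Psi x).
have ms := bounded_cont_meas bs.
have mnn i j := bounded_measM (bounded_measM ms (n_bounded_meas i)) (n_bounded_meas j).
have i0 : itg P Om (fun x => sigma_profile x * divg Psi x).
  exact: (bounded_meas_itg (bounded_measM ms (bounded_cont_meas bdv))).
have iB i : itg P Om (fun x => sigma_profile x * n i x * n i x * divg Psi x).
  exact: (bounded_meas_itg (bounded_measM (mnn i i) (bounded_cont_meas bdv))).
have iD1 i j : itg P Om (fun x => sigma_profile x * n i x * n j x * Psid Psi j i x).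
  exact: (bounded_meas_itg (bounded_measM (mnn i j) (bounded_cont_meas (bPd j i)))).
have iD2 i j : itg P Om (fun x => sigma_profile x * n i x * n i x * (gj j x / g x * Psi x 0 j)).
  exact: (bounded_meas_itg (bounded_measM (mnn i i) (bounded_cont_meas (bq j)))).
have iC j : itg P Om (fun x => sqWx_profile j x * Psi x 0 j).
  exact: (bounded_meas_itg (bounded_measM (bounded_cont_meas (sqWx_profile_bounded_cont j)) (bounded_cont_meas (bP j)))).
(* Uses |n|^2 = 1, as does the term with grad gamma / gamma in [R2]. *)
have EB : \sum_(i <- ord) \int[P]_(x in Om) (sigma_profile x * n i x * n i x * divg Psi x) = X0.
  rewrite -(Rintegral_sum mOm _ iB); apply: eq_Rintegral => x _.
  rewrite -mulr_suml -[in RHS](mulr1 (sigma_profile x)) -(n1 x) mulr_sumr.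
  by congr (_ * _); apply: eq_bigr => i _; rewrite expr2 mulrA.
pose X1 := \sum_(i <- ord) \sum_(j <- ord) \int[P]_(x in Om) (sigma_profile x * n i x * n j x * Psid Psi j i x).
pose X2 := \sum_(i <- ord) \sum_(j <- ord) \int[P]_(x in Om) (sigma_profile x * n i x * n i x * (gj j x / g x * Psi x 0 j)).
pose X3 := \sum_(j <- ord) \int[P]_(x in Om) (sqWx_profile j x * Psi x 0 j).
have iD1s i := itg_sum mOm ord (iD1 i).
have R1 : \int[P]_(x in Om) (sigma_profile x * (divg Psi x - \sum_i \sum_j n i x * n j x * Psid Psi j i x)) = X0 - X1.
  have -> : X1 = \int[P]_(x in Om) (\sum_(i <- ord) \sum_(j <- ord) sigma_profile x * n i x * n j x * Psid Psi j i x).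
    by rewrite (Rintegral_sum mOm ord iD1s); apply: eq_bigr => i _; rewrite (Rintegral_sum mOm ord (iD1 i)).
  rewrite -(RintegralB mOm i0 (itg_sum mOm ord iD1s)); apply: eq_Rintegral => x _.
  rewrite mulrBr; congr (_ - _); rewrite mulr_sumr; apply: eq_bigr => i _.
  by rewrite mulr_sumr; apply: eq_bigr => j _; rewrite !mulrA.
have R2 : \int[P]_(x in Om) (\sum_j (gj j x / g x * sigma_profile x + sqWx_profile j x) * Psi x 0 j) = X2 + X3.
  have -> : X2 = \int[P]_(x in Om) (\sum_(j <- ord) \sum_(i <- ord) sigma_profile x * n i x * n i x * (gj j x / g x * Psi x 0 j)).
    rewrite (Rintegral_sum mOm ord (fun j => itg_sum mOm ord (fun i => iD2 i j))) /X2 exchange_big /=.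
    by apply: eq_bigr => j _; rewrite (Rintegral_sum mOm ord (fun i => iD2 i j)).
  rewrite /X3 -(Rintegral_sum mOm ord iC).
  rewrite -(RintegralD mOm (itg_sum mOm ord (fun j => itg_sum mOm ord (fun i => iD2 i j))) (itg_sum mOm ord iC)).
  apply: eq_Rintegral => x _ /=; rewrite -big_split /=; apply: eq_bigr => j _.
  have -> : \sum_(i <- ord) sigma_profile x * n i x * n i x * (gj j x / g x * Psi x 0 j) =
      sigma_profile x * (gj j x / g x * Psi x 0 j).
    rewrite -mulr_suml -[in RHS](mulr1 (sigma_profile x)) -(n1 x) mulr_sumr.
    by congr (_ * _); apply: eq_bigr => i _; rewrite expr2 mulrA.
  by ring.
apply: rcvg_eq.
  apply: rcvg_near L; apply: filterS2 en_le int_defined => eps [eps0 iw _] iD.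
  rewrite (hI (u eps) eps eps0 (u_H2 eps0) iw iD).
  have E1 : \int[mu]_(x in Om) (2 * q x (v eps x) * q x (v eps x) * divg Psi x) =
      2 * \int[mu]_(x in Om) (W x (u eps x) * divg Psi x).
    rewrite -(RintegralZl _ mOm (itgM_bounded_cont Om_C2 bdv iw)); apply: eq_Rintegral => x /set_mem Ox.
    by rewrite -(sqW_normalized pot (u eps) Ox) -/(v eps x) expr2 !mulrA.
  rewrite E1 -/ui -/v.
  have E2 (k : R) : 2^-1 * (k * (2 * \int[mu]_(x in Om) (W x (u eps x) * divg Psi x))) =
    k * \int[mu]_(x in Om) (W x (u eps x) * divg Psi x) by field.
  rewrite E2; congr (_ - _ - _ + _ + _).
  - by rewrite -mulr_sumr mulrA [2^-1 * eps]mulrC.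
  - by rewrite -mulr_sumr.
  - rewrite mulr_sumr; apply: eq_bigr => i _; rewrite mulr_sumr; apply: eq_bigr => j _.
    by rewrite mulrBr.
  - by rewrite -mulr_sumr.
have Z : \sum_(i <- ord) (0 : R) = 0 by rewrite big1.
rewrite R1 R2 EB Z addr0.
have ED : \sum_(i <- ord) \sum_(j <- ord) D2 i j = X1 - X2.
  by rewrite /X1 /X2 -sumrB; apply: eq_bigr => i _; rewrite sumrB.
rewrite ED -/X3 -/X0.
have El (p0 p1 p2 p3 : R) : - (2^-1 * p0) - 2^-1 * p0 - p3 + (p1 - p2) = - (p0 - p1) - (p2 + p3) by field.
exact: El.
Qed.

End limit_of_variations.

(** * Energies and convergence in the normalised variable *)

Section phase_limits.
Context {R : realType} {N : nat}.
Notation mu := (@lebesgueN R N).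
Notation e_ i := (@basis_rV R N i).
Variables (Om : set 'rV[R]_N) (W : 'rV[R]_N -> R -> R) (a b : 'rV[R]_N -> R).
Hypotheses (Om_C2 : C2_domain Om) (pot : potential Om W a b).
Let oOm : open Om := open_C2_domain Om_C2.
Let bOm : bounded_set Om := bounded_C2_domain Om_C2.
Let mOm : measurable Om := open_measurable_rV oOm.
Notation g := (gam a b).
Variables (u : R -> 'rV[R]_N -> R) (A : set 'rV[R]_N).
Hypothesis u_H2 : forall eps, 0 < eps -> Hk 2 Om (u eps).
Hypotheses (mA : measurable A) (bv : BV Om (phase_fun a b A)).

Definition energy_density eps x := eps^-1 * W x (u eps x) + eps / 2 * \sum_i weak_partial Om i (u eps) x ^+ 2.

Lemma energy_epsE eps : 0 < eps ->
  energy_eps Om W eps (u eps) = (\int[mu]_(x in Om) (energy_density eps x)%:E)%E.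
Proof.
move=> eps0; rewrite /energy_eps; case: pselect => [h|nH]; last by exfalso; apply: nH; exact: HkW (u_H2 eps0).
apply: eq_integral => x _; rewrite enorm_sq /dot /energy_density.
by congr (_ + _ * _)%:E; apply: eq_bigr => i _; rewrite mxE expr2.
Qed.

(** Both summands of the density are nonnegative, so a finite energy makes each of them integrable,
    in particular W(x, u). *)
Lemma energy_density_itg eps : 0 < eps -> (\int[mu]_(x in Om) (energy_density eps x)%:E)%E \is a fin_num ->
  itg mu Om (energy_density eps) /\ itg mu Om (fun x => W x (u eps x)).
Proof.
move=> eps0 fin; have mu_ : measurable_fun Om (u eps) := L2_measurable (Hk_L2 (u_H2 eps0)).
have mw : measurable_fun Om (fun x => W x (u eps x)) := flat_measurable oOm mOm (fun _ h => h) (W_jcont pot) mu_.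
have mi i : measurable_fun Om (weak_partial Om i (u eps)).
  exact: L2_measurable (Hk_L2 (Hk_weak oOm bOm i (u_H2 eps0)).2).
have w0 x : Om x -> 0 <= eps^-1 * W x (u eps x).
  by move=> Ox; rewrite mulr_ge0 ?(W_ge0 pot)// invr_ge0 ltW.
have s0 x : 0 <= eps / 2 * \sum_i weak_partial Om i (u eps) x ^+ 2.
  by rewrite mulr_ge0 ?divr_ge0 ?(ltW eps0)// sumr_ge0// => i _; exact: sqr_ge0.
have me : measurable_fun Om (energy_density eps).
  have m1 := measurable_funM (@measurable_cst _ _ _ _ Om eps^-1) mw.
  have m2 : measurable_fun Om (fun x => \sum_i weak_partial Om i (u eps) x ^+ 2).
    by apply: measurable_sum => i; exact: measurable_funX.
  exact: (measurable_funD m1 (measurable_funM (@measurable_cst _ _ _ _ Om (eps / 2)) m2)).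
have ie : itg mu Om (energy_density eps).
  apply/integrableP; split; first exact/measurable_EFinP.
  rewrite (eq_integral (fun x => (energy_density eps x)%:E)); first by rewrite ltey_eq fin.
  by move=> x /set_mem Ox /=; rewrite ger0_norm// addr_ge0// w0.
split => //; apply: (itg_le mOm mw _ (itgZ mOm eps ie)) => x Ox.
rewrite ger0_norm ?(W_ge0 pot)// /energy_density mulrDr mulVKf ?gt_eqF// lerDl.
by rewrite mulr_ge0// ltW.
Qed.

Lemma normalized_cvg :
  (\int[mu]_(x in Om) `|u eps x - phase_fun a b A x|%:E)%E @[eps --> 0^'+] --> 0%E ->
  (\int[mu]_(x in Om) `|normalized a b (u eps) x - \1_A x|) @[eps --> 0^'+] --> (0 : R).
Proof.
move=> /fine_cvgP[_ L]; have [_ _ big] := gam_bounded_cont Om_C2 pot; have [_ [G G0 hG]] := big.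
have [dl dl0 hdl] := gam_bound pot.
have ip : itg mu Om (phase_fun a b A) := bv.1.
apply: rcvg_le => k k0; have k1 : 0 < k / G by rewrite divr_gt0.
have := rcvg_dist L k1; apply: filterS2 (@eps_near R) => eps eps0.
rewrite !subr0 /= => h.
have iu : itg mu Om (u eps) := L2_itg oOm bOm (Hk_L2 (u_H2 eps0)).
have id_ := itgB mOm iu ip.
have iZ := itgZ mOm G (itg_norm id_).
have mv : measurable_fun Om (normalized a b (u eps)) := normalized_measurable Om_C2 pot (itg_measurable iu).
have mchi : measurable_fun Om (\1_A : 'rV[R]_N -> R) by exact: measurable_indic.
have bnd x : Om x -> `|(`|normalized a b (u eps) x - \1_A x|)| <= G * `|u eps x - phase_fun a b A x|.
  move=> Ox; have g0 : g x != 0 by rewrite gt_eqF// (lt_le_trans dl0 (hdl x Ox)).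
  have -> : normalized a b (u eps) x - \1_A x = (g x)^-1 * (u eps x - phase_fun a b A x).
    by rewrite /normalized /phase_fun; move: g0; rewrite /gam; move: (\1_A x) => ch g0; field.
  by rewrite normr_id normrM ler_wpM2r//; exact: hG.
have mN := measurable_funB mv mchi.
have mN' : measurable_fun Om (fun x => `|normalized a b (u eps) x - \1_A x|) by exact: (measurableT_comp (@normr_measurable _ setT) mN).
have := abs_Rintegral_le mOm mN' bnd iZ; rewrite (RintegralZl _ mOm (itg_norm id_)) => /le_trans; apply.
apply: (@le_trans _ _ (G * (k / G))); last by rewrite mulrC divfK// gt_eqF.
rewrite ler_wpM2l ?(ltW G0)//; exact: le_trans (ler_norm _) h.
Qed.

End phase_limits.

(** * A unit normal defined everywhere *)

Section unit_normal.
Context d {T : measurableType d} {R : realType} {N : nat}.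
Variables (D : 'I_N -> {charge set T -> \bar R}) (i0 : 'I_N).
Let B := [set x | enorm (\row_j tv_normal D j x) = 1].

(* tv_normal, replaced by a coordinate vector on the null set where it is not a unit vector. *)
Definition unit_normal j x : R := \1_B x * tv_normal D j x + (1 - \1_B x) * (j == i0)%:R.

Lemma tv_normal_measurable j : measurable_fun setT (tv_normal D j).
Proof. exact: itg_measurable (tv_normal_density D j).1. Qed.

Lemma unit_normal_measurable A j : measurable_fun A (unit_normal j).
Proof.
apply: measurable_funTS.
have mB : measurable B.
  have m := measurable_enorm (D := setT) tv_normal_measurable.
  by have := m measurableT [set 1] (measurable_set1 _); rewrite setTI.
have m1 : measurable_fun setT (\1_B : T -> R) by exact: measurable_indic.
apply: measurable_funD; apply: measurable_funM => //; first exact: tv_normal_measurable.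
by apply: measurable_funB.
Qed.

Lemma unit_normal_sq x : \sum_j unit_normal j x ^+ 2 = 1.
Proof.
rewrite /unit_normal indicE; have [xB|xB] := boolP (x \in B).
  have /(congr1 (fun s => s ^+ 2)) := set_mem xB; rewrite enorm_sq /dot expr1n => E.
  by apply: (etrans _ E); apply: eq_bigr => j _; rewrite mxE mul1r subrr mul0r addr0 expr2.
rewrite (bigD1 i0)//= eqxx mul0r add0r subr0 mul1r expr1n big1 ?addr0// => j ji.
by rewrite (negbTE ji) mul0r mulr0 addr0 expr0n.
Qed.

Lemma unit_normal_ae : {ae tv_measure D, forall x, forall j, unit_normal j x = tv_normal D j x}.
Proof.
have := tv_normal_norm1 D; apply: filterS => x /(_ I) h j.
by rewrite /unit_normal indicE mem_set// mul1r subrr mul0r addr0.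
Qed.

End unit_normal.

Section phase_variation.
Context {R : realType} {N : nat}.
Variables (Om : set 'rV[R]_N) (A : set 'rV[R]_N) (Psi : 'rV[R]_N -> 'rV[R]_N).

(** [Psid Psi j i] is the entry (j, i) of the Jacobian matrix; n (x) n being symmetric, the order of
    the indices in the double sum is immaterial. *)
Lemma frob_projection x : frob (1%:M - (inner_normal Om A x)^T *m inner_normal Om A x) (jac Psi x) =
  divg Psi x - \sum_i \sum_j tv_normal (distr_grad Om \1_A) i x * tv_normal (distr_grad Om \1_A) j x * Psid Psi j i x.
Proof.
rewrite /frob /divg exchange_big -sumrB /=; apply: eq_bigr => i _.
have -> : 'D_(basis_rV R i) (fun y => Psi y 0 i) x = \sum_j (j == i)%:R * Psid Psi j i x.
  by rewrite (bigD1 i)//= eqxx mul1r big1 ?addr0// => j /negbTE ->; rewrite mul0r.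
rewrite -sumrB; apply: eq_bigr => j _.
by rewrite /jac !mxE big_ord1 !mxE mulrBl [tv_normal _ i x * _]mulrC.
Qed.

End phase_variation.

Unset Implicit Arguments.
Set Strict Implicit.
Set Printing Implicit Defensive.

Theorem theorem3p1 (R : realType) (N : nat) (Om : set 'rV[R]_N)
    (W : 'rV[R]_N -> R -> R) (a b : 'rV[R]_N -> R)
    (u : R -> 'rV[R]_N -> R) (A : set 'rV[R]_N)
    (N_ge2 : (2 <= N)%N)
    (Om_C2 : C2_domain Om)
    (W_pot : potential Om W a b)
    (u_H2 : forall eps : R, 0 < eps -> Hk 2 Om (u eps))
    (A_meas : measurable A)
    (A_sub : A `<=` Om)
    (uA_BV : BV Om (phase_fun a b A))
    (u_cvg : (\int[@lebesgueN R N]_(x in Om)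
                `|u eps x - phase_fun a b A x|%:E)%E @[eps --> 0^'+] --> 0%E)
    (E_cvg : energy_eps Om W eps (u eps) @[eps --> 0^'+] -->
             energy Om W a b (phase_fun a b A))
    (Psi : 'rV[R]_N -> 'rV[R]_N)
    (Psi_C1 : forall i, Ck_closure 1 Om (fun x => Psi x 0 i))
    (Psi_tangent : forall x, bdry Om x -> dot (Psi x) (outer_normal Om x) = 0)
    (int_defined : \forall eps \near 0^'+, (@lebesgueN R N).-integrable Om
       (fun x => (variation_density Om W a b Psi eps (u eps) x)%:E)) :
  \int[@lebesgueN R N]_(x in Om) variation_density Om W a b Psi eps (u eps) x
    @[eps --> 0^'+] -->
  - (\int[perimeter_measure Om A]_(x in Om)
       (sigma W a b x *
        frob (1%:M - (inner_normal Om A x)^T *m inner_normal Om A x)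
             (jac Psi x)))
  - (\int[perimeter_measure Om A]_(x in Om)
       dot (grad (sigma W a b) x) (Psi x)).
Proof.
have oOm := open_C2_domain Om_C2; have bOm := bounded_C2_domain Om_C2.
have mOm : measurable Om := open_measurable_rV oOm.
(* The coordinate direction serving as default value of [unit_normal]. *)
have i0 : 'I_N by exact: Ordinal (leq_trans (isT : (0 < 2)%N) N_ge2).
have [dl dl0 hdl] := gam_bound W_pot.
have [M aM] : exists M, forall j x, Om x -> `|'D_(basis_rV R j) a x| <= M /\ `|'D_(basis_rV R j) b x| <= M.
  have hb k f (hf : Ck_closure k.+1 Om f) j : exists2 M, 0 < M & forall x, Om x -> `|'D_(basis_rV R j) f x| <= M.
    by case: (Ck_closure_bounded_cont Om_C2 (basis_rV R j) hf) => _ [].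
  have [M1 M10 h1] := fin_bound (hb _ _ (pot_aC2 W_pot)); have [M2 M20 h2] := fin_bound (hb _ _ (pot_bC2 W_pot)).
  exists (M1 + M2) => j x Ox; split.
    by rewrite (le_trans (h1 j x Ox))// lerDl ltW.
  by rewrite (le_trans (h2 j x Ox))// lerDr ltW.
have exD := phase_distr_grad oOm bOm (a_C1 Om_C2 W_pot) (b_C1 Om_C2 W_pot)
  (fun j x Ox => (aM j x Ox).1) (fun j x Ox => (aM j x Ox).2) dl0 hdl A_meas uA_BV.
have hD := distr_grad_spec exD.
set D := distr_grad Om (\1_A : 'rV[R]_N -> R) in hD.
have E0 : perimeter_measure Om A = tv_measure D by [].
pose P := tv_measure D; pose n := unit_normal D i0.
have lchi : loc_integrable Om (\1_A : 'rV[R]_N -> R).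
  have ichi := indic_itgO Om_C2 A_meas.
  split; first exact: itg_measurable ichi.
  by move=> K cK KO; apply: integrableS ichi => //; exact: compact_measurable_rV.
have mn j : measurable_fun Om (n j) := @unit_normal_measurable _ _ _ _ D i0 Om j.
have n1 x : \sum_j n j x ^+ 2 = 1 := unit_normal_sq D i0 x.
have nae := unit_normal_ae D i0.
have mt j : measurable_fun Om (tv_normal D j) := measurable_funTS (@tv_normal_measurable _ _ _ _ D j).
have chiP j T T' : test1 Om j T T' -> \int[lebesgueN N]_(x in Om) (\1_A x * T' x) = - \int[P]_(x in Om) (T x * n j x).
  move=> hT; rewrite (distr_grad_test1 oOm bOm hD lchi hT); congr (- _).
  have [cT _ _] := hT; have mT : measurable_fun Om T := Cc_measurable cT.
  apply: (Rintegral_ae_eq mOm); [exact: measurable_funM|exact: measurable_funM|].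
  by apply: filterS nae => x hx _; rewrite /n hx.
have v_lim := normalized_cvg Om_C2 W_pot u_H2 A_meas uA_BV u_cvg.
have bs := sigma_profile_bounded_cont Om_C2 W_pot.
have is_ : itg P Om (sigma_profile W a b) := bounded_meas_itg Om_C2 P (bounded_cont_meas Om_C2 bs).
have Es : energy Om W a b (phase_fun a b A) = (\int[P]_(x in Om) sigma_profile W a b x)%:E.
  rewrite (energy_phase oOm W A_meas A_sub _ uA_BV); last first.
    by move=> x Ox; rewrite eq_sym -subr_eq0 gt_eqF// (lt_le_trans dl0 (hdl x Ox)).
  rewrite (Rintegral_EFin mOm is_); apply: eq_integral => x /set_mem Ox.
  by rewrite (sigmaE Om_C2 W_pot).
(* The limit energy is a real number, so the energies, extended reals a priori, are finite for small
   [eps]; this yields the integrability of W(x, u). *)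
rewrite Es in E_cvg; have /fine_cvgP[Efin EL] := E_cvg.
pose en eps := energy_density Om W u eps.
have Enear : \forall eps \near (0 : R)^'+, [/\ 0 < eps, itg (lebesgueN N) Om (fun x => W x (u eps x)) &
    fine (energy_eps Om W eps (u eps)) = \int[lebesgueN N]_(x in Om) en eps x].
  apply: filterS2 Efin (@eps_near R) => eps fin eps0.
  rewrite (energy_epsE W u_H2 eps0) in fin *.
  by have [_ iw] := energy_density_itg Om_C2 W_pot u_H2 eps0 fin.
have en_cvg : (\int[lebesgueN N]_(x in Om) en eps x) @[eps --> 0^'+] --> \int[P]_(x in Om) sigma_profile W a b x.
  by apply: rcvg_near EL; apply: filterS Enear => eps [].
pose Emax := \int[P]_(x in Om) sigma_profile W a b x + 1.
have en_le : \forall eps \near (0 : R)^'+,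
    [/\ 0 < eps, itg (lebesgueN N) Om (fun x => W x (u eps x)) & \int[lebesgueN N]_(x in Om) en eps x <= Emax].
  apply: filterS2 Enear (rcvg_dist en_cvg ltr01) => eps [eps0 iw _] h; split => //.
  by rewrite /Emax addrC -lerBlDr (le_trans (ler_norm _)).
have L := variation_limit Om_C2 W_pot u_H2 A_meas mn n1 chiP v_lim en_le en_cvg Psi_C1 Psi_tangent int_defined.
apply: (rcvg_eq L); rewrite E0 -/P; congr (- _ - _).
  have [_ bPd] := Psi_bounded_cont Om_C2 Psi_C1.
  have bdv := divg_bounded_cont Om_C2 Psi_C1.
  have mF (m : 'I_N -> 'rV[R]_N -> R) : (forall j, measurable_fun Om (m j)) ->
      measurable_fun Om (fun x => sigma_profile W a b x * (divg Psi x - \sum_i \sum_j m i x * m j x * Psid Psi j i x)).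
    move=> mm; apply: measurable_funM; first exact: (bounded_cont_measurable Om_C2 bs).
    apply: measurable_funB; first exact: (bounded_cont_measurable Om_C2 bdv).
    apply: measurable_sum => i; apply: measurable_sum => j; apply: measurable_funM; first exact: measurable_funM.
    exact: (bounded_cont_measurable Om_C2 (bPd j i)).
  (* Back from the everywhere unit field to the Radon-Nikodym normal of the statement, which agrees
     with it almost everywhere for the perimeter measure. *)
  rewrite (Rintegral_ae_eq mOm (mF n mn) (mF _ mt)).
    apply: eq_Rintegral => x /set_mem Ox; rewrite (sigmaE Om_C2 W_pot Ox).
    by rewrite frob_projection.
  apply: filterS nae => x hx _; congr (_ * (_ - _)); apply: eq_bigr => i _; apply: eq_bigr => j _.
  by rewrite /n !hx.
apply: eq_Rintegral => x /set_mem Ox; rewrite /dot; apply: eq_bigr => j _; rewrite mxE.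
by have d := sigma_derive Om_C2 W_pot j Ox; rewrite (@derive_val _ _ _ _ _ _ _ d).
Qed.
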